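(* Let $d\ge1$, $\sigma\in\mathbb R$, let $b:\mathbb R^d\to\mathbb R^d$ be measurable, let $(X_t)_{t\ge0}$ solve $\mathrm dX_t=b(X_t)\,\mathrm dt+\sigma\,\mathrm dW_t$, and for $\delta\in(0,1]$ let $$X_{(n+1)\delta}^\delta=\pi^{(\delta)}(X_{n\delta}^\delta)+b^{(\delta)}(\pi^{(\delta)}(X_{n\delta}^\delta))\delta+\sigma\big(W_{(n+1)\delta}-W_{n\delta}\big).$$ Assume: (a) There are $L_0>0,\ell_0\ge0$ with $|b(x)-b(y)|\le L_0(1+|x|^{\ell_0}+|y|^{\ell_0})|x-y|$ for all $x,y$. (b) $\pi^{(\delta)}(0)=0$ and $|\pi^{(\delta)}(x)-\pi^{(\delta)}(y)|\le|x-y|$ for all $x,y$. (c) There exist $R,C_R,K_R,K_R^*>0$, $\theta\in[0,1/2)$, $\delta_R\in(0,1]$ such that for all $\delta\in(0,\delta_R]$ and $x,y\in\mathbb R^d$: $|b^{(\delta)}(\pi^{(\delta)}(x))-b^{(\delta)}(\pi^{(\delta)}(y))|\le C_R|x-y|$ if $|x|\le R$ and $|y|\le R$; and, if $|x|>R$ or $|y|>R$, $|b^{(\delta)}(\pi^{(\delta)}(x))-b^{(\delta)}(\pi^{(\delta)}(y))|\le K_R\delta^{-\theta}|x-y|$ and $\langle\pi^{(\delta)}(x)-\pi^{(\delta)}(y),b^{(\delta)}(\pi^{(\delta)}(x))-b^{(\delta)}(\pi^{(\delta)}(y))\rangle\le-K_R^*|\pi^{(\delta)}(x)-\pi^{(\delta)}(y)|^2$.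 (d) For every $r>0$ there is $\delta_r^*\in(0,1]$ such that for all $\delta\in(0,\delta_r^*]$: $\inf_{|x|\ge r}|\pi^{(\delta)}(x)|\ge r$ and $|\pi^{(\delta)}(x)|=|x|$ for $|x|\le r$; and there are increasing positive functions $\psi_1,\psi_2$ on $[0,\infty)$ such that for all $\delta\in(0,1]$, $x\in\mathbb R^d$, $r\ge0$, $|b^{(\delta)}(\pi^{(\delta)}(x))|\le\psi_1(r)+\psi_2(r)\delta^{-\theta}|\pi^{(\delta)}(x)|\mathbf 1_{\{|\pi^{(\delta)}(x)|>r\}}$. (e) With $R_0:=2\big((1+R)(1+96C_R/K_R^* )+\psi_1(1)\big)$, $$\sigma^2>\tfrac{8(1+R)}{dK_R^*}\Big(\big(3C_R(K_R^*+96C_R)(1+R)\big)\vee\big(\psi_1(R)K_R^*\big)\vee\big(12C_R\psi_1(R_0)\big)\Big).$$ (f) There are $\lambda_b,C_b>0$ with $\langle x,b(x)\rangle\le-\lambda_b|x|^2+C_b$ for all $x$. (g) For every $\alpha>0$ there are $c_\alpha,l_\alpha\ge0$ with $|\pi^{(\delta)}(x)-x|\le c_\alpha(1+|x|^{l_\alpha})\delta^\alpha$ for all $\delta\in(0,1]$, $x\in\mathbb R^d$; and there are $\beta>0$, $l_\beta^*,\lambda_b^*\ge0$ with $|b^{(\delta)}(x)-b(x)|\le\lambda_b^*(1+|x|^{l_\beta^*})\delta^\beta$ for all $\delta\in(0,1]$, $x\in\mathbb R^d$. (h) If $\beta>1/2$, then in addition there are $L_6,\ell_0^\star\ge0$ with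 $\|\nabla b(x)-\nabla b(y)\|_{\rm op}\le L_6(1+|x|^{\ell_0^\star}+|y|^{\ell_0^\star})|x-y|$ for all $x,y$. Set $$\lambda_1:=6C_R\sigma^2\Big(\sigma^2+\tfrac{24C_R(K_R^*+96C_R)(1+R)^2}{dK_R^*}\Big)^{-1}-3C_R,\qquad\lambda_2:=K_R^*/4,$$ $$\delta_1^\star:=\delta_R\wedge(2K_R^* )^{-1}\wedge(K_R^*/K_R^2)^{\frac1{1-2\theta}}\wedge\tfrac1{C_R}\wedge\tfrac1{\lambda_1}\wedge\tfrac1{\lambda_2}\wedge\delta_{R_0}^*\wedge(2\psi_2(1))^{\frac1{\theta-1}}\wedge\big(4(2+d)(1+R^2)\sigma^2\big)^{-1},$$ $$\delta_2^{\star\star}:=\delta_1^\star\wedge\big(K_R^*/(4\psi_2(1)^2)\big)^{\frac1{1-2\theta}},\qquad \ell_\star:=\big(2\ell_0+1+(1+\ell_0^\star)\mathbf 1_{\{\beta>1/2\}}\big)\vee(\ell_0+l_2)\vee l_\beta^* ,$$ where $l_2$ is $l_\alpha$ for $\alpha=2$. Then there exists a constant $C_0>0$ such that for all $\delta\in(0,\delta_2^{\star\star}]$, all integers $n\ge0$ and all $\mu\in\mathscr P_2(\mathbb R^d)$, $$\mathbb W_2\big(\pi_\infty,\pi_\infty^{(\delta)}\big)\le C_0\,\delta^{1\wedge\beta}d^{\frac12\ell_\star}$$ and $$\mathbb W_2\big(\mu P^{(\delta)}_{n\delta},\pi_\infty\big)\le C_0\Big(e^{-\frac12(\lambda_1\wedge\lambda_2)n\delta}\,\mathbb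 W_2(\mu,\pi_\infty)+\delta^{1\wedge\beta}d^{\frac12\ell_\star}\Big),$$ where $\pi_\infty$ is the invariant probability measure of $(X_t)_{t\ge0}$ and $\pi_\infty^{(\delta)}$ is the unique invariant probability measure of $(X^\delta_{n\delta})_{n\ge0}$.
   Context: $(W_t)_{t\ge0}$ is a $d$-dimensional Brownian motion on a complete filtered probability space $(\Omega,\mathscr F,(\mathscr F_t),\mathbb P)$; initial values are $\mathscr F_0$-measurable. For each $\delta$, $b^{(\delta)},\pi^{(\delta)}:\mathbb R^d\to\mathbb R^d$ are measurable modified versions of $b$ and of the identity (for fixed $x$, $b^{(\delta)}(x)\to b(x)$ and $\pi^{(\delta)}(x)\to x$ as $\delta\to0$). The SDE is strongly well-posed. $|\cdot|$, $\langle\cdot,\cdot\rangle$: Euclidean norm and inner product; $\|\cdot\|_{\rm op}$: operator norm; $\nabla$: (weak) gradient; $\vee,\wedge$: max, min. $\mathscr P_2(\mathbb R^d)$: Borel probability measures with finite second moment; $\mathbb W_2$: $L^2$-Wasserstein distance. $\mu P^{(\delta)}_{n\delta}$ is the law of $X^\delta_{n\delta}$ when $X_0^\delta$ has law $\mu$. Under (e) one has $\lambda_1>0$. *)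

(* Defs.v *)
From HB Require Import structures.
From mathcomp Require Import all_boot all_order all_algebra.
From mathcomp Require Import all_classical all_reals all_analysis.
Import Order.TTheory GRing.Theory Num.Theory.
Import numFieldNormedType.Exports.

Set Implicit Arguments.
Unset Strict Implicit.
Unset Printing Implicit Defensive.

Local Open Scope classical_set_scope.
Local Open Scope ring_scope.

(* R^d carries its Borel sigma-algebra. The library's norm on 'rV[R]_d is the
   sup norm: it is only used through the topology it induces, and the Euclidean
   norm is [enorm]. *)
HB.instance Definition _ (R : realType) (d : nat) :=
  @isMeasurable.Build (sigma_display (@open 'rV[R]_d)) 'rV[R]_d <<s @open 'rV[R]_d >>
    (@sigma_algebra0 _ _ _) (@sigma_algebraC _ _) (@sigma_algebra_bigcup _ _ _).

Section euclidean.
Context {R : realType} {d : nat}.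
Local Notation V := 'rV[R]_d.

Definition inner (x y : V) : R := \sum_(i < d) x ord0 i * y ord0 i.

Definition enorm (x : V) : R := Num.sqrt (inner x x).

(* Matrices act on row vectors from the right, as in v *m 'J f x = 'd f x v. *)
Definition opnorm (A : 'M[R]_d) : R :=
  sup [set enorm (v *m A) | v in [set v : V | enorm v <= 1]].

End euclidean.

Section wasserstein.
Context {R : realType} {d : nat}.
Local Notation V := 'rV[R]_d.
Local Open Scope ereal_scope.

Definition finite_second_moment (mu : probability V R) : Prop :=
  \int[mu]_x (enorm x ^+ 2)%:E < +oo.

Definition couplings (mu nu : set V -> \bar R) : set (probability (V * V)%type R) :=
  [set g | forall A : set V, measurable A ->
     g (A `*` setT) = mu A /\ g (setT `*` A) = nu A].

Definition W2 (mu nu : set V -> \bar R) : \bar R :=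
  sqrte (ereal_inf
    [set \int[g]_z (enorm (z.1 - z.2) ^+ 2)%:E | g in couplings mu nu]).

(* Measures are compared on measurable sets only: the library does not constrain
   their values elsewhere. *)
Definition unique_such (Q : probability V R -> Prop) (pi : probability V R) : Prop :=
  Q pi /\ forall pi' : probability V R, Q pi' ->
    forall A : set V, measurable A -> pi' A = pi A.

End wasserstein.

Section stochastic_basis.
Context {R : realType} {disp : measure_display} {Omega : measurableType disp}.
Variables (P : probability Omega R) (F : R -> set (set Omega)).

(* Time is R; only nonnegative times are ever constrained or used. *)
Definition complete_filtration : Prop :=
  [/\ measure_is_complete P,
      forall t : R, 0 <= t -> sigma_algebra setT (F t) /\ F t `<=` measurable,
      forall s t : R, 0 <= s -> s <= t -> F s `<=` F t &
      P.-negligible `<=` F 0].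

Context {d : nat}.
Local Notation V := 'rV[R]_d.

Definition measurable_wrt (G : set (set Omega)) (Y : Omega -> V) : Prop :=
  forall A : set V, measurable A -> G (Y @^-1` A).

Definition adapted (Y : R -> Omega -> V) : Prop :=
  forall t : R, 0 <= t -> measurable_wrt (F t) (Y t).

Definition continuous_paths (Y : R -> Omega -> V) : Prop :=
  {ae P, forall w, {within `[0, +oo[, continuous (fun t => Y t w)}}.

Definition increment (W : R -> Omega -> V) (s t : R) (w : Omega) : V :=
  W t w - W s w.

Definition brownian_motion (W : R -> Omega -> V) : Prop :=
  [/\ adapted W,
      {ae P, forall w, W 0 w = 0},
      continuous_paths W,
      (forall s t : R, 0 <= s -> s < t -> forall (A : set Omega) (B : set V),
         F s A -> measurable B ->
         (P (A `&` increment W s t @^-1` B) =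
          P A * P (increment W s t @^-1` B))%E) &
      (forall s t : R, 0 <= s -> s < t -> forall B : 'I_d -> set R,
         (forall i, measurable (B i)) ->
         (P [set w | forall i, B i (increment W s t w ord0 i)] =
          \prod_(i < d) normal_prob 0%R (Num.sqrt (t - s)%R) (B i))%E)].

(* The noise is additive, so dX = b(X) dt + sigma dW is a pathwise integral
   equation. *)
Definition sde_solution (W : R -> Omega -> V) (b : V -> V) (sigma : R)
    (xi : Omega -> V) (X : R -> Omega -> V) : Prop :=
  [/\ adapted X, continuous_paths X,
      {ae P, forall w, X 0 w = xi w} &
      {ae P, forall w, forall t : R, 0 <= t -> forall i,
         lebesgue_measure.-integrable `[0, t] (EFin \o (fun s => b (X s w) ord0 i)) /\
         X t w ord0 i =
           X 0 w ord0 i + \int[lebesgue_measure]_(s in `[0, t]) (b (X s w) ord0 i)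
           + sigma * W t w ord0 i}].

Definition strongly_well_posed (W : R -> Omega -> V) (b : V -> V) (sigma : R) :=
  forall xi : Omega -> V, measurable_wrt (F 0) xi ->
    (exists X, sde_solution W b sigma xi X) /\
    (forall X Y, sde_solution W b sigma xi X -> sde_solution W b sigma xi Y ->
       {ae P, forall w, forall t : R, 0 <= t -> X t w = Y t w}).

(* [X x] is the process started from x. The measure mu P_t, where
   P_t(x, A) = P(X x t \in A). *)
Definition semigroup (X : V -> R -> Omega -> V) (mu : probability V R) (t : R)
    (A : set V) : \bar R :=
  (\int[mu]_x P (X x t @^-1` A))%E.

Definition sde_invariant (X : V -> R -> Omega -> V) (pi : probability V R) : Prop :=
  forall t : R, 0 <= t -> forall A : set V, measurable A -> semigroup X pi t A = pi A.

End stochastic_basis.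

(* The chain at time n * delta, for the maps pi^(delta) and b^(delta). *)
Fixpoint scheme {R : realType} {d : nat} {T : Type} (W : R -> T -> 'rV[R]_d)
    (pid bd : 'rV[R]_d -> 'rV[R]_d) (sigma delta : R) (X0 : T -> 'rV[R]_d)
    (n : nat) (w : T) : 'rV[R]_d :=
  if n is m.+1 then
    let y := pid (scheme W pid bd sigma delta X0 m w) in
    y + delta *: bd y + sigma *: (W (m.+1%:R * delta) w - W (m%:R * delta) w)
  else X0 w.

Section chain_law.
Context {R : realType} {disp : measure_display} {Omega : measurableType disp}.
Context {d : nat}.
Local Notation V := 'rV[R]_d.
Variables (P : probability Omega R) (W : R -> Omega -> V).
Variables (pid bd : V -> V) (sigma delta : R).

(* F_0-measurable initial values are independent of W, and F_0 need not carry
   every law mu: the chain is run on V * Omega under mu \x P, with the first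
   coordinate as its initial value. *)
Definition chain_law (mu : probability V R) (n : nat) : set V -> \bar R :=
  pushforward (mu \x P)%E
    (scheme (fun t (z : V * Omega) => W t z.2) pid bd sigma delta fst n).

Definition chain_invariant (pi : probability V R) : Prop :=
  forall (n : nat) (A : set V), measurable A -> chain_law pi n A = pi A.

End chain_law.

(* Main.v *)
(* Two copies of the scheme driven by the same noise contract in mean square for
   the cost [W x * |x - y|^2]: the bounded weight [W = 1 + eps * w(|x|)] is lowered
   on average by the noise inside the ball of radius [rho], which is where the lower
   bound on [sigma^2] enters, and this beats the expansion at rate [C_R] there.
   Replacing one step by two half steps along the same Brownian path costs a local
   error whose leading part has mean zero, so by the contraction the two chains stay
   within [O(delta^(1 /\ beta))] in L^2, uniformly in time. Hence the dyadically
   refined chains form an L^2-Cauchy sequence; its limit is the solution of the SDE,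
   because a chain is an Euler sum along a path. Reading the noise backwards in time
   makes each chain converge, and the laws of these limits are the invariant
   measures. Both estimates follow by running the chain and the flow along one
   Brownian path from coupled initial values. As [d >= 1] and [lstar >= 0], the
   factor [d^(lstar/2)] is at least 1 and can be added to the bound. *)
Require Import Defs.
From HB Require Import structures.
From mathcomp Require Import all_boot all_order all_algebra.
From mathcomp Require Import all_classical all_reals all_analysis.
From mathcomp Require Import measurable_realfun ring lra.
Import Order.TTheory GRing.Theory Num.Theory.
Import numFieldNormedType.Exports.

Set Implicit Arguments.
Unset Strict Implicit.
Unset Printing Implicit Defensive.

Local Open Scope classical_set_scope.
Local Open Scope ring_scope.

(** * The Euclidean norm *)

(** Synchronous coupling leaves nothing random in the difference of the two copies after one step.
    With a weight that depends on the first copy alone, the expected cost therefore factorises into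
    a mean weight and a deterministic squared distance. Inside the ball the squared distance may
    grow by the factor [1 + 3 * C * delta]; the scale [wt_eps] makes the mean weight fall by
    [6 * C * delta] there, and [rate_in] is what remains after division by the largest weight.
    Outside, the curvature of the weight is tuned to spend only part of the rate [K].

    The obstacle in the halving step is that weight and local error feel the same noise: the leading
    error has mean zero only against a constant weight. Freezing the weight at the noiseless mean
    costs a further factor of order [Num.sqrt delta], which its Lipschitz bound supplies. For
    [beta <= 1 / 2] the derivative of [b] is replaced by zero, as an error of order
    [delta * Num.sqrt delta] is then good enough.

    Invariance of the limit law is obtained at dyadic times and extended by continuity of paths. *)

Section euclid.
Context {R : realType} {d : nat}.
Local Notation V := 'rV[R]_d.
Implicit Types x y z : V.

Lemma innerC x y : inner x y = inner y x.
Proof. by apply: eq_bigr => i _; rewrite mulrC. Qed.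

Lemma innerDl x y z : inner (x + y) z = inner x z + inner y z.
Proof. by rewrite -big_split; apply: eq_bigr => i _; rewrite mxE mulrDl. Qed.

Lemma innerZl (c : R) x y : inner (c *: x) y = c * inner x y.
Proof. by rewrite mulr_sumr; apply: eq_bigr => i _; rewrite mxE mulrA. Qed.

Lemma innerDr x y z : inner x (y + z) = inner x y + inner x z.
Proof. by rewrite innerC innerDl !(innerC x). Qed.

Lemma innerZr (c : R) x y : inner x (c *: y) = c * inner x y.
Proof. by rewrite innerC innerZl innerC. Qed.

Lemma innerNl x y : inner (- x) y = - inner x y.
Proof. by rewrite -scaleN1r innerZl mulN1r. Qed.

Lemma innerNr x y : inner x (- y) = - inner x y.
Proof. by rewrite innerC innerNl innerC. Qed.

Lemma inner0l x : inner 0 x = 0.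
Proof. by rewrite -(scale0r 0) innerZl mul0r. Qed.

Lemma inner_ge0 x : 0 <= inner x x.
Proof. by apply: sumr_ge0 => i _; rewrite -expr2 sqr_ge0. Qed.

Lemma enorm_ge0 x : 0 <= enorm x.
Proof. exact: sqrtr_ge0. Qed.

Lemma enorm_sqr x : enorm x ^+ 2 = inner x x.
Proof. by rewrite sqr_sqrtr// inner_ge0. Qed.

Lemma enorm_sqrE x : enorm x ^+ 2 = \sum_i x ord0 i ^+ 2.
Proof. by rewrite enorm_sqr; apply: eq_bigr => i _; rewrite expr2. Qed.

Lemma enorm0 : enorm (0 : V) = 0.
Proof. by rewrite /enorm inner0l sqrtr0. Qed.

Lemma enormZ (c : R) x : enorm (c *: x) = `|c| * enorm x.
Proof.
rewrite /enorm innerZl innerZr mulrA -expr2 sqrtrM ?sqr_ge0//.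
by rewrite sqrtr_sqr.
Qed.

Lemma enormN x : enorm (- x) = enorm x.
Proof. by rewrite -scaleN1r enormZ normrN1 mul1r. Qed.

Lemma enormB x y : enorm (x - y) = enorm (y - x).
Proof. by rewrite -enormN opprB. Qed.

Lemma enormD_sqr x y :
  enorm (x + y) ^+ 2 = enorm x ^+ 2 + 2 * inner x y + enorm y ^+ 2.
Proof. rewrite !enorm_sqr innerDl !innerDr (innerC y x); ring. Qed.

Lemma enorm_eq0 x : enorm x = 0 -> x = 0.
Proof.
move=> x0; have := enorm_sqrE x; rewrite x0 expr0n /= => /esym/eqP.
rewrite psumr_eq0 => [/allP h|i _]; last exact: sqr_ge0.
apply/rowP => i; rewrite mxE; have := h i (mem_index_enum _).
by rewrite sqrf_eq0 => /eqP.
Qed.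

(** Cauchy-Schwarz by expanding the square of [enorm y *: x - enorm x *: y]. The expansion carries a
    factor [enorm x * enorm y], so vanishing norms are treated apart. *)
Lemma inner_le x y : inner x y <= enorm x * enorm y.
Proof.
have [/enorm_eq0->|x0] := eqVneq (enorm x) 0.
  by rewrite inner0l mulr_ge0// enorm_ge0.
have [/enorm_eq0->|y0] := eqVneq (enorm y) 0.
  by rewrite innerC inner0l mulr_ge0// enorm_ge0.
have xp : 0 < enorm x by rewrite lt_neqAle eq_sym x0 enorm_ge0.
have yp : 0 < enorm y by rewrite lt_neqAle eq_sym y0 enorm_ge0.
have := sqr_ge0 (enorm (enorm y *: x - enorm x *: y)).
rewrite enormD_sqr enormN !enormZ innerNr innerZr innerZl !ger0_norm ?enorm_ge0//.
move=> h; have xy : 0 < enorm x * enorm y by rewrite mulr_gt0.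
have : 0 <= enorm x * enorm y * (enorm x * enorm y - inner x y) by lra.
by rewrite pmulr_rge0// subr_ge0.
Qed.

Lemma norm_inner_le x y : `|inner x y| <= enorm x * enorm y.
Proof.
by rewrite ler_norml inner_le andbT lerNl -innerNl (le_trans (inner_le _ _))// enormN.
Qed.

Lemma ler_enormD x y : enorm (x + y) <= enorm x + enorm y.
Proof.
rewrite -(@ler_pXn2r _ 2)// ?nnegrE ?addr_ge0 ?enorm_ge0//.
rewrite enormD_sqr; have := inner_le x y; lra.
Qed.

Lemma ler_enormB x y : enorm (x - y) <= enorm x + enorm y.
Proof. by rewrite (le_trans (ler_enormD _ _))// enormN. Qed.

Lemma ler_enorm_sub x y : enorm x - enorm y <= enorm (x - y).
Proof. by rewrite lerBlDr -{1}(subrK y x) ler_enormD. Qed.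

Lemma ler_enorm_dist x y : `|enorm x - enorm y| <= enorm (x - y).
Proof. by rewrite ler_norml ler_enorm_sub andbT lerNl opprB enormB ler_enorm_sub. Qed.

Lemma enormD_sqr_le x y : enorm (x + y) ^+ 2 <= 2 * enorm x ^+ 2 + 2 * enorm y ^+ 2.
Proof.
have := sqr_ge0 (enorm (x - y)).
by rewrite !enormD_sqr innerNr enormN; lra.
Qed.

Lemma coord_le_enorm x i : `|x ord0 i| <= enorm x.
Proof.
rewrite -sqrtr_sqr ler_wsqrtr// /inner (bigD1 i)//= -expr2 lerDl.
by apply: sumr_ge0 => j _; rewrite -expr2 sqr_ge0.
Qed.

Lemma enorm_le_sum x : enorm x <= \sum_i `|x ord0 i|.
Proof.
have s0 : 0 <= \sum_i `|x ord0 i| by apply: sumr_ge0.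
rewrite -(@ler_pXn2r _ 2)// ?nnegrE ?enorm_ge0// enorm_sqrE expr2 mulr_suml.
apply: ler_sum => i _; rewrite -[leLHS]ger0_norm ?sqr_ge0// normrX expr2.
rewrite ler_wpM2l// (bigD1 i)//= lerDl; exact: sumr_ge0.
Qed.

Lemma enorm_le_coord x (c : R) : (forall i, `|x ord0 i| <= c) -> enorm x <= d%:R * c.
Proof.
move=> h; apply: (le_trans (enorm_le_sum _)); apply: (le_trans (ler_sum _ (fun i _ => h i))).
by rewrite sumr_const card_ord mulr_natl.
Qed.

Lemma sup_norm_le_enorm x : `|x| <= enorm x.
Proof.
rewrite [leLHS]mx_normrE; apply: bigmax_le; first exact: enorm_ge0.
by move=> [i j] _ /=; rewrite (ord1 i) coord_le_enorm.
Qed.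

Lemma coord_le_sup_norm x i : `|x ord0 i| <= `|x|.
Proof.
rewrite [leRHS]mx_normrE.
exact: (le_bigmax _ (fun ij : 'I_1 * 'I_d => `|x ij.1 ij.2|) (ord0, i)).
Qed.

Lemma enorm_le_sup_norm x : enorm x <= d%:R * `|x|.
Proof. by apply: enorm_le_coord => i; exact: coord_le_sup_norm. Qed.

(** The topology is that of the sup norm, which is equivalent to [enorm] with constants 1 and [d];
    from here on convergence is read through [enorm]. *)
Lemma cvg_enormP (I : Type) (F : set_system I) {FF : Filter F} (f : I -> V) (l : V) :
  f @ F --> l <-> (fun i => enorm (f i - l)) @ F --> (0 : R).
Proof.
split=> h.
  have h1 : (fun i => `|f i - l|) @ F --> (0 : R).
    have : (fun i => f i - l) @ F --> l - l by apply: cvgB => //; exact: cvg_cst.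
    by rewrite subrr => /cvg_norm; rewrite normr0.
  have h2 : (fun i => d%:R * `|f i - l|) @ F --> (0 : R).
    by rewrite -[0 in X in _ --> X](mulr0 d%:R); apply: cvgM => //; exact: cvg_cst.
  apply: (squeeze_cvgr _ (cvg_cst 0) h2); apply: nearW => i.
  by rewrite enorm_ge0 enorm_le_sup_norm.
apply/cvgrPdist_le => e e0; have /cvgrPdist_le/(_ e e0) := h.
apply: filterS => i /=; rewrite sub0r normrN ger0_norm ?enorm_ge0// distrC.
exact: le_trans (sup_norm_le_enorm _).
Qed.

Lemma continuous_coord i : continuous (fun x : V => x ord0 i).
Proof. exact: coord_continuous. Qed.

Lemma continuous_enorm : continuous (@enorm R d).
Proof.
move=> x; apply: (proj2 (@cvgrPdist_le _ _ _ (nbhs x) (nbhs_filter x) enorm (enorm x))).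
move=> e e0; have /cvg_enormP : (fun y : V => y) @ x --> x by exact: cvg_id.
move=> /cvgrPdist_le/(_ e e0); apply: filterS => y /=.
rewrite sub0r normrN ger0_norm ?enorm_ge0// => h.
by rewrite distrC (le_trans (ler_enorm_dist _ _)).
Qed.

End euclid.
#[global] Hint Extern 0 (is_true (0 <= enorm _)) => solve [apply: enorm_ge0] : core.

(** * Borel sets of R^d and bounded Lipschitz test functions *)

Section borel.
Context {R : realType} {d : nat}.
Local Notation V := 'rV[R]_d.

Lemma continuous_measurable_rV (f : V -> R) : continuous f -> measurable_fun [set: V] f.
Proof.
move=> /continuousP cf; apply: (measurability _ (RGenOpens.measurableE R)).
move=> _ [_ [a [b ->]] <-]; rewrite setTI; apply: sub_sigma_algebra.
apply: cf; exact: interval_open.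
Qed.

Lemma measurable_coord (i : 'I_d) : measurable_fun [set: V] (fun x : V => x ord0 i).
Proof. by apply: continuous_measurable_rV; exact: (@continuous_coord R d i). Qed.

Lemma measurable_enorm : measurable_fun [set: V] (@enorm R d).
Proof. by apply: continuous_measurable_rV; exact: continuous_enorm. Qed.

Lemma lipschitz_measurable (f : V -> R) (L : R) :
  (forall x y, `|f x - f y| <= L * enorm (x - y)) -> measurable_fun [set: V] f.
Proof.
move=> fL; apply: continuous_measurable_rV => x.
apply: (proj2 (@cvgrPdist_le _ _ _ (nbhs x) (nbhs_filter x) f (f x))) => e e0.
have L0 : 0 < `|L| + 1 by rewrite ltr_wpDl.
have /cvg_enormP : (fun y : V => y) @ x --> x by exact: cvg_id.
move=> /cvgrPdist_le/(_ (e / (`|L| + 1)) (divr_gt0 e0 L0)); apply: filterS => y /=.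
rewrite sub0r normrN (ger0_norm (enorm_ge0 _)) => h.
rewrite distrC (le_trans (fL _ _))//; move: h; rewrite ler_pdivlMr// => h.
rewrite (le_trans _ h)// mulrC ler_wpM2l//.
by rewrite (le_trans (ler_norm _))// lerDl.
Qed.

(** Rational boxes form a countable base. Hence a map into R^d is measurable as soon as its
    coordinates are, which is [measurable_rV]. *)
Lemma open_bigcup_box (U : set V) : open U ->
  U = \bigcup_(k in [set k : 'rV[rat]_d * rat |
         [set x : V | forall i, `|x ord0 i - ratr (k.1 ord0 i)| < ratr k.2] `<=` U])
       [set x : V | forall i, `|x ord0 i - ratr (k.1 ord0 i)| < ratr k.2].
Proof.
move=> oU; apply/seteqP; split=> [x Ux|x [k /= kU xk]]; last exact: kU.
have /nbhs_ballP[e /= e0 xeU] : nbhs x U by exact: open_nbhs_nbhs.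
(* A centre within [r] of [x], together with [2 * r < e], puts the box around [x] and inside the
   ball of radius [e]. *)
have [r] := rat_in_itvoo (divr_gt0 e0 (ltr0n R 2)).
rewrite in_itv/= => /andP[r0 re].
have /choice[q qP] : forall i : 'I_d, exists q : rat, `|x ord0 i - ratr q| < ratr r.
  move=> i; have [|q] := @rat_in_itvoo R (x ord0 i) (x ord0 i + ratr r).
    by rewrite ltrDl.
  rewrite in_itv/= => /andP[q1 q2]; exists q.
  by rewrite ltr_norml; apply/andP; split; lra.
exists (\row_i q i, r) => /=; last by move=> i; rewrite mxE.
move=> y yq; apply: xeU; split => // j i; rewrite (ord1 j).
have := yq i; have := qP i; rewrite mxE /ball /= !ltr_norml => /andP[a1 a2] /andP[b1 b2].
by apply/andP; split; lra.
Qed.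

Lemma measurable_rV d' (T : measurableType d') (f : T -> V) :
  (forall i, measurable_fun setT (fun x => f x ord0 i)) -> measurable_fun setT f.
Proof.
move=> mf; apply: (@measurability _ _ _ _ setT f open) => //.
move=> _ [U oU <-]; rewrite setTI (open_bigcup_box oU) preimage_bigcup.
rewrite bigcup_mkcond; apply: countable_bigcupT_measurable; first exact: countableP.
move=> k; case: ifP => // _.
rewrite (_ : _ @^-1` _ = \bigcap_(i in [set: 'I_d])
    ((fun x => f x ord0 i) @^-1` [set r | `|r - ratr (k.1 ord0 i)| < ratr k.2])); last first.
  by apply/seteqP; split=> [x h i _|x h i]; [exact: h|exact: (h i)].
apply: fin_bigcap_measurable => // i _.
rewrite -[X in measurable X]setTI; apply: mf => //.
rewrite [X in measurable X](_ : _ = `]ratr (k.1 ord0 i) - ratr k.2,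
    ratr (k.1 ord0 i) + ratr k.2[%classic); first exact: measurable_itv.
by apply/seteqP; split=> r /=; rewrite in_itv/= ltr_norml => /andP[? ?];
   apply/andP; split; lra.
Qed.

Section closure.
Context d' (T : measurableType d').
Implicit Types f g : T -> V.

Lemma measurable_coord_comp f i : measurable_fun setT f ->
  measurable_fun setT (fun x => f x ord0 i).
Proof. by move=> mf; exact: (measurableT_comp (measurable_coord i) mf). Qed.

Lemma measurable_rVD f g : measurable_fun setT f -> measurable_fun setT g ->
  measurable_fun setT (fun x => f x + g x).
Proof.
move=> mf mg; apply: measurable_rV => i; under eq_fun do rewrite mxE.
by apply: measurable_funD; exact: measurable_coord_comp.
Qed.

Lemma measurable_rVZ (h : T -> R) f : measurable_fun setT h -> measurable_fun setT f ->
  measurable_fun setT (fun x => h x *: f x).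
Proof.
move=> mh mf; apply: measurable_rV => i; under eq_fun do rewrite mxE.
by apply: measurable_funM => //; exact: measurable_coord_comp.
Qed.

Lemma measurable_rVN f : measurable_fun setT f -> measurable_fun setT (fun x => - f x).
Proof.
move=> mf; under eq_fun do rewrite -scaleN1r.
by apply: measurable_rVZ => //; exact: measurable_cst.
Qed.

Lemma measurable_rVB f g : measurable_fun setT f -> measurable_fun setT g ->
  measurable_fun setT (fun x => f x - g x).
Proof. by move=> mf mg; apply: measurable_rVD => //; exact: measurable_rVN. Qed.

Lemma measurable_enorm_comp f : measurable_fun setT f ->
  measurable_fun setT (fun x => enorm (f x)).
Proof. by move=> mf; exact: (measurableT_comp measurable_enorm mf). Qed.

End closure.

(** Open lower orthants are stable under intersection, generate the Borel sets and exhaust the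
    space, so two laws that agree on them are equal. *)
Definition orthant (a : V) : set V := [set x | forall i, x ord0 i < a ord0 i].

Lemma measurable_orthant a : measurable (orthant a).
Proof.
rewrite [X in measurable X](_ : _ = \bigcap_(i in [set: 'I_d])
    ((fun x : V => x ord0 i) @^-1` `]-oo, a ord0 i[%classic)); last first.
  by apply/seteqP; split=> x h i => [_|]; have /= := h i; rewrite in_itv/=; [|apply].
apply: fin_bigcap_measurable => // i _.
by rewrite -[X in measurable X]setTI; exact: measurable_coord.
Qed.

Lemma borel_orthant : @measurable _ V = <<s range orthant >>.
Proof.
apply/seteqP; split=> [|A]; last first.
  apply: smallest_sub; first exact: sigma_algebra_measurable.
  by move=> _ [a _ <-]; exact: measurable_orthant.
pose T := g_sigma_algebraType (range orthant).
have : measurable_fun [set: T] (fun x : T => (x : V)).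
  apply: measurable_rV => i; apply: (measurability _ (RGenInftyO.measurableE R)).
  move=> _ [_ [a ->] <-]; rewrite setTI.
  (* The half space below [a] in direction [i] is the union of the orthants whose other bounds
     grow. *)
  pose b (n : nat) : V := \row_j (if j == i then a else n%:R).
  rewrite [X in measurable X](_ : _ = \bigcup_n orthant (b n)).
    by apply: bigcupT_measurable => n; apply: sub_sigma_algebra; exists (b n).
  apply/seteqP; split=> x; last first.
    by move=> [n _ /(_ i)]; rewrite mxE eqxx /= in_itv.
  rewrite /= in_itv/= => xa; exists (Num.truncn `|x|).+1 => // j; rewrite mxE; case: eqVneq => [->//|_].
  rewrite (le_lt_trans _ (truncnS_gt _))// (le_trans (ler_norm _))//.
  exact: coord_le_sup_norm.
by move=> mid A mA; rewrite -(setTI A); exact: (mid measurableT A mA).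
Qed.

Lemma orthantI : setI_closed (range orthant).
Proof.
move=> _ _ [a _ <-] [b _ <-]; exists (\row_i Num.min (a ord0 i) (b ord0 i)) => //.
apply/seteqP; split=> [x h|x [h1 h2] i].
  by split=> i; have := h i; rewrite mxE lt_min => /andP[].
by rewrite mxE lt_min h1 h2.
Qed.

Lemma orthant_cover : \bigcup_n orthant (const_mx n%:R) = [set: V].
Proof.
apply/seteqP; split=> // x _; exists (Num.truncn `|x|).+1 => // j; rewrite mxE.
rewrite (le_lt_trans _ (truncnS_gt _))// (le_trans (ler_norm _))//.
exact: coord_le_sup_norm.
Qed.

Lemma probability_eq_orthant (m1 m2 : probability V R) :
  (forall a, m1 (orthant a) = m2 (orthant a)) ->
  forall A : set V, measurable A -> m1 A = m2 A.
Proof.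
move=> h A mA; apply: (@measure_unique _ _ _ (range orthant)
    (fun n => orthant (const_mx n%:R))) => //.
- exact: borel_orthant.
- exact: orthantI.
- exact: orthant_cover.
- by move=> _ [a _ <-]; exact: h.
- move=> n; rewrite (le_lt_trans (probability_le1 m1 (measurable_orthant _)))//.
  by rewrite ltry.
Qed.

End borel.

(** * Inequalities for nonnegative integrals *)

Section integration.
Context {R : realType} {disp : measure_display} {T : measurableType disp}.
Local Open Scope ereal_scope.

(** Monotonicity straight from the definition as a supremum over simple functions, so that neither
    integrand has to be shown measurable. *)
Lemma ge0_le_integralT (mu : {measure set T -> \bar R}) (f g : T -> \bar R) :
  (forall x, 0 <= f x) -> (forall x, f x <= g x) ->
  \int[mu]_x f x <= \int[mu]_x g x.
Proof.
move=> f0 fg; have g0 x : 0 <= g x by exact: le_trans (fg x).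
rewrite !ge0_integralTE//; apply: ge_ereal_sup => _ [h /= hf <-].
by apply: ereal_sup_ubound; exists h => // x; exact: le_trans (fg x).
Qed.

Lemma integral_cst_prob (P : probability T R) (c : \bar R) : \int[P]_x c = c.
Proof. rewrite (integral_cst P measurableT). by rewrite [X in _ * X](probability_setT P) mule1. Qed.

Lemma ge0_integral_le_centered (P : probability T R) (g A L : T -> R) :
  (forall w, 0 <= g w)%R -> (forall w, 0 <= A w)%R ->
  measurable_fun setT A ->
  P.-integrable setT (EFin \o L) -> \int[P]_w (L w)%:E = 0 ->
  (forall w, g w <= A w + L w)%R ->
  \int[P]_w (g w)%:E <= \int[P]_w (A w)%:E.
Proof.
move=> g0 A0 mA iL L0 gAL.
have [->|Afin] := eqVneq (\int[P]_w (A w)%:E) +oo; first by rewrite leey.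
have iA : P.-integrable setT (EFin \o A).
  apply/integrableP; split; first exact/measurable_EFinP.
  under eq_integral => w _ do rewrite /= ger0_norm//.
  by rewrite ltey.
apply: (@le_trans _ _ (\int[P]_w ((A w)%:E + (L w)%:E))).
  by apply: ge0_le_integralT => w; rewrite lee_fin.
by rewrite integralD//= L0 adde0.
Qed.

Lemma ge0_integralZDl (P : probability T R) (f g : T -> R) (a b : R) :
  (forall w, 0 <= f w)%R -> (forall w, 0 <= g w)%R -> (0 <= a)%R -> (0 <= b)%R ->
  measurable_fun setT f -> measurable_fun setT g ->
  \int[P]_w (a * f w + b * g w)%:E =
  a%:E * \int[P]_w (f w)%:E + b%:E * \int[P]_w (g w)%:E.
Proof.
move=> f0 g0 a0 b0 mf mg.
rewrite -ge0_integralZl//; last 2 first.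
- exact/measurable_EFinP.
- by move=> x _; rewrite lee_fin.
rewrite -ge0_integralZl//; last 2 first.
- exact/measurable_EFinP.
- by move=> x _; rewrite lee_fin.
rewrite -ge0_integralD//.
- by move=> x _; rewrite mule_ge0 ?lee_fin.
- by apply: measurable_funeM; exact/measurable_EFinP.
- by move=> x _; rewrite mule_ge0 ?lee_fin.
- by apply: measurable_funeM; exact/measurable_EFinP.
Qed.

End integration.

(** * Bounded Lipschitz functions determine a law *)

Section test_functions.
Context {R : realType} {d : nat}.
Local Notation V := 'rV[R]_d.

(** Lipschitz functions with values in the unit interval: enough of them to determine a law,
    preserved by the transition operators of contracting chains, and with finite means under every
    law. *)
Definition blip (g : V -> R) : Prop :=
  (forall x, 0 <= g x <= 1) /\
  exists2 L : R, 0 <= L & forall x y, `|g x - g y| <= L * enorm (x - y).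

Lemma blip_measurable g : blip g -> measurable_fun setT g.
Proof. by move=> [_ [L _ /lipschitz_measurable]]. Qed.

Lemma min_dist (a b u v e : R) : `|a - b| <= e -> `|u - v| <= e ->
  `|Num.min a u - Num.min b v| <= e.
Proof.
rewrite !ler_norml /Num.min => /andP[? ?] /andP[? ?].
by case: ltP => ?; case: ltP => ?; apply/andP; split; lra.
Qed.

(** A 1-Lipschitz function, capped at 1, that is positive exactly on the orthant below [a]. Scaled
    up and truncated it increases to the indicator of that orthant. *)
Definition gap (a x : V) : R := \big[Num.min/1]_(i < d) (a ord0 i - x ord0 i).

Lemma gap_lip a x y : `|gap a x - gap a y| <= 1 * enorm (x - y).
Proof.
rewrite mul1r /gap; elim/big_rec2 : _ => [|i u v _ h].
  by rewrite subrr normr0.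
apply: min_dist => //.
rewrite (_ : _ - _ = - ((x - y) ord0 i)); last by rewrite !mxE; ring.
by rewrite normrN coord_le_enorm.
Qed.

Lemma gap_gt0 a x : (0 < gap a x) <-> orthant a x.
Proof.
split=> [/bigmin_gtP[_ h] i|h]; first by have := h i isT; rewrite subr_gt0.
by apply/bigmin_gtP; split=> // i _; rewrite subr_gt0.
Qed.

Definition orthant_fn (a : V) (n : nat) (x : V) : R :=
  Num.max 0 (Num.min 1 (n%:R * gap a x)).

Lemma orthant_fn_blip a n : blip (orthant_fn a n).
Proof.
split=> [x|].
  by rewrite /orthant_fn le_max lexx /= ge_max ler01 ge_min lexx.
exists n%:R => // x y; rewrite /orthant_fn.
have h : `|n%:R * gap a x - n%:R * gap a y| <= n%:R * enorm (x - y).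
  rewrite -mulrBr normrM ger0_norm// ler_wpM2l//.
  by have := gap_lip a x y; rewrite mul1r.
have : `|Num.min 1 (n%:R * gap a x) - Num.min 1 (n%:R * gap a y)| <= n%:R * enorm (x - y).
  by apply: min_dist => //; rewrite subrr normr0 mulr_ge0.
move: (Num.min _ _) (Num.min _ _) => u v.
rewrite !ler_norml /Num.max => /andP[? ?].
by case: ltP => ?; case: ltP => ?; apply/andP; split; lra.
Qed.

Lemma orthant_fn_nd a x : {homo (fun n => orthant_fn a n x) : n m / (n <= m)%N >-> n <= m}.
Proof.
move=> n m nm; rewrite /orthant_fn.
have nmR : n%:R <= m%:R :> R by rewrite ler_nat.
have [g0|g0] := leP 0 (gap a x).
  have : n%:R * gap a x <= m%:R * gap a x by rewrite ler_wpM2r.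
  move: (n%:R * _) (m%:R * _) => u v uv.
  by rewrite ge_max !le_max lexx /= le_min !ge_min lexx uv !orbT.
have h (k : nat) : Num.max 0 (Num.min 1 (k%:R * gap a x)) = 0 :> R.
  apply/max_idPl; rewrite ge_min; apply/orP; right.
  by rewrite mulr_ge0_le0// ltW.
by rewrite !h.
Qed.

Lemma orthant_fn_cvg a x : orthant_fn a n x @[n --> \oo] --> (\1_(orthant a) x : R).
Proof.
rewrite indicE; case: (boolP (x \in orthant a)) => /=.
  rewrite inE => /gap_gt0 g0; apply: (@cvg_near_cst) => //.
  exists (Num.truncn (gap a x)^-1).+1 => // n /= hn; apply/eqP; rewrite /orthant_fn.
  have h : 1 <= n%:R * gap a x.
    rewrite -ler_pdivrMr// mul1r (le_trans (ltW (truncnS_gt _)))// ler_nat.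
    exact: hn.
  by rewrite (min_idPl h) (max_idPr ler01).
rewrite notin_setE => ng; have g0 : gap a x <= 0.
  by rewrite leNgt; apply/negP => /gap_gt0.
apply: (@cvg_near_cst) => //; apply: nearW => n; rewrite /orthant_fn.
by apply/max_idPl; rewrite ge_min mulr_ge0_le0// orbT.
Qed.

(** Monotone convergence along [orthant_fn] recovers the mass of every orthant. *)
Lemma probability_eq_blip (m1 m2 : probability V R) :
  (forall g, blip g -> (\int[m1]_x (g x)%:E = \int[m2]_x (g x)%:E)%E) ->
  forall A : set V, measurable A -> m1 A = m2 A.
Proof.
move=> h; apply: probability_eq_orthant => a.
have key (m : probability V R) :
    (\int[m]_x (orthant_fn a n x)%:E)%E @[n --> \oo] --> m (orthant a).
  have := @cvg_monotone_convergence _ _ _ m setT measurableT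
    (fun n x => (orthant_fn a n x)%:E).
  rewrite (_ : (\int[m]_x limn (fun n => (orthant_fn a n x)%:E) = m (orthant a))%E).
    apply.
    - by move=> n; apply/measurable_EFinP; apply: blip_measurable; exact: orthant_fn_blip.
    - by move=> n x _; rewrite lee_fin; have [+ _] := orthant_fn_blip a n => /(_ x)/andP[].
    - by move=> x _ n k nk; rewrite lee_fin; exact: orthant_fn_nd.
  rewrite -[in RHS](setIT (orthant a)) -integral_indic//; last exact: measurable_orthant.
  apply: eq_integral => x _; apply/cvg_lim => //.
  by apply: cvg_EFin; [exact: nearW|exact: orthant_fn_cvg].
apply: (cvg_unique _ (key m1)).
  exact: ereal_hausdorff.
rewrite /= (eq_cvg _ _ (fun n => h _ (orthant_fn_blip a n))); exact: key.
Qed.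

End test_functions.

(** * Laws, product measures and iid noise *)

Section laws.
Context {R : realType} {d1 d2 : measure_display}.
Context {T1 : measurableType d1} {T2 : measurableType d2}.
Local Open Scope ereal_scope.

Definition law (P : probability T1 R) (f : T1 -> T2) (mf : measurable_fun setT f) :
  probability T2 R := distribution P (mfun_Sub (mem_set mf)).

Lemma lawE P f (mf : measurable_fun setT f) A : law P mf A = P (f @^-1` A).
Proof. by []. Qed.

Lemma ge0_integral_law P f (mf : measurable_fun setT f) (g : T2 -> \bar R) :
  measurable_fun setT g -> (forall y, 0 <= g y) ->
  \int[law P mf]_y g y = \int[P]_x g (f x).
Proof. by move=> mg g0; rewrite /law ge0_integral_distribution. Qed.

(** The product measure under a name of its own, to which the probability structure below is
    attached. *)
Definition prodp (P : probability T1 R) (Q : probability T2 R) :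
  set (T1 * T2) -> \bar R := P \x Q.

Section instances.
Variables (P : probability T1 R) (Q : probability T2 R).

HB.instance Definition _ := Measure.on (prodp P Q).

Let prodpT : prodp P Q setT = 1.
Proof.
rewrite /prodp -setXTT (_ : (P \x Q) _ = P setT * Q setT).
  by rewrite !probability_setT mule1.
exact: product_measure1E.
Qed.

HB.instance Definition _ := Measure_isProbability.Build _ _ _ (prodp P Q) prodpT.

End instances.

Lemma prodpE (P : probability T1 R) (Q : probability T2 R) A B :
  measurable A -> measurable B -> prodp P Q (A `*` B) = P A * Q B.
Proof. exact: product_measure1E. Qed.

Lemma ge0_integral_prodp (P : probability T1 R) (Q : probability T2 R) f :
  measurable_fun setT f -> (forall z, 0 <= f z) ->
  \int[prodp P Q]_z f z = \int[P]_x \int[Q]_y f (x, y).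
Proof. by move=> mf f0; rewrite /prodp fubini_tonelli1. Qed.

Lemma ge0_integral_swap (P : probability T1 R) (Q : probability T2 R) f :
  measurable_fun setT f -> (forall z, 0 <= f z) ->
  \int[P]_x \int[Q]_y f (x, y) = \int[Q]_y \int[P]_x f (x, y).
Proof. by move=> mf f0; rewrite fubini_tonelli. Qed.

Lemma measurable_integral_r (Q : probability T2 R) f :
  measurable_fun setT f -> (forall z, 0 <= f z) ->
  measurable_fun setT (fun x : T1 => \int[Q]_y f (x, y)).
Proof. by move=> mf f0; exact: (measurable_fun_fubini_tonelli_F _ mf f0). Qed.

End laws.

(** * Conditioning on an independent past *)

Section freezing.
Context {R : realType} {d0 d1 d2 : measure_display}.
Context {Omega : measurableType d0} {T : measurableType d1} {E : measurableType d2}.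
Local Open Scope ereal_scope.

(** The factorisation on rectangles identifies the joint law of [Y] and [Z] with a product measure;
    Tonelli then integrates [Z] out while [Y] is held fixed. *)
Lemma freezing (P : probability Omega R) (gam : probability E R)
  (Y : Omega -> T) (Z : Omega -> E) (g : T * E -> \bar R) :
  measurable_fun setT Y -> measurable_fun setT Z ->
  (forall A B, measurable A -> measurable B ->
     P (Y @^-1` A `&` Z @^-1` B) = P (Y @^-1` A) * gam B) ->
  measurable_fun setT g -> (forall z, 0 <= g z) ->
  \int[P]_w g (Y w, Z w) = \int[P]_w \int[gam]_e g (Y w, e).
Proof.
move=> mY mZ ind mg g0.
have mYZ : measurable_fun setT (fun w => (Y w, Z w)) by exact: measurable_fun_pair.
rewrite -(ge0_integral_law P mYZ mg g0).
rewrite -(ge0_integral_law P mY (f := Y) (g := fun x => \int[gam]_e g (x, e))); first last.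
- by move=> x; exact: integral_ge0.
- exact: measurable_integral_r.
rewrite -ge0_integral_prodp//; apply: eq_measure_integral => A mA _; apply/esym.
apply: (@product_measure_unique _ _ _ _ _ (law P mY) gam (law P mYZ)) => //.
Qed.

End freezing.

Section measurable_wrt.
Context {d0 d1 : measure_display} {Omega : measurableType d0} {T : measurableType d1}.

Definition mwrt (G : set (set Omega)) (Y : Omega -> T) :=
  forall A, measurable A -> G (Y @^-1` A).

(** On [Omega] with the sigma-algebra [G], adaptedness is ordinary measurability, so the closure
    properties of measurable functions apply to it. *)
Lemma mwrtP (G : set (set Omega)) (Y : Omega -> T) : sigma_algebra setT G ->
  mwrt G Y <-> measurable_fun [set: g_sigma_algebraType G] (Y : g_sigma_algebraType G -> T).
Proof.
move=> sG; have GE : <<s G >> = G by exact: sigma_algebra_id.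
split=> [h _ A mA|h A mA].
  by rewrite setTI; apply: sub_sigma_algebra; exact: h.
by have := h measurableT A mA; rewrite setTI /measurable/= GE.
Qed.

Lemma mwrt_measurable (G : set (set Omega)) (Y : Omega -> T) :
  G `<=` measurable -> mwrt G Y -> measurable_fun setT Y.
Proof. by move=> Gm h _ A mA; rewrite setTI; apply: Gm; exact: h. Qed.

End measurable_wrt.

(** * Chains driven by independent noise, forward and backward *)

Section iid_noise.
Context {R : realType} {d0 d2 : measure_display}.
Context {Omega : measurableType d0} {E : measurableType d2}.
Local Open Scope ereal_scope.

(** [G n] is the information available before step [n]; [zeta n] becomes known one index later and
    is independent of [G n]. Taking [A] to be the whole space in [iid_indep] shows that every
    [zeta n] has law [gam]. *)
Record iid_noise (P : probability Omega R) (G : nat -> set (set Omega))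
    (zeta : nat -> Omega -> E) (gam : probability E R) : Prop := IidNoise {
  iid_sigma : forall n, sigma_algebra setT (G n);
  iid_sub : forall n, G n `<=` measurable;
  iid_incr : forall n, G n `<=` G n.+1;
  iid_meas : forall n, mwrt (G n.+1) (zeta n);
  iid_indep : forall n A B, G n A -> measurable B ->
    P (A `&` zeta n @^-1` B) = P A * gam B }.

Variables (P : probability Omega R) (G : nat -> set (set Omega)).
Variables (zeta : nat -> Omega -> E) (gam : probability E R).
Hypothesis noise : iid_noise P G zeta gam.

Lemma iid_measurable n : measurable_fun setT (zeta n).
Proof. exact: (mwrt_measurable (iid_sub noise (n := n.+1)) (iid_meas noise n)). Qed.

Lemma iid_mwrt k n : (k < n)%N -> mwrt (G n) (zeta k).
Proof.
elim: n => // n ih; rewrite ltnS leq_eqVlt => /orP[/eqP->|/ih h A mA].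
  exact: (iid_meas noise).
by apply: (iid_incr noise); exact: h.
Qed.

Lemma iid_freezing d1 (T : measurableType d1) n (Y : Omega -> T) (g : T * E -> \bar R) :
  mwrt (G n) Y -> measurable_fun setT g -> (forall z, 0 <= g z) ->
  \int[P]_w g (Y w, zeta n w) = \int[P]_w \int[gam]_e g (Y w, e).
Proof.
move=> mY mg g0; apply: freezing => //.
- exact: (mwrt_measurable (iid_sub noise (n := n))).
- exact: iid_measurable.
- by move=> A B mA mB; apply: (iid_indep noise) => //; exact: mY.
Qed.

Section chains.
Context {d1 : measure_display} {S : measurableType d1}.
Variable psi : S * E -> S.
Hypothesis mpsi : measurable_fun setT psi.

Fixpoint fwd (s : S) (n : nat) (w : Omega) : S :=
  if n is m.+1 then psi (fwd s m w, zeta m w) else s.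

(** The map of the newest noise is applied first and that of the oldest last. Going from [n] to
    [n.+1] steps changes only the starting point of the old composition, which a contraction
    forgets; [fwd] has the same law at each time but does not settle along a path. *)
Fixpoint bwd (n : nat) (s : S) (w : Omega) : S :=
  if n is m.+1 then bwd m (psi (s, zeta m w)) w else s.

(** The transition operator. Both chains have expectation [iter n Pop] at time [n], which is how
    estimates pass from one to the other. *)
Definition Pop (g : S -> \bar R) (s : S) : \bar R := \int[gam]_e g (psi (s, e)).

Lemma mwrt_fwd s n : mwrt (G n) (fwd s n).
Proof.
elim: n => [|n ih] /=.
  apply/(mwrtP _ (iid_sigma noise 0)); exact: measurable_cst.
apply/(mwrtP _ (iid_sigma noise n.+1)); apply: (measurableT_comp mpsi).
apply: measurable_fun_pair.
  by apply/(mwrtP _ (iid_sigma noise n.+1)) => A mA; apply: (iid_incr noise); exact: ih.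
by apply/(mwrtP _ (iid_sigma noise n.+1)); exact: (iid_meas noise).
Qed.

Lemma measurable_fwd s n : measurable_fun setT (fwd s n).
Proof. exact: (mwrt_measurable (iid_sub noise (n := n)) (mwrt_fwd s n)). Qed.

Lemma Pop_ge0 g : (forall s, 0 <= g s) -> forall s, 0 <= Pop g s.
Proof. by move=> g0 s; exact: integral_ge0. Qed.

Lemma measurable_Pop g : measurable_fun setT g -> (forall s, 0 <= g s) ->
  measurable_fun setT (Pop g).
Proof.
move=> mg g0; apply: (measurable_integral_r _ (f := fun z => g (psi z))) => //.
exact: measurableT_comp.
Qed.

Lemma fwd_stepE g s n : measurable_fun setT g -> (forall s, 0 <= g s) ->
  \int[P]_w g (fwd s n.+1 w) = \int[P]_w Pop g (fwd s n w).
Proof.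
move=> mg g0 /=; rewrite (iid_freezing (g := fun z => g (psi z)) (mwrt_fwd s n))//.
exact: measurableT_comp.
Qed.

Lemma integral_fwd g s n : measurable_fun setT g -> (forall s, 0 <= g s) ->
  \int[P]_w g (fwd s n w) = iter n Pop g s.
Proof.
elim: n g => [|n ih] g mg g0; first by rewrite /= integral_cst_prob.
rewrite fwd_stepE// iterSr ih//; [exact: measurable_Pop|exact: Pop_ge0].
Qed.

Lemma fwd_step_le (g h : S -> R) s n : measurable_fun setT g -> (forall s, 0 <= g s)%R ->
  (forall s, \int[gam]_e (g (psi (s, e)))%:E <= (h s)%:E) ->
  \int[P]_w (g (fwd s n.+1 w))%:E <= \int[P]_w (h (fwd s n w))%:E.
Proof.
move=> mg g0 gh; rewrite (fwd_stepE (g := fun x => (g x)%:E))//; last exact/measurable_EFinP.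
apply: ge0_le_integralT => w; last exact: gh.
by apply: integral_ge0 => e _; rewrite lee_fin.
Qed.

Lemma measurable_bwd n d3 (Om : measurableType d3) (Y : Om -> S) (iota : Om -> Omega) :
  measurable_fun setT Y -> (forall k, (k < n)%N -> measurable_fun setT (zeta k \o iota)) ->
  measurable_fun setT (fun x => bwd n (Y x) (iota x)).
Proof.
elim: n Y => [|n ih] Y mY mz //=.
apply: (ih (fun x => psi (Y x, zeta n (iota x)))) => [|k kn].
  by apply: (measurableT_comp mpsi); apply: measurable_fun_pair => //; exact: mz.
by apply: mz; exact: ltnW.
Qed.

Lemma bwd_freezing n (h : E -> S) g : measurable_fun setT h ->
  measurable_fun setT g -> (forall s, 0 <= g s) ->
  \int[P]_w g (bwd n (h (zeta n w)) w) = \int[gam]_e \int[P]_w g (bwd n (h e) w).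
Proof.
move=> mh mg g0.
have mm : measurable_fun [set: g_sigma_algebraType (G n) * E]
    (fun z => g (bwd n (h z.2) z.1)).
  apply: (measurableT_comp mg); apply: measurable_bwd => [|k kn].
    by apply: measurableT_comp => //; exact: measurable_snd.
  have /(mwrtP _ (iid_sigma noise n)) mk := iid_mwrt kn.
  exact: (measurableT_comp mk measurable_fst).
rewrite (iid_freezing (T := g_sigma_algebraType (G n)) (Y := fun w => w)
   (g := fun z => g (bwd n (h z.2) z.1)))//; last first.
  by apply/(mwrtP _ (iid_sigma noise n)); exact: measurable_id.
apply: (ge0_integral_swap P gam (f := fun z : Omega * E => g (bwd n (h z.2) z.1))) => //.
apply: (measurableT_comp mg); apply: measurable_bwd => [|k kn].
  by apply: measurableT_comp => //; exact: measurable_snd.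
by apply: measurableT_comp; [exact: iid_measurable|exact: measurable_fst].
Qed.

Lemma integral_bwd g s n : measurable_fun setT g -> (forall s, 0 <= g s) ->
  \int[P]_w g (bwd n s w) = iter n Pop g s.
Proof.
elim: n s => [|n ih] s mg g0 /=; first by rewrite /= integral_cst_prob.
have mh : measurable_fun setT (fun e => psi (s, e)).
  by apply: (measurableT_comp mpsi); apply: measurable_fun_pair => //; exact: measurable_cst.
rewrite (bwd_freezing n mh mg g0).
by apply: eq_integral => e _; rewrite ih.
Qed.

End chains.

End iid_noise.

(** * Gaussian moments *)

Section affine.
Context {R : realType} {disp : measure_display} {T : measurableType disp}.
Local Open Scope ereal_scope.

Lemma ge0_integral_affine (P : probability T R) (f : T -> R) (c a : R) :
  (0 <= c)%R -> (0 <= a)%R -> (forall w, 0 <= f w)%R -> measurable_fun setT f ->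
  \int[P]_w (c + a * f w)%:E = c%:E + a%:E * \int[P]_w (f w)%:E.
Proof.
move=> c0 a0 f0 mf; rewrite -ge0_integralZl//; last 2 first.
- exact/measurable_EFinP.
- by move=> x _; rewrite lee_fin.
rewrite -[c%:E in RHS](integral_cst_prob P) -ge0_integralD//.
- by move=> x _; rewrite mule_ge0 ?lee_fin.
- by apply: measurable_funeM; exact/measurable_EFinP.
Qed.

End affine.

(** * Integration against a density *)

Section density.
Context {R : realType} {disp : measure_display} {T : measurableType disp}.
Variables (mu nu : {measure set T -> \bar R}) (rho : T -> R).
Hypotheses (rho0 : forall x, 0 <= rho x) (mrho : measurable_fun setT rho).
Hypothesis nuE : forall A, measurable A -> nu A = (\int[mu]_(x in A) (rho x)%:E)%E.
Local Open Scope ereal_scope.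

Import HBNNSimple.

Let integral_density_nnsfun (f : {nnsfun T >-> R}) :
  \int[nu]_x (f x)%:E = \int[mu]_x ((f x)%:E * (rho x)%:E).
Proof.
under [LHS]eq_integral do rewrite fimfunE -fsumEFin//.
rewrite [LHS]ge0_integral_fsum//; last 2 first.
  - by move=> r; exact/measurable_EFinP/measurableT_comp.
  - by move=> n x _; rewrite EFinM nnfun_muleindic_ge0.
under [RHS]eq_integral.
  move=> x xD; rewrite muleC fimfunE -fsumEFin// ge0_mule_fsumr; last first.
    by move=> r; rewrite EFinM nnfun_muleindic_ge0.
  over.
rewrite [RHS]ge0_integral_fsum//; last 2 first.
  - move=> r; apply: emeasurable_funM; first exact/measurable_EFinP.
    exact/measurable_EFinP/measurableT_comp.
  - move=> n x _; apply: mule_ge0; first by rewrite lee_fin.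
    by rewrite EFinM nnfun_muleindic_ge0.
apply: eq_fsbigr => r _.
rewrite integralZl_indic_nnsfun// integral_indic// setIT nuE//.
have [r0|r0] := ltP r 0%R.
  rewrite preimage_nnfun0// integral_set0 mule0.
  by rewrite integral0_eq// => x _; rewrite indicE in_set0 mulr0 mule0.
rewrite [in LHS]integral_mkcond/= -ge0_integralZl//; first last.
- by move=> x _; rewrite patchE; case: ifP => // _; rewrite lee_fin.
- apply/(measurable_restrictT _ _).1 => //; exact/measurable_EFinP/measurable_funTS.
apply: eq_integral => x _; rewrite patchE indicE.
by case: ifPn => _; rewrite ?mule0 ?mulr0 ?mulr1 ?mule0// muleC.
Qed.

Lemma ge0_integral_density (f : T -> \bar R) :
  measurable_fun setT f -> (forall x, 0 <= f x) ->
  \int[nu]_x f x = \int[mu]_x (f x * (rho x)%:E).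
Proof.
move=> mf f0; pose f_ := nnsfun_approx measurableT mf.
have f_cvg x : (f_ n x)%:E @[n --> \oo] --> f x.
  by apply: cvg_nnsfun_approx => // y _; exact: f0.
transitivity (lim (\int[nu]_x (f_ n x)%:E @[n --> \oo])).
  rewrite -monotone_convergence//=.
  - by apply: eq_integral => x _; apply/esym/cvg_lim.
  - by move=> n; exact/measurable_EFinP/measurable_funTS.
  - by move=> n x _; rewrite lee_fin.
  - by move=> x _ m n mn; rewrite lee_fin; exact/lefP/nd_nnsfun_approx.
transitivity (lim (\int[mu]_x ((f_ n x)%:E * (rho x)%:E) @[n --> \oo])).
  by congr (lim _); apply/funext => A /=; under eq_fun do rewrite integral_density_nnsfun.
rewrite -monotone_convergence//=.
- apply: eq_integral => x _; apply/cvg_lim => //.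
  by apply: cvgeZr => //; exact: f_cvg.
- move=> n; apply: emeasurable_funM; last exact/measurable_EFinP.
  exact/measurable_EFinP/measurable_funTS.
- by move=> n x _; rewrite mule_ge0 ?lee_fin.
- move=> x _ m n mn; rewrite lee_wpmul2r// ?lee_fin//.
  exact/lefP/nd_nnsfun_approx.
Qed.

End density.

(** * Moments of the one-dimensional normal law *)

Section normal_moments.
Context {R : realType}.
Local Notation mu := (@lebesgue_measure R).

(** The integrand times the density is [K] times another normal density, whose mass is 1:
    exponential moments come out of completing a square, with no integration. *)
Lemma integral_normal_change (s m' s' K : R) (f : R -> R) : s != 0 -> 0 <= K ->
  (forall x, 0 <= f x) -> measurable_fun setT f ->
  (forall x, f x * normal_pdf 0 s x = K * normal_pdf m' s' x) ->
  (\int[normal_prob 0%R s]_x (f x)%:E = K%:E)%E.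
Proof.
move=> s0 K0 f0 mf fE.
rewrite (@ge0_integral_density _ _ _ mu (normal_prob 0 s) (normal_pdf 0 s))//; first last.
- exact/measurable_EFinP.
- exact: measurable_normal_pdf.
- by move=> x; exact: normal_pdf_ge0.
under eq_integral do rewrite -EFinM fE EFinM.
rewrite ge0_integralZl//; first by rewrite integral_normal_pdf mule1.
- by apply/measurable_EFinP; exact: measurable_normal_pdf.
- by move=> x _; rewrite lee_fin normal_pdf_ge0.
Qed.

Lemma normal_mgf (s a : R) : 0 < s ->
  (\int[normal_prob 0%R s]_x (expR (a * x))%:E = (expR (a ^+ 2 * s ^+ 2 / 2))%:E)%E.
Proof.
move=> s0; have sn0 : s != 0 by rewrite gt_eqF.
apply: (@integral_normal_change _ (a * s ^+ 2) s) => //; rewrite ?expR_ge0//.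
  by apply: measurableT_comp => //; exact: measurable_funM.
move=> x; rewrite !normal_pdfE//= mulrCA [RHS]mulrCA; congr (_ * _).
rewrite /normal_fun -!expRD; congr expR; field; exact: sn0.
Qed.

(** The tilted density is normal of variance [s ^+ 2 / (1 - 2 * c * s ^+ 2)], up to the quotient of
    the two peaks. *)
Lemma normal_sqr_mgf (s c : R) : 0 < s -> 2 * c * s ^+ 2 < 1 ->
  (\int[normal_prob 0%R s]_x (expR (c * x ^+ 2))%:E =
   (Num.sqrt (1 - 2 * c * s ^+ 2))^-1%:E)%E.
Proof.
move=> s0 c1; have sn0 : s != 0 by rewrite gt_eqF.
set u := 1 - 2 * c * s ^+ 2; have u0 : 0 < u by rewrite /u; lra.
have su0 : 0 < Num.sqrt u by rewrite sqrtr_gt0.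
have sun0 : Num.sqrt u != 0 by rewrite gt_eqF.
apply: (@integral_normal_change _ 0 (s / Num.sqrt u)) => //; rewrite ?invr_ge0 ?ltW//.
  apply: measurableT_comp => //; apply: measurable_funM => //; exact: measurable_funX.
have pk : normal_peak s = (Num.sqrt u)^-1 * normal_peak (s / Num.sqrt u).
  rewrite /normal_peak exprMn exprVn sqr_sqrtr ?(ltW u0)//.
  rewrite (_ : s ^+ 2 / u * pi *+ 2 = u^-1 * (s ^+ 2 * pi *+ 2)); last first.
    by rewrite !mulr2n; ring.
  rewrite sqrtrM ?invr_ge0 ?(ltW u0)// sqrtrV ?(ltW u0)// invfM invrK mulrA.
  by rewrite mulVf// mul1r.
move=> x; rewrite !normal_pdfE ?mulf_neq0 ?invr_neq0//= mulrCA pk -mulrA.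
congr (_ * (_ * _)); rewrite /normal_fun -expRD; congr expR.
rewrite exprMn exprVn sqr_sqrtr ?(ltW u0)// /u; field.
by rewrite sn0 -/u gt_eqF.
Qed.

(** This is [sinh t >= t]. Doubling the argument at least doubles the difference, so it suffices to
    look at [t / 2 ^+ n], where [1 + x <= expR x] gives the bound up to the factor [1 + t / 2 ^+ n];
    letting [n] grow removes it. *)
Lemma expR_sub_ge (t : R) : 0 <= t -> 2 * t <= expR t - expR (- t).
Proof.
move=> t0; have S2 (x : R) : 0 <= x ->
    2 * (expR x - expR (- x)) <= expR (2 * x) - expR (- (2 * x)).
  move=> x0; rewrite (_ : expR (2 * x) - _ =
    (expR x - expR (- x)) * (expR x + expR (- x))); last first.
    by rewrite mulr_natl mulr2n opprD !expRD; ring.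
  have ex0 : 0 <= expR x - expR (- x) by rewrite subr_ge0 ler_expR; lra.
  rewrite mulrC ler_wpM2l//; have := expR_ge1Dx x; have := expR_ge1Dx (- x); lra.
have Sn n : 2 ^+ n * (expR (t / 2 ^+ n) - expR (- (t / 2 ^+ n))) <= expR t - expR (- t).
  elim: n => [|n]; first by rewrite expr0 divr1 mul1r.
  apply: le_trans; rewrite exprSr -mulrA ler_wpM2l ?exprn_ge0//.
  have := S2 (t / (2 ^+ n * 2)); rewrite (_ : 2 * (t / _) = t / 2 ^+ n); last first.
    by field; rewrite expf_neq0.
  by apply; rewrite divr_ge0// mulr_ge0// exprn_ge0.
have S1 (x : R) : 0 <= x -> 2 * x <= (expR x - expR (- x)) * (1 + x).
  move=> x0; have h1 := expR_ge1Dx x.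
  have h2 : expR (- x) * (1 + x) <= 1.
    by rewrite expRN mulrC ler_pdivrMr ?expR_gt0// mul1r.
  have h3 : (1 + x) * (1 + x) <= expR x * (1 + x) by rewrite ler_wpM2r//; lra.
  have := sqr_ge0 x; lra.
set S := expR t - expR (- t); have S0 : 0 <= S by rewrite subr_ge0 ler_expR; lra.
apply/ler_addgt0Pr => e e0.
have [n hn] : exists n, t * S / e <= 2 ^+ n.
  exists (Num.truncn (t * S / e)).+1; rewrite (le_trans (ltW (truncnS_gt _)))//.
  by rewrite -natrX ler_nat ltnW// ltn_expl.
have p0 : 0 < 2 ^+ n :> R by rewrite exprn_gt0.
have := S1 (t / 2 ^+ n); rewrite divr_ge0 ?(ltW p0)// => /(_ isT).
rewrite -(ler_pM2l p0) (_ : 2 ^+ n * (2 * _) = 2 * t); last by field; rewrite gt_eqF.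
move=> /le_trans; apply; rewrite mulrA.
apply: (@le_trans _ _ (S * (1 + t / 2 ^+ n))).
  by rewrite ler_wpM2r ?Sn// addr_ge0// divr_ge0// ltW.
rewrite mulrDr mulr1 lerD2l mulrA ler_pdivrMr// mulrC (mulrC e) -ler_pdivrMr//.
Qed.

(** The excess over 2 is the square of [expR (y / 2) - expR (- (y / 2))], to which [expR_sub_ge]
    applies. *)
Lemma expR_addN_ge (y : R) : 2 + y ^+ 2 <= expR y + expR (- y).
Proof.
wlog y0 : y / 0 <= y.
  move=> h; have [/h//|/ltW y0] := leP 0 y.
  by have := h (- y); rewrite sqrrN opprK oppr_ge0 [expR (- y) + _]addrC; apply.
have h := @expR_sub_ge (y / 2); have {}h := h (divr_ge0 y0 (ler0n _ 2)).
have {}h : y ^+ 2 <= (expR (y / 2) - expR (- (y / 2))) ^+ 2.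
  by rewrite ler_pXn2r// ?nnegrE//; lra.
move: h; have -> : expR y = expR (y / 2) ^+ 2 by rewrite -expRM_natr; congr expR; field.
have -> : expR (- y) = expR (- (y / 2)) ^+ 2 by rewrite -expRM_natr; congr expR; field.
have : expR (y / 2) * expR (- (y / 2)) = 1 by exact: expRxMexpNx_1.
move: (expR _) (expR _) => p q; nra.
Qed.

Lemma invr_sqrt_le (t v : R) : 0 < t -> 0 <= v -> 1 <= v ^+ 2 * t -> (Num.sqrt t)^-1 <= v.
Proof.
move=> t0 v0 h; rewrite -div1r ler_pdivrMr ?sqrtr_gt0//.
rewrite -(@ler_pXn2r _ 2)// ?nnegrE ?mulr_ge0// expr1n exprMn sqr_sqrtr//; exact: ltW.
Qed.

Section moments_prob.
Variable s : R.
Hypothesis s0 : 0 < s.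
Local Notation N := (normal_prob 0%R s).
Local Open Scope ereal_scope.

Let sn0 : s != 0%R. Proof. by rewrite gt_eqF. Qed.
Let s20 : (0 < s ^+ 2)%R. Proof. by rewrite exprn_gt0. Qed.

Lemma measurable_sqr_fun : measurable_fun setT (fun x : R => x ^+ 2)%R.
Proof. exact: measurable_funX. Qed.

Lemma integral_cst_sqr (c : R) : (0 <= c)%R ->
  \int[N]_x (1 + c * x ^+ 2)%:E = 1 + c%:E * \int[N]_x (x ^+ 2)%:E.
Proof.
by move=> c0; rewrite ge0_integral_affine// => x; exact: sqr_ge0.
Qed.

(** The second moment is read off an exponential one: [1 + c * x ^+ 2 <= expR (c * x ^+ 2)] with
    [c = u / s ^+ 2], whose mean is at most [1 + u + 2 * u ^+ 2]. Division by [c] leaves the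
    relative error [2 * u], with [u] arbitrarily small. *)
Lemma normal_sqr_ub : \int[N]_x (x ^+ 2)%:E <= (s ^+ 2)%:E.
Proof.
have key (u : R) : (0 < u <= 1 / 8)%R ->
    \int[N]_x (x ^+ 2)%:E <= (s ^+ 2 * (1 + 2 * u))%:E.
  move=> /andP[u0 u8]; set c := (u / s ^+ 2)%R.
  have c0 : (0 < c)%R by rewrite divr_gt0.
  have cs : (c * s ^+ 2 = u)%R by rewrite /c divfK// gt_eqF.
  have c2 : (2 * c * s ^+ 2 = 2 * u)%R by rewrite -mulrA cs.
  have h : 1 + c%:E * \int[N]_x (x ^+ 2)%:E <= (1 + u + 2 * u ^+ 2)%:E.
    rewrite -integral_cst_sqr ?(ltW c0)//.
    apply: (@le_trans _ _ (\int[N]_x (expR (c * x ^+ 2))%:E)).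
      apply: ge0_le_integralT => x; rewrite lee_fin; last exact: expR_ge1Dx.
      by rewrite addr_ge0// mulr_ge0 ?(ltW c0)// sqr_ge0.
    rewrite normal_sqr_mgf ?c2//; last by lra.
    rewrite lee_fin; apply: invr_sqrt_le; [lra|nra|].
    have h3 : (u ^+ 3 <= u ^+ 2 / 8)%R by rewrite exprS; have := sqr_ge0 u; nra.
    have h4 : (u ^+ 4 <= u ^+ 2 / 64)%R by rewrite (exprD u 2 2); have := sqr_ge0 u; nra.
    have h5 : (u ^+ 5 <= u ^+ 2 / 512)%R by rewrite (exprD u 3 2); have := sqr_ge0 u; nra.
    have u20 := sqr_ge0 u.
    rewrite (_ : _ * _ = 1 + (u ^+ 2 - 6 * u ^+ 3 - 4 * u ^+ 4 - 8 * u ^+ 5))%R; last by ring.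
    lra.
  move: h; have : 0 <= \int[N]_x (x ^+ 2)%:E.
    by apply: integral_ge0 => x _; rewrite lee_fin sqr_ge0.
  case: (\int[N]_x _) => [r| |] //; last by rewrite mulry gtr0_sg// mul1e addey// leye_eq.
  rewrite -EFinM -EFinD !lee_fin => r0 h.
  rewrite -(ler_pM2l c0) mulrA cs; lra.
apply/lee_addgt0Pr => e e0.
set u := Num.min (1 / 8)%R (e / (2 * s ^+ 2))%R.
have u0 : (0 < u)%R by rewrite lt_min divr_gt0//= divr_gt0// mulr_gt0.
have u8 : (u <= 1 / 8)%R by rewrite ge_min lexx.
have ue : (u * (2 * s ^+ 2) <= e)%R by rewrite -ler_pdivlMr ?mulr_gt0// ge_min lexx orbT.
apply: (le_trans (key u _)); first by rewrite u0.
rewrite -EFinD lee_fin; lra.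
Qed.

(** From [1 - c * x ^+ 2 <= expR (- c * x ^+ 2)] with [c = 1 / (10 * s ^+ 2)]. The true factor is 1;
    [weight_step_in] can do with 82 / 100. *)
Lemma normal_sqr_lb : (86 / 100 * s ^+ 2)%:E <= \int[N]_x (x ^+ 2)%:E.
Proof.
set c := (10^-1 / s ^+ 2)%R.
have c0 : (0 < c)%R by rewrite divr_gt0.
have cs : (c * s ^+ 2 = 10^-1)%R by rewrite /c divfK// gt_eqF.
have c2 : (2 * c * s ^+ 2 = 2 * 10^-1)%R by rewrite -mulrA cs.
have c2N : (2 * - c * s ^+ 2 = - (2 * 10^-1))%R by rewrite mulrN mulNr c2.
have h : 1 <= (9135 / 10000)%:E + c%:E * \int[N]_x (x ^+ 2)%:E.
  have mE : measurable_fun setT (fun x : R => expR (- c * x ^+ 2)).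
    by apply: measurableT_comp => //; apply: measurable_funM => //; exact: measurable_sqr_fun.
  apply: (@le_trans _ _ (\int[N]_x (1 * expR (- c * x ^+ 2) + c * x ^+ 2)%:E)).
    rewrite -[leLHS](integral_cst_prob N); apply: ge0_le_integralT => x; rewrite lee_fin//.
    have := expR_ge1Dx (- c * x ^+ 2); lra.
  rewrite ge0_integralZDl ?(ltW c0)//; last by move=> x; exact: sqr_ge0.
  rewrite mul1e leeD2r// normal_sqr_mgf ?c2N//.
  by rewrite lee_fin; apply: invr_sqrt_le; lra.
move: h; have : 0 <= \int[N]_x (x ^+ 2)%:E.
  by apply: integral_ge0 => x _; rewrite lee_fin sqr_ge0.
case: (\int[N]_x _) => [r| |] //; last by move=> *; rewrite leey.
rewrite -EFinM -EFinD !lee_fin => r0 h.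
rewrite -(ler_pM2l c0) (mulrC (86 / 100)%R) mulrA cs; lra.
Qed.

(** [expR_addN_ge] at [c * x ^+ 2] isolates the fourth power: for [c = 1 / (10 * s ^+ 2)] the two
    exponential moments add up to at most [2 + 32 / 1000]. The true factor is 3. *)
Lemma normal_exp4_ub : \int[N]_x (x ^+ 4)%:E <= (32 / 10 * s ^+ 4)%:E.
Proof.
set c := (10^-1 / s ^+ 2)%R.
have c0 : (0 < c)%R by rewrite divr_gt0.
have cs : (c * s ^+ 2 = 10^-1)%R by rewrite /c divfK// gt_eqF.
have c2 : (2 * c * s ^+ 2 = 2 * 10^-1)%R by rewrite -mulrA cs.
have c2N : (2 * - c * s ^+ 2 = - (2 * 10^-1))%R by rewrite mulrN mulNr c2.
have mE (k : R) : measurable_fun setT (fun x : R => expR (k * x ^+ 2)).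
  by apply: measurableT_comp => //; apply: measurable_funM => //; exact: measurable_sqr_fun.
have h : 2%:E + (c ^+ 2)%:E * \int[N]_x (x ^+ 4)%:E <= (2 + 32 / 1000)%:E.
  rewrite -(@ge0_integral_affine _ _ _ N (fun x => x ^+ 4)%R) ?sqr_ge0//; last first.
    by move=> x; rewrite exprn_even_ge0.
  apply: (@le_trans _ _ (\int[N]_x (1 * expR (c * x ^+ 2) + 1 * expR (- c * x ^+ 2))%:E)).
    apply: ge0_le_integralT => x; rewrite lee_fin.
      by apply: addr_ge0 => //; apply: mulr_ge0; rewrite exprn_even_ge0.
    rewrite !mul1r mulNr; have := expR_addN_ge (c * x ^+ 2).
    by rewrite exprMn -exprM.
  rewrite ge0_integralZDl//; [|exact: mE|exact: mE].
  rewrite !mul1e !normal_sqr_mgf ?c2 ?c2N//; last by lra.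
  rewrite -EFinD lee_fin.
  have h1 : ((Num.sqrt (1 - 2 * 10^-1))^-1 <= 1119 / 1000 :> R)%R.
    by apply: invr_sqrt_le; lra.
  have h2 : ((Num.sqrt (1 - - (2 * 10^-1)))^-1 <= 913 / 1000 :> R)%R.
    by apply: invr_sqrt_le; lra.
  lra.
move: h; have : 0 <= \int[N]_x (x ^+ 4)%:E.
  by apply: integral_ge0 => x _; rewrite lee_fin exprn_even_ge0.
case: (\int[N]_x _) => [r| |] //; last first.
  by rewrite mulry gtr0_sg ?exprn_gt0// mul1e addey// leye_eq.
rewrite -EFinM -EFinD !lee_fin => r0 h.
have -> : (s ^+ 4 = (s ^+ 2) ^+ 2)%R by rewrite -exprM.
rewrite -(ler_pM2l (exprn_gt0 2 c0)) mulrCA -exprMn cs; lra.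
Qed.

Lemma integrable_normal_id : N.-integrable setT (EFin \o id).
Proof.
apply/integrableP; split; first exact/measurable_EFinP.
apply: (@le_lt_trans _ _ (\int[N]_x (1 + 1 * x ^+ 2)%:E)).
  apply: ge0_le_integralT => x /=; rewrite lee_fin// mul1r.
  by have := sqr_ge0 (`|x| - 1)%R; rewrite sqrrB real_normK ?num_real//; have := sqr_ge0 x; lra.
rewrite integral_cst_sqr// mul1e (le_lt_trans (leeD2l _ normal_sqr_ub))//.
by rewrite -EFinD ltry.
Qed.

(** A mean [r] satisfies [1 + a * r <= expR (a ^+ 2 * s ^+ 2 / 2)] for all [a]. The right-hand side
    exceeds 1 only to second order in [a], so [a = t * r] with small [t] contradicts [r != 0]. *)
Lemma normal_mean0 : \int[N]_x x%:E = 0.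
Proof.
have iN := integrable_normal_id.
have iE (a : R) : N.-integrable setT (fun x => (expR (a * x))%:E).
  apply/integrableP; split.
    by apply/measurable_EFinP; apply: measurableT_comp => //; exact: measurable_funM.
  under eq_integral do rewrite gee0_abs ?lee_fin ?expR_ge0//.
  by rewrite normal_mgf// ltry.
have Ifin := integrable_fin_num measurableT iN.
rewrite -[LHS]/(\int[N]_x (EFin \o id) x).
move: Ifin; case IE : (\int[N]_x (EFin \o id) x) => [r| |] // _.
have key (a : R) : (1 + a * r <= expR (a ^+ 2 * s ^+ 2 / 2))%R.
  rewrite -lee_fin -normal_mgf// EFinD EFinM -IE -integralZl//.
  rewrite -[1%:E](integral_cst_prob N) -integralD//; last 2 first.
  - exact: finite_measure_integrable_cst.
  - exact: integrableZl.
  apply: le_integral => //.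
  - apply: integrableD => //; first exact: finite_measure_integrable_cst.
    exact: integrableZl.
  - by move=> x _ /=; rewrite -EFinM -EFinD lee_fin expR_ge1Dx.
apply/eqP; rewrite eqe; apply/negPn/negP => r0.
have r20 : (0 < r ^+ 2)%R by rewrite exprn_even_gt0.
(* The caps give an exponent [y <= 1 / 2], where [expR y <= 1 + 2 * y], and
   [2 * y <= t * r ^+ 2 / 2]. *)
pose t := Num.min 1%R (Num.min (r ^+ 2 * s ^+ 2)^-1 (2 * s ^+ 2)^-1)%R.
have p0 : (0 < r ^+ 2 * s ^+ 2)%R by rewrite mulr_gt0.
have q0 : (0 < 2 * s ^+ 2)%R by rewrite mulr_gt0.
have t0 : (0 < t)%R by rewrite !lt_min ltr01 !invr_gt0 p0 q0.
have t1 : (t <= 1)%R by rewrite ge_min lexx.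
have tp : (t * (r ^+ 2 * s ^+ 2) <= 1)%R.
  by rewrite -ler_pdivlMr// div1r !ge_min lexx !orbT.
have tq : (t * (2 * s ^+ 2) <= 1)%R.
  by rewrite -ler_pdivlMr// div1r !ge_min lexx !orbT.
have := key (t * r)%R; set y := (X in expR X).
have yE : (y = t * (t * (r ^+ 2 * s ^+ 2)) / 2)%R by rewrite /y; ring.
have y0 : (0 <= y)%R by rewrite yE divr_ge0// mulr_ge0 ?(ltW t0)// mulr_ge0 ?ltW.
have y2 : (y <= 1 / 2)%R by rewrite yE ler_pM2r ?invr_gt0//; nra.
have ye : (2 * y <= t * r ^+ 2 / 2)%R.
  have -> : (2 * y = t * r ^+ 2 * (t * (2 * s ^+ 2)) / 2)%R by rewrite yE; field.
  by rewrite ler_pM2r ?invr_gt0// ger_pMr// mulr_gt0.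
have ey : (expR y <= 1 + 2 * y)%R.
  have h1 := expR_ge1Dx (- y)%R; have h2 := expRxMexpNx_1 y.
  have h3 := expR_gt0 y; have y1 : (0 < 1 - y)%R by lra.
  rewrite -(ler_pM2r y1); apply: (@le_trans _ _ 1%R); last by nra.
  by rewrite -h2 ler_pM2l//; lra.
have tr : (0 < t * r ^+ 2)%R by rewrite mulr_gt0.
move=> h; have : (1 + t * r * r <= 1 + 2 * y)%R by exact: le_trans ey.
rewrite -mulrA -expr2; lra.
Qed.

End moments_prob.

End normal_moments.

(** * Gaussian vectors *)

Section gaussian_vectors.
Context {R : realType} {d : nat}.
Local Notation V := 'rV[R]_d.

(** Only the marginals are recorded: each moment computed below is a sum over coordinates or is
    dominated by one. *)
Definition gaussian (g : probability V R) (s : R) : Prop :=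
  forall (i : 'I_d) B, measurable B ->
    g ((fun x : V => x ord0 i) @^-1` B) = normal_prob 0%R s B.

Lemma expr_le_fact_expR (y : R) p : 0 <= y -> y ^+ p <= p`!%:R * expR y.
Proof.
move=> y0; case: p => [|p]; first by rewrite expr0 fact0 mul1r (le_trans _ (expR_ge1Dx y))// lerDl.
have := expR_ge1Dxn p y0 => h; rewrite -ler_pdivrMl ?ltr0n ?fact_gt0// mulrC.
by apply: le_trans h; rewrite lerDr.
Qed.

(** A coordinate of largest modulus controls the norm up to the factor [d], and the two signs in the
    exponent cover its modulus. The summand 1 covers the zero vector and [d = 0]. *)
Lemma expR_enorm_le (a : R) (x : V) : 0 <= a -> expR (a * enorm x) <=
  1 + \sum_i (expR (a * d%:R * x ord0 i) + expR (- (a * d%:R) * x ord0 i)).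
Proof.
move=> a0; have e0 i : 0 <= expR (a * d%:R * x ord0 i) + expR (- (a * d%:R) * x ord0 i).
  by rewrite addr_ge0 ?expR_ge0.
have [j hj|h0] := pickP (fun j : 'I_d => enorm x <= d%:R * `|x ord0 j|); last first.
  have x0 : enorm x = 0.
    case: (posnP d) => [d0|d0].
      have dR : d%:R = 0 :> R by rewrite d0.
      have := enorm_le_sup_norm x; rewrite dR mul0r => h.
      by apply/eqP; rewrite eq_le h enorm_ge0.
    have [i0 _ hi0] := @arg_maxP _ _ _ (Ordinal d0) xpredT (fun i => `|x ord0 i|) isT.
    have := h0 i0 => /negP; case; apply: enorm_le_coord => i; exact: hi0.
  by rewrite x0 mulr0 expR0 lerDl; apply: sumr_ge0.
apply: (@le_trans _ _ (expR (a * d%:R * x ord0 j) + expR (- (a * d%:R) * x ord0 j))).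
  have [xj|xj] := leP 0 (x ord0 j).
    rewrite (@le_trans _ _ (expR (a * d%:R * x ord0 j)))// ?lerDl ?expR_ge0//.
    by rewrite ler_expR -mulrA ler_wpM2l//; move: hj; rewrite ger0_norm.
  rewrite (@le_trans _ _ (expR (- (a * d%:R) * x ord0 j)))// ?lerDr ?expR_ge0//.
  by rewrite ler_expR mulNr -mulrN -mulrA ler_wpM2l//; move: hj; rewrite ltr0_norm.
by rewrite (bigD1 j)//= addrCA lerDl addr_ge0// sumr_ge0.
Qed.

Section one_law.
Variables (g : probability V R) (s : R).
Hypotheses (s0 : 0 < s) (gs : gaussian g s).
Local Open Scope ereal_scope.

Lemma gaussian_coord (i : 'I_d) (f : R -> \bar R) :
  measurable_fun setT f -> (forall x, 0 <= f x) ->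
  \int[g]_x f (x ord0 i) = \int[normal_prob 0%R s]_y f y.
Proof.
have mci : measurable_fun setT ((fun x : V => x ord0 i) : V -> measurableTypeR R).
  exact: measurable_coord.
move=> mf f0; rewrite -(ge0_integral_law g mci (g := f))//.
by apply: eq_measure_integral => A mA _; exact: gs.
Qed.

Lemma gaussian_coordZ (i : 'I_d) (f : R -> R) :
  measurable_fun setT f -> (forall x, 0 <= f x)%R ->
  \int[g]_x (f (x ord0 i))%:E = \int[normal_prob 0%R s]_y (f y)%:E.
Proof.
move=> mf f0; apply: (gaussian_coord i (f := fun y => (f y)%:E)) => //.
exact/measurable_EFinP.
Qed.

Lemma gaussian_mgf (i : 'I_d) (a : R) :
  \int[g]_x (expR (a * x ord0 i))%:E = (expR (a ^+ 2 * s ^+ 2 / 2))%:E.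
Proof.
rewrite (gaussian_coordZ i (f := fun y => expR (a * y))) ?normal_mgf//.
by apply: measurableT_comp => //; exact: measurable_funM.
Qed.

Lemma integral_enorm_sqr : \int[g]_x (enorm x ^+ 2)%:E =
  \sum_(i < d) \int[normal_prob 0%R s]_y (y ^+ 2)%:E.
Proof.
under eq_integral do rewrite enorm_sqrE -sumEFin.
rewrite ge0_integral_sum//; last 2 first.
- by move=> i; apply/measurable_EFinP; apply: measurable_funX; exact: measurable_coord.
- by move=> i x _; rewrite lee_fin sqr_ge0.
apply: eq_bigr => i _; apply: (gaussian_coordZ i (f := fun y => y ^+ 2)%R).
  exact: measurable_funX.
exact: sqr_ge0.
Qed.

Lemma gaussian_sqr_ub : \int[g]_x (enorm x ^+ 2)%:E <= (d%:R * s ^+ 2)%:E.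
Proof.
rewrite integral_enorm_sqr (le_trans (lee_sum _ (fun i _ => normal_sqr_ub s0)))//.
by rewrite sumEFin sumr_const card_ord mulr_natl.
Qed.

Lemma gaussian_sqr_lb : (86 / 100 * (d%:R * s ^+ 2))%:E <= \int[g]_x (enorm x ^+ 2)%:E.
Proof.
rewrite integral_enorm_sqr; apply: le_trans (lee_sum _ (fun i _ => normal_sqr_lb s0)).
by rewrite sumEFin sumr_const card_ord lee_fin -mulr_natr; lra.
Qed.

(** Cauchy-Schwarz, in the form of [2 a b <= a^2 + b^2] summed over pairs, bounds the fourth power
    of the norm by [d] times the sum of the fourth powers of the coordinates. *)
Lemma gaussian_exp4_ub : \int[g]_x (enorm x ^+ 4)%:E <= (32 / 10 * d%:R ^+ 2 * s ^+ 4)%:E.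
Proof.
have key (x : V) : (enorm x ^+ 4 <= d%:R * \sum_(i < d) x ord0 i ^+ 4)%R.
  have -> : (enorm x ^+ 4 = (\sum_(i < d) x ord0 i ^+ 2) ^+ 2)%R.
    by rewrite -enorm_sqrE -exprM.
  pose a i := (x ord0 i ^+ 2)%R.
  rewrite expr2 big_distrlr/=.
  apply: (@le_trans _ _ (\sum_(i < d) \sum_(j < d) ((a i ^+ 2 + a j ^+ 2) / 2))%R).
    apply: ler_sum => i _; apply: ler_sum => j _; rewrite -/(a i) -/(a j).
    by have := sqr_ge0 (a i - a j); rewrite sqrrB; lra.
  have -> : (\sum_(i < d) x ord0 i ^+ 4 = \sum_(i < d) a i ^+ 2)%R.
    by apply: eq_bigr => i _; rewrite /a -exprM.
  have E i : (\sum_(j < d) (a i ^+ 2 + a j ^+ 2) / 2 =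
      (d%:R * a i ^+ 2 + \sum_(j < d) a j ^+ 2) / 2)%R.
    by rewrite -mulr_suml big_split/= sumr_const card_ord mulr_natl.
  rewrite (eq_bigr _ (fun i _ => E i)) -mulr_suml big_split/= -mulr_sumr.
  rewrite sumr_const card_ord -[(_ *+ d)%R]mulr_natl; lra.
apply: (@le_trans _ _ (\int[g]_x (d%:R%:E * (\sum_(i < d) (x ord0 i ^+ 4)%:E)))).
  apply: ge0_le_integralT => x; first by rewrite lee_fin exprn_ge0.
  by rewrite sumEFin -EFinM lee_fin.
have m4 (i : 'I_d) : measurable_fun setT (fun x : V => (x ord0 i ^+ 4)%:E).
  by apply/measurable_EFinP; apply: measurable_funX; exact: measurable_coord.
have p4 (i : 'I_d) (x : V) : 0 <= (x ord0 i ^+ 4)%:E by rewrite lee_fin exprn_even_ge0.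
rewrite ge0_integralZl//; last 2 first.
- by apply: emeasurable_sum => i.
- by move=> x _; apply: sume_ge0 => i _.
rewrite ge0_integral_sum//.
rewrite (_ : \sum_(i < d) _ = \sum_(i < d) \int[normal_prob 0%R s]_y (y ^+ 4)%:E); last first.
  apply: eq_bigr => i _; apply: (gaussian_coordZ i (f := fun y => y ^+ 4)%R).
    exact: measurable_funX.
  by move=> y; rewrite exprn_even_ge0.
apply: (@le_trans _ _ (d%:R%:E * \sum_(i < d) (32 / 10 * s ^+ 4)%:E)).
  by rewrite lee_wpmul2l ?lee_fin//; apply: lee_sum => i _; exact: normal_exp4_ub.
rewrite sumEFin -EFinM lee_fin sumr_const card_ord -mulr_natr; lra.
Qed.

Lemma integrable_gaussian_coord (i : 'I_d) :
  g.-integrable setT (EFin \o (fun x : V => x ord0 i)).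
Proof.
have mi := @measurable_coord R d i.
have /integrableP[_ h] := @integrable_normal_id R s s0.
apply/integrableP; split; first exact/measurable_EFinP.
rewrite /= (gaussian_coord i (f := fun y => `|y%:E|))//.
by apply: measurableT_comp => //; exact/measurable_EFinP.
Qed.

Lemma gaussian_coord_mean0 (i : 'I_d) : \int[g]_x (x ord0 i)%:E = 0.
Proof.
have mi : measurable_fun setT ((fun x : V => x ord0 i) : V -> measurableTypeR R).
  exact: measurable_coord.
rewrite -(@normal_mean0 R s s0).
have := @integral_pushforward _ _ _ _ R _ mi g setT EFin.
rewrite /= => <- //.
- by apply: eq_measure_integral => A mA _; exact: gs.
- by rewrite preimage_setT; exact: integrable_gaussian_coord.
Qed.

Lemma gaussian_inner_mean0 (v : V) :
  g.-integrable setT (EFin \o (fun x : V => inner v x)) /\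
  \int[g]_x (inner v x)%:E = 0.
Proof.
have iZ (i : 'I_d) : g.-integrable setT (fun x : V => (v ord0 i)%:E * (x ord0 i)%:E).
  by apply: integrableZl => //; exact: integrable_gaussian_coord.
have E : (fun x : V => (inner v x)%:E) =
    (fun x : V => \sum_(i < d) ((v ord0 i)%:E * (x ord0 i)%:E)).
  by apply/funext => x; rewrite /inner -sumEFin; apply: eq_bigr => i _; rewrite EFinM.
split; rewrite ?[EFin \o _]E.
  by apply: integrable_sum.
under eq_integral do rewrite [(inner _ _)%:E](congr1 (@^~ _) E).
rewrite integral_sum// big1// => i _.
rewrite integralZl//; last exact: integrable_gaussian_coord.
by rewrite gaussian_coord_mean0 mule0.
Qed.

Lemma gaussian_exp_enorm (a : R) : (0 <= a)%R ->
  \int[g]_x (expR (a * enorm x))%:E <=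
  (1 + d%:R * (2 * expR ((a * d%:R) ^+ 2 * s ^+ 2 / 2)))%:E.
Proof.
move=> a0.
pose f i (x : V) := (expR (a * d%:R * x ord0 i) + expR (- (a * d%:R) * x ord0 i))%:E.
have mexp (c : R) (i : 'I_d) : measurable_fun setT (fun x : V => (expR (c * x ord0 i))%:E).
  apply/measurable_EFinP; apply: measurableT_comp => //; apply: measurable_funM => //.
  exact: measurable_coord.
have mf i : measurable_fun setT (f i).
  rewrite /f; under eq_fun do rewrite EFinD; exact: emeasurable_funD.
have f0 i x : 0 <= f i x by rewrite lee_fin addr_ge0 ?expR_ge0.
apply: (@le_trans _ _ (\int[g]_x (1 + \sum_(i < d) f i x))).
  apply: ge0_le_integralT => x; first by rewrite lee_fin expR_ge0.
  by rewrite /f sumEFin -EFinD lee_fin expR_enorm_le.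
rewrite ge0_integralD//; last 2 first.
- by move=> x _; apply: sume_ge0.
- exact: emeasurable_sum.
rewrite integral_cst_prob ge0_integral_sum//.
rewrite (eq_bigr (fun=> (2 * expR ((a * d%:R) ^+ 2 * s ^+ 2 / 2))%:E)).
  by rewrite sumEFin -EFinD lee_fin sumr_const card_ord -[(_ *+ d)%R]mulr_natl.
move=> i _; rewrite /f; under eq_integral do rewrite EFinD.
rewrite ge0_integralD//.
by rewrite !gaussian_mgf sqrrN -EFinD; congr EFin; ring.
Qed.

End one_law.

Definition gauss_const (p : nat) : R :=
  p`!%:R * expR 1 * (1 + d%:R * (2 * expR (d%:R ^+ 2 / 2))).

Lemma gauss_const_ge0 p : 0 <= gauss_const p.
Proof. by rewrite !mulr_ge0 ?expR_ge0// addr_ge0// !mulr_ge0 ?expR_ge0. Qed.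

(** Measuring the norm in units of [s] makes the bound independent of [s]: powers are dominated by
    the exponential at rate [s^-1]. *)
Lemma gaussian_poly (g : probability V R) (s : R) p : 0 < s -> gaussian g s ->
  (\int[g]_x ((1 + enorm x / s) ^+ p)%:E <= (gauss_const p)%:E)%E.
Proof.
move=> s0 gs.
have q0 : 0 <= p`!%:R * expR 1 :> R by rewrite mulr_ge0 ?expR_ge0.
apply: (@le_trans _ _ (\int[g]_x ((p`!%:R * expR 1)%:E * (expR (s^-1 * enorm x))%:E)))%E.
  have h0 x : 0 <= 1 + enorm x / s by rewrite addr_ge0// divr_ge0// ltW.
  apply: ge0_le_integralT => x; first by rewrite lee_fin exprn_ge0.
  rewrite -EFinM lee_fin -mulrA -expRD [s^-1 * _]mulrC; exact: expr_le_fact_expR.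
rewrite ge0_integralZl ?lee_fin//; last first.
  apply/measurable_EFinP; apply: measurableT_comp => //; apply: measurable_funM => //.
  exact: measurable_enorm.
rewrite [leRHS]EFinM lee_wpmul2l ?lee_fin//.
apply: (le_trans (gaussian_exp_enorm s0 gs _)); first by rewrite invr_ge0 ltW.
rewrite lee_fin (_ : (s^-1 * _) ^+ 2 * s ^+ 2 = d%:R ^+ 2)//.
by field; rewrite gt_eqF.
Qed.

End gaussian_vectors.
Arguments gauss_const {R} d p.

(** * The weight *)

Section radial_weight.
Context {R : realType}.
Variables (rho C K : R).
Hypotheses (rho0 : 0 < rho) (C0 : 0 < C) (K0 : 0 < K).

Definition wt_in : R := 1 + rho.
Definition wt_out : R := (1 + rho) * (1 + 96 * C / K).
(** Chosen so that [wt_eps * (wt_curv / 2) * (d%:R * sigma ^+ 2)] is [K / 4], a quarter of the outer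
    rate. [wt_out] is then determined by [wt_curv * (wt_out - wt_in) = 2 * wt_in]. *)
Definition wt_curv : R := K / (48 * C).

(** A concave parabola up to [wt_in], then a convex one that reaches zero with zero slope at
    [wt_out]. Noise lowers the weight where it is concave; [wt_in] exceeds [rho] by 1 to leave room
    for one step from the ball. *)
Definition wt_rad (r : R) : R :=
  if r <= wt_in then wt_in * wt_out - r ^+ 2
  else if r <= wt_out then wt_curv / 2 * (wt_out - r) ^+ 2 else 0.

Local Notation a := wt_in.
Local Notation b := wt_out.
Local Notation M := wt_curv.

Lemma wt_curv_gt0 : 0 < M.
Proof. by rewrite divr_gt0// mulr_gt0. Qed.

Lemma wt_in_gt0 : 0 < a.
Proof. by rewrite addr_gt0. Qed.

Lemma wt_in_lt_out : a < b.
Proof. by rewrite -[ltLHS]mulr1 ltr_pM2l ?wt_in_gt0// ltrDl divr_gt0// mulr_gt0. Qed.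

Lemma wt_curvE : M * (b - a) = 2 * a.
Proof. by rewrite /wt_curv /wt_out /wt_in; field; rewrite ?gt_eqF. Qed.

(** The two equalities state that the parabolas have equal slopes and equal values at [wt_in]. *)
Lemma wt_facts : [/\ 0 < M, 0 < a, a < b, M * (b - a) = 2 * a &
  a * b = a ^+ 2 + M / 2 * (b - a) ^+ 2].
Proof.
have M0 := wt_curv_gt0; have a0 := wt_in_gt0; have ab := wt_in_lt_out; have ME := wt_curvE.
split => //.
by have -> : M / 2 * (b - a) ^+ 2 = M * (b - a) * (b - a) / 2; [field|rewrite ME; field].
Qed.

Lemma wt_rad_ge0 (r : R) : 0 <= r -> 0 <= wt_rad r.
Proof.
have [M0 a0 ab ME abE] := wt_facts.
move=> r0; rewrite /wt_rad; case: ifP => [ra|_].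
  have : r ^+ 2 <= a ^+ 2 by rewrite ler_pXn2r// nnegrE// ltW.
  have : 0 <= M / 2 * (b - a) ^+ 2 by rewrite mulr_ge0 ?sqr_ge0// divr_ge0// ltW.
  by rewrite abE; lra.
by case: ifP => // _; rewrite mulr_ge0 ?sqr_ge0// divr_ge0// ltW.
Qed.

Lemma wt_rad_out (r : R) : b <= r -> wt_rad r = 0.
Proof.
have [M0 a0 ab ME abE] := wt_facts.
move=> br; rewrite /wt_rad leNgt (lt_le_trans ab br)/=; case: ifP => // rb.
by have -> : r = b; [apply/eqP; rewrite eq_le rb|rewrite subrr expr0n/= mulr0].
Qed.

Lemma wt_rad_le (r : R) : 0 <= r -> wt_rad r <= a * b - Num.min r a ^+ 2.
Proof.
have [M0 a0 ab ME abE] := wt_facts.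
move=> r0; rewrite /wt_rad; case: ifP => [ra|/negbT]; first by rewrite (min_idPl ra).
rewrite -ltNge => ar; rewrite (min_idPr (ltW ar)) abE addrAC subrr add0r.
case: ifP => [rb|_]; last by rewrite mulr_ge0 ?sqr_ge0// divr_ge0// ltW.
by apply: ler_wpM2l; [rewrite divr_ge0// ltW|rewrite ler_pXn2r// ?nnegrE; lra].
Qed.

Lemma wt_rad_ub (r : R) : 0 <= r -> wt_rad r <= a * b.
Proof. by move=> r0; rewrite (le_trans (wt_rad_le r0))// gerBl sqr_ge0. Qed.

(** The steepest slope, [2 * a] in modulus, occurs at the junction [a]; points on different sides of
    a junction are compared through it. *)
Lemma wt_rad_lip (r s : R) : 0 <= r -> 0 <= s -> wt_rad r - wt_rad s <= 2 * a * `|r - s|.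
Proof.
have [M0 a0 ab ME abE] := wt_facts.
move=> r0 s0; have Ma : M * (b - a) = 2 * a := ME.
have h1 : r - s <= `|r - s| by exact: ler_norm.
have h2 : s - r <= `|r - s| by rewrite distrC ler_norm.
move: (`|r - s|) h1 h2 => e h1 h2; have e0 : 0 <= e by lra.
have K1 (u v : R) : a <= u -> u <= b -> a <= v -> v <= b -> v - u <= e ->
    M / 2 * (b - u) ^+ 2 - M / 2 * (b - v) ^+ 2 <= 2 * a * e.
  move=> au ub av vb uv.
  have -> : M / 2 * (b - u) ^+ 2 - M / 2 * (b - v) ^+ 2 =
    M * ((2 * b - u - v) / 2) * (v - u) by field.
  have h3 : 0 <= M * ((2 * b - u - v) / 2) by apply: mulr_ge0; [exact: ltW|lra].
  have h4 : M * ((2 * b - u - v) / 2) <= 2 * a by rewrite -Ma ler_pM2l//; lra.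
  by rewrite (le_trans (ler_wpM2l h3 uv))// ler_wpM2r.
have K2 (u v : R) : 0 <= u -> u <= a -> 0 <= v -> v <= a -> v - u <= e ->
    v ^+ 2 - u ^+ 2 <= 2 * a * e.
  move=> u0 ua v0 va uv; rewrite subr_sqr mulrC.
  by rewrite (le_trans (ler_wpM2l _ uv)) ?ler_wpM2r//; lra.
rewrite /wt_rad; case: ifP => [ra|/negbT]; [|rewrite -ltNge => ar; case: ifP => [rb|/negbT]].
- case: ifP => [sa|/negbT]; [|rewrite -ltNge => as_; case: ifP => [sb|/negbT]].
  + by have := K2 r s r0 ra s0 sa h2; lra.
  + have := K2 r a r0 ra (ltW a0) (lexx _); have := K1 a s (lexx _) (ltW ab) (ltW as_) sb.
    rewrite abE => k1 k2.
    have k3 : a ^+ 2 - r ^+ 2 <= 2 * a * (a - r) by have := sqr_ge0 (a - r); lra.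
    have k4 : M / 2 * (b - a) ^+ 2 - M / 2 * (b - s) ^+ 2 <= 2 * a * (s - a).
      have -> : M / 2 * (b - a) ^+ 2 - M / 2 * (b - s) ^+ 2 =
        M * (b - a) * (s - a) - M / 2 * (s - a) ^+ 2 by field.
      by rewrite Ma gerBl mulr_ge0 ?sqr_ge0// divr_ge0// ltW.
    have k5 : 2 * a * (s - r) <= 2 * a * e by rewrite ler_pM2l// mulr_gt0.
    lra.
  + rewrite -ltNge subr0 abE => bs.
    have k3 : a ^+ 2 - r ^+ 2 <= 2 * a * (a - r) by have := sqr_ge0 (a - r); lra.
    have k4 : M / 2 * (b - a) ^+ 2 <= 2 * a * (b - a).
      have -> : M / 2 * (b - a) ^+ 2 = M * (b - a) * (b - a) / 2 by field.
      rewrite Ma; have ba : 0 <= b - a by rewrite subr_ge0 ltW.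
      by have := mulr_ge0 (ltW a0) ba; lra.
    have k5 : 2 * a * (b - r) <= 2 * a * e by rewrite ler_pM2l ?mulr_gt0//; lra.
    lra.
- case: ifP => [sa|/negbT]; [|rewrite -ltNge => as_; case: ifP => [sb|/negbT]].
  + apply: (@le_trans _ _ 0); last by rewrite !mulr_ge0// ltW.
    have k1 : M / 2 * (b - r) ^+ 2 <= M / 2 * (b - a) ^+ 2.
      by apply: ler_wpM2l; [rewrite divr_ge0// ltW|rewrite ler_pXn2r// ?nnegrE; lra].
    have k2 : s ^+ 2 <= a ^+ 2 by rewrite ler_pXn2r// nnegrE// ltW.
    by rewrite abE; lra.
  + exact: (K1 r s (ltW ar) rb (ltW as_) sb h2).
  + rewrite -ltNge => bs; have := K1 r b (ltW ar) rb (ltW ab) (lexx _).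
    by rewrite subrr expr0n/= mulr0; apply; lra.
- rewrite -ltNge => br; rewrite sub0r.
  apply: (@le_trans _ _ 0); last by rewrite !mulr_ge0// ltW.
  by rewrite oppr_le0; have := wt_rad_ge0 s0; rewrite /wt_rad.
Qed.

(** [wt_rad] minus [M / 2] times the square is concave: a concave parabola, a line of slope
    [- (M * b)] and again a concave parabola, with matching slopes. [k] is the slope of a supporting
    line at [t]; its sign and its vanishing at 0 are what composition with the norm requires. *)
Lemma wt_rad_tangent (t : R) : 0 <= t -> exists k : R, [/\ k <= 0, t = 0 -> k = 0 &
  forall s : R, 0 <= s ->
    wt_rad s - M / 2 * s ^+ 2 <= wt_rad t - M / 2 * t ^+ 2 + k * (s - t)].
Proof.
have [M0 a0 ab ME abE] := wt_facts.
move=> t0; have Mb : M * b = (2 + M) * a by have := ME; lra.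
have P (u v : R) : 0 <= u -> 0 <= v -> 0 <= u * v by exact: mulr_ge0.
have sq (u : R) : 0 <= (1 + M / 2) * u ^+ 2.
  by rewrite mulr_ge0 ?sqr_ge0// addr_ge0// divr_ge0// ltW.
have sM (u : R) : 0 <= M / 2 * u ^+ 2 by rewrite mulr_ge0 ?sqr_ge0// divr_ge0// ltW.
have M2 : 0 <= 2 + M by rewrite addr_ge0// ltW.
have in1 (s : R) : a * b - s ^+ 2 - M / 2 * s ^+ 2 =
    M / 2 * b ^+ 2 - M * b * s - (1 + M / 2) * (a - s) ^+ 2.
  have h : (M * b - (2 + M) * a) * (a - s) = 0 by rewrite Mb subrr mul0r.
  rewrite abE; lra.
have [ta|at_] := leP t a; [|have [tb|bt] := leP t b].
- exists (- ((2 + M) * t)); split => [|->|s s0].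
  + by rewrite oppr_le0 mulr_ge0.
  + by rewrite mulr0 oppr0.
  rewrite {2}/wt_rad ta in1 Mb /wt_rad.
  have [sa|as_] := leP s a; [|have [sb|bs] := leP s b].
  + by rewrite in1 Mb; have := sq (s - t); lra.
  + have -> : M / 2 * (b - s) ^+ 2 - M / 2 * s ^+ 2 = M / 2 * b ^+ 2 - M * b * s by field.
    rewrite Mb; have := sq (a - t); have := P _ _ M2 (P (s - a) (a - t) _ _); lra.
  + have := sq (a - t); have := P _ _ M2 (P (s - a) (a - t) _ _).
    have := sM (s - b); have -> : M / 2 * (s - b) ^+ 2 =
      M / 2 * s ^+ 2 - M * b * s + M / 2 * b ^+ 2 by field.
    by rewrite Mb; lra.
- exists (- (M * b)); split => [|t00|s s0].
  + by rewrite oppr_le0 mulr_ge0// ltW// (lt_trans a0).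
  + by move: at_; rewrite t00; have := a0; lra.
  rewrite {2}/wt_rad (leNgt t a) at_/= tb.
  have -> : M / 2 * (b - t) ^+ 2 - M / 2 * t ^+ 2 + - (M * b) * (s - t) =
    M / 2 * b ^+ 2 - M * b * s by field.
  rewrite /wt_rad; have [sa|as_] := leP s a; [|have [sb|bs] := leP s b].
  + by rewrite in1; have := sq (a - s); lra.
  + by have -> : M / 2 * (b - s) ^+ 2 - M / 2 * s ^+ 2 = M / 2 * b ^+ 2 - M * b * s by field.
  + have := sM (s - b); have -> : M / 2 * (s - b) ^+ 2 =
      M / 2 * s ^+ 2 - M * b * s + M / 2 * b ^+ 2 by field.
    lra.
- exists (- (M * t)); split => [|->|s s0].
  + by rewrite oppr_le0 mulr_ge0// ltW.
  + by rewrite mulr0 oppr0.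
  rewrite {2}/wt_rad (leNgt t a) (lt_trans ab bt)/= (leNgt t b) bt/=.
  have st (u : R) : u <= b -> M / 2 * b ^+ 2 - M * b * u <= 0 - M / 2 * t ^+ 2 + - (M * t) * (u - t).
    move=> ub; rewrite -subr_ge0.
    have -> : 0 - M / 2 * t ^+ 2 + - (M * t) * (u - t) - (M / 2 * b ^+ 2 - M * b * u) =
      M / 2 * ((t - b) * (t + b - 2 * u)) by field.
    by apply: mulr_ge0; [rewrite divr_ge0// ltW|apply: mulr_ge0; lra].
  rewrite /wt_rad; have [sa|as_] := leP s a; [|have [sb|bs] := leP s b].
  + rewrite in1; apply: le_trans (st s _); last by lra.
    by have := sq (a - s); lra.
  + have -> : M / 2 * (b - s) ^+ 2 - M / 2 * s ^+ 2 = M / 2 * b ^+ 2 - M * b * s by field.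
    exact: st.
  + have := sM (s - t); lra.
Qed.

(** Since [k <= 0] and the norm is convex, the radial supporting line lies below a linear function
    of [y]; the square of the norm, added back, expands exactly around [m]. At [m = 0] there is no
    direction, and [k = 0] makes none necessary. *)
Lemma wt_rad_semiconcave d (m : 'rV[R]_d) : exists G : 'rV[R]_d, forall y,
  wt_rad (enorm y) <= wt_rad (enorm m) + inner G (y - m) + M / 2 * enorm (y - m) ^+ 2.
Proof.
have [M0 a0 ab ME abE] := wt_facts.
have [k [k0 kt H]] := wt_rad_tangent (enorm_ge0 m).
have [m0|mn0] := eqVneq (enorm m) 0.
  exists 0 => y; have := H _ (enorm_ge0 y).
  rewrite (kt m0) mul0r addr0 inner0l addr0 m0 expr0n/= mulr0 subr0.
  by rewrite (enorm_eq0 m0) subr0; lra.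
have mp : 0 < enorm m by rewrite lt_neqAle eq_sym mn0 enorm_ge0.
exists ((k / enorm m + M) *: m) => y.
have ky := H _ (enorm_ge0 y).
have cs : k * (enorm y - enorm m) <= k / enorm m * inner m (y - m).
  have E : k / enorm m * inner m (y - m) = k * (inner m y / enorm m - enorm m).
    by rewrite innerDr innerNr -enorm_sqr; field.
  rewrite E; apply: ler_wnM2l => //; rewrite lerD2r ler_pdivrMr// mulrC.
  exact: inner_le.
rewrite innerZl mulrDl.
have yE : enorm y ^+ 2 = enorm m ^+ 2 + 2 * inner m (y - m) + enorm (y - m) ^+ 2.
  by rewrite -enormD_sqr addrC subrK.
by move: ky; rewrite yE; lra.
Qed.

End radial_weight.

(** From [4 * k * t <= (t + k) ^+ 2] and [8 * k ^+ 3 * t <= (t + k) ^+ 4]; the constants are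
    [1 / (16 * k ^+ 2)] and [1 / (4 * k ^+ 3)] rounded up at [k = 31 / 32]. A fourth power is wanted
    because the fourth moment of the noise is of second order in the step. *)
Lemma quartic_excess (R : realType) (t k al : R) : 0 <= t -> 31 / 32 <= k -> 0 <= al ->
  t ^+ 2 + 2 * al * t <= (7 / 100 + 7 / 25 * al) * (t + k) ^+ 4.
Proof.
move=> t0 kp a1.
have kk : 15 / 16 <= k ^+ 2 by rewrite expr2; nra.
have k3 : 25 / 28 <= k ^+ 3 by rewrite exprS; nra.
have y4 : 0 <= (t + k) ^+ 4 by rewrite exprn_even_ge0.
have k1 : t ^+ 2 <= 7 / 100 * (t + k) ^+ 4.
  have h : 4 * k * t <= (t + k) ^+ 2 by have := sqr_ge0 (t - k); lra.
  have h0 : 0 <= 4 * k * t by apply: mulr_ge0 => //; lra.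
  have : (4 * k * t) ^+ 2 <= ((t + k) ^+ 2) ^+ 2 by rewrite ler_pXn2r// nnegrE// sqr_ge0.
  rewrite -exprM !exprMn; have := ler_wpM2r (sqr_ge0 t) kk; lra.
have k2 : 2 * t <= 7 / 25 * (t + k) ^+ 4.
  have : 8 * k ^+ 3 * t <= (t + k) ^+ 4.
    (* A decomposition into squares; the best constant, 256 / 27, leaves room above 8. *)
    rewrite -subr_ge0; pose y1 := t + k.
    have -> : (t + k) ^+ 4 - 8 * k ^+ 3 * t = (y1 ^+ 2 - 3 / 2 * k ^+ 2) ^+ 2 +
      3 * k ^+ 2 * (y1 - 4 / 3 * k) ^+ 2 + k ^+ 4 * (8 - 9 / 4 - 16 / 3).
      by rewrite /y1; field.
    have p1 := sqr_ge0 (y1 ^+ 2 - 3 / 2 * k ^+ 2).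
    have p2 : 0 <= 3 * k ^+ 2 * (y1 - 4 / 3 * k) ^+ 2.
      by apply: mulr_ge0 (sqr_ge0 _); apply: mulr_ge0 (sqr_ge0 _).
    have p3 : 0 <= k ^+ 4 by rewrite exprn_even_ge0.
    lra.
  have := ler_wpM2r t0 k3; lra.
have := ler_wpM2l a1 k2; lra.
Qed.

(** * Mean change of the weight under the noise *)

Section weight_step.
Context {R : realType} {d : nat}.
Local Notation V := 'rV[R]_d.
Variables (rho C K sigma : R).
Hypotheses (rho0 : 0 < rho) (C0 : 0 < C) (K0 : 0 < K) (d0 : (0 < d)%N) (s0 : 0 < sigma ^+ 2).

Local Notation a := (wt_in rho).
Local Notation b := (wt_out rho C K).
Local Notation M := (wt_curv C K).

(** Normalised by [wt_eps * (d%:R * sigma ^+ 2) = 24 * C]: a quarter of the mean squared noise then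
    lowers the weight by [6 * C * delta], twice what the expansion of the squared distance takes. *)
Definition wt_eps : R := 24 * C / (d%:R * sigma ^+ 2).
Definition weight (x : V) : R := 1 + wt_eps * wt_rad rho C K (enorm x).
Definition weight_max : R := 1 + wt_eps * (a * b).

Local Notation e := wt_eps.

Let dR0 : 0 < d%:R :> R. Proof. by rewrite ltr0n. Qed.

Lemma wt_eps_gt0 : 0 < e.
Proof. by apply: divr_gt0; apply: mulr_gt0; rewrite ?ltr0n. Qed.

Lemma wt_epsE : e * (d%:R * sigma ^+ 2) = 24 * C.
Proof. by rewrite /wt_eps divfK// gt_eqF// mulr_gt0. Qed.

Lemma weight_ge1 x : 1 <= weight x.
Proof.
by rewrite lerDl mulr_ge0 ?(ltW wt_eps_gt0)//; apply: wt_rad_ge0.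
Qed.

Lemma weight_ge0 x : 0 <= weight x.
Proof. exact: le_trans (weight_ge1 x). Qed.

Lemma weight_le x : weight x <= weight_max.
Proof.
by rewrite lerD2l ler_pM2l ?wt_eps_gt0//; apply: wt_rad_ub.
Qed.

Lemma weight_sub_le x y : weight x - weight y <= e * (2 * a) * enorm (x - y).
Proof.
rewrite /weight opprD addrACA subrr add0r -mulrBr -mulrA ler_pM2l ?wt_eps_gt0//.
apply: (le_trans (wt_rad_lip rho0 C0 K0 (enorm_ge0 x) (enorm_ge0 y))).
by rewrite ler_wpM2l ?ler_enorm_dist// mulr_ge0// ltW// wt_in_gt0.
Qed.

Lemma weight_lip x y : `|weight x - weight y| <= e * (2 * a) * enorm (x - y).
Proof. by rewrite ler_norml weight_sub_le andbT lerNl opprB enormB weight_sub_le. Qed.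

Lemma weight_semiconcave (m : V) : exists G : V, forall y,
  weight y <= weight m + inner G (y - m) + e * (M / 2) * enorm (y - m) ^+ 2.
Proof.
have [G hG] := wt_rad_semiconcave rho0 C0 K0 m; exists (e *: G) => y.
rewrite innerZl /weight -!addrA lerD2l -mulrA -!mulrDr ler_pM2l ?wt_eps_gt0//.
by rewrite addrA.
Qed.

Variables (delta : R) (g : probability V R).
Hypotheses (dl0 : 0 < delta) (hg : gaussian g (Num.sqrt delta)).

Let sd0 : 0 < Num.sqrt delta. Proof. by rewrite sqrtr_gt0. Qed.
Let sd2 : Num.sqrt delta ^+ 2 = delta. Proof. by rewrite sqr_sqrtr// ltW. Qed.

(** Semiconcavity leaves a linear term of mean zero and a quadratic one, of mean at most
    [24 * C * (wt_curv / 2) * delta], which is [K / 4 * delta]. *)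
Lemma weight_step_any (m : V) :
  (\int[g]_z (weight (m + sigma *: z))%:E <= (weight m + K / 4 * delta)%:E)%E.
Proof.
have [G hG] := weight_semiconcave m.
have q0 : 0 <= e * (M / 2) * sigma ^+ 2.
  have := wt_eps_gt0; have := wt_curv_gt0 C0 K0 => h1 h2.
  apply: mulr_ge0; last exact: ltW.
  by apply: mulr_ge0; [exact: ltW|rewrite divr_ge0// ltW].
have [iL L0] := gaussian_inner_mean0 sd0 hg (sigma *: G).
have m2 : measurable_fun setT (fun z : V => enorm z ^+ 2).
  by apply: measurable_funX; exact: measurable_enorm.
apply: (@le_trans _ _
    (\int[g]_z (weight m + e * (M / 2) * sigma ^+ 2 * enorm z ^+ 2)%:E)%E).
  apply: (ge0_integral_le_centered _ _ _ iL L0).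
  - by move=> z; exact: weight_ge0.
  - by move=> z; rewrite addr_ge0 ?weight_ge0// mulr_ge0// sqr_ge0.
  - by apply: measurable_funD => //; exact: measurable_funM.
  - move=> z; have := hG (m + sigma *: z); rewrite [m + _ - m]addrAC subrr add0r enormZ.
    by rewrite exprMn real_normK ?num_real// innerZr innerZl; lra.
rewrite ge0_integral_affine ?weight_ge0//; last by move=> z; exact: sqr_ge0.
apply: (@le_trans _ _ ((weight m)%:E + (e * (M / 2) * sigma ^+ 2)%:E * (d%:R * delta)%:E)%E).
  by rewrite leeD2l// lee_wpmul2l ?lee_fin// -sd2; exact: gaussian_sqr_ub.
rewrite -EFinM -EFinD lee_fin lerD2l.
have -> : e * (M / 2) * sigma ^+ 2 * (d%:R * delta) = e * (d%:R * sigma ^+ 2) * (M / 2) * delta.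
  by ring.
rewrite wt_epsE /wt_curv le_eqVlt; apply/orP; left; apply/eqP; field.
by rewrite gt_eqF.
Qed.

Lemma sqr_excess_le (m y : V) (c : R) : 0 <= c -> 31 / 32 <= c -> enorm m <= a - c ->
  enorm (m + y) ^+ 2 - Num.min (enorm (m + y)) a ^+ 2 <=
    (7 / 100 + 7 / 25 * a) * enorm y ^+ 4.
Proof.
move=> c0 c1 mc; have a1 : 0 < a := wt_in_gt0 rho0.
have ty := ler_enormD m y.
have y0 := enorm_ge0 y; have my0 := enorm_ge0 (m + y).
have qa : 0 <= 7 / 100 + 7 / 25 * a by lra.
have Q0 : 0 <= (7 / 100 + 7 / 25 * a) * enorm y ^+ 4 by exact: mulr_ge0 qa (exprn_ge0 _ y0).
have [ma|am] := leP (enorm (m + y)) a.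
  by rewrite subrr.
set k : R := 31 / 32; set t := enorm y - k.
have t0 : 0 < t by rewrite /t /k; lra.
apply: (@le_trans _ _ (t ^+ 2 + 2 * a * t)).
  have h : enorm (m + y) <= a + t by rewrite /t /k; lra.
  have -> : t ^+ 2 + 2 * a * t = (a + t) ^+ 2 - a ^+ 2 by ring.
  by rewrite lerD2r ler_pXn2r// ?nnegrE ?(ltW (addr_gt0 a1 t0)).
have -> : enorm y = t + k by rewrite /t; ring.
by apply: quartic_excess; rewrite ?(ltW t0) ?(ltW a1)// /k.
Qed.

(** Were the parabola valid everywhere, the mean loss would be [sigma ^+ 2] times the second moment
    of the noise, at least 86 / 100 of [s]. Leaving the parabola costs a fourth moment, at most 32 /
    100 of [s] for small steps; more than one half is left. *)
Lemma weight_step_in (m : V) : 4 * (2 + d%:R) * (1 + rho ^+ 2) * sigma ^+ 2 * delta <= 1 ->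
  enorm m <= a - 31 / 32 ->
  (\int[g]_z (weight (m + sigma *: z))%:E <=
   (1 + e * (a * b - enorm m ^+ 2 - d%:R * sigma ^+ 2 * delta / 2))%:E)%E.
Proof.
move=> hd hm; have a1 : 0 < a := wt_in_gt0 rho0.
have e0 := wt_eps_gt0.
have a2 : 1 < a by rewrite ltrDl.
set Q : R := 7 / 100 + 7 / 25 * a.
have Q0 : 0 <= Q by rewrite /Q; lra.
set s := d%:R * sigma ^+ 2 * delta.
have s1 : 0 < s by apply: mulr_gt0 => //; apply: mulr_gt0.
have hs : 4 * (1 + rho ^+ 2) * s <= 1.
  apply: le_trans hd; rewrite /s -subr_ge0.
  have -> : 4 * (2 + d%:R) * (1 + rho ^+ 2) * sigma ^+ 2 * delta -
    4 * (1 + rho ^+ 2) * (d%:R * sigma ^+ 2 * delta) =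
    8 * (1 + rho ^+ 2) * (sigma ^+ 2 * delta) by ring.
  apply: mulr_ge0; last by rewrite ltW// mulr_gt0.
  by rewrite mulr_ge0// addr_ge0// sqr_ge0.
have s4 : s <= 1 / 4 by have := mulr_ge0 (sqr_ge0 rho) (ltW s1); lra.
have m2 : measurable_fun setT (fun z : V => enorm z ^+ 2).
  by apply: measurable_funX; exact: measurable_enorm.
have m4 : measurable_fun setT (fun z : V => enorm z ^+ 4).
  by apply: measurable_funX; exact: measurable_enorm.
have := gaussian_sqr_ub sd0 hg; have := gaussian_sqr_lb sd0 hg; rewrite sd2.
case IE : (\int[g]_z (enorm z ^+ 2)%:E)%E => [I| |] //; rewrite !lee_fin => I1 I2.
have iI : g.-integrable setT (fun z => (enorm z ^+ 2)%:E).
  apply/integrableP; split; first exact/measurable_EFinP.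
  under eq_integral do rewrite gee0_abs ?lee_fin ?sqr_ge0//.
  by rewrite IE ltry.
have [iL L0] := gaussian_inner_mean0 sd0 hg (- (e * (2 * sigma)) *: m).
(* The centred part: the linear term and the fluctuation of the squared norm about its mean [I]. *)
pose L z := inner (- (e * (2 * sigma)) *: m) z + - (e * sigma ^+ 2) * (enorm z ^+ 2 - I).
have iI' : g.-integrable setT (fun z => (- (e * sigma ^+ 2))%:E * ((enorm z ^+ 2)%:E - I%:E))%E.
  apply: integrableZl => //; apply: integrableB => //.
  exact: finite_measure_integrable_cst.
have LE : (EFin \o L) = (fun z => (inner (- (e * (2 * sigma)) *: m) z)%:E +
    (- (e * sigma ^+ 2))%:E * ((enorm z ^+ 2)%:E - I%:E))%E.
  by apply/funext => z; rewrite /L/= EFinD EFinM EFinB.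
have iL' : g.-integrable setT (EFin \o L) by rewrite LE; exact: integrableD.
have L0' : (\int[g]_z (L z)%:E = 0)%E.
  rewrite -[LHS]/(\int[g]_z (EFin \o L) z)%E LE integralD// L0 add0e.
  rewrite integralZl//; last first.
    by apply: integrableB => //; exact: finite_measure_integrable_cst.
  rewrite integralB//; last exact: finite_measure_integrable_cst.
  by rewrite IE integral_cst_prob subee// mule0.
pose c0 := 1 + e * (a * b - enorm m ^+ 2 - sigma ^+ 2 * I).
have sI : sigma ^+ 2 * I <= s.
  by rewrite /s -mulrA mulrCA ler_pM2l.
have sI2 : 86 / 100 * s <= sigma ^+ 2 * I.
  have -> : 86 / 100 * s = sigma ^+ 2 * (86 / 100 * (d%:R * delta)) by rewrite /s; ring.
  by rewrite ler_pM2l.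
have c00 : 0 <= c0.
  rewrite addr_ge0// mulr_ge0 ?(ltW e0)//.
  have h1 : enorm m ^+ 2 <= (a - 31 / 32) ^+ 2.
    by have m0 := enorm_ge0 m; rewrite ler_pXn2r// nnegrE; lra.
  have h2 : a ^+ 2 <= a * b by rewrite expr2 ler_pM2l// ltW// wt_in_lt_out.
  lra.
have q4 : 0 <= e * Q * sigma ^+ 4.
  by apply: mulr_ge0; [exact: mulr_ge0 (ltW e0) Q0|rewrite exprn_even_ge0].
apply: (@le_trans _ _ (\int[g]_z (c0 + e * Q * sigma ^+ 4 * enorm z ^+ 4)%:E)%E).
  apply: (ge0_integral_le_centered _ _ _ iL' L0').
  - by move=> z; exact: weight_ge0.
  - by move=> z; apply: addr_ge0 => //; rewrite mulr_ge0 ?exprn_ge0.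
  - by apply: measurable_funD => //; exact: measurable_funM.
  - move=> z; have h1 := wt_rad_le rho0 C0 K0 (enorm_ge0 (m + sigma *: z)).
    have h2 : enorm (m + sigma *: z) ^+ 2 - Num.min (enorm (m + sigma *: z)) a ^+ 2 <=
       Q * (sigma ^+ 4 * enorm z ^+ 4).
      have -> : sigma ^+ 4 * enorm z ^+ 4 = enorm (sigma *: z) ^+ 4.
        by rewrite enormZ exprMn (exprM `|sigma| 2 2) real_normK ?num_real// -exprM.
      by apply: (@sqr_excess_le _ _ (31 / 32)) => //; lra.
    have h3 : enorm (m + sigma *: z) ^+ 2 =
      enorm m ^+ 2 + 2 * sigma * inner m z + sigma ^+ 2 * enorm z ^+ 2.
      by rewrite enormD_sqr innerZr enormZ exprMn real_normK ?num_real//; ring.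
    have h4 : wt_rad rho C K (enorm (m + sigma *: z)) <=
      a * b - (enorm m ^+ 2 + 2 * sigma * inner m z + sigma ^+ 2 * enorm z ^+ 2) +
       Q * (sigma ^+ 4 * enorm z ^+ 4) by rewrite -h3; lra.
    rewrite /weight /c0 /L innerZl; have := ler_wpM2l (ltW e0) h4; lra.
rewrite ge0_integral_affine//; last by move=> z; rewrite exprn_ge0.
apply: (@le_trans _ _ (c0%:E + (e * Q * sigma ^+ 4)%:E *
    (32 / 10 * d%:R ^+ 2 * Num.sqrt delta ^+ 4)%:E)%E).
  by rewrite leeD2l// lee_wpmul2l ?lee_fin//; exact: gaussian_exp4_ub.
rewrite -EFinM -EFinD lee_fin /c0 -addrA lerD2l.
have -> : Num.sqrt delta ^+ 4 = delta ^+ 2 by rewrite (exprM _ 2 2) sd2.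
have -> : e * Q * sigma ^+ 4 * (32 / 10 * d%:R ^+ 2 * delta ^+ 2) =
  e * (32 / 10 * (Q * s) * s) by rewrite /s; ring.
rewrite -mulrDr ler_pM2l//.
(* [Q <= 2 / 5 * (1 + rho ^+ 2)] meets [4 * (1 + rho ^+ 2) * s <= 1], which is the noise bound on
   the step size. *)
have Qs : Q * s <= 1 / 10.
  have h2 : Q <= 2 / 5 * (1 + rho ^+ 2).
    by rewrite /Q /wt_in; have := sqr_ge0 (rho - 7 / 20); lra.
  have := ler_wpM2r (ltW s1) h2; lra.
have := ler_wpM2r (ltW s1) Qs; lra.
Qed.

End weight_step.

(** * The drift step and the weighted contraction *)

Section drift_map.
Context {R : realType} {d : nat}.
Local Notation V := 'rV[R]_d.
Variables (rho C K KR dmt delta : R) (p q : V -> V).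
Hypotheses (C0 : 0 < C) (K0 : 0 < K) (dl0 : 0 < delta).
Hypothesis hp : forall x y, enorm (p x - p y) <= enorm (x - y).
Hypothesis hin : forall x y, enorm x <= rho -> enorm y <= rho ->
  enorm (q (p x) - q (p y)) <= C * enorm (x - y).
Hypothesis hout : forall x y, rho < enorm x \/ rho < enorm y ->
  enorm (q (p x) - q (p y)) <= KR * dmt * enorm (x - y) /\
  inner (p x - p y) (q (p x) - q (p y)) <= - K * enorm (p x - p y) ^+ 2.
Hypotheses (dC : delta * C <= 1) (dK : delta * (2 * K) <= 1).
Hypothesis dKR : (KR * dmt) ^+ 2 * delta <= K.

Definition drift (x : V) : V := p x + delta *: q (p x).

Lemma drift_sub x y : drift x - drift y = (p x - p y) + delta *: (q (p x) - q (p y)).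
Proof. by rewrite /drift scalerBr opprD addrACA. Qed.

Lemma drift_in x y : enorm x <= rho -> enorm y <= rho ->
  enorm (drift x - drift y) <= (1 + C * delta) * enorm (x - y).
Proof.
move=> xr yr; rewrite drift_sub (le_trans (ler_enormD _ _))// enormZ ger0_norm ?(ltW dl0)//.
have := hp x y; have := ler_wpM2l (ltW dl0) (hin xr yr); lra.
Qed.

(** Dissipativity contributes [- 2 * K * delta], and the square of the drift increment takes back at
    most [K * delta] by [dKR]. *)
Lemma drift_out x y : rho < enorm x \/ rho < enorm y ->
  enorm (drift x - drift y) ^+ 2 <= (1 - K * delta) * enorm (x - y) ^+ 2.
Proof.
move=> /hout[h1 h2]; rewrite drift_sub enormD_sqr innerZr enormZ exprMn ger0_norm ?(ltW dl0)//.
have g1 : enorm (q (p x) - q (p y)) ^+ 2 <= (KR * dmt) ^+ 2 * enorm (x - y) ^+ 2.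
  rewrite -exprMn ler_pXn2r// nnegrE//; exact: le_trans h1.
have g2 : enorm (p x - p y) ^+ 2 <= enorm (x - y) ^+ 2 by rewrite ler_pXn2r// nnegrE.
have g3 := ler_wpM2l (ltW dl0) h2.
have g4 : delta ^+ 2 * enorm (q (p x) - q (p y)) ^+ 2 <= delta * K * enorm (x - y) ^+ 2.
  apply: (le_trans (ler_wpM2l (sqr_ge0 delta) g1)).
  have := ler_wpM2r (sqr_ge0 (enorm (x - y))) (ler_wpM2l (ltW dl0) dKR); lra.
have g5 : 0 <= 1 - delta * (2 * K) by rewrite subr_ge0.
have := ler_wpM2l g5 g2; lra.
Qed.

Lemma drift_lip_sqr x y :
  enorm (drift x - drift y) ^+ 2 <= (1 + 3 * C * delta) * enorm (x - y) ^+ 2.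
Proof.
have z0 := sqr_ge0 (enorm (x - y)).
have Cd : 0 < C * delta by rewrite mulr_gt0.
have Kd : 0 < K * delta by rewrite mulr_gt0.
have [xr|xr] := leP (enorm x) rho; [have [yr|yr] := leP (enorm y) rho|].
- have h := drift_in xr yr.
  have : enorm (drift x - drift y) ^+ 2 <= ((1 + C * delta) * enorm (x - y)) ^+ 2.
    by rewrite ler_pXn2r// ?nnegrE// mulr_ge0// addr_ge0// ltW.
  move/le_trans; apply; rewrite exprMn ler_wpM2r//.
  have : (C * delta) ^+ 2 <= C * delta by rewrite expr2 ger_pMr// mulrC.
  lra.
- have := @drift_out x y (or_intror yr); have := mulr_ge0 (ltW Cd) z0; have := mulr_ge0 (ltW Kd) z0; lra.
- have := @drift_out x y (or_introl xr); have := mulr_ge0 (ltW Cd) z0; have := mulr_ge0 (ltW Kd) z0; lra.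
Qed.

Section weighted.
Variables (sigma ps1 psr psR ps2 R0 : R) (g : probability V R).
Hypotheses (rho0 : 0 < rho) (d0 : (0 < d)%N) (s0 : 0 < sigma ^+ 2).
Hypothesis hg : gaussian g (Num.sqrt delta).
Hypotheses (psr0 : 0 <= psr) (psR0 : 0 <= psR) (ps10 : 0 <= ps1).
Hypothesis R0E : R0 = 2 * ((1 + rho) * (1 + 96 * C / K) + ps1).
Hypothesis e1 : 24 * C * (K + 96 * C) * (1 + rho) ^+ 2 < sigma ^+ 2 * (d%:R * K).
Hypothesis e2 : 8 * (1 + rho) * psr < sigma ^+ 2 * d%:R.
Hypothesis e3 : 96 * (1 + rho) * C * psR < sigma ^+ 2 * (d%:R * K).
Hypothesis dnoise : 4 * (2 + d%:R) * (1 + rho ^+ 2) * sigma ^+ 2 * delta <= 1.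
Hypothesis hpn : forall x, enorm x <= R0 -> enorm (p x) = enorm x.
Hypothesis hpR : forall x, R0 <= enorm x -> R0 <= enorm (p x).
Hypothesis hqr : forall x, enorm x <= rho -> enorm (q (p x)) <= psr.
Hypothesis hqR : forall x, enorm x <= R0 -> enorm (q (p x)) <= psR.
Hypothesis hq : forall x, enorm (q (p x)) <= ps1 + ps2 * dmt * enorm (p x).
Hypothesis dps2 : delta * (ps2 * dmt) <= 1 / 2.
Hypothesis dle1 : delta <= 1.

Let lam1 : R := 6 * C * sigma ^+ 2 *
    (sigma ^+ 2 + 24 * C * (K + 96 * C) * (1 + rho) ^+ 2 / (d%:R * K))^-1 - 3 * C.
Let lam2 : R := K / 4.

Local Notation W := (weight rho C K sigma).
Local Notation eps := (@wt_eps R d C sigma).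

Let dR0 : 0 < d%:R :> R. Proof. by rewrite ltr0n. Qed.

Let sn0 : sigma != 0.
Proof. by apply: contraTneq s0 => ->; rewrite expr0n ltxx. Qed.

(** The origin of [lam1]: it is the rate for which [(lam1 + 3 * C) * W <= 6 * C] even at the largest
    value of the weight. *)
Lemma lam1E : (lam1 + 3 * C) * @weight_max R d rho C K sigma = 6 * C.
Proof.
rewrite /lam1 subrK /weight_max /wt_eps /wt_out /wt_in; field.
have Kn : K != 0 by rewrite gt_eqF.
have dn : d%:R != 0 :> R by rewrite gt_eqF.
rewrite Kn dn sn0/= gt_eqF//; apply: addr_gt0; first by apply: mulr_gt0 => //; exact: mulr_gt0.
apply: mulr_gt0; last by rewrite exprn_gt0// addr_gt0.
by apply: mulr_gt0; rewrite ?mulr_gt0// addr_gt0// mulr_gt0.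
Qed.

Lemma rho_le_R0 : rho <= R0.
Proof.
have h : 0 < 96 * C / K by rewrite divr_gt0// mulr_gt0.
rewrite R0E; move: (96 * C / K) h (mulr_gt0 rho0 h) => t t0 rt.
have p0 := ps10; have r0 := rho0.
by lra.
Qed.

(** The drift displaces [x] by at most [delta * psr], which by [e2] uses up a quarter of
    [d%:R * sigma ^+ 2 * delta]. Of the half granted by [weight_step_in] a quarter remains, and
    [wt_eps] turns it into [6 * C * delta]. *)
Lemma weight_in x : enorm x <= rho ->
  (\int[g]_z (W (drift x + sigma *: z))%:E <= (W x - 6 * C * delta)%:E)%E.
Proof.
move=> xr; have pn := hpn (le_trans xr rho_le_R0).
have qn := hqr xr; have x0 := enorm_ge0 x.
have ds : d%:R * sigma ^+ 2 * delta <= 1 / 4.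
  have h1 : 0 < sigma ^+ 2 * delta by rewrite mulr_gt0.
  have h2 := mulr_ge0 (sqr_ge0 rho) (ltW h1).
  have h3 : 0 < d%:R * (sigma ^+ 2 * delta) by rewrite mulr_gt0.
  have h4 := mulr_ge0 (sqr_ge0 rho) (ltW h3).
  by move: dnoise; lra.
have dp : 8 * (1 + rho) * (delta * psr) <= d%:R * sigma ^+ 2 * delta.
  by have := ler_wpM2l (ltW dl0) (ltW e2); lra.
have dp0 : 0 <= delta * psr by rewrite mulr_ge0 ?(ltW dl0).
have rdp := mulr_ge0 (ltW rho0) dp0.
have mx : enorm (drift x) <= enorm x + delta * psr.
  rewrite (le_trans (ler_enormD _ _))// pn lerD2l enormZ ger0_norm ?(ltW dl0)//.
  by rewrite ler_wpM2l// ltW.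
have mx1 : enorm (drift x) <= wt_in rho - 31 / 32 by rewrite /wt_in; lra.
apply: (le_trans (weight_step_in rho0 C0 K0 d0 s0 dl0 hg dnoise mx1)).
have mxg : enorm x ^+ 2 - 2 * rho * (delta * psr) <= enorm (drift x) ^+ 2.
  have h1 : enorm x - delta * psr <= enorm (drift x).
    rewrite -pn lerBlDr; have -> : p x = drift x + (- (delta *: q (p x))) by rewrite addrK.
    rewrite (le_trans (ler_enormD _ _))// enormN lerD2l enormZ ger0_norm ?(ltW dl0)//.
    by rewrite ler_wpM2l// ltW.
  have h2 : 2 * enorm x * (delta * psr) <= 2 * rho * (delta * psr).
    by rewrite ler_wpM2r// ler_wpM2l.
  have m0 := enorm_ge0 (drift x).
  have [h3|h3] := leP 0 (enorm x - delta * psr).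
    have : (enorm x - delta * psr) ^+ 2 <= enorm (drift x) ^+ 2 by rewrite ler_pXn2r// nnegrE.
    by have := sqr_ge0 (delta * psr); lra.
  have := sqr_ge0 (enorm (drift x)).
  have : enorm x * enorm x <= enorm x * (delta * psr) by rewrite ler_wpM2l//; lra.
  lra.
rewrite lee_fin /weight /wt_rad ifT; last by rewrite /wt_in; lra.
have e0 := @wt_eps_gt0 _ d C sigma C0 d0 s0.
have eE := @wt_epsE _ d C sigma d0 s0.
have h : wt_in rho * wt_out rho C K - enorm (drift x) ^+ 2 - d%:R * sigma ^+ 2 * delta / 2 <=
  wt_in rho * wt_out rho C K - enorm x ^+ 2 - d%:R * sigma ^+ 2 * delta / 4 by lra.
have h2 := ler_wpM2l (ltW e0) h.
have h3 : eps * (d%:R * sigma ^+ 2 * delta / 4) = 6 * C * delta.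
  have -> : eps * (d%:R * sigma ^+ 2 * delta / 4) = eps * (d%:R * sigma ^+ 2) * delta / 4 by field.
  by rewrite eE; field.
lra.
Qed.

(** Up to [R0] the retraction keeps the norm, so the weight changes through the drift alone, by at
    most [K / 2 * delta] according to [e3]. Beyond [R0], the drift removes at most [ps1] and half of
    the norm, so the mean position is still past [wt_out], where the weight is minimal. The noise
    adds [K / 4 * delta] in both cases. *)
Lemma weight_out x : rho < enorm x ->
  (\int[g]_z (W (drift x + sigma *: z))%:E <= (W x + 3 / 4 * K * delta)%:E)%E.
Proof.
move=> rx; apply: (le_trans (weight_step_any rho0 C0 K0 d0 s0 dl0 hg _)).
rewrite lee_fin.
suff : W (drift x) <= W x + K / 2 * delta by have k0 := K0; have dd := dl0; lra.
have e0 := @wt_eps_gt0 _ d C sigma C0 d0 s0.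
have [xR|Rx] := leP (enorm x) R0.
  have -> : W x = W (p x) by rewrite /weight hpn.
  rewrite -lerBlDl; apply: (le_trans (weight_sub_le rho0 C0 K0 d0 s0 _ _)).
  rewrite /drift addrAC subrr add0r enormZ ger0_norm ?(ltW dl0)//.
  have h : eps * (2 * wt_in rho) * psR <= K / 2.
    have -> : eps * (2 * wt_in rho) * psR = 96 * (1 + rho) * C * psR / (2 * (d%:R * sigma ^+ 2)).
      by rewrite /wt_eps /wt_in; field; rewrite sn0 gt_eqF.
    have ps : 0 < 2 * (d%:R * sigma ^+ 2) by apply: mulr_gt0 => //; exact: mulr_gt0.
    rewrite ler_pdivrMr//.
    by have -> : K / 2 * (2 * (d%:R * sigma ^+ 2)) = sigma ^+ 2 * (d%:R * K);
      [field|exact: ltW].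
  have c0 : 0 <= eps * (2 * wt_in rho).
    by rewrite mulr_ge0 ?(ltW e0)// mulr_ge0// ltW// wt_in_gt0.
  have := ler_wpM2l (ltW dl0) (ler_wpM2l c0 (hqR xR)).
  have := ler_wpM2l (ltW dl0) h; lra.
have px := hpR (ltW Rx); have qx := hq x; have px0 := enorm_ge0 (p x).
have bm : wt_out rho C K <= enorm (drift x).
  have h1 : enorm (p x) - delta * enorm (q (p x)) <= enorm (drift x).
    rewrite lerBlDr; have -> : delta * enorm (q (p x)) = enorm (- (delta *: q (p x))).
      by rewrite enormN enormZ ger0_norm// ltW.
    by rewrite -{1}(addrK (delta *: q (p x)) (p x)) ler_enormD.
  have h2 : delta * enorm (q (p x)) <= ps1 + 1 / 2 * enorm (p x).
    apply: (le_trans (ler_wpM2l (ltW dl0) qx)).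
    have := ler_wpM2r px0 dps2; have := ler_wpM2r ps10 dle1; lra.
  by have p0 := ps10; move: px; rewrite R0E /wt_out; lra.
have -> : W (drift x) = 1 by rewrite /weight wt_rad_out// mulr0 addr0.
have := @weight_ge1 _ d rho C K sigma rho0 C0 K0 d0 s0 x.
have := mulr_gt0 K0 dl0; lra.
Qed.

(** The position of [x] alone decides the case. Inside, the loss [6 * C * delta] meets the expansion
    [1 + 3 * C * delta], and [lam1E] concludes. Outside, [weight_out] adds [3 / 4 * K * delta]
    against the factor [1 - K * delta], and [weight >= 1] leaves a quarter of [K]. *)
Lemma weight_contract x y : delta * Num.min lam1 lam2 <= 1 ->
  (\int[g]_z (W (drift x + sigma *: z))%:E * (enorm (drift x - drift y) ^+ 2)%:E <=
   ((1 - Num.min lam1 lam2 * delta) * (W x * enorm (x - y) ^+ 2))%:E)%E.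
Proof.
have c0 := C0; have k0 := K0; have dd := dl0.
move=> dlam; have z0 := sqr_ge0 (enorm (x - y)); have m0 := sqr_ge0 (enorm (drift x - drift y)).
have W1 := @weight_ge1 _ d rho C K sigma rho0 C0 K0 d0 s0 x.
have Wm := @weight_le _ d rho C K sigma rho0 C0 K0 d0 s0 x.
have [xr|rx] := leP (enorm x) rho.
  apply: (@le_trans _ _ ((W x - 6 * C * delta)%:E * ((1 + 3 * C * delta) * enorm (x - y) ^+ 2)%:E)%E).
    apply: lee_pmul; rewrite ?lee_fin//; last exact: drift_lip_sqr.
      by apply: integral_ge0 => z _; rewrite lee_fin (weight_ge0 rho0 C0 K0 d0 s0).
    exact: weight_in.
  rewrite -EFinM lee_fin mulrA [leRHS]mulrA ler_wpM2r//.
  have l1 : Num.min lam1 lam2 <= lam1 by rewrite ge_min lexx.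
  have E := lam1E.
  have l3 : 0 <= lam1 + 3 * C.
    have wm0 := lt_le_trans ltr01 (le_trans W1 Wm).
    by rewrite -(pmulr_lge0 _ wm0) E mulr_ge0// ltW.
  have l2 : (lam1 + 3 * C) * W x <= 6 * C by rewrite -E ler_wpM2l.
  have W0 : 0 <= W x by lra.
  have := ler_wpM2l (ltW dl0) l2; have := ler_wpM2l (ltW dl0) (ler_wpM2r W0 l1).
  have := sqr_ge0 (C * delta); lra.
apply: (@le_trans _ _ ((W x + 3 / 4 * K * delta)%:E * ((1 - K * delta) * enorm (x - y) ^+ 2)%:E)%E).
  apply: lee_pmul; rewrite ?lee_fin//; last by apply: drift_out; left.
    by apply: integral_ge0 => z _; rewrite lee_fin (weight_ge0 rho0 C0 K0 d0 s0).
  exact: weight_out.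
rewrite -EFinM lee_fin mulrA [leRHS]mulrA ler_wpM2r//.
have l1 : Num.min lam1 lam2 <= K / 4 by rewrite ge_min lexx orbT.
have Kd : 0 < K * delta by rewrite mulr_gt0.
have W0 : 0 <= W x by lra.
have := ler_wpM2l (ltW dl0) (ler_wpM2r W0 l1).
have := ler_wpM2l (ltW Kd) W1; have := sqr_ge0 (K * delta); lra.
Qed.

End weighted.

End drift_map.

(** * Contracting chains *)

Section chain_model.
Context {R : realType} {d : nat}.
Local Notation V := 'rV[R]_d.

(* [mn delta] is the deterministic part of one step, [W] the weight for which
   the synchronous coupling contracts, and [A x] stands for the Jacobian of [b]
   at [x] (the zero matrix when only the order [gam <= 1/2] is wanted). *)
Record chain_model (sigma D lam gam C K rho B Wm Lw Ce : R) (ke : nat) (quad : bool)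
    (b : V -> V) (A : V -> 'M[R]_d) (W : V -> R) (mn : R -> V -> V) : Prop := ChainModel {
  cm_D : 0 < D <= 1;
  cm_lam : 0 < lam;
  cm_lamD : lam * D <= 1;
  cm_gam : 0 < gam <= 1;
  cm_C : 0 < C;
  cm_K : 0 < K;
  cm_KD : K * D <= 1;
  cm_rho : 0 < rho;
  cm_B : 0 <= B;
  cm_Lw : 0 <= Lw;
  cm_Ce : 1 <= Ce;
  cm_W1 : forall x, 1 <= W x;
  cm_Wm : forall x, W x <= Wm;
  cm_WL : forall x y, `|W x - W y| <= Lw * enorm (x - y);
  cm_meas : forall dl, 0 < dl <= D -> measurable_fun setT (mn dl);
  cm_lip : forall dl, 0 < dl <= D -> forall x y,
    enorm (mn dl x - mn dl y) ^+ 2 <= (1 + 3 * C * dl) * enorm (x - y) ^+ 2;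
  cm_out : forall dl, 0 < dl <= D -> forall x y, rho < enorm x \/ rho < enorm y ->
    enorm (mn dl x - mn dl y) ^+ 2 <= (1 - K * dl) * enorm (x - y) ^+ 2;
  cm_contract : forall dl, 0 < dl <= D -> forall (g : probability V R),
    gaussian g (Num.sqrt dl) -> forall x y,
    (\int[g]_z (W (mn dl x + sigma *: z))%:E * (enorm (mn dl x - mn dl y) ^+ 2)%:E <=
     ((1 - lam * dl) * (W x * enorm (x - y) ^+ 2))%:E)%E;
  cm_mn0 : forall dl, 0 < dl <= D -> enorm (mn dl 0) <= B * dl;
  cm_err : forall dl, 0 < dl <= D -> forall x,
    enorm (mn dl x - x - dl *: b x) <= Ce * (1 + enorm x) ^+ ke * (dl * dl `^ gam);
  cm_blip : forall x y, enorm (b y - b x) <=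
    Ce * (1 + enorm x + enorm y) ^+ ke * enorm (y - x);
  cm_A : forall x v, enorm (v *m A x) <= Ce * (1 + enorm x) ^+ ke * enorm v;
  cm_taylor : forall x y, enorm (b y - b x - (y - x) *m A x) <=
    Ce * (1 + enorm x + enorm y) ^+ ke * enorm (y - x) ^+ (if quad then 2 else 1);
  cm_quad : ~~ quad -> gam <= 1 / 2 }.

(** By induction; the cross terms are controlled because [u - v] and [u ^+ p - v ^+ p] have the same
    sign. *)
Lemma convex_expr (t u v : R) p : 0 <= t <= 1 -> 0 <= u -> 0 <= v ->
  ((1 - t) * u + t * v) ^+ p <= (1 - t) * u ^+ p + t * v ^+ p.
Proof.
move=> /andP[t0 t1] u0 v0; elim: p => [|p ih]; first by rewrite !expr0; lra.
have w0 : 0 <= (1 - t) * u + t * v.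
  by rewrite addr_ge0// mulr_ge0// subr_ge0.
rewrite exprS (le_trans (ler_wpM2l w0 ih))// !exprS.
have h : 0 <= (u - v) * (u ^+ p - v ^+ p).
  have [uv|vu] := leP u v.
    rewrite mulr_le0// subr_le0//; apply: lerXn2r; rewrite ?nnegrE//.
  by rewrite mulr_ge0// subr_ge0 ?(ltW vu)//; apply: lerXn2r; rewrite ?nnegrE// ltW.
have t2 : 0 <= t * (1 - t) by rewrite mulr_ge0// subr_ge0.
have := mulr_ge0 t2 h; lra.
Qed.

Lemma expr_add_le (u v : R) p : 0 <= u -> 0 <= v -> (u + v) ^+ p <= 2 ^+ p * (u ^+ p + v ^+ p).
Proof.
move=> u0 v0; have := @convex_expr (1 / 2) u v p; rewrite u0 v0 => h.
have {}h : ((u + v) / 2) ^+ p <= (u ^+ p + v ^+ p) / 2.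
  have := h ltac:(lra) isT isT; rewrite (_ : (1 - 1 / 2) * u + 1 / 2 * v = (u + v) / 2); last by field.
  by lra.
have p0 : 0 < 2 ^+ p :> R by rewrite exprn_gt0.
have uv : 0 <= u ^+ p + v ^+ p by rewrite addr_ge0 ?exprn_ge0.
move: h; rewrite expr_div_n ler_pdivrMr// => h; apply: (le_trans h).
by rewrite mulrC ler_wpM2l ?(ltW p0)//; lra.
Qed.

Context {sigma D lam gam C K rho B Wm Lw Ce : R} {ke : nat} {quad : bool}.
Context {b : V -> V} {A : V -> 'M[R]_d} {W : V -> R} {mn : R -> V -> V}.
Hypothesis cm : chain_model sigma D lam gam C K rho B Wm Lw Ce ke quad b A W mn.

Definition step (dl : R) (z : V * V) : V := mn dl z.1 + sigma *: z.2.

Lemma measurable_step dl : 0 < dl <= D -> measurable_fun setT (step dl).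
Proof.
move=> hd; apply: measurable_rVD.
  exact: (measurableT_comp (cm_meas cm hd) measurable_fst).
by apply: measurable_rVZ; [exact: measurable_cst|exact: measurable_snd].
Qed.

Lemma Ce_ge0 : 0 <= Ce.
Proof. exact: le_trans (cm_Ce cm). Qed.

Lemma drift_growth x : enorm (b x) <= (enorm (b 0) + Ce) * (1 + enorm x) ^+ ke.+1.
Proof.
have x0 := enorm_ge0 x; have C0 := Ce_ge0.
have h := cm_blip cm 0 x; rewrite enorm0 addr0 subr0 in h.
have p1 : 1 <= (1 + enorm x) ^+ ke.+1 by rewrite exprn_ege1//; lra.
have p2 : (1 + enorm x) ^+ ke * enorm x <= (1 + enorm x) ^+ ke.+1.
  by rewrite exprSr ler_wpM2l ?exprn_ge0//; lra.
rewrite -(subrK (b 0) (b x)) (le_trans (ler_enormD _ _))//.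
have b0 := enorm_ge0 (b 0).
have := ler_wpM2l b0 p1; have := ler_wpM2l C0 p2; lra.
Qed.

(** Two points of the ball are at most [2 * rho] apart, so the expansion there is paid for by an
    additive constant of order [dl]. *)
Lemma mn_contract_add dl x y : 0 < dl <= D ->
  enorm (mn dl x - mn dl y) <= (1 - K / 2 * dl) * enorm (x - y) + dl * ((3 * C + K) * rho).
Proof.
move=> hd; have /andP[d0 dD] := hd; have x0 := enorm_ge0 (x - y).
have K0 := cm_K cm; have C0 := cm_C cm; have r0 := cm_rho cm.
have Kd : 0 < K * dl by rewrite mulr_gt0.
have Kd1 : K * dl <= 1 by rewrite (le_trans _ (cm_KD cm))// ler_pM2l.
have q0 : 0 <= dl * ((3 * C + K) * rho) by rewrite !mulr_ge0 ?addr_ge0 ?mulr_ge0// ltW.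
have out : rho < enorm x \/ rho < enorm y ->
    enorm (mn dl x - mn dl y) <= (1 - K / 2 * dl) * enorm (x - y) + dl * ((3 * C + K) * rho).
  move=> h; have := cm_out cm hd h => {}h.
  suff : enorm (mn dl x - mn dl y) <= (1 - K / 2 * dl) * enorm (x - y) by lra.
  rewrite -(@ler_pXn2r _ 2)// ?nnegrE ?mulr_ge0//; last lra.
  rewrite (le_trans h)// exprMn ler_wpM2r ?sqr_ge0//; have := sqr_ge0 (K * dl); lra.
have [xr|xr] := leP (enorm x) rho; last by apply: out; left.
have [yr|yr] := leP (enorm y) rho; last by apply: out; right.
have xy : enorm (x - y) <= 2 * rho by rewrite (le_trans (ler_enormB _ _))//; lra.
have Cd : 0 < C * dl by rewrite mulr_gt0.
have h : enorm (mn dl x - mn dl y) <= (1 + 3 / 2 * C * dl) * enorm (x - y).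
  rewrite -(@ler_pXn2r _ 2)// ?nnegrE ?mulr_ge0//; last lra.
  rewrite (le_trans (cm_lip cm hd x y))// exprMn ler_wpM2r ?sqr_ge0//.
  have := sqr_ge0 (C * dl); lra.
have c1 : 0 <= 3 / 2 * (C * dl) + K * dl / 2 by lra.
have := ler_wpM2l c1 xy; lra.
Qed.

(** * Moments by comparison with an Ornstein-Uhlenbeck chain *)

Section moments.
Context {dO : measure_display} {Om : measurableType dO}.
Variables (P : probability Om R) (G : nat -> set (set Om)) (zeta : nat -> Om -> V).
Variables (g : probability V R) (dl : R).
Hypotheses (hd : 0 < dl <= D) (noise : iid_noise P G zeta g) (hg : gaussian g (Num.sqrt dl)).

(* The second component is an Ornstein-Uhlenbeck chain driven by the same noise:
   the difference of the two components moves without noise. *)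
Definition ou_step (z : (V * V) * V) : V * V :=
  (step dl (z.1.1, z.2), (1 - dl) *: z.1.2 + sigma *: z.2).

Lemma measurable_ou_step : measurable_fun setT ou_step.
Proof.
apply: measurable_fun_pair.
  apply: (measurableT_comp (measurable_step hd)); apply: measurable_fun_pair.
    exact: measurableT_comp measurable_fst measurable_fst.
  exact: measurable_snd.
apply: measurable_rVD; apply: measurable_rVZ; try exact: measurable_cst.
  exact: measurableT_comp measurable_snd measurable_fst.
exact: measurable_snd.
Qed.

Lemma fwd_ou_fst x u n w : (fwd zeta ou_step (x, u) n w).1 = fwd zeta (step dl) x n w.
Proof. by elim: n => //= n <-. Qed.

Let dl1 : 0 < dl <= 1.
Proof.
have /andP[d0 dD] := hd; rewrite d0/= (le_trans dD)//; by have /andP[] := cm_D cm.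
Qed.
Let sd0 : 0 < Num.sqrt dl. Proof. by rewrite sqrtr_gt0; have /andP[] := hd. Qed.
Let sd2 : Num.sqrt dl ^+ 2 = dl. Proof. by rewrite sqr_sqrtr// ltW//; have /andP[] := hd. Qed.

(** One step turns the exponent [a] into [a * (1 - dl)] and adds variance [sigma ^+ 2 * dl]; as
    [(1 - dl) ^+ 2 + dl <= 1], the bound reproduces itself for every [n]. *)
Lemma ou_mgf x n (i : 'I_d) (a : R) :
  (\int[P]_w (expR (a * (fwd zeta ou_step (x, 0) n w).2 ord0 i))%:E <=
   (expR (a ^+ 2 * sigma ^+ 2 / 2))%:E)%E.
Proof.
have /andP[d0 d1] := dl1.
elim: n a => [|n ih] a.
  rewrite /= mxE mulr0 expR0 integral_cst_prob lee_fin -[leLHS]expR0 ler_expR.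
  by rewrite divr_ge0// mulr_ge0 ?sqr_ge0.
pose k : V * V -> R := fun s => expR (a * s.2 ord0 i).
pose e1 := expR (a ^+ 2 * sigma ^+ 2 * dl / 2).
pose h : V * V -> R := fun s => e1 * expR (a * (1 - dl) * s.2 ord0 i).
have m2 (c : R) : measurable_fun setT (fun s : V * V => expR (c * s.2 ord0 i)).
  apply: measurableT_comp => //; apply: measurable_funM => //.
  by apply: measurable_coord_comp; exact: measurable_snd.
have kh s : (\int[g]_e (k (ou_step (s, e)))%:E <= (h s)%:E)%E.
  rewrite /k /h /=; under eq_integral do rewrite !mxE mulrDr expRD EFinM mulrA.
  rewrite ge0_integralZl ?lee_fin ?expR_ge0//; last first.
    apply/measurable_EFinP; apply: measurableT_comp => //; apply: measurable_funM => //.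
    exact: measurable_coord.
  rewrite (gaussian_mgf sd0 hg) sd2 -EFinM lee_fin mulrC exprMn /e1.
  by rewrite !mulrA.
apply: (le_trans (@fwd_step_le _ _ _ _ _ _ _ _ _ noise _ _ _ measurable_ou_step k h (x, 0) n _ _ kh)).
- exact: m2.
- by move=> s; exact: expR_ge0.
rewrite /h; under eq_integral do rewrite EFinM.
rewrite ge0_integralZl ?lee_fin ?expR_ge0//; last first.
  apply/measurable_EFinP; apply: (measurableT_comp (m2 _)).
  exact: (measurable_fwd noise measurable_ou_step).
apply: (@le_trans _ _ (e1%:E * (expR ((a * (1 - dl)) ^+ 2 * sigma ^+ 2 / 2))%:E)%E).
  by rewrite lee_wpmul2l ?lee_fin ?expR_ge0//; exact: ih.
rewrite -EFinM lee_fin /e1 -expRD ler_expR exprMn.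
have h1 : (1 - dl) ^+ 2 <= 1 - dl.
  have : 0 <= dl * (1 - dl) by rewrite mulr_ge0 ?(ltW d0)// subr_ge0.
  lra.
have h2 : 0 <= a ^+ 2 * sigma ^+ 2 by rewrite mulr_ge0 ?sqr_ge0.
have := ler_wpM2l h2 h1; lra.
Qed.

Definition ou_const (p : nat) : R :=
  p`!%:R * expR 1 * (1 + d%:R * (2 * expR (d%:R ^+ 2 * sigma ^+ 2 / 2))).

Lemma ou_const_ge0 p : 0 <= ou_const p.
Proof. by rewrite !mulr_ge0 ?expR_ge0// addr_ge0// !mulr_ge0 ?expR_ge0. Qed.

Lemma ou_moment x n p :
  (\int[P]_w ((1 + enorm (fwd zeta ou_step (x, 0) n w).2) ^+ p)%:E <= (ou_const p)%:E)%E.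
Proof.
have mU : measurable_fun setT (fun w => (fwd zeta ou_step (x, 0) n w).2).
  exact: (measurableT_comp measurable_snd (measurable_fwd noise measurable_ou_step _ _)).
pose U w := (fwd zeta ou_step (x, 0) n w).2; rewrite -/U.
have q0 : 0 <= p`!%:R * expR 1 :> R by rewrite mulr_ge0 ?expR_ge0.
pose f (i : 'I_d) w := (expR (d%:R * U w ord0 i) + expR (- d%:R * U w ord0 i))%:E.
have mexp (c : R) (i : 'I_d) : measurable_fun setT (fun w => (expR (c * U w ord0 i))%:E).
  apply/measurable_EFinP; apply: measurableT_comp => //; apply: measurable_funM => //.
  exact: measurable_coord_comp.
have mf i : measurable_fun setT (f i).
  rewrite /f; under eq_fun do rewrite EFinD; exact: emeasurable_funD.
have f0 i w : (0 <= f i w)%E by rewrite lee_fin addr_ge0 ?expR_ge0.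
apply: (@le_trans _ _ (\int[P]_w ((p`!%:R * expR 1)%:E * (1 + \sum_(i < d) f i w)))%E).
  apply: ge0_le_integralT => w; first by rewrite lee_fin exprn_ge0// addr_ge0.
  rewrite /f sumEFin -EFinD -EFinM lee_fin.
  apply: (le_trans (expr_le_fact_expR p (addr_ge0 ler01 (enorm_ge0 (U w))))).
  rewrite expRD mulrA ler_wpM2l//.
  by have := expR_enorm_le (U w) (ler01 : 0 <= 1 :> R); rewrite !mul1r.
rewrite ge0_integralZl ?lee_fin//; last 2 first.
- by apply: emeasurable_funD => //; exact: emeasurable_sum.
- by move=> w _; rewrite adde_ge0// sume_ge0.
rewrite [leRHS]EFinM lee_wpmul2l ?lee_fin//.
rewrite ge0_integralD//; last 2 first.
- by move=> w _; apply: sume_ge0.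
- exact: emeasurable_sum.
rewrite integral_cst_prob ge0_integral_sum// EFinD leeD2l//.
apply: (@le_trans _ _ (\sum_(i < d) (2 * expR (d%:R ^+ 2 * sigma ^+ 2 / 2))%:E)%E).
  apply: lee_sum => i _; rewrite /f; under eq_integral do rewrite EFinD.
  rewrite ge0_integralD//.
  apply: (le_trans (leeD (ou_mgf _ _ _ _) (ou_mgf _ _ _ _))).
  by rewrite sqrrN -EFinD lee_fin; lra.
by rewrite sumEFin lee_fin sumr_const card_ord -[(_ *+ d)%R]mulr_natl.
Qed.

Definition ou_gap : R := (3 * C + K) * rho + Ce + (enorm (b 0) + Ce) + 1.

Lemma ou_gap_ge0 : 0 <= ou_gap.
Proof.
have C0 := cm_C cm; have K0 := cm_K cm; have r0 := cm_rho cm; have ce := Ce_ge0.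
have b0 := enorm_ge0 (b 0).
have : 0 <= (3 * C + K) * rho by rewrite mulr_ge0 ?(ltW r0)//; lra.
by rewrite /ou_gap; lra.
Qed.

(** The noise cancels. What remains is the contraction between [mn dl X] and [mn dl U], and the
    mismatch of the two drifts at [U], which is [dl] times a polynomial in [U]. *)
Lemma ou_diff (s : V * V) (e : V) : enorm ((ou_step (s, e)).1 - (ou_step (s, e)).2) <=
  (1 - K / 2 * dl) * enorm (s.1 - s.2) + dl * (ou_gap * (1 + enorm s.2) ^+ ke.+1).
Proof.
have /andP[d0 d1] := dl1; have ce := Ce_ge0; case: s => X U /=.
have -> : step dl (X, e) - ((1 - dl) *: U + sigma *: e) =
  (mn dl X - mn dl U) + ((mn dl U - U - dl *: b U) + dl *: (b U + U)).
  by rewrite /step scalerBl scale1r scalerDr; apply/rowP => i; rewrite !mxE; ring.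
have u0 := enorm_ge0 U; set q := 1 + enorm U.
have q1 : 1 <= q by rewrite /q; lra.
have qk : q ^+ ke <= q ^+ ke.+1 by rewrite ler_weXn2l.
have q1k : 1 <= q ^+ ke.+1 by rewrite exprn_ege1.
have qq : enorm U <= q ^+ ke.+1.
  by rewrite (le_trans (_ : _ <= q)) /q ?lerDr// -/q ler_eXnr.
have t1 := mn_contract_add X U hd.
have t2 := cm_err cm hd U; rewrite -/q in t2.
have t3 := drift_growth U; rewrite -/q in t3.
have g1 : dl `^ gam <= 1.
  by rewrite -(powRr0 dl) ger_powR ?d0 ?d1//; have /andP[/ltW] := cm_gam cm.
have t4 : enorm (mn dl U - U - dl *: b U) <= dl * (Ce * q ^+ ke.+1).
  apply: (le_trans t2); rewrite mulrCA ler_wpM2l ?(ltW d0)//.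
  apply: (@le_trans _ _ (Ce * q ^+ ke)); last by rewrite ler_wpM2l.
  by rewrite ler_piMr// mulr_ge0// exprn_ge0//; lra.
have t5 : enorm (dl *: (b U + U)) <= dl * ((enorm (b 0) + Ce) * q ^+ ke.+1 + q ^+ ke.+1).
  rewrite enormZ ger0_norm ?(ltW d0)// ler_wpM2l ?(ltW d0)//.
  by rewrite (le_trans (ler_enormD _ _))// lerD.
apply: (le_trans (ler_enormD _ _)); apply: (le_trans (lerD t1 (ler_enormD _ _))).
have r0 : 0 <= (3 * C + K) * rho.
  rewrite mulr_ge0 ?(ltW (cm_rho cm))//; have := cm_C cm; have := cm_K cm; lra.
have := ler_wpM2l (ltW d0) (ler_wpM2l r0 q1k); rewrite /ou_gap; lra.
Qed.

Definition gap_const (p : nat) : R := (ou_gap / (K / 2)) ^+ p * ou_const (ke.+1 * p).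

Lemma gap_const_ge0 p : 0 <= gap_const p.
Proof.
by rewrite mulr_ge0 ?ou_const_ge0// exprn_ge0// divr_ge0 ?ou_gap_ge0// divr_ge0// ltW// (cm_K cm).
Qed.

(** With [c = K / 2 * dl], the bound of [ou_diff] is a convex combination of the old gap and a
    polynomial in [U]; convexity of the power then gives a recursion whose bound does not grow with
    [n]. *)
Lemma gap_moment x n p :
  (\int[P]_w (enorm ((fwd zeta ou_step (x, 0%R) n w).1 - (fwd zeta ou_step (x, 0%R) n w).2) ^+ p)%:E
    <= (enorm x ^+ p + gap_const p)%:E)%E.
Proof.
have /andP[d0 d1] := dl1; have K0 := cm_K cm; have H0 := ou_gap_ge0.
have mS n' := measurable_fwd noise measurable_ou_step (x, 0) n'.
have x0 : 0 <= enorm x ^+ p by rewrite exprn_ge0.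
elim: n => [|n ih].
  by rewrite /= subr0 integral_cst_prob lee_fin lerDl gap_const_ge0.
set c := K / 2 * dl; have c01 : 0 <= c <= 1.
  have : 0 < K * dl by rewrite mulr_gt0.
  have : K * dl <= 1.
    by rewrite (le_trans _ (cm_KD cm))// ler_pM2l//; have /andP[] := hd.
  by rewrite /c => ? ?; apply/andP; split; lra.
have /andP[c0 c1] := c01.
pose Q := (ou_gap / (K / 2)) ^+ p.
have Q0 : 0 <= Q by rewrite exprn_ge0// divr_ge0// divr_ge0// ltW.
pose k : V * V -> R := fun s => enorm (s.1 - s.2) ^+ p.
pose r : V * V -> R := fun s => (1 + enorm s.2) ^+ (ke.+1 * p).
pose h : V * V -> R := fun s => (1 - c) * k s + c * Q * r s.
have mk : measurable_fun setT k.
  apply: measurable_funX; apply: measurable_enorm_comp.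
  by apply: measurable_rVB; [exact: measurable_fst|exact: measurable_snd].
have mr : measurable_fun setT r.
  apply: measurable_funX; apply: measurable_funD; first exact: measurable_cst.
  by apply: measurable_enorm_comp; exact: measurable_snd.
have kh s : (\int[g]_e (k (ou_step (s, e)))%:E <= (h s)%:E)%E.
  rewrite -[leRHS](integral_cst_prob g); apply: ge0_le_integralT => e.
    by rewrite lee_fin exprn_ge0.
  rewrite lee_fin /k /h.
  have dlE : dl * (ou_gap * (1 + enorm s.2) ^+ ke.+1) =
      c * (ou_gap / (K / 2) * (1 + enorm s.2) ^+ ke.+1).
    by rewrite /c; field; rewrite gt_eqF.
  have t := ou_diff s e; rewrite dlE -/c in t.
  have w0 : 0 <= ou_gap / (K / 2) * (1 + enorm s.2) ^+ ke.+1.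
    by rewrite mulr_ge0 ?exprn_ge0 ?addr_ge0// divr_ge0// divr_ge0// ltW.
  have := convex_expr p c01 (enorm_ge0 (s.1 - s.2)) w0.
  have : enorm ((ou_step (s, e)).1 - (ou_step (s, e)).2) ^+ p <=
    ((1 - c) * enorm (s.1 - s.2) + c * (ou_gap / (K / 2) * (1 + enorm s.2) ^+ ke.+1)) ^+ p.
    by apply: lerXn2r => //; rewrite nnegrE// (le_trans _ t).
  have -> : (ou_gap / (K / 2) * (1 + enorm s.2) ^+ ke.+1) ^+ p = Q * r s by rewrite exprMn -exprM.
  by rewrite -[c * Q * _]mulrA => h1 h2; exact: le_trans h1 h2.
apply: (le_trans (@fwd_step_le _ _ _ _ _ _ _ _ _ noise _ _ _ measurable_ou_step k h (x, 0) n mk _ kh)).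
  by move=> s; rewrite exprn_ge0.
rewrite /h (@ge0_integralZDl _ _ _ P (fun w => k (fwd zeta ou_step (x, 0) n w))
  (fun w => r (fwd zeta ou_step (x, 0) n w))).
- apply: (@le_trans _ _ ((1 - c)%:E * (enorm x ^+ p + gap_const p)%:E +
    (c * Q)%:E * (ou_const (ke.+1 * p))%:E)%E).
    apply: leeD; apply: lee_wpmul2l; rewrite ?lee_fin ?subr_ge0//.
      by apply: mulr_ge0.
    exact: ou_moment.
  rewrite -!EFinM -EFinD lee_fin /gap_const -/Q.
  have := mulr_ge0 c0 x0; lra.
- by move=> w; rewrite exprn_ge0.
- by move=> w; rewrite exprn_ge0// addr_ge0.
- by rewrite subr_ge0.
- by rewrite mulr_ge0.
- exact: (measurableT_comp mk (mS n)).
- exact: (measurableT_comp mr (mS n)).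
Qed.

Definition mom_const (p : nat) : R := 2 ^+ p * (1 + gap_const p + ou_const p).

Lemma chain_moment x n p :
  (\int[P]_w ((1 + enorm (fwd zeta (step dl) x n w)) ^+ p)%:E <=
   (mom_const p * (1 + enorm x) ^+ p)%:E)%E.
Proof.
pose S w := fwd zeta ou_step (x, 0) n w.
have mS : measurable_fun setT S := measurable_fwd noise measurable_ou_step (x, 0) n.
have x0 := enorm_ge0 x.
have p0 : 0 <= 2 ^+ p :> R by rewrite exprn_ge0.
apply: (@le_trans _ _ (\int[P]_w (2 ^+ p * enorm ((S w).1 - (S w).2) ^+ p +
    2 ^+ p * (1 + enorm (S w).2) ^+ p)%:E)%E).
  apply: ge0_le_integralT => w; first by rewrite lee_fin exprn_ge0// addr_ge0.
  rewrite lee_fin -mulrDr; apply: le_trans (expr_add_le _ _ _) => //; last by rewrite addr_ge0.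
  apply: lerXn2r; rewrite ?nnegrE ?addr_ge0// -(fwd_ou_fst x 0) -/(S w).
  by have := ler_enormD ((S w).1 - (S w).2) (S w).2; rewrite subrK; lra.
rewrite ge0_integralZDl//.
- apply: (@le_trans _ _ ((2 ^+ p)%:E * (enorm x ^+ p + gap_const p)%:E +
      (2 ^+ p)%:E * (ou_const p)%:E)%E).
    apply: leeD; apply: lee_wpmul2l; rewrite ?lee_fin//; [exact: gap_moment|exact: ou_moment].
  rewrite -!EFinM -EFinD lee_fin /mom_const -mulrDr -mulrA ler_wpM2l//.
  have h1 : enorm x ^+ p <= (1 + enorm x) ^+ p by apply: lerXn2r; rewrite ?nnegrE ?addr_ge0// lerDr.
  have h2 : 1 <= (1 + enorm x) ^+ p by rewrite exprn_ege1// lerDl.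
  have := ler_wpM2l (gap_const_ge0 p) h2; have := ler_wpM2l (ou_const_ge0 p) h2; lra.
- by move=> w; rewrite exprn_ge0.
- by move=> w; rewrite exprn_ge0// addr_ge0.
- apply: measurable_funX; apply: measurable_enorm_comp; apply: measurable_rVB.
    exact: (measurableT_comp measurable_fst mS).
  exact: (measurableT_comp measurable_snd mS).
- apply: measurable_funX; apply: measurable_funD; first exact: measurable_cst.
  by apply: measurable_enorm_comp; exact: (measurableT_comp measurable_snd mS).
Qed.

End moments.

End chain_model.

(** * Halving the step *)

Section poly_domination.
Context {R : realType} {I : Type}.
Variables (Dm : set I) (G : I -> R).
Hypothesis G1 : forall i, Dm i -> 1 <= G i.

(** Being closed under sums, products and powers, it spares tracking the constants and degrees of
    the local error. *)
Definition pdom (f : I -> R) : Prop :=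
  exists C : R, exists p : nat, 0 <= C /\ forall i, Dm i -> 0 <= f i <= C * G i ^+ p.

Lemma pdom_cst (c : R) : 0 <= c -> pdom (fun=> c).
Proof. by move=> c0; exists c, 0%N; split=> // i _; rewrite expr0 mulr1 c0 lexx. Qed.

Lemma pdom_le (f g : I -> R) : pdom g -> (forall i, Dm i -> 0 <= f i <= g i) -> pdom f.
Proof.
move=> [c [p [c0 h]]] fg; exists c, p; split=> // i Di.
have /andP[f0 fgi] := fg _ Di; have /andP[_ gi] := h _ Di.
by rewrite f0 (le_trans fgi).
Qed.

Lemma pdomG : pdom G.
Proof.
exists 1, 1%N; split=> // i /G1 g1.
by rewrite mul1r expr1 lexx andbT (le_trans _ g1).
Qed.

Lemma pdomD (f g : I -> R) : pdom f -> pdom g -> pdom (fun i => f i + g i).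
Proof.
move=> [c [p [c0 h]]] [c' [p' [c'0 h']]]; exists (c + c'), (p + p')%N.
split=> [|i Di]; first exact: addr_ge0.
have /andP[f0 fi] := h _ Di; have /andP[g0 gi] := h' _ Di; have g1 := G1 Di.
rewrite addr_ge0//= mulrDl; apply: lerD.
  by rewrite (le_trans fi)// ler_wpM2l// ler_weXn2l// leq_addr.
by rewrite (le_trans gi)// ler_wpM2l// ler_weXn2l// leq_addl.
Qed.

Lemma pdomM (f g : I -> R) : pdom f -> pdom g -> pdom (fun i => f i * g i).
Proof.
move=> [c [p [c0 h]]] [c' [p' [c'0 h']]]; exists (c * c'), (p + p')%N.
split=> [|i Di]; first exact: mulr_ge0.
have /andP[f0 fi] := h _ Di; have /andP[g0 gi] := h' _ Di.
by rewrite mulr_ge0//= exprD mulrACA ler_pM.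
Qed.

Lemma pdomX (f : I -> R) n : pdom f -> pdom (fun i => f i ^+ n).
Proof.
move=> pf; elim: n => [|n ih].
  by apply: (pdom_le (pdom_cst (@ler01 R))) => i _; rewrite expr0 ler01 lexx.
have h := pdomM pf ih; apply: (pdom_le h) => i Di; rewrite exprS lexx andbT.
by have [c [p [_ /(_ i Di)/andP[]]]] := h.
Qed.

End poly_domination.

Lemma ge0_integralZ_le {R : realType} {d1 : measure_display} {T : measurableType d1}
    (P : probability T R) (f : T -> R) (c B : R) : 0 <= c -> measurable_fun setT f ->
  (forall x, 0 <= f x) -> (\int[P]_x (f x)%:E <= B%:E)%E ->
  (\int[P]_x (c * f x)%:E <= (c * B)%:E)%E.
Proof.
move=> c0 mf f0 h; under eq_integral do rewrite EFinM.
rewrite ge0_integralZl ?lee_fin//; first by rewrite EFinM lee_wpmul2l ?lee_fin.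
  exact/measurable_EFinP.
by move=> x _; rewrite lee_fin.
Qed.

Ltac nonneg := repeat first [ done | exact: sqr_ge0 | by apply: ltW | apply: mulr_ge0
  | apply: addr_ge0 | apply: exprn_ge0 | apply: divr_ge0
  | rewrite invr_ge0 ].

Section product_marginal.
Context {R : realType} {d1 d2 : measure_display}.
Context {T1 : measurableType d1} {T2 : measurableType d2}.
Local Open Scope ereal_scope.

Lemma integral_prodp_fst (P : probability T1 R) (Q : probability T2 R) (f : T1 -> \bar R) :
  measurable_fun setT f -> \int[prodp P Q]_z f z.1 = \int[P]_x f x.
Proof.
have ge0 g : measurable_fun setT g -> (forall x, 0 <= g x) ->
    \int[prodp P Q]_z g z.1 = \int[P]_x g x.
  move=> mg g0; rewrite (@ge0_integral_prodp _ _ _ _ _ P Q (fun z => g z.1))//.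
    by apply: eq_integral => x _; rewrite /= integral_cst_prob.
  exact: (measurableT_comp mg measurable_fst).
move=> mf; rewrite integralE [RHS]integralE; congr (_ - _).
  rewrite -(ge0 (f^\+)%E)//; last by apply: measurable_funepos.
  by apply: eq_integral => z _; rewrite !funeposE.
rewrite -(ge0 (f^\-)%E)//; last by apply: measurable_funeneg.
by apply: eq_integral => z _; rewrite !funenegE.
Qed.

Lemma integrable_prodp_fst (P : probability T1 R) (Q : probability T2 R) (f : T1 -> \bar R) :
  P.-integrable setT f -> (prodp P Q).-integrable setT (fun z => f z.1).
Proof.
move=> /integrableP[mf fi]; apply/integrableP; split.
  exact: (measurableT_comp mf measurable_fst).
rewrite (integral_prodp_fst P Q (f := fun x => `|f x|))//.
exact: measurableT_comp.
Qed.

End product_marginal.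

(** The scalar form of one comparison step: [a] is the noiseless distance, [w] the weight after the
    noise, [w0] the weight at the noiseless mean, [zm] and [zr] the products with the leading error
    and the rest. Only [w * zm] is too large. Taking out [w0 * zm], of mean zero, leaves a product
    with [w - w0], of order [s], hence of order [h ^+ 2] altogether. The remaining cross terms are
    split by Young's inequality with parameter [ka]. *)
Lemma half_step_arith {R : realType} (a g s h dl t w w0 zm zr nr nm nd Wm Lw sg C0 C1 C2 C3 C4 ka : R)
    (p k : nat) :
  0 <= a -> 1 <= g -> 0 <= s -> s * s = h -> h <= dl -> 0 <= dl -> dl <= 1 -> dl <= t ->
  0 <= Lw -> 0 <= sg -> 0 <= C0 -> 0 <= C1 -> 0 < ka -> 0 <= Wm ->
  C2 = 4 * Lw * sg * C1 -> C3 = C2 + 2 * Wm * C0 ->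
  C4 = C3 ^+ 2 / (4 * ka) + 2 * Wm * (C0 ^+ 2 + C1 ^+ 2) ->
  0 <= w -> w <= Wm -> `|w - w0| <= Lw * (sg * (2 * (s * g))) ->
  0 <= nm -> nm <= C1 * g ^+ k.+1 * (h * s) -> 0 <= nr -> nr <= C0 * g ^+ p * (dl * t) ->
  `|zm| <= a * nm -> zr <= a * nr -> nd ^+ 2 <= 2 * nr ^+ 2 + 2 * nm ^+ 2 ->
  w * (a ^+ 2 + 2 * (zr - zm) + nd ^+ 2) <=
  1 * (w * a ^+ 2) + 1 * (ka * dl * a ^+ 2 * 1 + dl * t ^+ 2 * C4 * g ^+ ((p + k.+2) * 2)) +
  - (2 * w0 * zm).
Proof.
move=> a0 g1 s0 sh hdl d0 d1 t1 Lw0 sg0 C00 C10 ka0 Wm0 C2E C3E C4E w0' wWm hw nm0 hM nr0 hr1 zm1 zr1 nd1.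
have g0 : 0 <= g by clear -g1; lra.
have h0 : 0 <= h by rewrite -sh; nonneg.
have ht : h <= t by clear -hdl t1; lra.
have t0 : 0 <= t by clear -d0 t1; lra.
have gk n : 0 <= g ^+ n by rewrite exprn_ge0.
have C20 : 0 <= C2 by rewrite C2E; nonneg.
have adt : 0 <= a * (dl * t) by nonneg.
have b1 : - (2 * (w - w0) * zm) <= C2 * g ^+ k.+2 * (a * (dl * t)).
  have k1 : `|zm| <= a * (C1 * g ^+ k.+1 * (h * s)) by rewrite (le_trans zm1)// ler_wpM2l.
  have k2 := ler_pM (normr_ge0 _) (normr_ge0 _) hw k1.
  have k3 : - ((w - w0) * zm) <= `|w - w0| * `|zm| by rewrite -normrM -normrN ler_norm.
  have k4 : h * h <= dl * t by apply: ler_pM.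
  have k5 : 0 <= C2 * g ^+ k.+2 * a by nonneg.
  have k6 := ler_wpM2l k5 k4.
  have k7 : 2 * (Lw * (sg * (2 * (s * g))) * (a * (C1 * g ^+ k.+1 * (h * s)))) =
      C2 * g ^+ k.+2 * a * (h * h).
    by rewrite -{3}sh C2E (exprS g k.+1); ring.
  by clear -k2 k3 k6 k7; lra.
have b2 : 2 * w * zr <= 2 * Wm * C0 * g ^+ p * (a * (dl * t)).
  have k1 : zr <= a * (C0 * g ^+ p * (dl * t)) by rewrite (le_trans zr1)// ler_wpM2l.
  have k2 : 0 <= a * (C0 * g ^+ p * (dl * t)) by nonneg.
  have k3 := ler_wpM2l w0' k1; have k4 := ler_wpM2r k2 wWm.
  by clear -k3 k4; lra.
set q := (p + k.+2)%N.
have q1 : g ^+ p <= g ^+ q by rewrite ler_weXn2l// leq_addr.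
have q3 : g ^+ k.+2 <= g ^+ q by rewrite ler_weXn2l// /q leq_addl.
have b3 : w * nd ^+ 2 <= 2 * Wm * (C0 ^+ 2 + C1 ^+ 2) * g ^+ (q * 2) * (dl * t ^+ 2).
  have q2 : g ^+ k.+1 <= g ^+ q.
    by rewrite ler_weXn2l// /q addnS ltnW// ltnS leq_addl.
  have k1 : nr ^+ 2 <= C0 ^+ 2 * (g ^+ (q * 2) * (dl * t ^+ 2)).
    apply: (@le_trans _ _ ((C0 * g ^+ q * (dl * t)) ^+ 2)).
      apply: lerXn2r; rewrite ?nnegrE; try by nonneg.
      by apply: (le_trans hr1); rewrite ler_wpM2r//; [nonneg|rewrite ler_wpM2l].
    rewrite exprM !exprMn -mulrA ler_wpM2l ?sqr_ge0// ler_wpM2l ?exprn_ge0//.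
    by rewrite ler_wpM2r ?sqr_ge0// expr2 ler_piMr.
  have k2 : nm ^+ 2 <= C1 ^+ 2 * (g ^+ (q * 2) * (dl * t ^+ 2)).
    apply: (@le_trans _ _ ((C1 * g ^+ q * (h * s)) ^+ 2)).
      apply: lerXn2r; rewrite ?nnegrE; try by nonneg.
      by apply: (le_trans hM); rewrite ler_wpM2r//; [nonneg|rewrite ler_wpM2l].
    rewrite exprM !exprMn -mulrA ler_wpM2l ?sqr_ge0// ler_wpM2l ?exprn_ge0//.
    rewrite (expr2 s) sh mulrC; apply: ler_pM; rewrite ?sqr_ge0//.
    by apply: lerXn2r; rewrite ?nnegrE.
  have k4 := ler_pM w0' (sqr_ge0 _) wWm nd1.
  have := ler_wpM2l Wm0 (lerD k1 k2); clear -k4; lra.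
have b4 : C2 * g ^+ k.+2 * (a * (dl * t)) + 2 * Wm * C0 * g ^+ p * (a * (dl * t)) <=
    ka * dl * a ^+ 2 + C3 ^+ 2 / (4 * ka) * g ^+ (q * 2) * (dl * t ^+ 2).
  have k1 : 0 <= C2 * (a * (dl * t)) by nonneg.
  have k2 : 0 <= 2 * Wm * C0 * (a * (dl * t)) by nonneg.
  have k3 := ler_wpM2l k1 q3; have k4 := ler_wpM2l k2 q1.
  have k5 : 0 <= dl * (ka * (a - C3 * g ^+ q * t / (2 * ka)) ^+ 2) by nonneg.
  have k6 : dl * (ka * (a - C3 * g ^+ q * t / (2 * ka)) ^+ 2) = ka * dl * a ^+ 2 +
    C3 ^+ 2 / (4 * ka) * g ^+ (q * 2) * (dl * t ^+ 2) - C3 * g ^+ q * (a * (dl * t)).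
    by rewrite exprM; field; rewrite gt_eqF.
  by move: k3 k4 k5; rewrite k6 C3E; clear; lra.
by clear -b1 b2 b3 b4 C4E; rewrite C4E; lra.
Qed.

(** * Local error of one step against two half steps *)

Section half_step.
Context {R : realType} {d : nat}.
Local Notation V := 'rV[R]_d.
Context {sigma D lam gam C K rho B Wm Lw Ce : R} {ke : nat} {quad : bool}.
Context {b : V -> V} {A : V -> 'M[R]_d} {W : V -> R} {mn : R -> V -> V}.
Hypothesis cm : chain_model sigma D lam gam C K rho B Wm Lw Ce ke quad b A W mn.

Local Notation stp := (@step R d sigma mn).

Definition half_step (dl : R) (z : V * (V * V)) : V :=
  stp (dl / 2) (stp (dl / 2) (z.1, z.2.1), z.2.2).

(* Minus the leading term of the local error; it has mean zero. *)
Definition lead (h : R) (y e : V) : V := (h * sigma) *: (e *m A y).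

Definition rest (dl : R) (y e : V) : V :=
  mn dl y + sigma *: e - mn (dl / 2) (stp (dl / 2) (y, e)) + lead (dl / 2) y e.

(* Arguments: step size, state, the two half-step increments. *)
Local Notation I := (R * V * V * V)%type.
Definition half_dom : set I := [set i | 0 < i.1.1.1 <= D].
(** The increments enter in units of their standard deviation, so the moments of [growth] are
    bounded independently of the step size. *)
Definition growth (i : I) : R := (1 + enorm i.1.1.2) *
  (1 + enorm i.1.2 / Num.sqrt (i.1.1.1 / 2)) * (1 + enorm i.2 / Num.sqrt (i.1.1.1 / 2)).

Local Notation pd := (pdom half_dom growth).

Lemma growth_ge (i : I) : half_dom i ->
  [/\ 1 <= growth i, 1 + enorm i.1.1.2 <= growth i,
   enorm i.1.2 <= Num.sqrt (i.1.1.1 / 2) * growth i &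
   enorm i.2 <= Num.sqrt (i.1.1.1 / 2) * growth i].
Proof.
case: i => [[[dl y] e1] e2] /= /andP[/= d0 _]; rewrite /growth /=.
have s0 : 0 < Num.sqrt (dl / 2) by rewrite sqrtr_gt0 divr_gt0.
set s := Num.sqrt _ in s0 *.
have y0 := enorm_ge0 y.
have n1 : 0 <= enorm e1 / s by rewrite divr_ge0// ltW.
have n2 : 0 <= enorm e2 / s by rewrite divr_ge0// ltW.
have E1 : enorm e1 = s * (enorm e1 / s) by field; lra.
have E2 : enorm e2 = s * (enorm e2 / s) by field; lra.
set u := enorm e1 / s in n1 E1 *; set v := enorm e2 / s in n2 E2 *; set a := enorm y in y0 *.
have au : 0 <= a * u by rewrite mulr_ge0.
have av : 0 <= a * v by rewrite mulr_ge0.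
have uv : 0 <= u * v by rewrite mulr_ge0.
have auv : 0 <= a * u * v by apply: mulr_ge0.
split; try lra; rewrite ?E1 ?E2; apply: ler_wpM2l; lra.
Qed.

Lemma growth_ge1 i : half_dom i -> 1 <= growth i. Proof. by case/growth_ge. Qed.

Lemma half_dom_bounds i : half_dom i -> [/\ 0 < i.1.1.1 <= D, 0 < i.1.1.1 / 2 <= D, 0 < i.1.1.1 <= 1,
  0 < Num.sqrt (i.1.1.1 / 2) <= 1 & Num.sqrt (i.1.1.1 / 2) ^+ 2 = i.1.1.1 / 2].
Proof.
move=> /andP[d0 d1]; have /andP[D0 D1] := cm_D cm; set dl := i.1.1.1 in d0 d1 *.
split; try by apply/andP; split; lra.
  rewrite sqrtr_gt0 divr_gt0//= -[leRHS](sqrtr1 R).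
  by rewrite ler_sqrt//; lra.
by rewrite sqr_sqrtr//; lra.
Qed.

Lemma half_dom_pow i : half_dom i -> [/\ i.1.1.1 <= i.1.1.1 `^ gam, i.1.1.1 `^ gam <= 1 &
  (i.1.1.1 / 2) `^ gam <= i.1.1.1 `^ gam].
Proof.
move=> Di; have [_ _ /andP[d0 d1] _ _] := half_dom_bounds Di; have /andP[g0 g1] := cm_gam cm.
split.
- by rewrite -[leLHS](powRr1 (ltW d0)) ger_powR ?d0.
- by rewrite -(powRr0 i.1.1.1) ger_powR ?d0//= ltW.
- by apply: ge0_ler_powR; rewrite ?nnegrE ?divr_ge0 ?(ltW g0)//; lra.
Qed.

Lemma pdom_state : pd (fun i => 1 + enorm i.1.1.2).
Proof.
apply: (pdom_le (pdomG growth_ge1)) => i Di; have [_ -> _ _] := growth_ge Di.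
by rewrite andbT addr_ge0.
Qed.

Lemma pdom_drift : pd (fun i => enorm (b i.1.1.2)).
Proof.
have Ce0 := Ce_ge0 cm.
apply: (pdom_le (pdomM (pdom_cst _ _ (addr_ge0 (enorm_ge0 (b 0)) Ce0))
  (pdomX ke.+1 pdom_state))) => i Di.
by rewrite enorm_ge0 (drift_growth cm).
Qed.

Definition euler_err (dl : R) (y : V) := mn dl y - y - dl *: b y.

Lemma pdom_gap : pd (fun i => enorm (stp (i.1.1.1 / 2) (i.1.1.2, i.1.2) - i.1.1.2)
  / Num.sqrt (i.1.1.1 / 2)).
Proof.
have Ce0 := Ce_ge0 cm.
have pe := pdomM (pdom_cst half_dom growth Ce0) (pdomX ke pdom_state).
apply: (pdom_le (pdomD growth_ge1 (pdomD growth_ge1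
  (pdomM (pdom_cst half_dom growth (normr_ge0 sigma)) (pdomG growth_ge1)) pdom_drift) pe)) => i Di.
have [hd hh /andP[d0 d1] /andP[s0 s1] s2] := half_dom_bounds Di; have [p1 p2 p3] := half_dom_pow Di.
have [g1 _ ge _] := growth_ge Di.
set s := Num.sqrt _ in s0 s1 s2 ge *; set dl := i.1.1.1 in hd hh d0 d1 s2 p1 p2 p3 *.
set y := i.1.1.2; set e := i.1.2 in ge *.
rewrite divr_ge0 ?(ltW s0)//= ler_pdivrMr//.
have -> : stp (dl / 2) (y, e) - y = sigma *: e + (dl / 2) *: b y + euler_err (dl / 2) y.
  by rewrite /step /= /euler_err; apply/rowP => j; rewrite !mxE; ring.
apply: (le_trans (ler_enormD _ _)); rewrite mulrDl; apply: lerD.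
  apply: (le_trans (ler_enormD _ _)); rewrite mulrDl; apply: lerD.
    by rewrite enormZ -mulrA ler_wpM2l// mulrC.
  rewrite enormZ ger0_norm; last by clear -cm d0; lra.
  by rewrite mulrC ler_wpM2l// -s2 expr2 ler_piMr// ltW.
apply: (le_trans (cm_err cm hh y)); rewrite ler_wpM2l//.
  by rewrite mulr_ge0// exprn_ge0// addr_ge0.
have q0 : 0 <= (dl / 2) `^ gam by exact: powR_ge0.
rewrite -s2 expr2 -mulrA ler_piMr//; first exact: ltW.
have h1 : s * (s ^+ 2) `^ gam <= s * 1 by rewrite ler_wpM2l ?(ltW s0)// s2; lra.
by rewrite expr2 mulr1 in h1; lra.
Qed.

(** Expanding [b] around [y] at the intermediate point [Y] leaves a Taylor remainder, the matrix
    [A y] applied to the drift part of [Y - y], and three one-step errors of the scheme. As [Y - y]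
    is of order [s], the remainder is [dl * s ^+ 2] when it is quadratic; when it is linear it is
    [dl * s], enough since then [gam <= 1 / 2]. *)
Lemma rest_pdom : exists C0 : R, exists p : nat, 0 <= C0 /\
  forall dl y e1 e2, 0 < dl <= D ->
    enorm (rest dl y e1) <= C0 * growth (dl, y, e1, e2) ^+ p * (dl * dl `^ gam).
Proof.
have Ce0 := Ce_ge0 cm.
have pe := pdomM (pdom_cst half_dom growth Ce0) (pdomX ke pdom_state).
have pY : pd (fun i => 1 + enorm i.1.1.2 + enorm (stp (i.1.1.1 / 2) (i.1.1.2, i.1.2))).
  apply: (pdom_le (pdomD growth_ge1 (pdomD growth_ge1 pdom_state pdom_state) pdom_gap)) => i Di.
  have [hd hh d1 /andP[s0 s1] s2] := half_dom_bounds Di.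
  rewrite !addr_ge0//=; set Y := stp _ _; set y := i.1.1.2; set s := Num.sqrt _ in s0 s1 *.
  have h : enorm (Y - y) <= enorm (Y - y) / s.
    by rewrite ler_pdivlMr// ler_piMr.
  have := ler_enormD (Y - y) y; rewrite subrK; lra.
have pt := pdomM (pdomM (pdom_cst half_dom growth Ce0) (pdomX ke pY))
  (pdomX (if quad then 2 else 1)%N pdom_gap).
have pA := pdomM pe (pdomD growth_ge1 pdom_drift pe).
have pY1 := pdomM (pdom_cst half_dom growth Ce0) (pdomX ke pY).
suff : pd (fun i => enorm (rest i.1.1.1 i.1.1.2 i.1.2) / (i.1.1.1 * i.1.1.1 `^ gam)).
  move=> [C0 [p [C00 h]]]; exists C0, p; split=> // dl y e1 e2 hd.
  have /= /andP[_] := h (dl, y, e1, e2) hd.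
  by rewrite ler_pdivrMr// mulr_gt0 ?powR_gt0//; have /andP[] := hd.
apply: (pdom_le (pdomD growth_ge1 (pdomD growth_ge1 pA pt)
  (pdomD growth_ge1 (pdomD growth_ge1 pe pe) pY1))) => i Di.
have [hd hh /andP[d0 d1] /andP[s0 s1] s2] := half_dom_bounds Di; have [p1 p2 p3] := half_dom_pow Di.
set s := Num.sqrt _ in s0 s1 s2 *; set dl := i.1.1.1 in hd hh d0 d1 s2 p1 p2 p3 *.
set y := i.1.1.2; set e := i.1.2.
have q0 : 0 < dl * dl `^ gam by rewrite mulr_gt0 ?powR_gt0.
set Y := stp _ _; set q := dl * dl `^ gam in q0 *.
rewrite divr_ge0 ?(ltW q0)//= ler_pdivrMr//.
have hq : dl / 2 * (dl / 2) <= q.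
  by rewrite /q; apply: ler_pM; rewrite ?divr_ge0//; clear -cm d0 p1; lra.
have hq2 : dl / 2 * (dl / 2) `^ gam <= q.
  by rewrite /q; apply: ler_pM; rewrite ?divr_ge0 ?powR_ge0//; clear -cm d0 p3; lra.
have -> : rest dl y e = - ((dl / 2) *: (((dl / 2) *: b y + euler_err (dl / 2) y) *m A y))
    - (dl / 2) *: (b Y - b y - (Y - y) *m A y)
    + (euler_err dl y - euler_err (dl / 2) y - euler_err (dl / 2) Y).
  have -> : (Y - y) *m A y = sigma *: (e *m A y) + ((dl / 2) *: b y + euler_err (dl / 2) y) *m A y.
    rewrite scalemxAl -mulmxDl; congr (_ *m _).
    by rewrite /Y /step /= /euler_err; apply/rowP => j; rewrite !mxE; ring.
  rewrite /rest /lead -/Y; set u := _ *m A y; set v := e *m A y.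
  have -> : euler_err (dl / 2) Y = mn (dl / 2) Y - Y - (dl / 2) *: b Y by [].
  rewrite {2}/Y /step /= /euler_err.
  by apply/rowP => j; rewrite !mxE; field.
have n0 : 0 <= (1 + enorm y) ^+ ke by rewrite exprn_ge0// addr_ge0.
have h0 := cm_err cm hh y; have h1 := cm_err cm hd y; have h2 := cm_err cm hh Y.
rewrite -/(euler_err _ _) in h0 h1 h2.
have le_a : enorm ((dl / 2) *: (((dl / 2) *: b y + euler_err (dl / 2) y) *m A y)) <=
    Ce * (1 + enorm y) ^+ ke * (enorm (b y) + Ce * (1 + enorm y) ^+ ke) * q.
  rewrite enormZ ger0_norm; last by clear -cm d0; lra.
  have t := cm_A cm y ((dl / 2) *: b y + euler_err (dl / 2) y).
  have t2 : enorm ((dl / 2) *: b y + euler_err (dl / 2) y) <=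
      (dl / 2) * (enorm (b y) + Ce * (1 + enorm y) ^+ ke).
    apply: (le_trans (ler_enormD _ _)); rewrite enormZ ger0_norm; last by clear -cm d0; lra.
    rewrite mulrDr lerD2l// (le_trans h0)// [leRHS]mulrC ler_wpM2l ?mulr_ge0//.
    by rewrite ler_piMr//; clear -cm d0 p2 p3; lra.
  have dh : 0 <= dl / 2 by clear -cm d0; lra.
  apply: (le_trans (ler_wpM2l dh (le_trans t (ler_wpM2l (mulr_ge0 Ce0 n0) t2)))).
  set c := Ce * _; set f := enorm (b y) + _.
  have -> : dl / 2 * (c * (dl / 2 * f)) = c * f * (dl / 2 * (dl / 2)) by ring.
  by rewrite ler_wpM2l// !mulr_ge0// addr_ge0// mulr_ge0.
have le_t : enorm ((dl / 2) *: (b Y - b y - (Y - y) *m A y)) <=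
    Ce * (1 + enorm y + enorm Y) ^+ ke *
    (enorm (Y - y) / s) ^+ (if quad then 2 else 1) * q.
  rewrite enormZ ger0_norm; last by clear -cm d0; lra.
  have t := cm_taylor cm y Y.
  have dh : 0 <= dl / 2 by clear -cm d0; lra.
  apply: (le_trans (ler_wpM2l dh t)); rewrite expr_div_n.
  set m := (if quad then _ else _) in t *; set c := Ce * _; set u := enorm (Y - y) ^+ m.
  have c0 : 0 <= c * u.
    by rewrite !mulr_ge0// exprn_ge0// ?addr_ge0// addr_ge0.
  suff hs : dl / 2 * s ^+ m <= q.
    have sm : 0 < s ^+ m by rewrite exprn_gt0.
    have -> : dl / 2 * (c * u) = c * u / s ^+ m * (dl / 2 * s ^+ m) by field; rewrite gt_eqF.
    by rewrite [c * (u / _)]mulrA ler_wpM2l// divr_ge0// ltW.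
  rewrite /m; case: (boolP quad) => hquad; first by rewrite s2.
  rewrite expr1 /q; apply: ler_pM; rewrite ?(ltW s0)//; try by clear -cm d0; lra.
  rewrite /s -powR12_sqrt; last by clear -cm d0; lra.
  apply: (@le_trans _ _ (dl `^ 2^-1)).
    by apply: ge0_ler_powR; rewrite ?nnegrE ?invr_ge0//; clear -cm d0; lra.
  by rewrite ger_powR ?d0//; have := cm_quad cm hquad; clear -cm; lra.
have le_1 : enorm (euler_err dl y) <= Ce * (1 + enorm y) ^+ ke * q by [].
have le_2 : enorm (euler_err (dl / 2) y) <= Ce * (1 + enorm y) ^+ ke * q.
  by rewrite (le_trans h0)// ler_wpM2l// mulr_ge0.
have le_3 : enorm (euler_err (dl / 2) Y) <= Ce * (1 + enorm y + enorm Y) ^+ ke * q.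
  apply: (le_trans h2); apply: ler_pM => //; rewrite ?mulr_ge0 ?powR_ge0 ?exprn_ge0 ?addr_ge0//.
    by clear -cm d0; lra.
  rewrite ler_wpM2l//; apply: lerXn2r; rewrite ?nnegrE ?addr_ge0//.
  by have := enorm_ge0 y; clear -cm; lra.
do 2 (apply: (le_trans (ler_enormD _ _)); rewrite ?mulrDl; apply: lerD).
- by rewrite enormN.
- by rewrite enormN.
- by apply: (le_trans (ler_enormB _ _)); apply: lerD.
- by rewrite enormN.
Qed.

(** Moves the matrix away from the noise: the leading error, tested against a fixed vector, becomes
    a linear functional of the increment. *)
Lemma inner_mulmx_tr (v u : V) (M : 'M[R]_d) : inner (v *m M^T) u = inner v (u *m M).
Proof.
rewrite /inner; under eq_bigr do rewrite mxE mulr_suml.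
rewrite exchange_big /=; apply: eq_bigr => i _; rewrite mxE mulr_sumr.
by apply: eq_bigr => j _; rewrite mxE; ring.
Qed.

Lemma integral_growth dl y n (gh : probability V R) :
  0 < dl <= D -> gaussian gh (Num.sqrt (dl / 2)) ->
  (\int[prodp gh gh]_e (growth (dl, y, e.1, e.2) ^+ n)%:E <=
   (gauss_const d n ^+ 2 * (1 + enorm y) ^+ n)%:E)%E.
Proof.
move=> /andP[d0 _] hg; have s0 : 0 < Num.sqrt (dl / 2) by rewrite sqrtr_gt0 divr_gt0.
set s := Num.sqrt _ in hg s0.
have mN : measurable_fun [set: V] (fun e : V => (1 + enorm e / s) ^+ n).
  apply: measurable_funX; apply: measurable_funD => //.
  by apply: measurable_funM => //; exact: measurable_enorm.
have N0 (e : V) : 0 <= (1 + enorm e / s) ^+ n by rewrite exprn_ge0// addr_ge0// divr_ge0// ltW.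
have y0 : 0 <= (1 + enorm y) ^+ n by rewrite exprn_ge0// addr_ge0.
rewrite (@ge0_integral_prodp _ _ _ _ _ gh gh (fun e => (growth (dl, y, e.1, e.2) ^+ n)%:E)); last 2 first.
- apply/measurable_EFinP; rewrite /growth/=; under eq_fun do rewrite !exprMn.
  apply: measurable_funM; last exact: (measurableT_comp mN measurable_snd).
  by apply: measurable_funM => //; exact: (measurableT_comp mN measurable_fst).
- by move=> z; rewrite lee_fin exprn_ge0// !mulr_ge0 ?addr_ge0 ?divr_ge0// ltW.
rewrite /growth /= -/s.
apply: (@le_trans _ _ (\int[gh]_e (((1 + enorm y) ^+ n * gauss_const d n) *
    (1 + enorm e / s) ^+ n)%:E)%E).
  apply: ge0_le_integralT => e.
    by apply: integral_ge0 => e' _; rewrite lee_fin exprn_ge0// !mulr_ge0 ?addr_ge0 ?divr_ge0// ltW.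
  under eq_integral do rewrite !exprMn.
  rewrite mulrAC; apply: ge0_integralZ_le => //; first exact: mulr_ge0.
  exact: gaussian_poly.
have c0 : 0 <= (1 + enorm y) ^+ n * gauss_const d n by rewrite mulr_ge0// gauss_const_ge0.
rewrite (_ : _ ^+ 2 * _ = (1 + enorm y) ^+ n * gauss_const d n * gauss_const d n); last by ring.
by apply: ge0_integralZ_le => //; exact: gaussian_poly.
Qed.

(** The difference of a coarse step from [x] and two half steps from [y] is [Z = mn dl x - mn dl y],
    free of noise, plus [rest] minus [lead]. The hypothesis on sums gives the two half increments
    together the law of a full one, so the contraction of the coarse step applies to [Z]. *)
Lemma half_step_error : exists C0 : R, exists p : nat, 0 <= C0 /\
  forall dl (gh gd : probability V R), 0 < dl <= D ->
  gaussian gh (Num.sqrt (dl / 2)) -> gaussian gd (Num.sqrt dl) ->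
  (forall f : V -> \bar R, measurable_fun setT f -> (forall z, 0 <= f z)%E ->
     \int[prodp gh gh]_e f (e.1 + e.2)%R = \int[gd]_z f z)%E ->
  forall x y,
  (\int[prodp gh gh]_e (W (stp dl (x, e.1 + e.2)) *
      enorm (stp dl (x, e.1 + e.2) - half_step dl (y, e)) ^+ 2)%:E <=
   ((1 - lam / 2 * dl) * (W x * enorm (x - y) ^+ 2) +
    dl * (dl `^ gam) ^+ 2 * (C0 * (1 + enorm y) ^+ p))%:E)%E.
Proof.
have Ce0 := Ce_ge0 cm.
have [C0 [p [C00 hr]]] := rest_pdom.
have l0 := cm_lam cm; have c0 := cm_C cm.
(* With this Young parameter the cross terms cost exactly half of the contraction rate. *)
set ka := lam / (2 * (1 + 3 * C)).
have ka0 : 0 < ka by rewrite divr_gt0// mulr_gt0//; lra.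
have Wm1 : 1 <= Wm := le_trans (cm_W1 cm 0) (cm_Wm cm 0).
have Wm0 : 0 <= Wm := le_trans ler01 Wm1.
have Lw0 := cm_Lw cm; have sg0 := normr_ge0 sigma.
pose C1 := `|sigma| * Ce; have C10 : 0 <= C1 by nonneg.
pose C2 := 4 * Lw * `|sigma| * C1; have C20 : 0 <= C2 by nonneg.
pose C3 := C2 + 2 * Wm * C0.
have C30 : 0 <= C3 by nonneg.
pose C4 := C3 ^+ 2 / (4 * ka) + 2 * Wm * (C0 ^+ 2 + C1 ^+ 2).
have C40 : 0 <= C4.
  apply: addr_ge0; first by apply: divr_ge0; [exact: sqr_ge0|nonneg].
  by nonneg.
have C1E : C1 = `|sigma| * Ce by [].
have C2E : C2 = 4 * Lw * `|sigma| * C1 by [].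
have C3E : C3 = C2 + 2 * Wm * C0 by [].
have C4E : C4 = C3 ^+ 2 / (4 * ka) + 2 * Wm * (C0 ^+ 2 + C1 ^+ 2) by [].
have kaE : ka * (1 + 3 * C) = lam / 2 by rewrite /ka; field; lra.
clearbody C4 C3 C2 C1 ka.
pose q := (p + ke.+2)%N.
exists (C4 * gauss_const d (q * 2) ^+ 2), (q * 2)%N.
split=> [|dl gh gd hd hgh hgd hsum x y]; first by rewrite mulr_ge0// sqr_ge0.
set h := dl / 2; set s := Num.sqrt h; set t := dl `^ gam.
set m := mn dl x; set Z := m - mn dl y; set a := enorm Z.
have a0 : 0 <= a by exact: enorm_ge0.
have xy0 : 0 <= enorm (x - y) ^+ 2 by exact: sqr_ge0.
pose w (e : V * V) := W (m + sigma *: (e.1 + e.2)).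
pose G (e : V * V) := growth (dl, y, e.1, e.2).
(* The leading cross term with the weight frozen at [m]: linear in the first half increment, hence
   centred. *)
pose L (e : V * V) := inner (- (2 * W m * (h * sigma)) *: (Z *m (A y)^T)) e.1.
pose c := dl * t ^+ 2 * C4.
have [_ _ /andP[d0 d1] /andP[s0 s1] s2] := @half_dom_bounds (dl, y, 0, 0) hd.
rewrite /= -/h -/s in d0 d1 s0 s1 s2.
have [t1 t2 _] := @half_dom_pow (dl, y, 0, 0) hd; rewrite /= -/t in t1 t2.
have h0 : 0 <= h by rewrite /h; clear -cm d0; lra.
have t0 : 0 <= t by exact: powR_ge0.
have cc0 : 0 <= c by nonneg.
have W0 z : 0 <= W z by exact: le_trans ler01 (cm_W1 cm z).
have pointwise e : W (stp dl (x, e.1 + e.2)) *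
    enorm (stp dl (x, e.1 + e.2) - half_step dl (y, e)) ^+ 2 <=
    1 * (w e * a ^+ 2) + 1 * (ka * dl * a ^+ 2 * 1 + c * G e ^+ (q * 2)) + L e.
  case: e => e1 e2; rewrite /w /L /G /= [stp dl _]/(m + sigma *: (e1 + e2)).
  set w' := W _; set g := growth _.
  have [g1 gy ge1 ge2] := @growth_ge (dl, y, e1, e2) hd.
  rewrite /= -/g -/h -/s in g1 gy ge1 ge2.
  set M := lead h y e1; set r := rest dl y e1.
  have -> : m + sigma *: (e1 + e2) - half_step dl (y, (e1, e2)) = Z + (r - M).
    rewrite /half_step {1}/step /= /Z /r /rest -/h -/M.
    by apply/rowP => j; rewrite !mxE; ring.
  have -> : inner (- (2 * W m * (h * sigma)) *: (Z *m (A y)^T)) e1 = - (2 * W m * inner Z M).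
    rewrite /M /lead innerZl innerZr.
    by rewrite inner_mulmx_tr; ring.
  have hM : enorm M <= C1 * g ^+ ke.+1 * (h * s).
    rewrite /M /lead enormZ normrM (ger0_norm h0).
    apply: (le_trans (ler_wpM2l _ (cm_A cm y e1))); first by nonneg.
    have yk0 : 0 <= (1 + enorm y) ^+ ke by rewrite exprn_ge0// addr_ge0.
    have yk : (1 + enorm y) ^+ ke <= g ^+ ke.
      by apply: lerXn2r; rewrite ?nnegrE ?addr_ge0//; clear -cm gy g1; lra.
    have h1 : (1 + enorm y) ^+ ke * enorm e1 <= g ^+ ke * (s * g) by apply: ler_pM.
    have h2 : 0 <= h * C1 by apply: mulr_ge0.
    by have := ler_wpM2l h2 h1; rewrite C1E exprS; clear -cm; lra.
  have hr1 : enorm r <= C0 * g ^+ p * (dl * t) by apply: hr.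
  have hw : `|w' - W m| <= Lw * (`|sigma| * (2 * (s * g))).
    apply: (le_trans (cm_WL cm _ _)); rewrite ler_wpM2l// addrAC subrr add0r enormZ ler_wpM2l//.
    by rewrite mulrDl mul1r (le_trans (ler_enormD _ _))// lerD.
  have sh : s * s = h by rewrite -s2 expr2.
  have hdl : h <= dl by rewrite /h; clear -cm d0; lra.
  have nd : enorm (r - M) ^+ 2 <= 2 * enorm r ^+ 2 + 2 * enorm M ^+ 2.
    by have := enormD_sqr_le r (- M); rewrite enormN.
  rewrite enormD_sqr -/a innerDr innerNr /c.
  by apply: (half_step_arith a0 g1 (ltW s0) sh hdl (ltW d0) d1 t1 Lw0 sg0 C00 C10 ka0 _ C2E C3E C4E _ _
    hw (enorm_ge0 M) hM (enorm_ge0 r) hr1 (norm_inner_le _ _) (inner_le _ _) nd) => //;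
    [exact: W0|exact: cm_Wm cm _].
have mW : measurable_fun setT W := lipschitz_measurable (cm_WL cm).
have madd : measurable_fun setT (fun e : V * V => e.1 + e.2).
  by apply: measurable_rVD; [exact: measurable_fst|exact: measurable_snd].
have mWm : measurable_fun setT (fun z : V => W (m + sigma *: z)).
  apply: (measurableT_comp mW); apply: measurable_rVD; first exact: measurable_cst.
  by apply: measurable_rVZ; [exact: measurable_cst|exact: measurable_id].
have mw : measurable_fun setT w := measurableT_comp mWm madd.
have mG : measurable_fun setT (fun e => G e ^+ (q * 2)).
  apply: measurable_funX; rewrite /G /growth /= -/h -/s.
  have mN : measurable_fun setT (fun e : V => 1 + enorm e / s).
    by apply: measurable_funD => //; apply: measurable_funM => //; exact: measurable_enorm.
  apply: measurable_funM; last exact: (measurableT_comp mN measurable_snd).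
  by apply: measurable_funM => //; exact: (measurableT_comp mN measurable_fst).
have G0 e : 0 <= G e ^+ (q * 2).
  by rewrite exprn_ge0// (le_trans ler01)//; exact: (@growth_ge1 (dl, y, e.1, e.2) hd).
set f1 := fun e => w e * a ^+ 2.
set f2 := fun e => ka * dl * a ^+ 2 * 1 + c * G e ^+ (q * 2).
have ka2 : 0 <= ka * dl * a ^+ 2 by nonneg.
have f10 e : 0 <= f1 e by rewrite mulr_ge0 ?sqr_ge0//; exact: W0.
have f20 e : 0 <= f2 e by rewrite addr_ge0// mulr_ge0.
have mf1 : measurable_fun setT f1 by apply: measurable_funM.
have mf2 : measurable_fun setT f2.
  by apply: measurable_funD => //; apply: measurable_funM.
have [iL L0] := @gaussian_inner_mean0 _ _ gh s s0 hgh (- (2 * W m * (h * sigma)) *: (Z *m (A y)^T)).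
apply: (@le_trans _ _ (\int[prodp gh gh]_e (1 * f1 e + 1 * f2 e)%:E)%E).
  apply: (@ge0_integral_le_centered _ _ _ (prodp gh gh) _ _ L) => //.
  - by move=> e; rewrite mulr_ge0 ?sqr_ge0//; exact: W0.
  - by move=> e; rewrite !mul1r addr_ge0.
  - by under eq_fun do rewrite !mul1r; apply: measurable_funD.
  - exact: (integrable_prodp_fst gh iL).
  - by rewrite -L0; apply: (integral_prodp_fst gh gh); have /integrableP[] := iL.
rewrite ge0_integralZDl// !mul1e.
have i1 : (\int[prodp gh gh]_e (f1 e)%:E <= ((1 - lam * dl) * (W x * enorm (x - y) ^+ 2))%:E)%E.
  rewrite /f1 /w (hsum (fun z => (W (m + sigma *: z) * a ^+ 2)%:E))//.
  - under eq_integral do rewrite EFinM.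
    rewrite ge0_integralZr ?lee_fin ?sqr_ge0//.
    + exact: (cm_contract cm hd hgd).
    + exact/measurable_EFinP.
    + by move=> z _; rewrite lee_fin; exact: W0.
  - by apply/measurable_EFinP; apply: measurable_funM.
  - by move=> z; rewrite lee_fin mulr_ge0 ?sqr_ge0//; exact: W0.
have i2 : (\int[prodp gh gh]_e (f2 e)%:E <=
    (ka * dl * a ^+ 2 + c * (gauss_const d (q * 2) ^+ 2 * (1 + enorm y) ^+ (q * 2)))%:E)%E.
  rewrite /f2 (@ge0_integralZDl _ _ _ _ (fun=> 1))// integral_cst_prob mule1 EFinD.
  by rewrite leeD2l// [leRHS]EFinM lee_wpmul2l ?lee_fin//; exact: integral_growth.
apply: (le_trans (leeD i1 i2)); rewrite -EFinD lee_fin.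
have k1 : ka * dl * a ^+ 2 <= lam / 2 * dl * (W x * enorm (x - y) ^+ 2).
  have u1 := cm_lip cm hd x y; rewrite -/m -/Z -/a in u1.
  have u2 : (1 + 3 * C * dl) * enorm (x - y) ^+ 2 <= (1 + 3 * C) * enorm (x - y) ^+ 2.
    by rewrite ler_wpM2r// lerD2l ler_piMr// mulr_ge0// ltW.
  have kd : 0 <= ka * dl by rewrite mulr_ge0// ltW.
  have u4 := ler_wpM2l kd (le_trans u1 u2).
  have ld : 0 <= lam / 2 * dl by rewrite mulr_ge0 ?(ltW d0)//; clear -cm l0; lra.
  have u5 := ler_wpM2l ld (ler_wpM2r xy0 (cm_W1 cm x)).
  have u6 : ka * dl * ((1 + 3 * C) * enorm (x - y) ^+ 2) = lam / 2 * dl * (1 * enorm (x - y) ^+ 2).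
    by rewrite -kaE; ring.
  by clear -cm u4 u5 u6; lra.
by rewrite /c; move: k1; clear -cm; lra.
Qed.

End half_step.

(** * Brownian increments as noise *)

Section noise.
Context {R : realType} {d : nat} {dO : measure_display} {Om : measurableType dO}.
Local Notation V := 'rV[R]_d.

(* [zeta dl n] is the increment of the driving noise over the [n]-th step of
   length [dl]. *)
Record noise_system (P : probability Om R) (filt : R -> nat -> set (set Om))
    (zeta : R -> nat -> Om -> V) (gam : R -> probability V R) : Prop := NoiseSystem {
  ns_noise : forall dl, 0 < dl -> iid_noise P (filt dl) (zeta dl) (gam dl);
  ns_gauss : forall dl, 0 < dl -> gaussian (gam dl) (Num.sqrt dl);
  ns_half : forall dl n w, 0 < dl ->
    zeta dl n w = zeta (dl / 2) n.*2 w + zeta (dl / 2) n.*2.+1 w }.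

Variables (P : probability Om R) (F : R -> set (set Om)) (W : R -> Om -> V).

Definition scheme_noise (dl : R) (n : nat) (w : Om) : V :=
  W (n.+1%:R * dl) w - W (n%:R * dl) w.

Lemma brownian_noise : complete_filtration P F -> brownian_motion P F W ->
  exists gam, noise_system P (fun dl n => F (n%:R * dl)) scheme_noise gam.
Proof.
move=> [_ Fs Fi _] [ad _ _ ind nrm].
have t0 (dl : R) n : 0 < dl -> 0 <= n%:R * dl by move=> dl0; rewrite mulr_ge0// ltW.
have tn (dl : R) n : 0 < dl -> n%:R * dl < n.+1%:R * dl by move=> dl0; rewrite ltr_pM2r// ltr_nat.
have sub (dl : R) n : n.+1%:R * dl - n%:R * dl = dl by rewrite -natr1; ring.
have mz dl n : 0 < dl -> mwrt (F (n.+1%:R * dl)) (scheme_noise dl n).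
  move=> dl0; have [sg _] := Fs _ (t0 dl n.+1 dl0).
  apply/(mwrtP _ sg); apply: measurable_rVB; apply/(mwrtP _ sg) => A mA.
    by apply: ad => //; exact: t0.
  by apply: (Fi (n%:R * dl)); rewrite ?t0 ?(ltW (tn _ _ _))//; apply: ad => //; exact: t0.
have mzO (dl : R) n : 0 < dl -> measurable_fun setT (scheme_noise dl n).
  by move=> dl0; apply: (mwrt_measurable _ (mz dl n dl0)); have [] := Fs _ (t0 dl n.+1 dl0).
have box dl n (B : 'I_d -> set R) : 0 < dl -> (forall i, measurable (B i)) ->
    P [set w | forall i, B i (scheme_noise dl n w ord0 i)] =
    (\prod_(i < d) normal_prob 0%R (Num.sqrt dl) (B i))%E.
  by move=> dl0 mB; rewrite -{2}(sub dl n); apply: nrm => //; [exact: t0|exact: tn].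
(* Increments of one length share their law because the product formula fixes it on orthants. *)
have same dl n (A : set V) (dl0 : 0 < dl) : measurable A ->
    law P (mzO dl n dl0) A = law P (mzO dl 0 dl0) A.
  apply: probability_eq_orthant => a.
  have E m : scheme_noise dl m @^-1` orthant a =
      [set w | forall i, `]-oo, a ord0 i[%classic (scheme_noise dl m w ord0 i)].
    by apply/seteqP; split=> w /= h i; have := h i; rewrite in_itv.
  transitivity (P (scheme_noise dl n @^-1` orthant a)); first by [].
  transitivity (P (scheme_noise dl 0 @^-1` orthant a)); last by [].
  have bE m := box dl m (fun i => `]-oo, a ord0 i[%classic) dl0 (fun i => measurable_itv _).
  by rewrite !E !bE.
have [gam gamP] : exists gam : R -> probability V R, forall dl (dl0 : 0 < dl),
    gam dl = law P (mzO dl 0 dl0).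
  (* For [dl <= 0] an arbitrary law is put; [noise_system] asks nothing there. *)
  exists (fun dl => if pselect (0 < dl) is left h then law P (mzO dl 0 h)
    else law P (measurable_cst (0 : V))) => dl dl0.
  by case: pselect => // h; congr (law P _); exact: Prop_irrelevance.
exists gam; split=> [dl dl0|dl dl0 i B mB|dl n w dl0].
- split.
  + by move=> n; have [] := Fs _ (t0 dl n dl0).
  + by move=> n; have [] := Fs _ (t0 dl n dl0).
  + by move=> n; apply: Fi; [exact: t0|exact/ltW/tn].
  + by move=> n; exact: mz.
  + move=> n A B FA mB.
    rewrite (ind _ _ (t0 dl n dl0) (tn dl n dl0))//; congr (_ * _)%E.
    by rewrite (gamP dl dl0) -(same dl n B dl0 mB).
- rewrite (gamP dl dl0) lawE.
  rewrite (_ : _ @^-1` _ = [set w | forall j, (if j == i then B else setT) (scheme_noise dl 0 w ord0 j)]).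
    rewrite (box dl 0 (fun j => if j == i then B else setT))//; last by move=> j; case: ifP.
    rewrite (bigD1 i)//= eqxx big1 ?mule1// => j /negbTE ->.
    exact: (@probability_setT _ _ _ (normal_prob 0 (Num.sqrt dl))).
  apply/seteqP; split=> w /=; first by move=> h j; case: eqP => // ->.
  by move=> /(_ i); rewrite eqxx.
- rewrite /scheme_noise.
  have E m : m.*2%:R * (dl / 2) = m%:R * dl :> R.
    by rewrite -muln2 natrM; field.
  rewrite -doubleS !E.
  by rewrite [RHS]addrC subrKA.
Qed.

End noise.

Lemma integral_indicT {R : realType} {d1 : measure_display} {T : measurableType d1}
    (P : probability T R) (C : set T) : measurable C ->
  (\int[P]_w (\1_C w)%:E = P C)%E.
Proof. by move=> mC; rewrite integral_indic// setIT. Qed.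

(** * Consecutive increments taken in pairs *)

Section pair_noise.
Context {R : realType} {d0 d2 : measure_display}.
Context {Om : measurableType d0} {E : measurableType d2}.
Variables (P : probability Om R) (G : nat -> set (set Om)).
Variables (zeta : nat -> Om -> E) (gam : probability E R).
Hypothesis noise : iid_noise P G zeta gam.
Local Open Scope ereal_scope.

Lemma iid_law n (f : E -> \bar R) : measurable_fun setT f -> (forall e, 0 <= f e) ->
  \int[P]_w f (zeta n w) = \int[gam]_e f e.
Proof.
move=> mf f0.
have mY : mwrt (G n) (fun _ : Om => tt).
  by apply/(mwrtP _ (iid_sigma noise n)); exact: measurable_cst.
rewrite (iid_freezing noise (g := fun z : unit * E => f z.2) mY)//.
  by rewrite /= integral_cst_prob.
exact: (measurableT_comp mf measurable_snd).
Qed.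

(** Freezing is applied twice: first with the past of step [n.+1], which contains [A] and [zeta n],
    then with the past of step [n]. *)
Lemma pair_noise_indep n A (B : set (E * E)) : G n A -> measurable B ->
  P (A `&` (fun w => (zeta n w, zeta n.+1 w)) @^-1` B) = P A * prodp gam gam B.
Proof.
move=> GA mB; pose f (z : E * E) : \bar R := (\1_B z)%:E.
have mf : measurable_fun setT f by apply/measurable_EFinP; exact: measurable_indic.
have f0 z : 0 <= f z by rewrite lee_fin.
have mA : measurable A by exact: (iid_sub noise GA).
have mO : measurable (A `&` (fun w => (zeta n w, zeta n.+1 w)) @^-1` B).
  apply: measurableI => //; rewrite -[X in measurable X]setTI.
  have mm : measurable_fun setT (fun w => (zeta n w, zeta n.+1 w)).
    by apply: measurable_fun_pair; exact: (iid_measurable noise).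
  exact: mm.
have sA (k : nat) : (n <= k)%N -> G k A.
  by move=> nk; rewrite -(subnKC nk); elim: (k - n)%N => [|m ih]; rewrite ?addn0// addnS; exact: (iid_incr noise).
have mI (k : nat) : (n <= k)%N ->
    measurable_fun [set: g_sigma_algebraType (G k)] (\1_A : _ -> R).
  by move=> nk; apply: measurable_indic; apply: sub_sigma_algebra; exact: sA.
rewrite -(integral_indicT P mO).
transitivity (\int[P]_w ((\1_A w)%:E * f (zeta n w, zeta n.+1 w))).
  apply: eq_integral => w _; rewrite /f -EFinM !indicE in_setI; congr (_%:E).
  by rewrite -mulnb natrM.
have mYn (k : nat) : mwrt (G k) (fun w : Om => w : g_sigma_algebraType (G k)).
  by apply/(mwrtP _ (iid_sigma noise k)); exact: measurable_id.
rewrite (iid_freezing noise (T := g_sigma_algebraType (G n.+1)) (n := n.+1) (Y := fun w => w)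
  (g := fun z => (\1_A z.1)%:E * f (zeta n z.1, z.2)))//; last 2 first.
- apply: emeasurable_funM; first by apply/measurable_EFinP; exact: (measurableT_comp (mI n.+1 (leqnSn n)) measurable_fst).
  apply: (measurableT_comp mf); apply: measurable_fun_pair; last exact: measurable_snd.
  have /(mwrtP _ (iid_sigma noise n.+1)) mk := iid_meas noise n.
  exact: (measurableT_comp mk measurable_fst).
- by move=> z; rewrite mule_ge0// lee_fin.
pose phi e := \int[gam]_e' f (e, e').
have mphi : measurable_fun setT phi by exact: measurable_integral_r.
have phi0 e : 0 <= phi e by exact: integral_ge0.
transitivity (\int[P]_w ((\1_A w)%:E * phi (zeta n w))).
  apply: eq_integral => w _; rewrite /= ge0_integralZl ?lee_fin//.
  by apply: (measurableT_comp mf); apply: measurable_fun_pair => //.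
rewrite (iid_freezing noise (T := g_sigma_algebraType (G n)) (n := n) (Y := fun w => w)
  (g := fun z => (\1_A z.1)%:E * phi z.2))//; last 2 first.
- apply: emeasurable_funM; first by apply/measurable_EFinP; exact: (measurableT_comp (mI n (leqnn n)) measurable_fst).
  exact: (measurableT_comp mphi measurable_snd).
- by move=> z; rewrite mule_ge0// lee_fin.
have E1 : \int[gam]_e phi e = prodp gam gam B.
  by rewrite -(ge0_integral_prodp gam gam mf f0) /f integral_indicT.
transitivity (\int[P]_w ((\1_A w)%:E * prodp gam gam B)).
  by apply: eq_integral => w _; rewrite /= ge0_integralZl ?lee_fin// E1.
rewrite ge0_integralZr ?measure_ge0//; last by apply/measurable_EFinP; exact: measurable_indic.
by rewrite integral_indicT.
Qed.

Let subs n : G n `<=` G n.+2.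
Proof. by move=> A GA; do 2 apply: (iid_incr noise). Qed.

Lemma pair_noise : iid_noise P (fun n => G n.*2)
  (fun n w => (zeta n.*2 w, zeta n.*2.+1 w)) (prodp gam gam).
Proof.
split=> [n|n|n|n|n A B].
- exact: (iid_sigma noise).
- exact: (iid_sub noise).
- exact: subs.
- apply/(mwrtP _ (iid_sigma noise _)); apply: measurable_fun_pair;
    apply/(mwrtP _ (iid_sigma noise _)); exact: (iid_mwrt noise).
- exact: pair_noise_indep.
Qed.

(** A backward chain meets the later half increment first, hence the reversed pairs; by Tonelli
    their law is the same. *)
Lemma pair_noise_swap : iid_noise P (fun n => G n.*2)
  (fun n w => (zeta n.*2.+1 w, zeta n.*2 w)) (prodp gam gam).
Proof.
split=> [n|n|n|n|n A B GA mB].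
- exact: (iid_sigma noise).
- exact: (iid_sub noise).
- exact: subs.
- apply/(mwrtP _ (iid_sigma noise _)); apply: measurable_fun_pair;
    apply/(mwrtP _ (iid_sigma noise _)); exact: (iid_mwrt noise).
have msw : measurable_fun setT (fun z : E * E => (z.2, z.1)).
  by apply: measurable_fun_pair; [exact: measurable_snd|exact: measurable_fst].
have mB' : measurable ((fun z : E * E => (z.2, z.1)) @^-1` B).
  by rewrite -[X in measurable X]setTI; exact: msw.
rewrite (pair_noise_indep GA mB' (n := n.*2)); congr (_ * _).
have mi (C : set (E * E)) : measurable C -> measurable_fun setT (fun z => (\1_C z)%:E : \bar R).
  by move=> mC; apply/measurable_EFinP; exact: measurable_indic.
rewrite -(integral_indicT (prodp gam gam) mB') -(integral_indicT (prodp gam gam) mB).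
rewrite !(ge0_integral_prodp gam gam)//; try exact: mi.
rewrite (ge0_integral_swap gam gam (f := fun z => (\1_B z)%:E))//; exact: mi.
Qed.

End pair_noise.

(** * Limits of random variables *)

Section vlim.
Context {R : realType} {d : nat}.
Local Notation V := 'rV[R]_d.

(* A measurable stand-in for the limit of a sequence, defined everywhere. *)
Definition vlim (u : nat -> V) : V :=
  \row_i fine (limn_esup (fun n => (u n ord0 i)%:E)).

Lemma measurable_vlim {d' : measure_display} {T : measurableType d'} (u : nat -> T -> V) :
  (forall n, measurable_fun setT (u n)) -> measurable_fun setT (fun x => vlim (u^~ x)).
Proof.
move=> mu; apply: measurable_rV => i; under eq_fun do rewrite mxE.
apply: (measurableT_comp (@fine_measurable R setT measurableT)).
apply: measurable_fun_limn_esup => n; apply/measurable_EFinP; exact: measurable_coord_comp.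
Qed.

Lemma cvg_rowP (u : nat -> V) (l : V) :
  (forall i, u n ord0 i @[n --> \oo] --> l ord0 i) <-> u n @[n --> \oo] --> l.
Proof.
split=> [h|h i]; last exact: (continuous_cvg _ (@continuous_coord _ _ i l) h).
apply/cvg_enormP; apply: (@squeeze_cvgr _ _ _ _ (fun=> 0) (fun n => \sum_i `|(u n - l) ord0 i|)).
- by apply: nearW => n; rewrite enorm_ge0 enorm_le_sum.
- exact: cvg_cst.
have E (r : seq 'I_d) : \sum_(i <- r) `|(u n - l) ord0 i| @[n --> \oo] --> (0 : R).
  elim: r => [|i r ih]; first by (under eq_fun do rewrite big_nil); exact: cvg_cst.
  have t1 : `|(u n - l) ord0 i| @[n --> \oo] --> (0 : R).
    rewrite -(normr0 R); apply: cvg_norm.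
    (under eq_fun do rewrite !mxE); rewrite -(subrr (l ord0 i)); apply: cvgB => //.
    exact: cvg_cst.
  (under eq_fun do rewrite big_cons); rewrite -[X in nbhs X]addr0; exact: cvgD.
exact: E.
Qed.

Lemma vlimE (u : nat -> V) l : u n @[n --> \oo] --> l -> vlim u = l.
Proof.
move=> /cvg_rowP h; apply/rowP => i; rewrite mxE.
have h2 : (u n ord0 i)%:E @[n --> \oo] --> (l ord0 i)%:E by apply: cvg_EFin; [exact: nearW|exact: h].
by have [_ ->] := cvg_limn_einf_sup h2.
Qed.

End vlim.

Lemma cvg_enorm_sqr {R : realType} {d : nat} (u : nat -> 'rV[R]_d) (l : 'rV[R]_d) :
  u n @[n --> \oo] --> l -> enorm (u n) ^+ 2 @[n --> \oo] --> enorm l ^+ 2.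
Proof.
move=> h; have h1 : enorm (u n) @[n --> \oo] --> enorm l.
  exact: (cvg_comp u (@enorm R d) h (continuous_enorm (x := l))).
by rewrite expr2; under eq_fun do rewrite expr2; exact: cvgM.
Qed.

Section fatou.
Context {R : realType} {dO : measure_display} {Om : measurableType dO}.
Variable P : probability Om R.
Local Open Scope ereal_scope.

Lemma fatou_le (f : nat -> Om -> R) (g : Om -> R) (B : \bar R) :
  (forall n, measurable_fun setT (f n)) -> (forall n w, 0 <= f n w)%R ->
  measurable_fun setT g -> (forall w, 0 <= g w)%R ->
  {ae P, forall w, f n w @[n --> \oo] --> g w} ->
  (\forall n \near \oo, \int[P]_w (f n w)%:E <= B) ->
  \int[P]_w (g w)%:E <= B.
Proof.
move=> mf f0 mg g0 fg fB.
have mf' n : measurable_fun setT (fun w => (f n w)%:E) by exact/measurable_EFinP.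
have f0' n w : setT w -> 0 <= (f n w)%:E by rewrite lee_fin.
apply: (@le_trans _ _ (\int[P]_w limn_einf (fun n => (f n w)%:E))).
  rewrite le_eqVlt; apply/orP; left; apply/eqP; apply: ge0_ae_eq_integral => //.
  - exact/measurable_EFinP.
  - rewrite /limn_einf; apply: measurableT_comp; first exact: oppe_measurable.
    by apply: measurable_fun_limn_esup => n; apply: measurableT_comp => //; exact: oppe_measurable.
  - by move=> w _; rewrite lee_fin.
  - move=> w _; rewrite limn_einf_lim; apply: lime_ge; first exact: is_cvg_einfs.
    by apply: nearW => n; apply: le_ereal_inf_tmp => _ /= [m _ <-]; rewrite lee_fin.
  apply: filterS fg => w h _.
  have h2 : (f n w)%:E @[n --> \oo] --> (g w)%:E by apply: cvg_EFin; [exact: nearW|exact: h].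
  by have [-> _] := cvg_limn_einf_sup h2.
apply: (le_trans (fatou P measurableT mf' f0')).
have [N _ fN] := fB.
rewrite limn_einf_lim; apply: lime_le; first exact: is_cvg_einfs.
apply: nearW => n; apply: (@le_trans _ _ (\int[P]_w (f (n + N)%N w)%:E)).
  by apply: ereal_inf_lbound; exists (n + N)%N => //=; exact: leq_addr.
by apply: fN; rewrite /=; exact: leq_addl.
Qed.

End fatou.

(** * Almost sure limits from geometric mean-square increments *)

Section geometric_limit.
Context {R : realType} {d : nat}.
Local Notation V := 'rV[R]_d.

Lemma enormD_sqr_split (s : R) (x y : V) : 0 < s < 1 ->
  enorm (x + y) ^+ 2 <= (1 - s)^-1 * enorm x ^+ 2 + s^-1 * enorm y ^+ 2.
Proof.
move=> /andP[s0 s1]; have t0 : 0 < 1 - s by rewrite subr_gt0.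
have h := sqr_ge0 (enorm (s *: x - (1 - s) *: y)).
have E : enorm (s *: x - (1 - s) *: y) ^+ 2 = s ^+ 2 * enorm x ^+ 2 -
    2 * (s * (1 - s)) * inner x y + (1 - s) ^+ 2 * enorm y ^+ 2.
  rewrite enormD_sqr enormN !enormZ innerZl innerNr innerZr !exprMn !real_normK ?num_real//; ring.
rewrite E in h.
rewrite -subr_ge0 enormD_sqr.
rewrite (_ : _ - _ = (s ^+ 2 * enorm x ^+ 2 - 2 * (s * (1 - s)) * inner x y +
    (1 - s) ^+ 2 * enorm y ^+ 2) / (s * (1 - s))); last by field; rewrite !gt_eqF.
by rewrite divr_ge0// mulr_ge0// ltW.
Qed.

(** Splitting off one increment at a time with the weights [1 - s] and [s] produces factors
    [s^-1 ^+ i], harmless against increments whose squares decay like [s ^+ (2 * i)]. *)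
Lemma telescope_sqr (s : R) (x : nat -> V) n k : 0 < s < 1 ->
  enorm (x (n + k)%N - x n) ^+ 2 <=
  (1 - s)^-1 * \sum_(i < k) s^-1 ^+ i * enorm (x (n + i).+1 - x (n + i)%N) ^+ 2.
Proof.
move=> s01; have /andP[s0 s1] := s01.
elim: k n => [|k ih] n; first by rewrite addn0 subrr enorm0 expr0n/= big_ord0 mulr0.
have -> : x (n + k.+1)%N - x n = (x n.+1 - x n) + (x (n.+1 + k)%N - x n.+1).
  by rewrite addSnnS [RHS]addrC subrKA.
apply: (le_trans (enormD_sqr_split _ _ s01)).
rewrite big_ord_recl expr0 mul1r addn0 mulrDr lerD2l.
have is0 : 0 <= s^-1 by rewrite invr_ge0 ltW.
apply: (le_trans (ler_wpM2l is0 (ih n.+1))); rewrite mulrCA.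
rewrite ler_wpM2l ?invr_ge0 ?subr_ge0 ?(ltW s1)// mulr_sumr; apply: ler_sum => i _.
by rewrite /= mulrA -exprS /bump /= add1n addSnnS.
Qed.

Lemma geometric_sum_le (s : R) k : 0 < s < 1 -> \sum_(i < k) s ^+ i <= (1 - s)^-1.
Proof.
move=> /andP[s0 s1]; have t0 : 0 < 1 - s by rewrite subr_gt0.
rewrite -[leRHS]mul1r ler_pdivlMr// mulrC.
have -> : (1 - s) * \sum_(i < k) s ^+ i = 1 - s ^+ k.
  by rewrite -opprB mulNr -subrX1 opprB.
by rewrite gerBl exprn_ge0// ltW.
Qed.

Lemma cvg_of_geometric (s M : R) (x : nat -> V) : 0 < s < 1 ->
  (forall n, enorm (x n.+1 - x n) ^+ 2 <= M * s ^+ n) -> x n @[n --> \oo] --> vlim x.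
Proof.
move=> s01 xM; have /andP[s0 s1] := s01.
have M0 : 0 <= M by have := xM 0%N; rewrite expr0 mulr1; exact: le_trans (sqr_ge0 _).
suff [l xl] : exists l : V, x n @[n --> \oo] --> l.
  by rewrite (vlimE xl); exact: xl.
have cvg_i i : cvgn (fun n => x n ord0 i).
  pose u n : R := x n.+1 ord0 i - x n ord0 i.
  have su : cvgn (series u).
    apply: normed_cvg.
    apply: (@series_le_cvg _ _ (geometric (Num.sqrt M) (Num.sqrt s))).
    - by move=> n /=.
    - by move=> n /=; rewrite mulr_ge0// ?exprn_ge0 ?sqrtr_ge0.
    - move=> n /=; rewrite -(@ler_pXn2r _ 2)// ?nnegrE ?mulr_ge0 ?exprn_ge0 ?sqrtr_ge0//.
      rewrite exprMn sqr_sqrtr// -exprM mulnC exprM sqr_sqrtr ?(ltW s0)//.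
      apply: le_trans (xM n); apply: lerXn2r; rewrite ?nnegrE//.
      by have := coord_le_enorm (x n.+1 - x n) i; rewrite !mxE.
    - apply: is_cvg_geometric_series; rewrite ger0_norm ?sqrtr_ge0//.
      by rewrite -sqrtr1 ltr_sqrt.
  have -> : (fun n => x n ord0 i) = (fun n => series u n + x 0%N ord0 i).
    by apply/funext => n; rewrite /series /= telescope_sumr// subrK.
  by apply: is_cvgD => //; exact: is_cvg_cst.
exists (\row_i lim ((fun n => x n ord0 i) @ \oo)); apply/cvg_rowP => i.
by rewrite mxE; exact: cvg_i.
Qed.

Context {dO : measure_display} {Om : measurableType dO}.
Variable P : probability Om R.

Lemma integral_telescope (s C : R) (U : nat -> Om -> V) n k : 0 < s < 1 -> 0 <= C ->
  (forall n, measurable_fun setT (U n)) ->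
  (forall n, \int[P]_w (enorm (U n.+1 w - U n w) ^+ 2)%:E <= (C * (s ^+ 2) ^+ n)%:E)%E ->
  (\int[P]_w (enorm (U (n + k)%N w - U n w) ^+ 2)%:E <=
   (C * (1 - s)^-1 ^+ 2 * (s ^+ 2) ^+ n)%:E)%E.
Proof.
move=> s01 C0 mU hU; have /andP[s0 s1] := s01.
have t0 : 0 <= (1 - s)^-1 by rewrite invr_ge0 subr_ge0 ltW.
have r0 i : 0 <= s^-1 ^+ i by rewrite exprn_ge0// invr_ge0 ltW.
have mD j : measurable_fun setT (fun w => enorm (U j.+1 w - U j w) ^+ 2).
  by apply: measurable_funX; apply: measurable_enorm_comp; exact: measurable_rVB.
apply: (@le_trans _ _ (\int[P]_w ((1 - s)^-1 *
    \sum_(i < k) s^-1 ^+ i * enorm (U (n + i).+1 w - U (n + i)%N w) ^+ 2)%:E)%E).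
  by apply: ge0_le_integralT => w; rewrite lee_fin ?sqr_ge0//; exact: (telescope_sqr (U^~ w)).
rewrite (_ : C * _ * _ = (1 - s)^-1 * (C * (1 - s)^-1 * (s ^+ 2) ^+ n)); last by ring.
apply: ge0_integralZ_le => //.
- by apply: measurable_sum => i; exact: measurable_funM.
- by move=> w; apply: sumr_ge0 => i _; rewrite mulr_ge0 ?sqr_ge0.
under eq_integral do rewrite -sumEFin.
rewrite ge0_integral_sum//; last 2 first.
- by move=> i; apply/measurable_EFinP; exact: measurable_funM.
- by move=> i w _; rewrite lee_fin mulr_ge0 ?sqr_ge0.
apply: (@le_trans _ _ (\sum_(i < k) (C * (s ^+ 2) ^+ n * s ^+ i)%:E)%E).
  apply: lee_sum => i _.
  rewrite (_ : C * _ * _ = s^-1 ^+ i * (C * (s ^+ 2) ^+ (n + i))).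
    by apply: ge0_integralZ_le => // w; exact: sqr_ge0.
  rewrite exprD -[(s ^+ 2) ^+ i]exprM mulnC exprM exprVn expr2.
  by field; rewrite expf_neq0// gt_eqF.
rewrite sumEFin lee_fin -mulr_sumr.
by rewrite [leRHS]mulrAC ler_wpM2l ?geometric_sum_le// mulr_ge0// exprn_ge0// sqr_ge0.
Qed.

(** The series of squared increments weighted by [s^-1 ^+ n] has finite mean, hence is finite almost
    everywhere, and its value [M] bounds each squared increment by [M * s ^+ n]: paths converge
    geometrically. Fatou carries the mean-square bound to the limit. *)
Lemma cvg_sqr (s C : R) (U : nat -> Om -> V) : 0 < s < 1 -> 0 <= C ->
  (forall n, measurable_fun setT (U n)) ->
  (forall n, \int[P]_w (enorm (U n.+1 w - U n w) ^+ 2)%:E <= (C * (s ^+ 2) ^+ n)%:E)%E ->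
  {ae P, forall w, U n w @[n --> \oo] --> vlim (U^~ w)} /\
  forall n, (\int[P]_w (enorm (vlim (U^~ w) - U n w) ^+ 2)%:E <=
    (C * (1 - s)^-1 ^+ 2 * (s ^+ 2) ^+ n)%:E)%E.
Proof.
move=> s01 C0 mU hU; have /andP[s0 s1] := s01.
have r0 i : 0 <= s^-1 ^+ i by rewrite exprn_ge0// invr_ge0 ltW.
have mD j : measurable_fun setT (fun w => enorm (U j.+1 w - U j w) ^+ 2).
  by apply: measurable_funX; apply: measurable_enorm_comp; exact: measurable_rVB.
pose T n w : \bar R := (s^-1 ^+ n * enorm (U n.+1 w - U n w) ^+ 2)%:E.
have T0 n w : (0 <= T n w)%E by rewrite lee_fin mulr_ge0 ?sqr_ge0.
have mT n : measurable_fun setT (T n) by apply/measurable_EFinP; exact: measurable_funM.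
have iT n : (\int[P]_w T n w <= (C * s ^+ n)%:E)%E.
  rewrite (_ : C * _ = s^-1 ^+ n * (C * (s ^+ 2) ^+ n)).
    by apply: ge0_integralZ_le => // w; exact: sqr_ge0.
  by rewrite exprVn -exprM mulnC exprM expr2; field; rewrite expf_neq0// gt_eqF.
pose S w : \bar R := (\sum_(n <oo) T n w)%E.
have mS : measurable_fun setT S by apply: ge0_emeasurable_sum.
have S0 w : (0 <= S w)%E by apply: nneseries_ge0.
have iS : (\int[P]_w S w < +oo)%E.
  rewrite /S integral_nneseries//; apply: (@le_lt_trans _ _ (C * (1 - s)^-1)%:E); last exact: ltry.
  apply: lime_le; first by apply: is_cvg_nneseries => n _ _; exact: integral_ge0.
  apply: nearW => N; rewrite big_mkord.
  apply: (@le_trans _ _ (\sum_(i < N) (C * s ^+ i)%:E)%E); first by apply: lee_sum => i _; exact: iT.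
  by rewrite sumEFin lee_fin -mulr_sumr ler_wpM2l// geometric_sum_le.
have ae_cvg : {ae P, forall w, U n w @[n --> \oo] --> vlim (U^~ w)}.
  have SI : P.-integrable setT S.
    by apply/integrableP; split=> //; under eq_integral do rewrite gee0_abs//.
  have := integrable_ae measurableT SI.
  apply: filterS => w /(_ I) Sfin; apply: (@cvg_of_geometric s (fine (S w))) => // n.
  have h : (T n w <= (fine (S w))%:E)%E.
    rewrite fineK//.
    apply: (@le_trans _ _ (\sum_(0 <= i < n.+1) T i w)%E); last exact: nneseries_lim_ge.
    by rewrite big_nat_recr//= leeDr// sume_ge0.
  by move: h; rewrite lee_fin exprVn mulrC ler_pdivrMr ?exprn_gt0.
split=> // n.
apply: (@fatou_le _ _ _ P (fun k w => enorm (U (n + k)%N w - U n w) ^+ 2)) => //.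
- by move=> k; apply: measurable_funX; apply: measurable_enorm_comp; exact: measurable_rVB.
- by move=> k w; exact: sqr_ge0.
- apply: measurable_funX; apply: measurable_enorm_comp; apply: measurable_rVB => //.
  exact: measurable_vlim.
- by move=> w; exact: sqr_ge0.
- apply: filterS ae_cvg => w h.
  apply: (@cvg_enorm_sqr _ _ (fun k => U (n + k)%N w - U n w)).
  apply: cvgB; last exact: cvg_cst.
  have -> : (fun k => U (n + k)%N w) = (fun k => U (k + n)%N w).
    by apply/funext => k; rewrite addnC.
  by rewrite (cvg_shiftn n (fun k => U k w)).
- by apply: nearW => k; exact: integral_telescope.
Qed.

End geometric_limit.

(** * Backward chains of different lengths *)

Section backward_blocks.
Context {R : realType} {d0 d1 d2 : measure_display}.
Context {Om : measurableType d0} {S : measurableType d1} {E : measurableType d2}.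
Variables (P : probability Om R) (G : nat -> set (set Om)).
Variables (zeta : nat -> Om -> E) (gam : probability E R) (psi : S * E -> S).
Local Open Scope ereal_scope.

Lemma iter_Pop_le (f g : S -> \bar R) n s : (forall s, 0 <= f s) -> (forall s, f s <= g s) ->
  iter n (Pop gam psi) f s <= iter n (Pop gam psi) g s.
Proof.
move=> f0 fg; elim: n s => [|n ih] s //=.
have h0 s' : 0 <= iter n (Pop gam psi) f s'.
  by elim: n s' {ih} => [|n ih'] s' //=; exact: Pop_ge0.
by apply: ge0_le_integralT => e.
Qed.

Hypothesis noise : iid_noise P G zeta gam.
Hypothesis mpsi : measurable_fun setT psi.

(** The chains of [m + n] and of [n] backward steps share the [n] oldest noises. The [m] newest act
    first and only randomise the starting point; integrating them out applies [Pop] that many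
    times. *)
Lemma bwd_block (k : S * S -> \bar R) m n x y : measurable_fun setT k -> (forall z, 0 <= k z) ->
  \int[P]_w k (bwd zeta psi (m + n) x w, bwd zeta psi n y w) =
  iter m (Pop gam psi) (fun x' => \int[P]_w k (bwd zeta psi n x' w, bwd zeta psi n y w)) x.
Proof.
move=> mk k0; elim: m x => [|m ih] x //=.
have mz d3 (Om' : measurableType d3) (iota : Om' -> Om) :
    (forall j, (j < m + n)%N -> measurable_fun setT (zeta j \o iota)) ->
    measurable_fun setT (fun z : Om' * E => k (bwd zeta psi (m + n) (psi (x, z.2)) (iota z.1),
      bwd zeta psi n y (iota z.1))).
  move=> mi; apply: (measurableT_comp mk); apply: measurable_fun_pair.
    apply: (measurable_bwd mpsi (iota := fun z : Om' * E => iota z.1)) => [|j jn].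
      apply: (measurableT_comp mpsi); apply: measurable_fun_pair; first exact: measurable_cst.
      exact: measurable_snd.
    exact: (measurableT_comp (mi j jn) measurable_fst).
  apply: (measurable_bwd mpsi (iota := fun z : Om' * E => iota z.1) (Y := fun=> y)) => [|j jn].
    exact: measurable_cst.
  exact: (measurableT_comp (mi j (leq_trans jn (leq_addl _ _))) measurable_fst).
rewrite (iid_freezing noise (T := g_sigma_algebraType (G (m + n))) (n := (m + n)%N) (Y := fun w => w)
   (g := fun z => k (bwd zeta psi (m + n) (psi (x, z.2)) z.1, bwd zeta psi n y z.1)))//; first last.
- apply: (mz _ (g_sigma_algebraType (G (m + n))) (fun w => w)) => j jn.
  by have /(mwrtP _ (iid_sigma noise (m + n))) := iid_mwrt noise jn.
- by apply/(mwrtP _ (iid_sigma noise (m + n))); exact: measurable_id.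
rewrite (ge0_integral_swap P gam (f := fun z : Om * E => k (bwd zeta psi (m + n) (psi (x, z.2)) z.1,
   bwd zeta psi n y z.1)))//.
  by apply: eq_integral => e _; rewrite -ih.
by apply: (mz _ Om (fun w => w)) => j jn; exact: (iid_measurable noise).
Qed.

Lemma measurable_fwd_joint n : measurable_fun setT (fun z : S * Om => fwd zeta psi z.1 n z.2).
Proof.
elim: n => [|n ih] /=; first exact: measurable_fst.
apply: (measurableT_comp mpsi); apply: measurable_fun_pair => //.
by apply: measurableT_comp; [exact: (iid_measurable noise)|exact: measurable_snd].
Qed.

End backward_blocks.

Lemma cvg_scale {R : realType} (k : R) (c : nat -> R) (l : R) :
  c n @[n --> \oo] --> l -> k * c n @[n --> \oo] --> k * l.
Proof. by move=> h; apply: cvgM => //; exact: cvg_cst. Qed.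

(** * Expectations of bounded Lipschitz functions *)

Section means.
Context {R : realType}.

Definition mean {dO : measure_display} {Om : measurableType dO} (P : probability Om R)
  (f : Om -> R) : R := fine (\int[P]_w (f w)%:E)%E.

Section unit_mean.
Context {dO : measure_display} {Om : measurableType dO}.
Variable P : probability Om R.

Lemma meanE (f : Om -> R) : (forall w, 0 <= f w <= 1) ->
  (\int[P]_w (f w)%:E)%E = (mean P f)%:E.
Proof.
move=> f01; rewrite /mean fineK// ge0_fin_numE; last first.
  by apply: integral_ge0 => w _; rewrite lee_fin; have /andP[] := f01 w.
apply: (@le_lt_trans _ _ (\int[P]_w (1%:E : \bar R))%E); last by rewrite integral_cst_prob ltry.
by apply: ge0_le_integralT => w; rewrite lee_fin; have /andP[] := f01 w.
Qed.

Lemma mean01 (f : Om -> R) : (forall w, 0 <= f w <= 1) -> 0 <= mean P f <= 1.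
Proof.
move=> f01; rewrite -!lee_fin -meanE//; apply/andP; split.
  by apply: integral_ge0 => w _; rewrite lee_fin; have /andP[] := f01 w.
rewrite -[leRHS](integral_cst_prob P).
by apply: ge0_le_integralT => w; rewrite lee_fin; have /andP[] := f01 w.
Qed.

Lemma cvg_mean (f : nat -> Om -> R) (h : Om -> R) :
  (forall n, measurable_fun setT (f n)) -> measurable_fun setT h ->
  (forall n w, 0 <= f n w <= 1) -> (forall w, 0 <= h w <= 1) ->
  {ae P, forall w, f n w @[n --> \oo] --> h w} ->
  mean P (f n) @[n --> \oo] --> mean P h.
Proof.
move=> mf mh f01 h01 fh.
have [] := @dominated_convergence _ _ _ P setT measurableT (fun n w => (f n w)%:E)
  (fun w => (h w)%:E) (fun=> 1%:E).
- by move=> n; apply/measurable_EFinP.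
- exact/measurable_EFinP.
- by apply: filterS fh => w hw _; apply: cvg_EFin; [exact: nearW|exact: hw].
- exact: finite_measure_integrable_cst.
- apply/aeW => w n _; rewrite lee_fin ger0_norm; have /andP[] := f01 n w => //.
move=> _ _; rewrite (meanE h01); under eq_fun do rewrite (meanE (f01 _)).
by move=> /fine_cvg.
Qed.

Context {d : nat}.
Local Notation V := 'rV[R]_d.

(** Young's inequality [L * u <= s + L ^+ 2 / (4 * s) * u ^+ 2] under the integral, which avoids
    square roots of integrals; [s] stays free. *)
Lemma mean_diff (A B : Om -> V) (g : V -> R) (L s c : R) :
  measurable_fun setT A -> measurable_fun setT B ->
  (forall x, 0 <= g x <= 1) -> 0 <= L -> (forall x y, `|g x - g y| <= L * enorm (x - y)) ->
  0 < s -> (\int[P]_w (enorm (A w - B w) ^+ 2)%:E <= c%:E)%E ->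
  `|mean P (g \o A) - mean P (g \o B)| <= s + L ^+ 2 / (4 * s) * c.
Proof.
move=> mA mB g01 L0 gL s0.
have mg : measurable_fun setT g := lipschitz_measurable gL.
suff one (A' B' : Om -> V) : measurable_fun setT A' -> measurable_fun setT B' ->
    (\int[P]_w (enorm (A' w - B' w) ^+ 2)%:E <= c%:E)%E ->
    mean P (g \o A') <= mean P (g \o B') + (s + L ^+ 2 / (4 * s) * c).
  move=> h; have h1 := one A B mA mB h.
  have h2 : mean P (g \o B) <= mean P (g \o A) + (s + L ^+ 2 / (4 * s) * c).
    by apply: one => //; rewrite (eq_integral (fun w => (enorm (A w - B w) ^+ 2)%:E))// => w _; rewrite enormB.
  by move: h1 h2; rewrite ler_norml; clear => h1 h2; apply/andP; split; lra.
move=> {}mA {}mB h.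
have k0 : 0 <= L ^+ 2 / (4 * s) by rewrite divr_ge0 ?sqr_ge0// mulr_ge0// ltW.
have md : measurable_fun setT (fun w => enorm (A' w - B' w) ^+ 2).
  by apply: measurable_funX; apply: measurable_enorm_comp; exact: measurable_rVB.
rewrite -lee_fin EFinD -!meanE; [|by move=> w; exact: g01|by move=> w; exact: g01].
apply: (@le_trans _ _ (\int[P]_w (1 * g (B' w) +
    1 * (s * 1 + L ^+ 2 / (4 * s) * enorm (A' w - B' w) ^+ 2))%:E)%E).
  apply: ge0_le_integralT => w; first by rewrite lee_fin; have /andP[] := g01 (A' w).
  rewrite lee_fin !mul1r mulr1.
  have h1 : g (A' w) - g (B' w) <= L * enorm (A' w - B' w) by exact: le_trans (ler_norm _) (gL _ _).
  set u := enorm _ in h1 *.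
  have h2 : 0 <= (L * u - 2 * s) ^+ 2 / (4 * s) by rewrite divr_ge0 ?sqr_ge0// mulr_ge0// ltW.
  have h3 : (L * u - 2 * s) ^+ 2 / (4 * s) = L ^+ 2 / (4 * s) * u ^+ 2 - L * u + s.
    by field; rewrite gt_eqF.
  by move: h1 h2; rewrite h3 /=; clear; lra.
rewrite ge0_integralZDl//; first last.
- by apply: measurable_funD => //; exact: measurable_funM.
- exact: measurableT_comp.
- by move=> w; rewrite mulr1 addr_ge0 ?(ltW s0)// mulr_ge0 ?sqr_ge0.
- by move=> w; have /andP[] := g01 (B' w).
rewrite !mul1e leeD2l//.
rewrite (@ge0_integralZDl _ _ _ P (fun=> 1))//; first last.
- exact: ltW.
- by move=> w; exact: sqr_ge0.
rewrite integral_cst_prob mule1 EFinD leeD2l// [leRHS]EFinM lee_wpmul2l ?lee_fin//.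
Qed.

Lemma cvg_mean_diff (A B : nat -> Om -> V) (g : V -> R) (c : nat -> R) :
  (forall n, measurable_fun setT (A n)) -> (forall n, measurable_fun setT (B n)) ->
  blip g -> (forall n, (\int[P]_w (enorm (A n w - B n w) ^+ 2)%:E <= (c n)%:E)%E) ->
  c n @[n --> \oo] --> (0 : R) ->
  mean P (g \o A n) - mean P (g \o B n) @[n --> \oo] --> (0 : R).
Proof.
move=> mA mB [g01 [L L0 gL]] hc c0; apply/cvgrPdist_le => e e0.
have e20 : 0 < e / 2 by rewrite divr_gt0.
have k0 : 0 <= L ^+ 2 / (4 * (e / 2)) by rewrite divr_ge0 ?sqr_ge0// mulr_ge0// ltW.
have : L ^+ 2 / (4 * (e / 2)) * c n @[n --> \oo] --> (0 : R).
  have := cvg_scale (k := L ^+ 2 / (4 * (e / 2))) c0; rewrite mulr0; exact.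
move=> /cvgrPdist_le /(_ _ e20); apply: filterS => n; rewrite !sub0r !normrN => hn.
apply: (le_trans (mean_diff (mA n) (mB n) g01 L0 gL e20 (hc n))).
rewrite [leRHS](splitr e) lerD2l; exact: le_trans (ler_norm _) hn.
Qed.

End unit_mean.

Context {d : nat}.
Local Notation V := 'rV[R]_d.

Lemma blip_continuous (g : V -> R) (u : nat -> V) l : blip g ->
  u n @[n --> \oo] --> l -> g (u n) @[n --> \oo] --> g l.
Proof.
move=> [_ [L L0 gL]] /cvg_enormP ul; apply/cvgrPdist_le => e e0.
have L1 : 0 < L + 1 by rewrite ltr_wpDl.
have eL : 0 < e / (L + 1) by rewrite divr_gt0.
move/cvgrPdist_le : ul => /(_ _ eL); apply: filterS => n.
rewrite sub0r normrN ger0_norm// ler_pdivlMr// => h.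
rewrite distrC (le_trans (gL _ _))// (le_trans _ h)// mulrC.
by rewrite mulrDr mulr1 lerDl.
Qed.

(** The choice [s = enorm (x - y)] in [mean_diff] turns the mean-square Lipschitz bound into an
    ordinary one. *)
Lemma blip_mean {dO : measure_display} {Om : measurableType dO} (P : probability Om R)
    (A : V -> Om -> V) (c : R) (g : V -> R) :
  (forall x, measurable_fun setT (A x)) -> 0 <= c ->
  (forall x y, (\int[P]_w (enorm (A x w - A y w) ^+ 2)%:E <= (c * enorm (x - y) ^+ 2)%:E)%E) ->
  blip g -> blip (fun x => mean P (g \o A x)).
Proof.
move=> mA c0 hA [g01 [L L0 gL]]; split=> [x|]; first by apply: mean01 => w; exact: g01.
exists (1 + L ^+ 2 / 4 * c) => [|x y].
  by rewrite addr_ge0// mulr_ge0// divr_ge0// sqr_ge0.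
have [->|xy] := eqVneq x y; first by rewrite !subrr enorm0 normr0 mulr0.
have e0 : 0 < enorm (x - y).
  rewrite lt_neqAle enorm_ge0 andbT eq_sym; apply: contra xy => /eqP/enorm_eq0/eqP.
  by rewrite subr_eq0.
apply: (le_trans (mean_diff (mA x) (mA y) g01 L0 gL e0 (hA x y))).
rewrite le_eqVlt; apply/orP; left; apply/eqP; field; rewrite gt_eqF//.
Qed.

(** If [T n g] forgets its argument, then [T n g 0] tends to the mean of [g] under every invariant
    law, and a limit is unique. *)
Lemma invariant_unique (p1 p2 : probability V R) (T : nat -> (V -> R) -> V -> R) :
  (forall g n, blip g -> blip (T n g)) ->
  (forall g n, blip g -> mean p1 (T n g) = mean p1 g) ->
  (forall g n, blip g -> mean p2 (T n g) = mean p2 g) ->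
  (forall g x, blip g -> T n g x - T n g 0 @[n --> \oo] --> (0 : R)) ->
  forall A, measurable A -> p1 A = p2 A.
Proof.
move=> bT i1 i2 Tx; apply: probability_eq_blip => g bg; have [g01 _] := bg.
rewrite (meanE p1 g01) (meanE p2 g01); congr (_%:E).
have key (p : probability V R) : (forall n, mean p (T n g) = mean p g) ->
    T n g 0 @[n --> \oo] --> mean p g.
  move=> ip; have T01 n x : 0 <= T n g x <= 1 by have [+ _] := bT g n bg; apply.
  have mT n : measurable_fun setT (T n g) by exact: blip_measurable (bT g n bg).
  (* Shifted and halved to stay in the unit interval, where bounded convergence is available as
     [cvg_mean]. *)
  have f01 n x : 0 <= (T n g x - T n g 0 + 1) / 2 <= 1.
    by have := T01 n x; have := T01 n 0; lra.
  have h : mean p (fun x => (T n g x - T n g 0 + 1) / 2) @[n --> \oo] --> mean p (fun=> 1 / 2).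
    apply: cvg_mean => //.
    - move=> n; apply: measurable_funM => //; apply: measurable_funD => //.
      by apply: measurable_funB.
    - by move=> w; lra.
    - apply: aeW => x.
      have h1 : (T n g x - T n g 0 + 1) / 2 @[n --> \oo] --> ((0 + 1) / 2 : R).
        by apply: cvgM; [apply: cvgD; [exact: Tx|exact: cvg_cst]|exact: cvg_cst].
      by rewrite add0r in h1.
  have E n : mean p (fun x => (T n g x - T n g 0 + 1) / 2) = (mean p g - T n g 0 + 1) / 2.
    have a0 : 0 <= (1 - T n g 0) / 2 by have := T01 n 0; lra.
    transitivity (mean p (fun x => 1 / 2 * T n g x + (1 - T n g 0) / 2 * 1)).
      by congr (mean p _); apply/funext => x; field.
    rewrite /mean.
    rewrite (@ge0_integralZDl _ _ _ p (T n g) (fun=> 1))//; last by move=> x; have /andP[] := T01 n x.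
    by rewrite -/(mean p g) integral_cst_prob (meanE p (T01 n)) ip -!EFinM -EFinD /=; field.
  have E2 : (fun n => mean p (fun x => (T n g x - T n g 0 + 1) / 2)) =
    (fun n => (mean p g - T n g 0 + 1) / 2) by apply/funext.
  have E3 : mean p (fun=> 1 / 2) = 1 / 2 by rewrite /mean integral_cst_prob.
  rewrite E2 E3 in h.
  have h2 : 1 + mean p g - 2 * ((mean p g - T n g 0 + 1) / 2) @[n --> \oo] --> 1 + mean p g - 2 * (1 / 2).
    by apply: cvgB; [exact: cvg_cst|exact: cvg_scale].
  have -> : (fun n => T n g 0) = (fun n => 1 + mean p g - 2 * ((mean p g - T n g 0 + 1) / 2)).
    by apply/funext => n; field.
  by rewrite (_ : 1 + _ - _ = mean p g) in h2; last field.
exact: cvg_unique (key p1 (fun n => i1 g n bg)) (key p2 (fun n => i2 g n bg)).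
Qed.

End means.

(** * Refining the step along one Brownian path *)

Section chain_estimates.
Context {R : realType} {d : nat}.
Local Notation V := 'rV[R]_d.
Context {sigma D lam gam C K rho B Wm Lw Ce : R} {ke : nat} {quad : bool}.
Context {b : V -> V} {A : V -> 'M[R]_d} {W : V -> R} {mn : R -> V -> V}.
Hypothesis cm : chain_model sigma D lam gam C K rho B Wm Lw Ce ke quad b A W mn.
Context {dO : measure_display} {Om : measurableType dO}.
Context {P : probability Om R} {filt : R -> nat -> set (set Om)}.
Context {zeta : R -> nat -> Om -> V} {nu : R -> probability V R}.
Hypothesis ns : noise_system P filt zeta nu.

Local Notation stp := (@step R d sigma mn).
Local Notation fine2 := (@half_step R d sigma mn).
Local Notation X dl := (fwd (zeta dl) (stp dl)).
Local Notation Y dl := (bwd (zeta dl) (stp dl)).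

Definition sqdist (s : V * V) : \bar R := (enorm (s.1 - s.2) ^+ 2)%:E.

Lemma sqdist_ge0 s : (0 <= sqdist s)%E.
Proof. by rewrite lee_fin sqr_ge0. Qed.

Lemma measurable_enorm_sub : measurable_fun setT (fun s : V * V => enorm (s.1 - s.2) ^+ 2).
Proof.
apply: measurable_funX; apply: measurable_enorm_comp.
by apply: measurable_rVB; [exact: measurable_fst|exact: measurable_snd].
Qed.

Lemma measurable_sqdist : measurable_fun setT sqdist.
Proof. apply/measurable_EFinP; exact: measurable_enorm_sub. Qed.

Lemma dom_half dl : 0 < dl <= D -> 0 < dl / 2 <= D.
Proof. by move=> /andP[d0 d1]; apply/andP; split; lra. Qed.

Lemma dom_gt0 dl : 0 < dl <= D -> 0 < dl.
Proof. by case/andP. Qed.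

Lemma Wm_ge1 : 1 <= Wm.
Proof. exact: le_trans (cm_W1 cm 0) (cm_Wm cm 0). Qed.

Lemma W_ge0 z : 0 <= W z.
Proof. exact: le_trans ler01 (cm_W1 cm z). Qed.

Lemma noise_sum dl (f : V -> \bar R) : 0 < dl -> measurable_fun setT f -> (forall z, 0 <= f z)%E ->
  (\int[prodp (nu (dl / 2)) (nu (dl / 2))]_e f (e.1 + e.2)%R = \int[nu dl]_z f z)%E.
Proof.
move=> d0 mf f0; have h0 : 0 < dl / 2 by rewrite divr_gt0.
rewrite -(iid_law (ns_noise ns d0) 0 mf f0).
under [RHS]eq_integral do rewrite (ns_half ns 0 _ d0).
rewrite -(iid_law (pair_noise (ns_noise ns h0)) 0 (f := fun e => f (e.1 + e.2)))//.
apply: (measurableT_comp mf); apply: measurable_rVD; [exact: measurable_fst|exact: measurable_snd].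
Qed.

Section contraction.
Variable dl : R.
Hypothesis hd : 0 < dl <= D.

Definition pair_step (z : (V * V) * V) : V * V := (stp dl (z.1.1, z.2), stp dl (z.1.2, z.2)).

Lemma measurable_pair_step : measurable_fun setT pair_step.
Proof.
apply: measurable_fun_pair; apply: (measurableT_comp (measurable_step cm hd));
  apply: measurable_fun_pair; try exact: measurable_snd.
  exact: (measurableT_comp measurable_fst measurable_fst).
exact: (measurableT_comp measurable_snd measurable_fst).
Qed.

Lemma fwd_pair x y n w : fwd (zeta dl) pair_step (x, y) n w = (X dl x n w, X dl y n w).
Proof. by elim: n => //= n ->. Qed.

Lemma bwd_pair x y n w : bwd (zeta dl) pair_step n (x, y) w = (Y dl n x w, Y dl n y w).
Proof. by elim: n x y => //= n ih x y; rewrite ih. Qed.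

Let d0 : 0 < dl := dom_gt0 hd.

(** Stated for [iter n Pop], it serves the forward and the backward chain alike. The weight lies
    between 1 and [Wm], whence the constant [Wm]. *)
Lemma pop_contract n x y : (iter n (Pop (nu dl) pair_step) sqdist (x, y) <=
  (Wm * expR (- lam * (n%:R * dl)) * enorm (x - y) ^+ 2)%:E)%E.
Proof.
have l0 := cm_lam cm; have noise := ns_noise ns d0.
have ld1 : lam * dl <= 1.
  rewrite (le_trans _ (cm_lamD cm))// ler_pM2l//; by have /andP[] := hd.
pose k (s : V * V) := W s.1 * enorm (s.1 - s.2) ^+ 2.
have k0 s : 0 <= k s by rewrite mulr_ge0 ?sqr_ge0 ?W_ge0.
have mk : measurable_fun setT k.
  apply: measurable_funM; last exact: measurable_enorm_sub.
  exact: (measurableT_comp (lipschitz_measurable (cm_WL cm)) measurable_fst).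
have mS m := measurable_fwd noise measurable_pair_step (x, y) m.
have step1 s : (\int[nu dl]_e (k (pair_step (s, e)))%:E <= (((1 - lam * dl) * k s))%:E)%E.
  have := cm_contract cm hd (ns_gauss ns d0) s.1 s.2; apply: le_trans.
  rewrite -ge0_integralZr ?lee_fin ?sqr_ge0//; last 2 first.
  - apply/measurable_EFinP; apply: (measurableT_comp (lipschitz_measurable (cm_WL cm))).
    apply: measurable_rVD; first exact: measurable_cst.
    by apply: measurable_rVZ; [exact: measurable_cst|exact: measurable_id].
  - by move=> z _; rewrite lee_fin W_ge0.
  apply: ge0_le_integralT => e; first by rewrite lee_fin.
  by rewrite -EFinM lee_fin /k /pair_step /step /= opprD addrACA subrr addr0.
have E n' : (\int[P]_w (k (fwd (zeta dl) pair_step (x, y) n' w))%:E <=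
    ((1 - lam * dl) ^+ n' * k (x, y))%:E)%E.
  elim: n' => [|n' ih]; first by rewrite /= integral_cst_prob expr0 mul1r.
  apply: (le_trans (fwd_step_le noise measurable_pair_step _ _ mk k0 step1)).
  rewrite exprS -mulrA; apply: ge0_integralZ_le => //; first by rewrite subr_ge0.
  exact: (measurableT_comp mk (mS n')).
rewrite -(integral_fwd noise measurable_pair_step (x, y) n measurable_sqdist sqdist_ge0).
apply: (@le_trans _ _ (\int[P]_w (k (fwd (zeta dl) pair_step (x, y) n w))%:E)%E).
  apply: ge0_le_integralT => w; rewrite ?sqdist_ge0// /sqdist lee_fin /k.
  by rewrite ler_peMl ?sqr_ge0// (cm_W1 cm).
apply: (le_trans (E n)); rewrite lee_fin /k /= mulrA ler_wpM2r ?sqr_ge0//.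
rewrite mulrC; apply: ler_pM; rewrite ?W_ge0 ?exprn_ge0 ?subr_ge0//; first exact: (cm_Wm cm).
rewrite (_ : - lam * (n%:R * dl) = (- (lam * dl)) * n%:R); last by ring.
rewrite expRM_natr; apply: lerXn2r; rewrite ?nnegrE ?subr_ge0 ?expR_ge0//.
by have := expR_ge1Dx (- (lam * dl)).
Qed.

Lemma fwd_contract n x y : (\int[P]_w (enorm (X dl x n w - X dl y n w) ^+ 2)%:E <=
  (Wm * expR (- lam * (n%:R * dl)) * enorm (x - y) ^+ 2)%:E)%E.
Proof.
apply: le_trans (pop_contract n x y).
rewrite -(integral_fwd (ns_noise ns d0) measurable_pair_step (x, y) n measurable_sqdist sqdist_ge0).
by under [leRHS]eq_integral do rewrite fwd_pair.
Qed.

Lemma bwd_contract n x y : (\int[P]_w (enorm (Y dl n x w - Y dl n y w) ^+ 2)%:E <=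
  (Wm * expR (- lam * (n%:R * dl)) * enorm (x - y) ^+ 2)%:E)%E.
Proof.
apply: le_trans (pop_contract n x y).
rewrite -(integral_bwd (ns_noise ns d0) measurable_pair_step (x, y) n measurable_sqdist sqdist_ge0).
by under [leRHS]eq_integral do rewrite bwd_pair.
Qed.

End contraction.

Lemma uniform_moment p : exists Cm : R, 1 <= Cm /\ forall dl n x, 0 < dl <= D ->
  (\int[P]_w ((1 + enorm (X dl x n w)) ^+ p)%:E <= (Cm * (1 + enorm x) ^+ p)%:E)%E /\
  (\int[P]_w ((1 + enorm (Y dl n x w)) ^+ p)%:E <= (Cm * (1 + enorm x) ^+ p)%:E)%E.
Proof.
have [Cm hC] : exists Cm : R, forall dl n x, 0 < dl <= D ->
    (\int[P]_w ((1 + enorm (X dl x n w)) ^+ p)%:E <= (Cm * (1 + enorm x) ^+ p)%:E)%E.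
  eexists => dl n x hd.
  exact: (chain_moment cm hd (ns_noise ns (dom_gt0 hd)) (ns_gauss ns (dom_gt0 hd))).
exists (Num.max 1 Cm); split=> [|dl n x hd]; first by rewrite le_max lexx.
have h : (\int[P]_w ((1 + enorm (X dl x n w)) ^+ p)%:E <= (Num.max 1 Cm * (1 + enorm x) ^+ p)%:E)%E.
  apply: (le_trans (hC _ _ _ hd)); rewrite lee_fin ler_wpM2r ?exprn_ge0 ?addr_ge0//.
  by rewrite le_max lexx orbT.
split=> //; apply: le_trans h.
pose g (x : V) := ((1 + enorm x) ^+ p)%:E : \bar R.
have mg : measurable_fun setT g.
  apply/measurable_EFinP; apply: measurable_funX; apply: measurable_funD => //.
  exact: measurable_enorm.
have g0 z : (0 <= g z)%E by rewrite lee_fin exprn_ge0// addr_ge0.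
have mst := measurable_step cm hd; have noise := ns_noise ns (dom_gt0 hd).
by rewrite (integral_bwd noise mst x n mg g0) (integral_fwd noise mst x n mg g0).
Qed.

Section halving.
Variable dl : R.
Hypothesis hd : 0 < dl <= D.

Definition pair_half (z : (V * V) * (V * V)) : V * V :=
  (stp dl (z.1.1, z.2.1 + z.2.2), fine2 dl (z.1.2, z.2)).

Lemma measurable_pair_half : measurable_fun setT pair_half.
Proof.
have m1 : measurable_fun setT (fun z : (V * V) * (V * V) => z.1.1).
  exact: (measurableT_comp measurable_fst measurable_fst).
have m2 : measurable_fun setT (fun z : (V * V) * (V * V) => z.1.2).
  exact: (measurableT_comp measurable_snd measurable_fst).
have m3 : measurable_fun setT (fun z : (V * V) * (V * V) => z.2.1).
  exact: (measurableT_comp measurable_fst measurable_snd).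
have m4 : measurable_fun setT (fun z : (V * V) * (V * V) => z.2.2).
  exact: (measurableT_comp measurable_snd measurable_snd).
have mh := measurable_step cm (dom_half hd).
apply: measurable_fun_pair.
  by apply: (measurableT_comp (measurable_step cm hd)); apply: measurable_fun_pair => //; exact: measurable_rVD.
apply: (measurableT_comp mh); apply: measurable_fun_pair => //.
by apply: (measurableT_comp mh); apply: measurable_fun_pair.
Qed.

Let d0 : 0 < dl := dom_gt0 hd.

Lemma fwd_pair_half x y n w :
  fwd (fun n w => (zeta (dl / 2) n.*2 w, zeta (dl / 2) n.*2.+1 w)) pair_half (x, y) n w =
  (X dl x n w, X (dl / 2) y n.*2 w).
Proof.
elim: n => //= n ->; congr pair.
by rewrite (ns_half ns n w d0).
Qed.

Lemma bwd_pair_half x y n w :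
  bwd (fun n w => (zeta (dl / 2) n.*2.+1 w, zeta (dl / 2) n.*2 w)) pair_half n (x, y) w =
  (Y dl n x w, Y (dl / 2) n.*2 y w).
Proof.
elim: n x y => //= n ih x y; rewrite ih.
by rewrite (ns_half ns n w d0) /pair_half /half_step /= addrC.
Qed.

End halving.

(** Each coarse step contracts by [1 - lam / 2 * dl] and adds [dl * t] times a moment of the fine
    chain, which is bounded uniformly in time; so the error does not accumulate. The backward
    statement is the same bound on [iter n Pop]. *)
Lemma strong_half : exists Cs : R, exists ks : nat, 0 <= Cs /\ forall dl n x, 0 < dl <= D ->
  (\int[P]_w (enorm (X (dl / 2) x n.*2 w - X dl x n w) ^+ 2)%:E <=
     (Cs * (1 + enorm x) ^+ ks * (dl `^ gam) ^+ 2)%:E)%E /\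
  (\int[P]_w (enorm (Y (dl / 2) n.*2 x w - Y dl n x w) ^+ 2)%:E <=
     (Cs * (1 + enorm x) ^+ ks * (dl `^ gam) ^+ 2)%:E)%E.
Proof.
have [C0 [p [C00 hC]]] := half_step_error cm.
have [Cm [Cm1 hm]] := uniform_moment p.
have l0 := cm_lam cm.
have Cm0 : 0 <= Cm by exact: le_trans Cm1.
exists (2 / lam * (C0 * Cm)), p; split=> [|dl n x hd].
  by nonneg.
have d0 := dom_gt0 hd; have hh := dom_half hd; have h0 := dom_gt0 hh.
have noise := pair_noise (ns_noise ns h0).
have noise' := pair_noise_swap (ns_noise ns h0).
set t := (dl `^ gam) ^+ 2; have t0 : 0 <= t by exact: sqr_ge0.
have ld1 : lam * dl <= 1.
  rewrite (le_trans _ (cm_lamD cm))// ler_pM2l//; by have /andP[] := hd.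
pose k (s : V * V) := W s.1 * enorm (s.1 - s.2) ^+ 2.
pose r (s : V * V) := (1 + enorm s.2) ^+ p.
have k0 s : 0 <= k s by rewrite mulr_ge0 ?sqr_ge0 ?W_ge0.
have r0 s : 0 <= r s by rewrite exprn_ge0// addr_ge0.
have mk : measurable_fun setT k.
  apply: measurable_funM; last exact: measurable_enorm_sub.
  exact: (measurableT_comp (lipschitz_measurable (cm_WL cm)) measurable_fst).
have mr : measurable_fun setT r.
  apply: measurable_funX; apply: measurable_funD => //; apply: measurable_enorm_comp.
  exact: measurable_snd.
have mph := measurable_pair_half hd.
have mS m := measurable_fwd noise mph (x, x) m.
pose h (s : V * V) := (1 - lam / 2 * dl) * k s + dl * t * C0 * r s.
have ld2 : 0 <= 1 - lam / 2 * dl by clear -cm ns ld1 l0 d0; have := mulr_gt0 l0 d0; lra.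
have dt0 : 0 <= dl * t * C0 by nonneg.
have step1 s : (\int[prodp (nu (dl / 2)) (nu (dl / 2))]_e (k (pair_half dl (s, e)))%:E <= (h s)%:E)%E.
  have := hC dl (nu (dl / 2)) (nu dl) hd (ns_gauss ns h0) (ns_gauss ns d0)
    (fun f => noise_sum d0) s.1 s.2.
  move=> h1; apply: (le_trans h1); rewrite lee_fin /h /k /r -/t le_eqVlt.
  by apply/orP; left; apply/eqP; ring.
(* The fixed point of that recursion. *)
set Q := 2 / lam * (C0 * Cm) * (1 + enorm x) ^+ p * t.
have E n' : (\int[P]_w (k (fwd (fun n w => (zeta (dl / 2) n.*2 w, zeta (dl / 2) n.*2.+1 w))
    (pair_half dl) (x, x) n' w))%:E <= Q%:E)%E.
  elim: n' => [|n' ih].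
    rewrite /= integral_cst_prob /k /= subrr enorm0 expr0n/= mulr0 lee_fin.
    by rewrite /Q; nonneg.
  apply: (le_trans (fwd_step_le noise mph _ _ mk k0 step1)).
  rewrite /h (@ge0_integralZDl _ _ _ P (fun w => k (fwd _ _ _ _ w)) (fun w => r (fwd _ _ _ _ w)))//;
    [|exact: (measurableT_comp mk (mS n'))|exact: (measurableT_comp mr (mS n'))].
  apply: (@le_trans _ _ ((1 - lam / 2 * dl)%:E * Q%:E +
      (dl * t * C0)%:E * (Cm * (1 + enorm x) ^+ p)%:E)%E).
    apply: leeD; apply: lee_wpmul2l; rewrite ?lee_fin//.
    under eq_integral do rewrite fwd_pair_half//=.
    by have [] := hm (dl / 2) n'.*2 x hh.
  rewrite -!EFinM -EFinD lee_fin le_eqVlt; apply/orP; left; apply/eqP.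
  by rewrite /Q; field; rewrite gt_eqF.
have F : (iter n (Pop (prodp (nu (dl / 2)) (nu (dl / 2))) (pair_half dl)) sqdist (x, x) <= Q%:E)%E.
  rewrite -(integral_fwd noise mph (x, x) n measurable_sqdist sqdist_ge0).
  apply: le_trans (E n); apply: ge0_le_integralT => w; rewrite ?sqdist_ge0// /sqdist lee_fin /k.
  by rewrite ler_peMl ?sqr_ge0// (cm_W1 cm).
split; apply: le_trans F.
  rewrite -(integral_fwd noise mph (x, x) n measurable_sqdist sqdist_ge0).
  by under [leRHS]eq_integral do rewrite fwd_pair_half// /sqdist enormB.
rewrite -(integral_bwd noise' mph (x, x) n measurable_sqdist sqdist_ge0).
by under [leRHS]eq_integral do rewrite bwd_pair_half// /sqdist enormB.
Qed.

(** By [bwd_block] the [m] extra steps replace the start [x] by the chain at time [m], whose second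
    moment is bounded; the [n] shared steps then contract. *)
Lemma bwd_gap : exists Cg : R, 0 <= Cg /\ forall dl m n x, 0 < dl <= D ->
  (\int[P]_w (enorm (Y dl (m + n) x w - Y dl n x w) ^+ 2)%:E <=
     (Cg * (1 + enorm x) ^+ 2 * expR (- lam * (n%:R * dl)))%:E)%E.
Proof.
have [Cm [Cm1 hm]] := uniform_moment 2.
have W1 := Wm_ge1; have W0 : 0 <= Wm by exact: le_trans W1.
exists (Wm * (2 * Cm + 2)); split=> [|dl m n x hd]; first by rewrite mulr_ge0// addr_ge0// mulr_ge0// (le_trans _ Cm1).
have mst := measurable_step cm hd; have noise := ns_noise ns (dom_gt0 hd).
rewrite (bwd_block noise mst (k := sqdist) m n x x measurable_sqdist sqdist_ge0).
set c := Wm * expR (- lam * (n%:R * dl)).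
have c0 : 0 <= c by rewrite mulr_ge0 ?expR_ge0.
pose f (x' : V) : \bar R := (c * enorm (x' - x) ^+ 2)%:E.
apply: (@le_trans _ _ (iter m (Pop (nu dl) (stp dl)) f x)).
  apply: iter_Pop_le => s; first by apply: integral_ge0 => w _; exact: sqdist_ge0.
  exact: bwd_contract.
have mf' : measurable_fun setT (fun x' : V => enorm (x' - x) ^+ 2).
  apply: measurable_funX; apply: measurable_enorm_comp; apply: measurable_rVB => //.
rewrite -(integral_fwd noise mst x m (g := f)); last 2 first.
- by apply/measurable_EFinP; apply: measurable_funM.
- by move=> s; rewrite lee_fin mulr_ge0 ?sqr_ge0.
have mX := measurable_fwd noise mst x m.
have e0 := enorm_ge0 x.
rewrite (_ : Wm * _ * _ * _ = c * ((2 * Cm + 2) * (1 + enorm x) ^+ 2)); last by rewrite /c; ring.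
apply: (ge0_integralZ_le (f := fun w => enorm (X dl x m w - x) ^+ 2)) => //.
- exact: (measurableT_comp mf' mX).
- by move=> w; exact: sqr_ge0.
apply: (@le_trans _ _ (\int[P]_w (2 * (1 + enorm (X dl x m w)) ^+ 2 + 2 * (1 + enorm x) ^+ 2 * 1)%:E)%E).
  apply: ge0_le_integralT => w; rewrite ?lee_fin ?sqr_ge0//.
  have q (u : R) : 0 <= u -> u ^+ 2 <= (1 + u) ^+ 2.
    by move=> u0; apply: lerXn2r; rewrite ?nnegrE ?addr_ge0// lerDr.
  have := enormD_sqr_le (X dl x m w) (- x); rewrite enormN mulr1 => /le_trans; apply.
  by apply: lerD; rewrite ler_wpM2l// q.
rewrite (@ge0_integralZDl _ _ _ P (fun w => (1 + enorm (X dl x m w)) ^+ 2) (fun=> 1))//.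
- rewrite integral_cst_prob mule1.
  apply: (@le_trans _ _ (2%:E * (Cm * (1 + enorm x) ^+ 2)%:E + (2 * (1 + enorm x) ^+ 2)%:E)%E).
    by rewrite leeD2r// lee_wpmul2l//; have [] := hm dl m x hd.
  by rewrite -EFinM -EFinD lee_fin; lra.
- by move=> w; exact: sqr_ge0.
- by rewrite mulr_ge0 ?sqr_ge0.
- apply: measurable_funX; apply: measurable_funD => //; exact: measurable_enorm_comp.
Qed.

End chain_estimates.

(** * Limits of refined and of backward chains *)

Section chain_limits.
Context {R : realType} {d : nat}.
Local Notation V := 'rV[R]_d.
Context {sigma D lam gam C K rho B Wm Lw Ce : R} {ke : nat} {quad : bool}.
Context {b : V -> V} {A : V -> 'M[R]_d} {W : V -> R} {mn : R -> V -> V}.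
Hypothesis cm : chain_model sigma D lam gam C K rho B Wm Lw Ce ke quad b A W mn.
Context {dO : measure_display} {Om : measurableType dO}.
Context {P : probability Om R} {filt : R -> nat -> set (set Om)}.
Context {zeta : R -> nat -> Om -> V} {nu : R -> probability V R}.
Hypothesis ns : noise_system P filt zeta nu.

Local Notation stp := (@step R d sigma mn).
Local Notation X dl := (fwd (zeta dl) (stp dl)).
Local Notation Y dl := (bwd (zeta dl) (stp dl)).

Definition dyad (dl : R) (k : nat) : R := dl / 2 ^+ k.

Lemma dyadS dl k : dyad dl k.+1 = dyad dl k / 2.
Proof. by rewrite /dyad exprSr invfM mulrA. Qed.

Lemma dyad_mul dl n k : (n * 2 ^ k)%:R * dyad dl k = n%:R * dl.
Proof. by rewrite /dyad natrM natrX; field; rewrite expf_neq0. Qed.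

Lemma dyadD dl j k : dyad (dyad dl j) k = dyad dl (j + k).
Proof. by rewrite /dyad exprD invfM mulrA. Qed.

Lemma dom_dyad dl k : 0 < dl <= D -> 0 < dyad dl k <= D.
Proof.
by move=> hd; elim: k => [|k ih]; [rewrite /dyad expr0 divr1|rewrite dyadS; exact: dom_half].
Qed.

Definition halfg : R := 2^-1 `^ gam.

Lemma halfg01 : 0 < halfg < 1.
Proof.
have /andP[g0 _] := cm_gam cm; rewrite powR_gt0//= /halfg.
rewrite /powR gt_eqF ?invr_gt0// -[ltRHS]expR0 ltr_expR pmulr_rlt0//.
by apply: ln_lt0; lra.
Qed.

Lemma dyad_powR dl k : 0 <= dl -> (dyad dl k `^ gam) ^+ 2 = (dl `^ gam) ^+ 2 * (halfg ^+ 2) ^+ k.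
Proof.
move=> d0; elim: k => [|k ih]; first by rewrite /dyad !expr0 divr1 mulr1.
rewrite dyadS powRM ?invr_ge0// ?divr_ge0 ?exprn_ge0// exprMn ih -/halfg -mulrA.
by rewrite [_ ^+ k.+1]exprSr.
Qed.

Definition fine_chain (dl : R) (n : nat) (x : V) (k : nat) (w : Om) : V :=
  X (dyad dl k) x (n * 2 ^ k)%N w.

Lemma double_pow n k : (n * 2 ^ k).*2 = (n * 2 ^ k.+1)%N.
Proof. by rewrite -muln2 -mulnA expnSr. Qed.

(* The limit of the refined chains at time [n * dl]: a measurable version of the
   solution of the stochastic differential equation. *)
Definition flow (dl : R) (n : nat) (x : V) (w : Om) : V := vlim ((fine_chain dl n x)^~ w).

Lemma measurable_flow dl n : 0 < dl <= D ->
  measurable_fun setT (fun z : V * Om => flow dl n z.1 z.2).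
Proof.
move=> hd; apply: (measurable_vlim (u := fun k (z : V * Om) => fine_chain dl n z.1 k z.2)) => k.
have hk := dom_dyad k hd.
exact: (measurable_fwd_joint (ns_noise ns (dom_gt0 hk)) (measurable_step cm hk)).
Qed.

Lemma measurable_fine_chain dl n x k : 0 < dl <= D -> measurable_fun setT (fine_chain dl n x k).
Proof.
move=> hd; have hk := dom_dyad k hd.
exact: (measurable_fwd (ns_noise ns (dom_gt0 hk)) (measurable_step cm hk)).
Qed.

Lemma measurable_flow_r dl n x : 0 < dl <= D -> measurable_fun setT (flow dl n x).
Proof.
move=> hd; apply: (measurable_vlim (u := fine_chain dl n x)) => k.
exact: measurable_fine_chain.
Qed.

(** Successive refinements differ by one halving, so their mean-square distances decay by the factor
    [halfg ^+ 2]. The case [k = 0] is the strong error of the chain itself, uniform in [n]. *)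
Lemma flow_cvg : exists Cf : R, exists kf : nat, 0 <= Cf /\ forall dl n x, 0 < dl <= D ->
  {ae P, forall w, fine_chain dl n x k w @[k --> \oo] --> flow dl n x w} /\
  forall k, (\int[P]_w (enorm (flow dl n x w - fine_chain dl n x k w) ^+ 2)%:E <=
     (Cf * (1 + enorm x) ^+ kf * (dl `^ gam) ^+ 2 * (halfg ^+ 2) ^+ k)%:E)%E.
Proof.
have [Cs [ks [Cs0 hs]]] := strong_half cm ns.
have := halfg01 => s01; have /andP[s0 s1] := s01.
exists (Cs * (1 - halfg)^-1 ^+ 2), ks; split=> [|dl n x hd].
  by rewrite mulr_ge0// sqr_ge0.
have d0 := dom_gt0 hd.
have C0 : 0 <= Cs * (1 + enorm x) ^+ ks * (dl `^ gam) ^+ 2.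
  by rewrite mulr_ge0 ?sqr_ge0// mulr_ge0// exprn_ge0// addr_ge0.
have hU k : (\int[P]_w (enorm (fine_chain dl n x k.+1 w - fine_chain dl n x k w) ^+ 2)%:E <=
    (Cs * (1 + enorm x) ^+ ks * (dl `^ gam) ^+ 2 * (halfg ^+ 2) ^+ k)%:E)%E.
  rewrite /fine_chain dyadS -double_pow -mulrA -dyad_powR ?(ltW d0)//.
  by have [] := hs (dyad dl k) (n * 2 ^ k)%N x (dom_dyad k hd).
have [h1 h2] := cvg_sqr s01 C0 (fun k => measurable_fine_chain n x k hd) hU.
split=> // k; apply: (le_trans (h2 k)); rewrite lee_fin le_eqVlt; apply/orP; left; apply/eqP; ring.
Qed.

Lemma flow_contract dl n x y : 0 < dl <= D ->
  (\int[P]_w (enorm (flow dl n x w - flow dl n y w) ^+ 2)%:E <=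
   (Wm * expR (- lam * (n%:R * dl)) * enorm (x - y) ^+ 2)%:E)%E.
Proof.
move=> hd; have [Cf [kf [_ hf]]] := flow_cvg.
have [c1 _] := hf dl n x hd; have [c2 _] := hf dl n y hd.
have md (u v : Om -> V) : measurable_fun setT u -> measurable_fun setT v ->
    measurable_fun setT (fun w => enorm (u w - v w) ^+ 2).
  by move=> mu mv; apply: measurable_funX; apply: measurable_enorm_comp; exact: measurable_rVB.
apply: (fatou_le (f := fun k w => enorm (fine_chain dl n x k w - fine_chain dl n y k w) ^+ 2)).
- by move=> k; apply: md; exact: measurable_fine_chain.
- by move=> k w; exact: sqr_ge0.
- by apply: md; exact: measurable_flow_r.
- by move=> w; exact: sqr_ge0.
- apply: filterS2 c1 c2 => w h1 h2.
  by apply: (@cvg_enorm_sqr _ _ (fun k => fine_chain dl n x k w - fine_chain dl n y k w)); exact: cvgB.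
- apply: nearW => k; apply: (le_trans (fwd_contract cm ns (dom_dyad k hd) _ x y)).
  by rewrite dyad_mul.
Qed.

Lemma expR_lt1 (r : R) : 0 < r -> 0 < expR (- r) < 1.
Proof. by move=> r0; rewrite expR_gt0/= -[ltRHS]expR0 ltr_expR oppr_lt0. Qed.

Lemma measurable_Y dl n x : 0 < dl <= D -> measurable_fun setT (Y dl n x).
Proof.
move=> hd; apply: (measurable_bwd (measurable_step cm hd) (Y := fun=> x) (iota := fun w => w)).
  exact: measurable_cst.
by move=> k _; exact: (iid_measurable (ns_noise ns (dom_gt0 hd))).
Qed.

Definition stat (dl : R) (w : Om) : V := vlim (fun n => Y dl n 0 w).

Lemma measurable_stat dl : 0 < dl <= D -> measurable_fun setT (stat dl).
Proof. by move=> hd; apply: measurable_vlim => n; exact: measurable_Y. Qed.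

Lemma stat_cvg dl : 0 < dl <= D ->
  {ae P, forall w, Y dl n 0 w @[n --> \oo] --> stat dl w} /\
  (\int[P]_w (enorm (stat dl w) ^+ 2)%:E < +oo)%E.
Proof.
move=> hd; have d0 := dom_gt0 hd; have [Cg [Cg0 hg]] := bwd_gap cm ns.
have l0 := cm_lam cm.
(* Half the exponent, since [cvg_sqr] takes the square root of the ratio of squared increments. *)
have s01 := expR_lt1 (divr_gt0 (mulr_gt0 l0 d0) (ltr0n R 2)).
have hU n : (\int[P]_w (enorm (Y dl n.+1 0 w - Y dl n 0 w) ^+ 2)%:E <=
    (Cg * (expR (- (lam * dl / 2)) ^+ 2) ^+ n)%:E)%E.
  have := hg dl 1%N n 0 hd; rewrite add1n enorm0 addr0 expr1n mulr1.
  rewrite -expRM_natl -expRM_natl; by congr (_ <= (_ * expR _)%:E)%E; field.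
have [h1 h2] := cvg_sqr s01 Cg0 (fun n => measurable_Y n 0 hd) hU.
split=> //; have := h2 0%N; rewrite /=; under eq_integral do rewrite subr0.
by move=> /le_lt_trans; apply; rewrite ltry.
Qed.

(** The step [D / 2 ^+ k] and the horizon [k * D] are refined together, so a single limit is rid of
    both the discretisation and the starting point. *)
Definition limseq (k : nat) (w : Om) : V := Y (dyad D k) (k * 2 ^ k)%N 0 w.

Definition stat0 (w : Om) : V := vlim (limseq^~ w).

Lemma D_dom : 0 < D <= D.
Proof. by rewrite lexx andbT; have /andP[] := cm_D cm. Qed.

Lemma measurable_limseq k : measurable_fun setT (limseq k).
Proof. exact: measurable_Y (dom_dyad k D_dom). Qed.

Lemma measurable_stat0 : measurable_fun setT stat0.
Proof. by apply: measurable_vlim => k; exact: measurable_limseq. Qed.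

Lemma integral_sqr_triangle (u v z : Om -> V) (c1 c2 : R) :
  measurable_fun setT u -> measurable_fun setT v -> measurable_fun setT z ->
  (\int[P]_w (enorm (u w - v w) ^+ 2)%:E <= c1%:E)%E ->
  (\int[P]_w (enorm (v w - z w) ^+ 2)%:E <= c2%:E)%E ->
  (\int[P]_w (enorm (u w - z w) ^+ 2)%:E <= (2 * c1 + 2 * c2)%:E)%E.
Proof.
move=> mu mv mz h1 h2.
have md (u' v' : Om -> V) : measurable_fun setT u' -> measurable_fun setT v' ->
    measurable_fun setT (fun w => enorm (u' w - v' w) ^+ 2).
  by move=> mu' mv'; apply: measurable_funX; apply: measurable_enorm_comp; exact: measurable_rVB.
apply: (@le_trans _ _ (\int[P]_w (2 * enorm (u w - v w) ^+ 2 + 2 * enorm (v w - z w) ^+ 2)%:E)%E).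
  apply: ge0_le_integralT => w; rewrite lee_fin ?sqr_ge0//.
  by have := enormD_sqr_le (u w - v w) (v w - z w); rewrite subrKA.
rewrite ge0_integralZDl//; [|by move=> w; exact: sqr_ge0|by move=> w; exact: sqr_ge0|exact: md|exact: md].
by rewrite [leRHS]EFinD; apply: leeD; rewrite [leRHS]EFinM lee_wpmul2l.
Qed.

(** From [k] to [k.+1] the step is halved at horizon [k * D], which is [strong_half], and then the
    horizon grows by [D] at the new step, which is [bwd_gap]. *)
Lemma stat0_cvg : {ae P, forall w, limseq k w @[k --> \oo] --> stat0 w} /\
  (\int[P]_w (enorm (stat0 w) ^+ 2)%:E < +oo)%E.
Proof.
have [Cg [Cg0 hg]] := bwd_gap cm ns; have [Cs [ks [Cs0 hs]]] := strong_half cm ns.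
have l0 := cm_lam cm; have D0 := dom_gt0 D_dom.
have /andP[e0 e1] := expR_lt1 (divr_gt0 (mulr_gt0 l0 D0) (ltr0n R 2)).
have /andP[g0 g1] := halfg01.
set e := expR _ in e0 e1.
(* The slower of the two rates, forgetting the start and refining the step. *)
pose s := Num.max e halfg.
have s01 : 0 < s < 1 by rewrite /s lt_max e0/= gt_max e1 g1.
set CC := 2 * Cg + 2 * (Cs * (D `^ gam) ^+ 2).
have CC0 : 0 <= CC by rewrite /CC; nonneg.
have hU k : (\int[P]_w (enorm (limseq k.+1 w - limseq k w) ^+ 2)%:E <= (CC * (s ^+ 2) ^+ k)%:E)%E.
  have hk := dom_dyad k D_dom; have hk1 := dom_dyad k.+1 D_dom.
  have t1 := hg _ (2 ^ k.+1)%N (k * 2 ^ k.+1)%N 0 hk1.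
  rewrite dyad_mul enorm0 addr0 expr1n mulr1 in t1.
  have [_ t2] := hs _ (k * 2 ^ k)%N 0 hk.
  rewrite double_pow -dyadS enorm0 addr0 expr1n mulr1 (dyad_powR _ (ltW D0)) in t2.
  rewrite -mulSn in t1.
  have := integral_sqr_triangle (measurable_Y _ 0 hk1) (measurable_Y _ 0 hk1) (measurable_Y _ 0 hk) t1 t2.
  move=> /le_trans; apply; rewrite lee_fin /CC [leRHS]mulrDl.
  have sk (r : R) : 0 <= r -> r <= s -> (r ^+ 2) ^+ k <= (s ^+ 2) ^+ k.
    by move=> r0 rs; apply: lerXn2r; rewrite ?nnegrE ?sqr_ge0//; apply: lerXn2r; rewrite ?nnegrE// (le_trans r0).
  apply: lerD.
    rewrite -[leRHS]mulrA ler_wpM2l// ler_wpM2l//.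
    rewrite (_ : expR _ = (e ^+ 2) ^+ k); last first.
      by rewrite /e -!expRM_natl; congr expR; field.
    by apply: sk; rewrite ?(ltW e0)// /s le_max lexx.
  rewrite -[leRHS]mulrA ler_wpM2l// -[leRHS]mulrA ler_wpM2l// ler_wpM2l ?sqr_ge0//.
  by rewrite sk ?(ltW g0)// /s le_max lexx orbT.
have [h1 h2] := cvg_sqr s01 CC0 measurable_limseq hU.
split=> //; have := h2 0%N; rewrite /=; under eq_integral do rewrite /limseq /= subr0.
by move=> /le_lt_trans; apply; rewrite ltry.
Qed.

Lemma stat0_moment p : exists Cm : R, 0 <= Cm /\
  (\int[P]_w ((1 + enorm (stat0 w)) ^+ p)%:E <= Cm%:E)%E /\
  forall k, (\int[P]_w ((1 + enorm (limseq k w)) ^+ p)%:E <= Cm%:E)%E.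
Proof.
have [Cm [Cm1 hm]] := uniform_moment cm ns p; have [c1 _] := stat0_cvg.
have hk k : (\int[P]_w ((1 + enorm (limseq k w)) ^+ p)%:E <= Cm%:E)%E.
  have [_] := hm _ (k * 2 ^ k)%N 0 (dom_dyad k D_dom).
  by rewrite enorm0 addr0 expr1n mulr1.
have mn' (u : Om -> V) : measurable_fun setT u -> measurable_fun setT (fun w => (1 + enorm (u w)) ^+ p).
  by move=> mu; apply: measurable_funX; apply: measurable_funD => //; exact: measurable_enorm_comp.
exists Cm; split; first exact: le_trans Cm1.
split=> //; apply: (fatou_le (f := fun k w => (1 + enorm (limseq k w)) ^+ p)).
- by move=> k; apply: mn'; exact: measurable_limseq.
- by move=> k w; rewrite exprn_ge0// addr_ge0.
- by apply: mn'; exact: measurable_stat0.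
- by move=> w; rewrite exprn_ge0// addr_ge0.
- apply: filterS c1 => w h.
  have h1 : 1 + enorm (limseq k w) @[k --> \oo] --> 1 + enorm (stat0 w).
    apply: cvgD; first exact: cvg_cst.
    exact: (cvg_comp (limseq^~ w) (@enorm R d) h (continuous_enorm (x := stat0 w))).
  exact: (cvg_comp (fun k => 1 + enorm (limseq k w)) (fun r => r ^+ p) h1 (@exprn_continuous _ p _)).
- by apply: nearW.
Qed.

Definition chain_op (dl : R) (n : nat) (g : V -> R) (x : V) : R := mean P (g \o X dl x n).

Definition flow_op (dl : R) (n : nat) (g : V -> R) (x : V) : R := mean P (g \o flow dl n x).

Lemma contract_le_Wm dl n : 0 < dl <= D -> Wm * expR (- lam * (n%:R * dl)) <= Wm.
Proof.
move=> hd; have W1 := Wm_ge1 cm; have l0 := cm_lam cm; have d0 := dom_gt0 hd.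
rewrite ler_piMr ?(le_trans _ W1)// -[leRHS]expR0 ler_expR mulNr oppr_le0.
by rewrite !mulr_ge0// ltW.
Qed.

Lemma measurable_X dl n x : 0 < dl <= D -> measurable_fun setT (X dl x n).
Proof. by move=> hd; exact: (measurable_fwd (ns_noise ns (dom_gt0 hd)) (measurable_step cm hd)). Qed.

Lemma blip_chain_op dl n g : 0 < dl <= D -> blip g -> blip (chain_op dl n g).
Proof.
move=> hd bg; apply: (blip_mean (c := Wm)) => //.
- by move=> x; exact: measurable_X.
- exact: le_trans (Wm_ge1 cm).
- move=> x y; apply: (le_trans (fwd_contract cm ns hd n x y)).
  by rewrite lee_fin ler_wpM2r ?sqr_ge0// contract_le_Wm.
Qed.

Lemma blip_flow_op dl n g : 0 < dl <= D -> blip g -> blip (flow_op dl n g).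
Proof.
move=> hd bg; apply: (blip_mean (c := Wm)) => //.
- by move=> x; exact: measurable_flow_r.
- exact: le_trans (Wm_ge1 cm).
- move=> x y; apply: (le_trans (flow_contract n x y hd)).
  by rewrite lee_fin ler_wpM2r ?sqr_ge0// contract_le_Wm.
Qed.

Lemma cvg_contract dl (c : R) : 0 < dl ->
  Wm * expR (- lam * (n%:R * dl)) * c @[n --> \oo] --> (0 : R).
Proof.
move=> d0; have l0 := cm_lam cm.
have /andP[e0 e1] := expR_lt1 (mulr_gt0 l0 d0).
have -> : (fun n => Wm * expR (- lam * (n%:R * dl)) * c) =
    (fun n => (Wm * c) * expR (- (lam * dl)) ^+ n).
  by apply/funext => n; rewrite -expRM_natl mulrAC; congr (_ * expR _); ring.
rewrite -(mulr0 (Wm * c)); apply: cvg_scale; apply: cvg_expr; rewrite ger0_norm ?expR_ge0//.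
Qed.

Lemma chain_op_forget dl g x : 0 < dl <= D -> blip g ->
  chain_op dl n g x - chain_op dl n g 0 @[n --> \oo] --> (0 : R).
Proof.
move=> hd bg; apply: (cvg_mean_diff (A := X dl x) (B := X dl 0)
  (c := fun n => Wm * expR (- lam * (n%:R * dl)) * enorm (x - 0) ^+ 2)) => //.
- by move=> n; exact: measurable_X.
- by move=> n; exact: measurable_X.
- by move=> n; exact: (fwd_contract cm ns hd).
- by apply: cvg_contract; exact: dom_gt0 hd.
Qed.

Lemma flow_op_forget dl g x : 0 < dl <= D -> blip g ->
  flow_op dl n g x - flow_op dl n g 0 @[n --> \oo] --> (0 : R).
Proof.
move=> hd bg; apply: (cvg_mean_diff (A := fun n => flow dl n x) (B := fun n => flow dl n 0)
  (c := fun n => Wm * expR (- lam * (n%:R * dl)) * enorm (x - 0) ^+ 2)) => //.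
- by move=> n; exact: measurable_flow_r.
- by move=> n; exact: measurable_flow_r.
- by move=> n; exact: flow_contract.
- by apply: cvg_contract; exact: dom_gt0 hd.
Qed.

Lemma chain_opE dl n g x : 0 < dl <= D -> blip g ->
  (chain_op dl n g x)%:E = iter n (Pop (nu dl) (stp dl)) (fun z => (g z)%:E) x.
Proof.
move=> hd bg; have [g01 _] := bg; rewrite -meanE; last by move=> w; exact: g01.
apply: (integral_fwd (ns_noise ns (dom_gt0 hd)) (measurable_step cm hd) x n (g := fun z => (g z)%:E)).
  by apply/measurable_EFinP; exact: blip_measurable.
by move=> s; rewrite lee_fin; have /andP[] := g01 s.
Qed.

(** Both sides are iterates of [Pop], at [m] and [m + n]; letting [m] grow yields the invariance of
    the law of [stat]. *)
Lemma chain_op_bwd dl m n g : 0 < dl <= D -> blip g ->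
  mean P (chain_op dl n g \o Y dl m 0) = mean P (g \o Y dl (m + n) 0).
Proof.
move=> hd bg; have [g01 _] := bg; have bT := blip_chain_op n hd bg; have [T01 _] := bT.
have noise := ns_noise ns (dom_gt0 hd); have mst := measurable_step cm hd.
have ib h k : blip h -> (mean P (h \o Y dl k 0))%:E = iter k (Pop (nu dl) (stp dl)) (fun z => (h z)%:E) 0.
  move=> bh; have [h01 _] := bh; rewrite -meanE; last by move=> w; exact: h01.
  apply: (integral_bwd noise mst 0 k (g := fun z => (h z)%:E)).
    by apply/measurable_EFinP; exact: blip_measurable.
  by move=> s; rewrite lee_fin; have /andP[] := h01 s.
apply: EFin_inj; rewrite !ib// iterD; congr (iter m _ _ _).
by apply/funext => z; exact: chain_opE.
Qed.

Lemma stat_invariant dl n g : 0 < dl <= D -> blip g ->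
  mean P (chain_op dl n g \o stat dl) = mean P (g \o stat dl).
Proof.
move=> hd bg; have bT := blip_chain_op n hd bg; have [c1 _] := stat_cvg hd.
have key h : blip h -> mean P (h \o Y dl m 0) @[m --> \oo] --> mean P (h \o stat dl).
  move=> bh; have [h01 _] := bh; have mh := blip_measurable bh.
  apply: cvg_mean => //.
  - by move=> m; apply: (measurableT_comp mh); exact: measurable_Y.
  - by apply: (measurableT_comp mh); exact: measurable_stat.
  - by move=> m w; exact: h01.
  - by move=> w; exact: h01.
  - by apply: filterS c1 => w hw; exact: blip_continuous hw.
have h1 := key _ bT; have h2 := key _ bg.
have E : (fun m => mean P (chain_op dl n g \o Y dl m 0)) =
    (fun m => mean P (g \o Y dl (m + n) 0)).
  by apply/funext => m; exact: chain_op_bwd.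
rewrite E in h1.
have h3 : mean P (g \o Y dl (m + n)%N 0) @[m --> \oo] --> mean P (g \o stat dl).
  by rewrite (cvg_shiftn n (fun m => mean P (g \o Y dl m 0))).
exact: cvg_unique h1 h3.
Qed.

(** Run the chain of step [dyad D (i + j)] longer by the time [n * dyad D j]: its law hardly changes
    by [bwd_gap]. The longer chain is also a refined chain from an independent copy of
    [limseq (i + j)], close to the flow by [flow_cvg]. Both errors vanish as [i] grows. *)
Lemma stat0_invariant j n g : blip g ->
  mean P (flow_op (dyad D j) n g \o stat0) = mean P (g \o stat0).
Proof.
move=> bg; have [g01 _] := bg; have mg := blip_measurable bg.
have hj := dom_dyad j D_dom; have D0 := dom_gt0 D_dom.
have bT := blip_flow_op n hj bg; have [T01 _] := bT; have mT := blip_measurable bT.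
have [c1 _] := stat0_cvg.
have key h : blip h -> mean P (h \o limseq (i + j)%N) @[i --> \oo] --> mean P (h \o stat0).
  move=> bh; have [h01 _] := bh; have mh := blip_measurable bh.
  rewrite (cvg_shiftn j (fun i => mean P (h \o limseq i))).
  apply: cvg_mean => //.
  - by move=> m; apply: (measurableT_comp mh); exact: measurable_limseq.
  - by apply: (measurableT_comp mh); exact: measurable_stat0.
  - by move=> m w; exact: h01.
  - by move=> w; exact: h01.
  - by apply: filterS c1 => w hw; exact: blip_continuous hw.
have h1 := key _ bT; have h2 := key _ bg.
have hi i := dom_dyad (i + j) D_dom.
pose Z' i := Y (dyad D (i + j)) ((n * 2 ^ i) + ((i + j) * 2 ^ (i + j)))%N 0.
have [Cg [Cg0 hg]] := bwd_gap cm ns.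
have l0 := cm_lam cm; have W1 := Wm_ge1 cm.
(* the chain run a little longer *)
have d1 : mean P (g \o Z' i) - mean P (g \o limseq (i + j)%N) @[i --> \oo] --> (0 : R).
  apply: (cvg_mean_diff (c := fun i => Cg * expR (- lam * (i%:R * D)))) => //.
  - by move=> i; exact: measurable_Y.
  - by move=> i; exact: measurable_limseq.
  - move=> i; apply: (le_trans (hg _ (n * 2 ^ i)%N _ 0 (hi i))).
    rewrite dyad_mul enorm0 addr0 expr1n mulr1 lee_fin ler_wpM2l// ler_expR.
    by rewrite !mulNr lerN2 ler_pM2l// ler_pM2r// ler_nat leq_addr.
  - have := cvg_contract (Cg / Wm) D0; have -> // : (fun i => Wm * expR (- lam * (i%:R * D)) * (Cg / Wm)) =
      (fun i => Cg * expR (- lam * (i%:R * D))).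
    by apply/funext => i; field; rewrite gt_eqF// (lt_le_trans _ W1).
(* the chain against the flow, from an independent start *)
have [Cf [kf [Cf0 hf]]] := flow_cvg.
have [Cm [Cm0 [_ hm]]] := stat0_moment kf.
pose A2 i (z : Om * Om) := fine_chain (dyad D j) n (limseq (i + j)%N z.1) i z.2.
pose B2 i (z : Om * Om) := flow (dyad D j) n (limseq (i + j)%N z.1) z.2.
have mz i : measurable_fun setT (fun z : Om * Om => (limseq (i + j)%N z.1, z.2)).
  apply: measurable_fun_pair; last exact: measurable_snd.
  exact: (measurableT_comp (measurable_limseq _) measurable_fst).
have mA2 i : measurable_fun setT (A2 i).
  have hk := dom_dyad i hj.
  exact: (measurableT_comp (measurable_fwd_joint (ns_noise ns (dom_gt0 hk)) (measurable_step cm hk) _) (mz i)).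
have mB2 i : measurable_fun setT (B2 i).
  exact: (measurableT_comp (measurable_flow n hj) (mz i)).
have dyE i : dyad (dyad D j) i = dyad D (i + j) by rewrite dyadD addnC.
have prodmean (h : Om * Om -> R) : measurable_fun setT h -> (forall z, 0 <= h z <= 1) ->
    mean (prodp P P) h = mean P (fun w' => mean P (fun w => h (w', w))).
  move=> mh h01; apply: EFin_inj; rewrite -!meanE//; last first.
    by move=> w'; apply: mean01 => w; exact: h01.
  rewrite ge0_integral_prodp; first by apply: eq_integral => w' _; rewrite -meanE.
    exact/measurable_EFinP.
  by move=> z; rewrite lee_fin; have /andP[] := h01 z.
have EA i : mean (prodp P P) (g \o A2 i) = mean P (g \o Z' i).
  rewrite prodmean; [|exact: (measurableT_comp mg)|by move=> z; exact: g01].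
  rewrite /Z' [(n * 2 ^ i + _)%N]addnC -(chain_op_bwd _ _ (hi i) bg).
  congr (mean P _); apply/funext => w'.
  by rewrite /A2 /fine_chain /chain_op /limseq /= dyE.
have EB i : mean (prodp P P) (g \o B2 i) = mean P (flow_op (dyad D j) n g \o limseq (i + j)%N).
  by rewrite prodmean; [|exact: (measurableT_comp mg)|by move=> z; exact: g01].
have d2 : mean (prodp P P) (g \o A2 i) - mean (prodp P P) (g \o B2 i) @[i --> \oo] --> (0 : R).
  set cc := Cf * (dyad D j `^ gam) ^+ 2.
  apply: (cvg_mean_diff (c := fun i => cc * Cm * (halfg ^+ 2) ^+ i)) => //.
  - move=> i.
    rewrite (ge0_integral_prodp P P (f := fun z => (enorm (A2 i z - B2 i z) ^+ 2)%:E)); last 2 first.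
    + by apply/measurable_EFinP; apply: measurable_funX; apply: measurable_enorm_comp; exact: measurable_rVB.
    + by move=> z; rewrite lee_fin sqr_ge0.
    have cc0 : 0 <= cc * (halfg ^+ 2) ^+ i.
      by rewrite /cc; nonneg.
    rewrite mulrAC.
    apply: (@le_trans _ _ (\int[P]_w (cc * (halfg ^+ 2) ^+ i * (1 + enorm (limseq (i + j)%N w)) ^+ kf)%:E)%E).
      apply: ge0_le_integralT => w; first by apply: integral_ge0 => w' _; rewrite lee_fin sqr_ge0.
      have [_ /(_ i)] := hf _ n (limseq (i + j)%N w) hj.
      rewrite /A2 /B2 /=; under eq_integral do rewrite enormB.
      by rewrite /cc; congr (_ <= _%:E)%E; ring.
    apply: ge0_integralZ_le => //.
    + apply: measurable_funX; apply: measurable_funD => //; apply: measurable_enorm_comp.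
      exact: measurable_limseq.
    + by move=> w; rewrite exprn_ge0// addr_ge0.
  - rewrite -(mulr0 (cc * Cm)); apply: cvg_scale; apply: cvg_expr.
    have /andP[g0 g1] := halfg01; rewrite ger0_norm ?sqr_ge0// expr_lt1//; exact: ltW.
have h4 : mean P (flow_op (dyad D j) n g \o limseq (i + j)%N) @[i --> \oo] --> mean P (g \o stat0) - 0 + 0.
  have -> : (fun i => mean P (flow_op (dyad D j) n g \o limseq (i + j)%N)) =
      (fun i => mean P (g \o limseq (i + j)%N) -
        (mean (prodp P P) (g \o A2 i) - mean (prodp P P) (g \o B2 i)) +
        (mean P (g \o Z' i) - mean P (g \o limseq (i + j)%N))).
    by apply/funext => i; rewrite EA EB; ring.
  by apply: cvgD => //; apply: cvgB.
rewrite subr0 addr0 in h4.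
exact: cvg_unique h1 h4.
Qed.

End chain_limits.

(** * Euler sums along a solution *)

Section paths.
Context {R : realType} {d : nat}.
Local Notation V := 'rV[R]_d.

(** Compactness of the segment, phrased as passing from eventually near each point to eventually
    everywhere; boundedness and uniform continuity of paths are two instances. *)
Lemma segment_cover (T : R) (Q : nat -> R -> Prop) :
  (forall t : R, 0 <= t <= T -> exists N : nat, exists2 e : R, 0 < e &
     forall n (s : R), (N <= n)%N -> `|s - t| < e -> 0 <= s <= T -> Q n s) ->
  exists N : nat, forall n (s : R), (N <= n)%N -> 0 <= s <= T -> Q n s.
Proof.
move=> h; have cK : compact (`[0, T] : set R) by exact: segment_compact.
have /(_ nat \oo (fun n s => 0 <= s <= T -> Q n s) _) := (compact_near_coveringP _).1 cK.
case.
  move=> t; rewrite /= in_itv/= => tT; have [N [e e0 hN]] := h t tT.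
  exists ([set s | `|s - t| < e], [set n | (N <= n)%N]) => /=.
    split; last by exists N.
    by apply/nbhs_normP; exists e => //= s; rewrite /= distrC.
  by move=> [s n] /= [hs hn] st; exact: (hN n s).
by move=> N _ hN; exists N => n s Nn sT; apply: (hN n Nn).
Qed.

Definition path_continuous (f : R -> V) : Prop := forall t e : R, 0 <= t -> 0 < e ->
  exists2 u : R, 0 < u & forall s : R, 0 <= s -> `|s - t| < u -> enorm (f s - f t) < e.

Lemma within_path_continuous (f : R -> V) :
  {within `[0, +oo[, continuous f} -> path_continuous f.
Proof.
move=> /subspace_continuousP fc t e t0 e0.
have ti : (`[0, +oo[%classic : set R) t by rewrite /= in_itv/= t0.
have /cvg_enormP /cvgrPdist_lt /(_ e e0) /nbhs_normP [u /= u0 hu] := fc t ti.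
exists u => // s s0 st; have := hu s; rewrite /= distrC => /(_ st).
by rewrite in_itv/= s0 sub0r normrN ger0_norm// => /(_ isT).
Qed.

Variable f : R -> V.
Hypothesis fc : path_continuous f.

Lemma path_bounded (T : R) : exists2 M : R, 0 <= M & forall s : R, 0 <= s <= T -> enorm (f s) <= M.
Proof.
have [|N hN] := @segment_cover T (fun n s => enorm (f s) <= n%:R); last first.
  by exists N%:R => // s; exact: hN.
move=> t /andP[t0 _]; have [u u0 hu] := fc t0 ltr01.
exists (Num.truncn (enorm (f t) + 1)).+1; exists u => // n s Nn st /andP[s0 _].
have h1 := hu s s0 st; have h2 := ler_enormD (f s - f t) (f t); rewrite subrK in h2.
have h3 : enorm (f t) + 1 < (Num.truncn (enorm (f t) + 1)).+1%:R by exact: truncnS_gt.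
have h4 : (Num.truncn (enorm (f t) + 1)).+1%:R <= n%:R :> R by rewrite ler_nat.
by clear -h1 h2 h3 h4; lra.
Qed.

Lemma path_uniform (T e : R) : 0 < e -> exists2 u : R, 0 < u &
  forall s t : R, 0 <= s <= T -> 0 <= t <= T -> `|s - t| <= u -> enorm (f s - f t) <= e.
Proof.
move=> e0.
have [|N hN] := @segment_cover T (fun n s =>
    forall r : R, 0 <= r <= T -> `|r - s| <= n.+1%:R^-1 -> enorm (f r - f s) <= e); last first.
  by exists N.+1%:R^-1; [rewrite invr_gt0|move=> s t sT tT st; exact: (hN N t)].
move=> t /andP[t0 _]; have e2 : 0 < e / 2 by rewrite divr_gt0.
have [u u0 hu] := fc t0 e2; have u2 : 0 < u / 2 by rewrite divr_gt0.
exists (Num.truncn (u / 2)^-1); exists (u / 2) => // n s Nn st /andP[s0 _] r /andP[r0 _] rs.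
have n1 : n.+1%:R^-1 < u / 2.
  rewrite invf_plt ?posrE ?ltr0n//; apply: (lt_le_trans (truncnS_gt _)).
  by rewrite ler_nat ltnS.
have h1 : enorm (f s - f t) < e / 2 by apply: hu => //; clear -st u0; lra.
have h2 : enorm (f r - f t) < e / 2.
  apply: hu => //; have := ler_normD (r - s) (s - t); rewrite subrKA => h.
  apply: (le_lt_trans h); rewrite [ltRHS](splitr u); apply: ler_ltD => //.
  by rewrite (le_trans rs)// ltW.
have := ler_enormB (f r - f t) (f s - f t).
rewrite opprB addrA subrK => h3; apply: (le_trans h3); clear -h1 h2; lra.
Qed.

End paths.

Section increments.
Context {R : realType}.
Local Notation mu := (@lebesgue_measure R).

Lemma Rintegral_increment (phi : R -> R) (s t w : R) : 0 <= s -> s < t ->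
  mu.-integrable `[0, t] (EFin \o phi) -> 0 <= w ->
  (forall r : R, s <= r <= t -> `|phi r - phi s| <= w) ->
  `|\int[mu]_(r in `[0, t]) phi r - \int[mu]_(r in `[0, s]) phi r - (t - s) * phi s| <= (t - s) * w.
Proof.
move=> s0 st it w0 hw.
rewrite Rintegral_itvB//; last by rewrite bnd_simp ltW.
have mI : measurable (`]s, t] : set R) by exact: measurable_itv.
have it' : mu.-integrable `]s, t] (EFin \o phi).
  have := @integrableS _ _ _ mu `[0, t]%classic `]s, t]%classic (EFin \o phi)
    (measurable_itv _) mI; apply => //.
  by move=> r /=; rewrite !in_itv/= => /andP[sr ->]; rewrite (le_trans s0 (ltW sr)).
have mst : fine (mu (`]s, t] : set R)) = t - s by rewrite lebesgue_measure_itv/= lte_fin st.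
have fin : (mu (`]s, t] : set R) < +oo)%E by rewrite lebesgue_measure_itv/= lte_fin st ltry.
have ic (c : R) : mu.-integrable `]s, t] (EFin \o (fun=> c)).
  apply/integrableP; split; first exact: measurable_cst.
  by rewrite integral_cst//= lte_mul_pinfty.
have -> : (t - s) * phi s = \int[mu]_(r in `]s, t]) phi s by rewrite Rintegral_cst// mst mulrC.
rewrite -RintegralB//.
have -> : (t - s) * w = \int[mu]_(r in `]s, t]) w by rewrite Rintegral_cst// mst mulrC.
have id : mu.-integrable `]s, t] (EFin \o (fun r => phi r - phi s)).
  rewrite (_ : _ \o _ = ((EFin \o phi) \- (EFin \o (fun=> phi s)))%E)//.
  by apply: integrableB => //; exact: ic.
apply: le_trans; first exact: le_normr_Rintegral.
apply: le_Rintegral => //; first exact: (integrable_abse id).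
by move=> r /=; rewrite in_itv/= => /andP[sr rt]; apply: hw; rewrite ltW.
Qed.

End increments.

(** * The scheme along one solution path *)

Section euler_path.
Context {R : realType} {d : nat}.
Local Notation V := 'rV[R]_d.
Context {sigma D lam gam C K rho B Wm Lw Ce : R} {ke : nat} {quad : bool}.
Context {b : V -> V} {A : V -> 'M[R]_d} {W : V -> R} {mn : R -> V -> V}.
Hypothesis cm : chain_model sigma D lam gam C K rho B Wm Lw Ce ke quad b A W mn.
Local Notation mu := (@lebesgue_measure R).

Variables (x : R -> V) (Wp : R -> V).
Hypothesis xc : path_continuous x.
Hypothesis xE : forall t : R, 0 <= t -> forall i,
  mu.-integrable `[0, t] (EFin \o (fun s => b (x s) ord0 i)) /\
  x t ord0 i = x 0 ord0 i + \int[mu]_(s in `[0, t]) (b (x s) ord0 i) + sigma * Wp t ord0 i.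

Fixpoint euler (h : R) (m : nat) : V :=
  if m is m'.+1 then mn h (euler h m') + sigma *: (Wp (m'.+1%:R * h) - Wp (m'%:R * h)) else x 0.

(** A discrete Gronwall argument. Each step expands by at most [1 + 3 / 2 * C * h], dominated by the
    exponential, and adds [h] times the consistency error of the scheme plus the oscillation [w] of
    the drift along the path. *)
Lemma euler_error (M T h w : R) m : 0 < h <= D -> 0 <= M -> 0 <= w ->
  (forall s : R, 0 <= s <= T -> enorm (x s) <= M) ->
  (forall s t : R, 0 <= s <= T -> 0 <= t <= T -> `|s - t| <= h -> enorm (b (x s) - b (x t)) <= w) ->
  m%:R * h <= T ->
  enorm (x (m%:R * h) - euler h m) <=
  expR (3 / 2 * C * (m%:R * h)) * (m%:R * h) * (Ce * (1 + M) ^+ ke * h `^ gam + d%:R * w).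
Proof.
move=> hd M0 w0 xM bw; have /andP[h0 hD] := hd; have C0 := cm_C cm; have Ce0 := Ce_ge0 cm.
set r := Ce * _ * _ + _.
have r0 : 0 <= r.
  by rewrite /r addr_ge0 ?mulr_ge0 ?exprn_ge0 ?addr_ge0 ?powR_ge0.
elim: m => [|m ih] mT; first by rewrite mul0r /= subrr enorm0 !mulr0 mul0r.
set s := m%:R * h; set t := m.+1%:R * h.
have ts : t = s + h by rewrite /t /s -natr1 mulrDl mul1r.
have s0 : 0 <= s by rewrite /s mulr_ge0// ltW.
have st : s < t by rewrite ts ltrDl.
have sT : s <= T by rewrite (le_trans (ltW st)).
have t0 : 0 <= t by rewrite (le_trans s0)// ltW.
have {}ih := ih sT; rewrite -/s in ih.
set y := euler h m in ih *.
pose I := x t - x s - sigma *: (Wp t - Wp s) - h *: b (x s).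
have hI : enorm I <= d%:R * (h * w).
  apply: enorm_le_coord => i.
  have [it eqt] := xE t0 i; have [_ eqs] := xE s0 i.
  have := @Rintegral_increment _ (fun r => b (x r) ord0 i) s t w s0 st it w0.
  rewrite (_ : t - s = h); last by rewrite ts addrAC subrr add0r.
  rewrite /I !mxE eqt eqs => h1; apply: le_trans (h1 _).
    by rewrite le_eqVlt; apply/orP; left; apply/eqP; congr `| _ |; ring.
  move=> u /andP[su ut]; have := coord_le_enorm (b (x u) - b (x s)) i.
  rewrite !mxE => /le_trans; apply; apply: bw.
  - by rewrite (le_trans s0 su) (le_trans ut).
  - by rewrite s0 sT.
  - by rewrite ger0_norm ?subr_ge0// lerBlDr addrC -ts.
have E : x t - euler h m.+1 = (mn h (x s) - mn h y) - (mn h (x s) - x s - h *: b (x s)) + I.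
  rewrite /I /= -/y -/s -/t; apply/rowP => i; rewrite !mxE; ring.
have L : enorm (mn h (x s) - mn h y) <= (1 + 3 / 2 * C * h) * enorm (x s - y).
  have q0 : 0 <= 1 + 3 / 2 * C * h by rewrite addr_ge0// !mulr_ge0// ltW.
  rewrite -(@ler_pXn2r _ 2)// ?nnegrE ?mulr_ge0//.
  rewrite (le_trans (cm_lip cm hd _ _))// exprMn ler_wpM2r ?sqr_ge0//.
  have := sqr_ge0 (C * h); clear -cm xc xE; lra.
have G : enorm (mn h (x s) - x s - h *: b (x s)) <= h * (Ce * (1 + M) ^+ ke * h `^ gam).
  apply: (le_trans (cm_err cm hd _)); rewrite mulrCA ler_wpM2l ?(ltW h0)//.
  rewrite ler_wpM2r ?powR_ge0// ler_wpM2l//; apply: lerXn2r; rewrite ?nnegrE ?addr_ge0//.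
  by rewrite lerD2l; apply: xM; rewrite s0.
rewrite E; apply: (le_trans (ler_enormD _ _)).
apply: (@le_trans _ _ ((1 + 3 / 2 * C * h) * (expR (3 / 2 * C * s) * s * r) + h * r)).
  have := ler_enormB (mn h (x s) - mn h y) (mn h (x s) - x s - h *: b (x s)).
  have q0 : 0 <= 1 + 3 / 2 * C * h by rewrite addr_ge0// !mulr_ge0// ltW.
  have := ler_wpM2l q0 ih; rewrite /r; move: hI L G; clear -cm xc xE; lra.
have e1 : (1 + 3 / 2 * C * h) * expR (3 / 2 * C * s) <= expR (3 / 2 * C * t).
  rewrite ts mulrDr expRD mulrC ler_wpM2l ?expR_ge0//.
  exact: expR_ge1Dx.
have e2 : 1 <= expR (3 / 2 * C * t).
  by rewrite -expR0 ler_expR !mulr_ge0// ltW.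
have k1 := ler_wpM2r (mulr_ge0 s0 r0) e1.
have k2 := ler_wpM2r (mulr_ge0 (ltW h0) r0) e2.
have -> : expR (3 / 2 * C * t) * t * r = expR (3 / 2 * C * t) * (s * r) + expR (3 / 2 * C * t) * (h * r).
  by rewrite {2}ts; ring.
by move: k1 k2; clear -cm xc xE; lra.
Qed.

(** For one fixed path: on a bounded time interval a continuous path is bounded and uniformly
    continuous, so both parts of the local error vanish with the step. *)
Lemma euler_cvg dl n : 0 < dl <= D ->
  euler (dyad dl k) (n * 2 ^ k)%N @[k --> \oo] --> x (n%:R * dl).
Proof.
move=> hd; apply/cvg_enormP; apply/cvgrPdist_le => e e0.
set T := n%:R * dl; have d0 := dom_gt0 hd.
have T0 : 0 <= T by rewrite mulr_ge0// ltW.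
have [M M0 xM] := path_bounded xc T.
have Ce0 := Ce_ge0 cm; have C0 := cm_C cm.
have M1 : 0 <= Ce * (1 + M + M) ^+ ke by rewrite mulr_ge0// exprn_ge0// !addr_ge0.
set EE := expR (3 / 2 * C * T) * T.
have EE0 : 0 <= EE by rewrite mulr_ge0 ?expR_ge0.
(* The oscillation of the drift allowed per step, so that its total contribution is at most [e / 2];
   [e'] below is the oscillation of the path that guarantees it. *)
pose w := e / (2 * (EE * d%:R + 1)).
have q1 : 0 < EE * d%:R + 1 by rewrite ltr_wpDl// mulr_ge0.
have w0 : 0 < w by rewrite divr_gt0// mulr_gt0.
pose e' := w / (Ce * (1 + M + M) ^+ ke + 1).
have q2 : 0 < Ce * (1 + M + M) ^+ ke + 1 by rewrite ltr_wpDl.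
have e'0 : 0 < e' by rewrite divr_gt0.
have [u u0 hu] := path_uniform xc T e'0.
have bw (s t : R) : 0 <= s <= T -> 0 <= t <= T -> `|s - t| <= u -> enorm (b (x s) - b (x t)) <= w.
  move=> sT tT st; apply: (le_trans (cm_blip cm _ _)).
  have h1 := hu _ _ sT tT st; have h2 := xM _ sT; have h3 := xM _ tT.
  apply: (@le_trans _ _ (Ce * (1 + M + M) ^+ ke * e')).
    apply: ler_pM => //; rewrite ?mulr_ge0 ?exprn_ge0 ?addr_ge0//.
    rewrite ler_wpM2l//; apply: lerXn2r; rewrite ?nnegrE ?addr_ge0//.
    by move: h2 h3; clear -cm xc xE; lra.
  rewrite /e' mulrA ler_pdivrMr// mulrC ler_wpM2l ?(ltW w0)//; clear -cm xc xE; lra.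
have hcvg : dyad dl k @[k --> \oo] --> (0 : R).
  have -> : dyad dl = (fun k => dl * 2^-1 ^+ k) by apply/funext => k; rewrite /dyad exprVn.
  rewrite -(mulr0 dl); apply: cvg_scale; apply: cvg_expr.
  by rewrite ger0_norm// invf_lt1// ltr1n.
have gcvg : EE * (Ce * (1 + M) ^+ ke) * (dyad dl k `^ gam) @[k --> \oo] --> (0 : R).
  rewrite -(mulr0 (EE * (Ce * (1 + M) ^+ ke))); apply: cvg_scale.
  have -> : (fun k => dyad dl k `^ gam) = (fun k => dl `^ gam * halfg (gam := gam) ^+ k).
    apply/funext; elim=> [|k ih]; first by rewrite /dyad !expr0 divr1 mulr1.
    rewrite dyadS powRM ?invr_ge0// ?divr_ge0 ?exprn_ge0 ?(ltW d0)// ih.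
    by rewrite -mulrA [in RHS]exprSr.
  rewrite -(mulr0 (dl `^ gam)); apply: cvg_scale; apply: cvg_expr.
  by have /andP[g0 g1] := halfg01 cm; rewrite ger0_norm ?(ltW g0).
have e20 : 0 < e / 2 by rewrite divr_gt0.
move/cvgrPdist_le : hcvg => /(_ _ u0); move/cvgrPdist_le : gcvg => /(_ _ e20).
apply: filterS2 => k; rewrite !sub0r !normrN => h1 h2.
have hk := dom_dyad k hd; have k0 := dom_gt0 hk.
rewrite ger0_norm// enormB.
have := @euler_error M T (dyad dl k) w (n * 2 ^ k)%N hk M0 (ltW w0) xM.
rewrite dyad_mul -/T => /(_ _ (lexx _)) h3.
apply: (le_trans (h3 _)).
  move=> s t sT tT st; apply: bw => //; rewrite (le_trans st)//.
  by rewrite (le_trans (ler_norm _)).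
rewrite -/EE mulrDr mulrA.
have h4 := le_trans (ler_norm _) h1.
have h5 : EE * (d%:R * w) <= e / 2.
  rewrite mulrA /w mulrA ler_pdivrMr ?mulr_gt0//.
  by move: (EE * d%:R) e0; clear -cm xc xE => z e0; lra.
by move: h4 h5; rewrite -!mulrA; clear -cm xc xE; lra.
Qed.

End euler_path.

(** * Invariant measures *)

Section random_maps.
Context {R : realType} {d : nat} {dO : measure_display} {Om : measurableType dO}.
Local Notation V := 'rV[R]_d.
Variable P : probability Om R.

Lemma mean_law {dT : measure_display} {T : measurableType dT} (Q : probability T R) (f : T -> V)
    (mf : measurable_fun setT f) (g : V -> R) : blip g -> mean (law Q mf) g = mean Q (g \o f).
Proof.
move=> bg; have [g01 _] := bg; rewrite /mean ge0_integral_law//.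
  by apply/measurable_EFinP; exact: blip_measurable.
by move=> y; rewrite lee_fin; have /andP[] := g01 y.
Qed.

Lemma mean_prodp {d1 : measure_display} {T : measurableType d1} (Q : probability T R)
    (h : T * Om -> R) : measurable_fun setT h -> (forall z, 0 <= h z <= 1) ->
  mean (prodp Q P) h = mean Q (fun x => mean P (fun w => h (x, w))).
Proof.
move=> mh h01; apply: EFin_inj; rewrite -!meanE//; last first.
  by move=> x; apply: mean01 => w; exact: h01.
rewrite ge0_integral_prodp; first by apply: eq_integral => x _; rewrite -meanE.
  exact/measurable_EFinP.
by move=> z; rewrite lee_fin; have /andP[] := h01 z.
Qed.

Lemma eq_mean (p q : probability V R) (g : V -> R) :
  (forall A, measurable A -> p A = q A) -> mean p g = mean q g.
Proof.
by move=> pq; rewrite /mean (eq_measure_integral q)// => A mA _; exact: pq.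
Qed.

Variables (Phi : V * Om -> V) (mPhi : measurable_fun setT Phi).

Lemma mean_random_map (mu : probability V R) (g : V -> R) : blip g ->
  mean (law (prodp mu P) mPhi) g = mean mu (fun x => mean P (fun w => g (Phi (x, w)))).
Proof.
move=> bg; have [g01 _] := bg; rewrite mean_law// mean_prodp//; last by move=> z; exact: g01.
by apply: (measurableT_comp _ mPhi); exact: blip_measurable.
Qed.

(** Reduces invariance on Borel sets to test functions, the form in which limits are taken. *)
Lemma random_map_invariantP (p : probability V R) :
  (forall A, measurable A -> law (prodp p P) mPhi A = p A) <->
  (forall g, blip g -> mean p (fun x => mean P (fun w => g (Phi (x, w)))) = mean p g).
Proof.
split=> [h g bg|h]; first by rewrite -mean_random_map//; exact: eq_mean.
apply: probability_eq_blip => g bg; have [g01 _] := bg.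
by rewrite (meanE _ g01) (meanE p g01) mean_random_map// h.
Qed.

Lemma law_prodpE (mu : probability V R) A : measurable A ->
  law (prodp mu P) mPhi A = (\int[mu]_x P ((fun w => Phi (x, w)) @^-1` A))%E.
Proof.
move=> mA; rewrite lawE.
have mA' : measurable (Phi @^-1` A) by rewrite -[X in measurable X]setTI; exact: mPhi.
rewrite -(integral_indicT (prodp mu P) mA').
rewrite (ge0_integral_prodp mu P (f := fun z => (\1_(Phi @^-1` A) z)%:E))//; last first.
  by apply/measurable_EFinP; exact: measurable_indic.
apply: eq_integral => x _; rewrite -integral_indicT//.
by rewrite -[X in measurable X]setTI; apply: (measurableT_comp mPhi).
Qed.

Lemma ae_eq_preimage (Y Z : Om -> V) A : measurable_fun setT Y -> measurable_fun setT Z ->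
  {ae P, forall w, Y w = Z w} -> measurable A -> P (Y @^-1` A) = P (Z @^-1` A).
Proof.
move=> mY mZ YZ mA.
have m (U : Om -> V) : measurable_fun setT U -> measurable (U @^-1` A).
  by move=> mU; rewrite -[X in measurable X]setTI; exact: mU.
rewrite -(integral_indicT P (m _ mY)) -(integral_indicT P (m _ mZ)).
apply: ge0_ae_eq_integral => //; try by apply/measurable_EFinP; apply: measurable_indic; exact: m.
apply: filterS YZ => w h _; rewrite !indicE; congr ((nat_of_bool _)%:R%:E).
by apply/idP/idP => /set_mem hw; apply/mem_set; move: hw; rewrite /preimage /= h.
Qed.

End random_maps.

(** * The flow as a solution, and its invariant law *)

Section sde.
Context {R : realType} {d : nat}.
Local Notation V := 'rV[R]_d.
Context {sigma D lam gam C K rho B Wm Lw Ce : R} {ke : nat} {quad : bool}.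
Context {b : V -> V} {A : V -> 'M[R]_d} {W : V -> R} {mn : R -> V -> V}.
Hypothesis cm : chain_model sigma D lam gam C K rho B Wm Lw Ce ke quad b A W mn.
Context {dO : measure_display} {Om : measurableType dO}.
Context {P : probability Om R} {filt : R -> nat -> set (set Om)}.
Context {Wp : R -> Om -> V} {nu : R -> probability V R}.
Hypothesis ns : noise_system P filt (scheme_noise Wp) nu.
Context {F : R -> set (set Om)} {X : V -> R -> Om -> V}.
Hypothesis hX : forall x, sde_solution P F Wp b sigma (cst x) (X x).
Hypothesis mX : forall x t, 0 <= t -> measurable_fun setT (X x t).

Local Notation flw := (@flow R d sigma mn dO Om (scheme_noise Wp)).
Local Notation flop := (@flow_op R d sigma mn dO Om P (scheme_noise Wp)).

Lemma flow_sde x dl n : 0 < dl <= D ->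
  {ae P, forall w, flw dl n x w = X x (n%:R * dl) w}.
Proof.
move=> hd; have [_ pc init eqn] := hX x.
apply: filterS3 pc init eqn => w /within_path_continuous xc x0 xE.
apply: vlimE.
have E h m : fwd (scheme_noise Wp h) (@step R d sigma mn h) x m w =
    @euler R d sigma mn ((X x)^~ w) (Wp^~ w) h m.
  by elim: m => [|m ih]; [rewrite /= x0|rewrite /= ih].
rewrite /fine_chain; under eq_fun do rewrite E.
exact: (@euler_cvg R d sigma D lam gam C K rho B Wm Lw Ce ke quad b A W mn cm ((X x)^~ w) (Wp^~ w) xc xE dl n hd).
Qed.

(** Every time lies on the grid of some admissible step: divide [t] by an integer above [t / D].
    Thus the flow, defined on grids only, reaches all times. *)
Lemma time_steps t : 0 <= t -> exists dl, exists n : nat, 0 < dl <= D /\ t = n%:R * dl.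
Proof.
have /andP[D0 _] := cm_D cm.
rewrite le_eqVlt => /predU1P[<-|t0]; first by exists D, 0%N; rewrite mul0r lexx D0.
have n0 : 0 < (Num.truncn (t / D)).+1%:R :> R by [].
exists (t / (Num.truncn (t / D)).+1%:R), (Num.truncn (t / D)).+1; split; last first.
  by field; rewrite gt_eqF.
rewrite divr_gt0//= ler_pdivrMr// mulrC -ler_pdivrMr//.
by apply: ltW; exact: truncnS_gt.
Qed.

Lemma flow_opE dl n g x : 0 < dl <= D -> blip g ->
  flop dl n g x = mean P (g \o X x (n%:R * dl)).
Proof.
move=> hd bg; have [g01 _] := bg; have mg := blip_measurable bg; have d0 := dom_gt0 hd.
rewrite /flow_op /mean; congr fine; apply: ge0_ae_eq_integral => //.
- apply/measurable_EFinP; apply: (measurableT_comp mg); exact: (measurable_flow_r cm ns).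
- by apply/measurable_EFinP; apply: (measurableT_comp mg); apply: mX; rewrite mulr_ge0// ltW.
- by move=> w _; rewrite lee_fin; have /andP[] := g01 (flw dl n x w).
- by move=> w _; rewrite lee_fin; have /andP[] := g01 (X x (n%:R * dl) w).
- by apply: filterS (flow_sde x n hd) => w h _; rewrite /= h.
Qed.

Lemma semigroup_flow (mu : probability V R) dl n (hd : 0 < dl <= D) S : measurable S ->
  semigroup P X mu (n%:R * dl) S = law (prodp mu P) (measurable_flow cm ns n hd) S.
Proof.
move=> mS; rewrite law_prodpE//; apply: eq_integral => x _.
apply: (ae_eq_preimage (Y := X x (n%:R * dl)) (Z := flw dl n x)) => //.
- by apply: mX; rewrite mulr_ge0// ltW// (dom_gt0 hd).
- exact: (measurable_flow_r cm ns n x hd).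
- by apply: filterS (flow_sde x n hd) => w ->.
Qed.

Lemma sde_invariantP (p : probability V R) : sde_invariant P X p <->
  forall dl n g, 0 < dl <= D -> blip g -> mean p (flop dl n g) = mean p g.
Proof.
split=> [ip dl n g hd bg|h t t0].
  apply: ((random_map_invariantP P (measurable_flow cm ns n hd) p).1 _ g bg) => S mS.
  rewrite -semigroup_flow//; apply: ip => //.
  by rewrite mulr_ge0// ltW// (dom_gt0 hd).
have [dl [n [hd ->]]] := time_steps t0 => S mS; rewrite (semigroup_flow _ _ hd)//.
apply: (random_map_invariantP P (measurable_flow cm ns n hd) p).2 => // g bg.
exact: h.
Qed.

Lemma dyad_cvg0 (r : R) : dyad r k @[k --> \oo] --> (0 : R).
Proof.
have -> : dyad r = (fun k => r * 2^-1 ^+ k) by apply/funext => k; rewrite /dyad exprVn.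
rewrite -(mulr0 r); apply: cvg_scale; apply: cvg_expr.
by rewrite ger0_norm// invf_lt1// ltr1n.
Qed.

Definition sde_stat : probability V R := law P (measurable_stat0 cm ns).

(** Invariance is known at dyadic multiples of [D]. An arbitrary time is approached by such times,
    and continuity of paths with bounded convergence passes to the limit. *)
Lemma sde_stat_invariant : sde_invariant P X sde_stat.
Proof.
apply/sde_invariantP => dl n g hd bg; have [g01 _] := bg; have mg := blip_measurable bg.
have D0 := dom_gt0 (D_dom cm); have d0 := dom_gt0 hd.
set t := n%:R * dl; have t0 : 0 <= t by rewrite mulr_ge0// ltW.
(* [s j] is the last point at or before [t] of the grid of step [D / 2 ^+ j]. *)
pose N j := Num.truncn (t / dyad D j); pose s j : R := (N j)%:R * dyad D j.
have Dj j := dom_gt0 (dom_dyad j (D_dom cm)).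
have sj j : s j <= t < s j + dyad D j.
  have q0 : 0 <= t / dyad D j by rewrite divr_ge0// ltW.
  have /andP[a1 a2] := truncn_itv q0.
  rewrite /s /N -ler_pdivlMr// a1/= -[X in _ < _ + X]mul1r -mulrDl -ltr_pdivrMr//.
  by rewrite natr1.
have s0 j : 0 <= s j by rewrite mulr_ge0// ltW.
have bD j := blip_flow_op cm ns (N j) (dom_dyad j (D_dom cm)) bg.
have bT := blip_flow_op cm ns n hd bg.
have cvx x : flop (dyad D j) (N j) g x @[j --> \oo] --> flop dl n g x.
  rewrite flow_opE//.
  have -> : (fun j => flop (dyad D j) (N j) g x) = (fun j => mean P (g \o X x (s j))).
    by apply/funext => j; rewrite flow_opE//; exact: dom_dyad (D_dom cm).
  apply: cvg_mean.
  - by move=> j; apply: (measurableT_comp mg); exact: mX.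
  - by apply: (measurableT_comp mg); exact: mX.
  - by move=> j w; exact: g01.
  - by move=> w; exact: g01.
  have [_ pc _ _] := hX x; apply: filterS pc => w /within_path_continuous xc.
  apply: blip_continuous => //; apply/cvg_enormP; apply/cvgrPdist_lt => e e0.
  have [u u0 hu] := xc t e t0 e0.
  have := dyad_cvg0 D => /cvgrPdist_lt /(_ u u0); apply: filterS => j.
  rewrite !sub0r !normrN => hj; rewrite ger0_norm//; apply: hu => //.
  have /andP[a1 a2] := sj j; rewrite ler0_norm ?subr_le0// opprB ltrBlDl.
  by rewrite (lt_trans a2)// ltrD2l (le_lt_trans (ler_norm _)).
have inv j : mean sde_stat (flop (dyad D j) (N j) g) = mean sde_stat g.
  by rewrite /sde_stat !mean_law//; exact: (stat0_invariant cm ns).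
have : mean sde_stat (flop (dyad D j) (N j) g) @[j --> \oo] --> mean sde_stat (flop dl n g).
  apply: cvg_mean.
  - by move=> j; exact: blip_measurable (bD j).
  - exact: blip_measurable bT.
  - by move=> j x; have [h _] := bD j; exact: h.
  - by move=> x; have [h _] := bT; exact: h.
  - by apply: aeW => x; exact: cvx.
under eq_fun do rewrite inv.
by move=> h; apply/esym; apply: (cvg_unique _ _ h) => //; exact: cvg_cst.
Qed.

Lemma sde_stat_unique (p : probability V R) : sde_invariant P X p ->
  forall S, measurable S -> p S = sde_stat S.
Proof.
move=> /sde_invariantP ip; have /sde_invariantP i0 := sde_stat_invariant.
have hD := D_dom cm.
apply: (@invariant_unique _ _ _ _ (fun n g => flop D n g)).
- by move=> g n; exact: (blip_flow_op cm ns n hD).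
- by move=> g n bg; exact: ip.
- by move=> g n bg; exact: i0.
- by move=> g x bg; exact: (flow_op_forget cm ns x hD bg).
Qed.

Lemma sde_stat_moment2 : finite_second_moment sde_stat.
Proof.
rewrite /finite_second_moment /sde_stat ge0_integral_law//.
- by have [] := stat0_cvg cm ns.
- by apply/measurable_EFinP; apply: measurable_funX; exact: measurable_enorm.
- by move=> x; rewrite lee_fin sqr_ge0.
Qed.

Definition chain_stat dl (hd : 0 < dl <= D) : probability V R := law P (measurable_stat cm ns hd).

Lemma chain_stat_moment2 dl (hd : 0 < dl <= D) : finite_second_moment (chain_stat hd).
Proof.
rewrite /finite_second_moment /chain_stat ge0_integral_law//.
- by have [] := stat_cvg cm ns hd.
- by apply/measurable_EFinP; apply: measurable_funX; exact: measurable_enorm.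
- by move=> x; rewrite lee_fin sqr_ge0.
Qed.

Definition chain_map dl n (z : V * Om) : V :=
  fwd (scheme_noise Wp dl) (@step R d sigma mn dl) z.1 n z.2.

Lemma measurable_chain_map dl n : 0 < dl <= D -> measurable_fun setT (chain_map dl n).
Proof.
by move=> hd; exact: (measurable_fwd_joint (ns_noise ns (dom_gt0 hd)) (measurable_step cm hd)).
Qed.

Section scheme.
Variables (dl : R) (hd : 0 < dl <= D) (pid bd : V -> V).
Hypothesis mnE : forall x, mn dl x = pid x + dl *: bd (pid x).

Lemma chain_lawE (mu : probability V R) n :
  chain_law P Wp pid bd sigma dl mu n = law (prodp mu P) (measurable_chain_map n hd) :> (set V -> \bar R).
Proof.
rewrite /chain_law; apply/funext => S; rewrite lawE /pushforward; congr (prodp mu P (_ @^-1` S)).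
apply/funext => z; rewrite /chain_map; elim: n => //= n ->.
by rewrite /step /= mnE.
Qed.

Lemma chain_invariantP (p : probability V R) : chain_invariant P Wp pid bd sigma dl p <->
  forall n g, blip g ->
    mean p (@chain_op R d sigma mn dO Om P (scheme_noise Wp) dl n g) = mean p g.
Proof.
split=> [ip n g bg|h n S mS].
  apply: ((random_map_invariantP P (measurable_chain_map n hd) p).1 _ g bg) => S mS.
  by rewrite -(ip n S mS) chain_lawE.
rewrite chain_lawE; apply: (random_map_invariantP P (measurable_chain_map n hd) p).2 => //.
by move=> g bg; exact: h.
Qed.

Lemma chain_stat_invariant : chain_invariant P Wp pid bd sigma dl (chain_stat hd).
Proof.
apply/chain_invariantP => n g bg; rewrite /chain_stat !mean_law//.
  exact: (stat_invariant cm ns).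
exact: (blip_chain_op cm ns).
Qed.

Lemma chain_stat_unique (p : probability V R) : chain_invariant P Wp pid bd sigma dl p ->
  forall S, measurable S -> p S = chain_stat hd S.
Proof.
move=> /chain_invariantP ip; have /chain_invariantP i0 := chain_stat_invariant.
apply: (@invariant_unique _ _ _ _
  (fun n g => @chain_op R d sigma mn dO Om P (scheme_noise Wp) dl n g)).
- by move=> g n; exact: (blip_chain_op cm ns n hd).
- by move=> g n bg; exact: ip.
- by move=> g n bg; exact: i0.
- by move=> g x bg; exact: (chain_op_forget cm ns x hd bg).
Qed.

End scheme.

End sde.

(** * Wasserstein estimates *)

Section ereal_affine.
Context {R : realType}.
Local Open Scope ereal_scope.

Lemma ereal_inf_affine (S : set (\bar R)) (x : \bar R) (a k : R) : (0 < a)%R ->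
  (forall c, S c -> x <= a%:E * c + k%:E) -> x <= a%:E * ereal_inf S + k%:E.
Proof.
move=> a0 h; rewrite -leeBlDr// -lee_pdivrMl//; apply: le_ereal_inf_tmp => c Sc.
by rewrite lee_pdivrMl// leeBlDr//; exact: h.
Qed.

(** Subadditivity of the square root. Strict positivity of [a] serves the infinite case, where the
    right-hand side must be infinite too. *)
Lemma sqrte_affine (x y : \bar R) (a k : R) : (0 <= a)%R -> (0 <= k)%R -> 0 <= y ->
  x <= a%:E * y + k%:E -> (0 < a)%R ->
  sqrte x <= (Num.sqrt a)%:E * sqrte y + (Num.sqrt k)%:E.
Proof.
move=> a0 k0; case: y => [y| |]// y0; last first.
  by move=> _ a1; rewrite /= gt0_muley ?addye ?leey// lte_fin sqrtr_gt0.
rewrite lee_fin in y0 => xle _.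
have ay0 : (0 <= a * y)%R by rewrite mulr_ge0.
have k1 : 0 <= a%:E * y%:E + k%:E by rewrite -EFinM -EFinD lee_fin addr_ge0.
apply: (@le_trans _ _ (sqrte (a%:E * y%:E + k%:E))); first by rewrite lee_sqrt.
rewrite -EFinM -EFinD /= -EFinM -EFinD lee_fin -sqrtrM//.
rewrite -(@ler_pXn2r _ 2)// ?nnegrE ?addr_ge0 ?sqrtr_ge0//.
rewrite sqr_sqrtr ?addr_ge0// sqrrD !sqr_sqrtr// lerD2r lerDl.
by rewrite mulrn_wge0// mulr_ge0// sqrtr_ge0.
Qed.

End ereal_affine.

Section marginals.
Context {R : realType} {d1 d2 d3 : measure_display}.
Context {T1 : measurableType d1} {T2 : measurableType d2} {Om : measurableType d3}.
Variables (Q : probability T1 R) (mu : probability T2 R) (f : T1 -> T2).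
Hypotheses (mf : measurable_fun setT f) (Qf : forall A, measurable A -> Q (f @^-1` A) = mu A).
Local Open Scope ereal_scope.

Lemma integral_marginal (h : T2 -> \bar R) : measurable_fun setT h -> (forall y, 0 <= h y) ->
  \int[Q]_x h (f x) = \int[mu]_y h y.
Proof.
move=> mh h0; rewrite -(ge0_integral_law Q mf mh h0).
by apply: eq_measure_integral => A mA _; exact: etrans (lawE Q mf A) (Qf mA).
Qed.

Lemma prodp_marginal (P : probability Om R) S : measurable S ->
  prodp Q P ((fun z => (f z.1, z.2)) @^-1` S) = prodp mu P S.
Proof.
move=> mS.
have mF : measurable_fun setT (fun z : T1 * Om => (f z.1, z.2)).
  by apply: measurable_fun_pair => //; exact: measurableT_comp mf measurable_fst.
rewrite -(lawE (prodp Q P) mF); apply/esym.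
apply: (@product_measure_unique _ _ _ _ _ mu P (law (prodp Q P) mF)) => // A B mA mB.
apply: etrans (lawE (prodp Q P) mF (A `*` B)) _.
have mA' : measurable (f @^-1` A) by rewrite -[X in measurable X]setTI; exact: mf.
by apply: etrans (prodpE Q P mA' mB) _; rewrite Qf.
Qed.

End marginals.

Section wasserstein.
Context {R : realType} {d : nat}.
Local Notation V := 'rV[R]_d.
Local Open Scope ereal_scope.

(** The square of [W2]. Estimates are affine at this level, and the root is taken once at the
    end. *)
Definition transport_cost (mu nu : set V -> \bar R) : \bar R := ereal_inf
  [set \int[g]_z (enorm (z.1 - z.2) ^+ 2)%:E | g in couplings mu nu].

Lemma W2E mu nu : W2 mu nu = sqrte (transport_cost mu nu).
Proof. by []. Qed.

Lemma transport_cost_ge0 mu nu : 0 <= transport_cost mu nu.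
Proof.
apply: le_ereal_inf_tmp => c [g _ <-].
by apply: integral_ge0 => z _; rewrite lee_fin sqr_ge0.
Qed.

Lemma eq_transport_cost (mu mu' nu : set V -> \bar R) : (forall A, measurable A -> mu A = mu' A) ->
  transport_cost mu nu = transport_cost mu' nu.
Proof.
move=> mm; rewrite /transport_cost (_ : couplings mu nu = couplings mu' nu)//.
by apply/seteqP; split=> g gc A mA; have [h1 h2] := gc A mA; rewrite h1 h2 mm.
Qed.

Let m1 : measurable_fun setT (fun z : V * V => z.1) := measurable_fst.
Let m2 : measurable_fun setT (fun z : V * V => z.2) := measurable_snd.

Lemma coupling_fst (mu nu : set V -> \bar R) (g : probability (V * V)%type R) A :
  couplings mu nu g -> measurable A -> g ((fun z => z.1) @^-1` A) = mu A.
Proof.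
move=> gc mA; have [<- _] := gc A mA; congr (g _).
by apply/seteqP; split=> z //= [].
Qed.

Lemma coupling_snd (mu nu : set V -> \bar R) (g : probability (V * V)%type R) A :
  couplings mu nu g -> measurable A -> g ((fun z => z.2) @^-1` A) = nu A.
Proof.
move=> gc mA; have [_ <-] := gc A mA; congr (g _).
by apply/seteqP; split=> z //= [].
Qed.

Lemma transport_costC_le (mu nu : set V -> \bar R) :
  transport_cost nu mu <= transport_cost mu nu.
Proof.
apply: le_ereal_inf_tmp => c [g gc <-].
have msw : measurable_fun setT (fun z : V * V => (z.2, z.1)) by exact: measurable_fun_pair.
have swc : couplings nu mu (law g msw).
  move=> A mA; split.
    apply: etrans (lawE g msw _) _; rewrite -(coupling_snd gc mA); congr (g _).
    by apply/seteqP; split=> z //= [].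
  apply: etrans (lawE g msw _) _; rewrite -(coupling_fst gc mA); congr (g _).
  by apply/seteqP; split=> z //= [].
apply: ge_ereal_inf; exists (\int[law g msw]_z (enorm (z.1 - z.2) ^+ 2)%:E).
  by exists (law g msw); [exact: swc|exact: erefl].
rewrite ge0_integral_law; last 2 first.
- exact: measurable_sqdist.
- by move=> z; exact: sqdist_ge0.
by under eq_integral do rewrite enormB.
Qed.

Lemma transport_costC (mu nu : set V -> \bar R) : transport_cost mu nu = transport_cost nu mu.
Proof. by apply/eqP; rewrite eq_le !transport_costC_le. Qed.

(** The independent coupling has finite cost. Finiteness is what lets [W2_stat] send a contraction
    factor to zero. *)
Lemma transport_cost_fin (mu nu : probability V R) :
  finite_second_moment mu -> finite_second_moment nu -> transport_cost mu nu < +oo.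
Proof.
move=> fm fn.
have gc : couplings mu nu (prodp mu nu).
  move=> A mA; split.
    by apply: etrans (prodpE mu nu mA measurableT) _; rewrite probability_setT mule1.
  by apply: etrans (prodpE mu nu measurableT mA) _; rewrite probability_setT mul1e.
apply: (@le_lt_trans _ _ (\int[prodp mu nu]_z (enorm (z.1 - z.2) ^+ 2)%:E)).
  by apply: ereal_inf_lbound; exists (prodp mu nu).
have mE : measurable_fun setT (fun x : V => (enorm x ^+ 2)%:E).
  by apply/measurable_EFinP; apply: measurable_funX; exact: measurable_enorm.
have E0 (x : V) : 0 <= (enorm x ^+ 2)%:E by rewrite lee_fin sqr_ge0.
apply: (@le_lt_trans _ _ (\int[prodp mu nu]_z
    (2%:E * ((enorm z.1 ^+ 2)%:E + (enorm z.2 ^+ 2)%:E)))).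
  apply: ge0_le_integral => //.
  - exact: measurable_sqdist.
  - apply: emeasurable_funM; first exact: measurable_cst.
    by apply: emeasurable_funD; exact: (measurableT_comp mE).
  - move=> z _; rewrite -EFinD -EFinM lee_fin.
    have h1 := ler_enormB z.1 z.2; have h0 := enorm_ge0 (z.1 - z.2).
    have : (enorm (z.1 - z.2) ^+ 2 <= (enorm z.1 + enorm z.2) ^+ 2)%R.
      by apply: lerXn2r; rewrite ?nnegrE ?addr_ge0// ?enorm_ge0.
    by have := sqr_ge0 (enorm z.1 - enorm z.2); clear; lra.
rewrite ge0_integralZl//; last 2 first.
- by apply: emeasurable_funD; exact: (measurableT_comp mE).
- by move=> z _; rewrite adde_ge0.
rewrite ge0_integralD//; last 2 first.
- exact: (measurableT_comp mE).
- exact: (measurableT_comp mE).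
rewrite (integral_marginal (f := fun z : V * V => z.1) m1 (fun A mA => coupling_fst gc mA) mE E0).
rewrite (integral_marginal (f := fun z : V * V => z.2) m2 (fun A mA => coupling_snd gc mA) mE E0).
by apply: lte_mul_pinfty => //; exact: lte_add_pinfty.
Qed.

End wasserstein.

(** * Coupling the chain with the flow *)

Section coupling.
Context {R : realType} {d : nat}.
Local Notation V := 'rV[R]_d.
Context {sigma D lam gam C K rho B Wm Lw Ce : R} {ke : nat} {quad : bool}.
Context {b : V -> V} {A : V -> 'M[R]_d} {W : V -> R} {mn : R -> V -> V}.
Hypothesis cm : chain_model sigma D lam gam C K rho B Wm Lw Ce ke quad b A W mn.
Context {dO : measure_display} {Om : measurableType dO}.
Context {P : probability Om R} {filt : R -> nat -> set (set Om)}.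
Context {Wp : R -> Om -> V} {nu : R -> probability V R}.
Hypothesis ns : noise_system P filt (scheme_noise Wp) nu.
Context {F : R -> set (set Om)} {X : V -> R -> Om -> V}.
Hypothesis hX : forall x, sde_solution P F Wp b sigma (cst x) (X x).
Hypothesis mX : forall x t, 0 <= t -> measurable_fun setT (X x t).

Local Notation p0 := (sde_stat cm ns).
Local Notation flw := (@flow R d sigma mn dO Om (scheme_noise Wp)).
Local Notation cmap := (@chain_map R d sigma mn dO Om Wp).
Local Notation claw mu n hd := (law (prodp mu P) (measurable_chain_map cm ns n hd)).
Local Notation rate n dl := (2 * (Wm * expR (- lam * (n%:R * dl)))).

Lemma rate_gt0 n dl : 0 < rate n dl.
Proof. by rewrite !mulr_gt0 ?expR_gt0//; exact: lt_le_trans (Wm_ge1 cm). Qed.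

(** The chain from the first coordinate is compared with the flow from the second through the chain
    from the second. Contraction handles the first leg, the strong error the second, paid at a point
    of law [p0], so only moments of [p0] enter the constant. The flow ends in law [p0] by
    invariance, which makes the end points a coupling. *)
Lemma transport_cost_step : exists Kc : R, 0 <= Kc /\
  forall dl (hd : 0 < dl <= D) n (mu : probability V R),
  (transport_cost (claw mu n hd) p0 <=
   (rate n dl)%:E * transport_cost mu p0 + (Kc * (dl `^ gam) ^+ 2)%:E)%E.
Proof.
have [Cf [kf [Cf0 hf]]] := flow_cvg cm ns.
have [Cm [Cm0 [hm _]]] := stat0_moment cm ns kf.
exists (2 * Cf * Cm); split=> [|dl hd n mu]; first by rewrite !mulr_ge0.
apply: ereal_inf_affine => [|c [g gc <-]]; first exact: rate_gt0.
have mq : measurable_fun setT (fun z : (V * V) * Om => (z.1.1, z.2)).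
  by apply: measurable_fun_pair => //; exact: (measurableT_comp measurable_fst measurable_fst).
have mq' : measurable_fun setT (fun z : (V * V) * Om => (z.1.2, z.2)).
  by apply: measurable_fun_pair => //; exact: (measurableT_comp measurable_snd measurable_fst).
have mc := measurable_chain_map cm ns n hd.
have mfl := measurable_flow cm ns n hd.
have mPhi : measurable_fun setT (fun z : (V * V) * Om => (cmap dl n (z.1.1, z.2), flw dl n z.1.2 z.2)).
  by apply: measurable_fun_pair; [exact: (measurableT_comp mc mq)|exact: (measurableT_comp mfl mq')].
have g1 S (mS : measurable S) := coupling_fst gc mS.
have g2 S (mS : measurable S) := coupling_snd gc mS.
apply: ge_ereal_inf.
have gc' : couplings (claw mu n hd) p0 (law (prodp g P) mPhi).
  move=> S mS; split; apply: (etrans (lawE (prodp g P) mPhi _)).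
    apply/esym; apply: (etrans (lawE (prodp mu P) mc S)); apply/esym.
    rewrite (_ : _ @^-1` _ = (fun z : (V * V) * Om => (z.1.1, z.2)) @^-1` (cmap dl n @^-1` S)).
      apply: (prodp_marginal measurable_fst g1).
      by rewrite -[X in measurable X]setTI; exact: mc.
    by apply/seteqP; split=> z //= [].
  rewrite (_ : _ @^-1` _ = (fun z : (V * V) * Om => (z.1.2, z.2)) @^-1`
      ((fun z => flw dl n z.1 z.2) @^-1` S)); last first.
    by apply/seteqP; split=> z //= [].
  apply: (etrans (prodp_marginal measurable_snd g2 P _)).
    by rewrite -[X in measurable X]setTI; exact: mfl.
  rewrite -(lawE (prodp p0 P) mfl) -(semigroup_flow cm ns hX mX)//.
  apply: (sde_stat_invariant cm ns hX mX) => //.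
  by rewrite mulr_ge0// ltW// (dom_gt0 hd).
exists (\int[law (prodp g P) mPhi]_z (enorm (z.1 - z.2) ^+ 2)%:E)%E.
  by exists (law (prodp g P) mPhi); [exact: gc'|exact: erefl].
rewrite ge0_integral_law; last 2 first.
- exact: measurable_sqdist.
- by move=> z; exact: sqdist_ge0.
rewrite (ge0_integral_prodp g P
  (f := fun z : (V * V) * Om => (enorm (cmap dl n (z.1.1, z.2) - flw dl n z.1.2 z.2) ^+ 2)%:E)); last 2 first.
- exact: (measurableT_comp measurable_sqdist mPhi).
- by move=> z; rewrite lee_fin sqr_ge0.
set k := 2 * Cf * (dl `^ gam) ^+ 2.
have k0 : 0 <= k by rewrite /k; nonneg.
have r0 := rate_gt0 n dl.
have mk : measurable_fun setT (fun x : V => ((1 + enorm x) ^+ kf)%:E).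
  apply/measurable_EFinP; apply: measurable_funX; apply: measurable_funD.
    exact: measurable_cst.
  exact: measurable_enorm.
have k1 (x : V) : (0 <= ((1 + enorm x) ^+ kf)%:E)%E.
  by rewrite lee_fin exprn_ge0// addr_ge0 ?enorm_ge0.
have mk2 : measurable_fun setT (fun z : V * V => ((1 + enorm z.2) ^+ kf)%:E).
  exact: (measurableT_comp mk measurable_snd).
apply: (@le_trans _ _ (\int[g]_z ((rate n dl)%:E * (enorm (z.1 - z.2) ^+ 2)%:E +
    k%:E * ((1 + enorm z.2) ^+ kf)%:E))%E).
  apply: ge0_le_integralT => [z|z].
    by apply: integral_ge0 => w _; rewrite lee_fin sqr_ge0.
  have t1 := fwd_contract cm ns hd n z.1 z.2.
  (* Refinement level 0, that is, the chain of step [dl] itself against the flow. *)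
  have [_ /(_ 0%N) t2] := hf dl n z.2 hd.
  rewrite /fine_chain /dyad expr0 divr1 expn0 muln1 expr0 mulr1 in t2.
  have mz (x : V) : measurable_fun setT (fun w => cmap dl n (x, w)).
    exact: (measurableT_comp mc (pair1_measurable x)).
  have t3 : (\int[P]_w (enorm (cmap dl n (z.2, w) - flw dl n z.2 w) ^+ 2)%:E <=
      (Cf * (1 + enorm z.2) ^+ kf * (dl `^ gam) ^+ 2)%:E)%E.
    by under eq_integral do rewrite enormB; exact: t2.
  have := integral_sqr_triangle (mz z.1) (mz z.2) (measurable_flow_r cm ns n z.2 hd) t1 t3.
  move=> /le_trans; apply; rewrite -!EFinM -EFinD lee_fin /k le_eqVlt; apply/orP; left; apply/eqP.
  by ring.
rewrite ge0_integralD//; last 4 first.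
- by move=> z _; rewrite -EFinM lee_fin mulr_ge0 ?sqr_ge0// ltW.
- by apply: emeasurable_funM; [exact: measurable_cst|exact: measurable_sqdist].
- by move=> z _; apply: mule_ge0; [rewrite lee_fin|exact: k1].
- by apply: emeasurable_funM => //; exact: measurable_cst.
rewrite ge0_integralZl//; last 3 first.
- exact: measurable_sqdist.
- by move=> z _; rewrite lee_fin sqr_ge0.
- by rewrite lee_fin ltW.
rewrite leeD2l// ge0_integralZl ?lee_fin//.
rewrite (integral_marginal (f := fun z : V * V => z.2) measurable_snd g2 mk k1).
rewrite /sde_stat ge0_integral_law//.
apply: (@le_trans _ _ (k%:E * Cm%:E)%E); first by rewrite lee_wpmul2l ?lee_fin.
by rewrite -EFinM lee_fin /k le_eqVlt; apply/orP; left; apply/eqP; ring.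
Qed.

Section scheme.
Context {Kc : R}.
Hypothesis (Kc0 : 0 <= Kc).
Hypothesis hK : forall dl (hd : 0 < dl <= D) n (mu : probability V R),
  (transport_cost (claw mu n hd) p0 <=
   (rate n dl)%:E * transport_cost mu p0 + (Kc * (dl `^ gam) ^+ 2)%:E)%E.
Variables (dl : R) (hd : 0 < dl <= D) (pid bd : V -> V).
Hypothesis mnE : forall x, mn dl x = pid x + dl *: bd (pid x).

Let sqrtK : Num.sqrt (Kc * (dl `^ gam) ^+ 2) = Num.sqrt Kc * dl `^ gam.
Proof. by rewrite sqrtrM// sqrtr_sqr ger0_norm// powR_ge0. Qed.

Lemma W2_chain n (mu : probability V R) :
  (W2 (chain_law P Wp pid bd sigma dl mu n) p0 <=
   (Num.sqrt (2 * Wm) * expR (- (1 / 2) * lam * (n%:R * dl)))%:E * W2 mu p0 +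
   (Num.sqrt Kc * dl `^ gam)%:E)%E.
Proof.
have r0 := rate_gt0 n dl.
rewrite (chain_lawE cm ns hd mnE) !W2E -sqrtK.
have -> : Num.sqrt (2 * Wm) * expR (- (1 / 2) * lam * (n%:R * dl)) = Num.sqrt (rate n dl).
  have -> : rate n dl = 2 * Wm * expR (- (1 / 2) * lam * (n%:R * dl)) ^+ 2.
    by rewrite -expRM_natl -mulrA; congr (_ * (_ * expR _)); field.
  have w0 : 0 <= 2 * Wm by rewrite mulr_ge0// (le_trans _ (Wm_ge1 cm)).
  by rewrite [RHS]sqrtrM// sqrtr_sqr ger0_norm// expR_ge0.
apply: sqrte_affine => //; rewrite ?(ltW r0)//.
- by rewrite mulr_ge0// sqr_ge0.
- exact: transport_cost_ge0.
Qed.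

(** Starting the chain from its own invariant law leaves the left-hand side of the step estimate
    unchanged while the factor [rate n dl] tends to zero. *)
Lemma W2_stat : (W2 p0 (chain_stat cm ns hd) <= (Num.sqrt Kc * dl `^ gam)%:E)%E.
Proof.
have d0 := dom_gt0 hd.
rewrite W2E transport_costC -sqrtK.
have T0 := transport_cost_ge0 (chain_stat cm ns hd) p0.
have TF : (transport_cost (chain_stat cm ns hd) p0 < +oo)%E.
  by apply: transport_cost_fin; [exact: chain_stat_moment2|exact: sde_stat_moment2].
have h n : (transport_cost (chain_stat cm ns hd) p0 <=
   (rate n dl)%:E * transport_cost (chain_stat cm ns hd) p0 + (Kc * (dl `^ gam) ^+ 2)%:E)%E.
  apply: le_trans (hK hd n (chain_stat cm ns hd)).
  rewrite (@eq_transport_cost _ _ (claw (chain_stat cm ns hd) n hd) (chain_stat cm ns hd))//.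
  move=> S mS; rewrite -(chain_stat_invariant cm ns hd mnE n mS).
  by rewrite (chain_lawE cm ns hd mnE).
have k0 : 0 <= Kc * (dl `^ gam) ^+ 2 by rewrite mulr_ge0// sqr_ge0.
move: T0 TF h; case: (transport_cost _ _) => [t| |]//; rewrite lee_fin => t0 _ h.
rewrite -[leLHS]/((Num.sqrt t)%:E) lee_fin ler_wsqrtr//.
have c : Wm * expR (- lam * (n%:R * dl)) * (2 * t) + Kc * (dl `^ gam) ^+ 2 @[n --> \oo] -->
    0 + Kc * (dl `^ gam) ^+ 2.
  by apply: cvgD; [exact: (cvg_contract cm (2 * t) d0)|exact: cvg_cst].
rewrite add0r in c; rewrite -(cvg_lim (@Rhausdorff R) c).
apply: limr_ge; first by apply/cvg_ex; eexists; exact: c.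
apply: nearW => n.
have := h n; rewrite -EFinM -EFinD lee_fin => /le_trans; apply.
by rewrite lerD2r le_eqVlt; apply/orP; left; apply/eqP; ring.
Qed.

End scheme.

End coupling.

(** * The hypotheses of the theorem *)

Section taylor.
Context {R : realType} {d : nat}.
Local Notation V := 'rV[R]_d.

Lemma opnorm_ub (A : 'M[R]_d) : has_ubound [set enorm (v *m A) | v in [set v : V | enorm v <= 1]].
Proof.
exists (\sum_j \sum_i `|A i j|) => _ [v /= v1 <-].
apply: (le_trans (enorm_le_sum _)); apply: ler_sum => j _; rewrite mxE.
apply: (le_trans (ler_norm_sum _ _ _)); apply: ler_sum => i _.
rewrite normrM ler_piMl//; exact: le_trans (coord_le_enorm v i) v1.
Qed.

Lemma opnorm_le (A : 'M[R]_d) (v : V) : enorm (v *m A) <= opnorm A * enorm v.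
Proof.
have [v0|v0] := eqVneq (enorm v) 0.
  by rewrite (enorm_eq0 v0) mul0mx enorm0 mulr0.
have vp : 0 < enorm v by rewrite lt0r v0 enorm_ge0.
rewrite -ler_pdivrMr//.
have -> : enorm (v *m A) / enorm v = enorm (((enorm v)^-1 *: v) *m A).
  by rewrite -scalemxAl enormZ ger0_norm ?invr_ge0 ?enorm_ge0// mulrC.
apply: ub_le_sup; first exact: opnorm_ub.
exists ((enorm v)^-1 *: v) => //=.
by rewrite enormZ ger0_norm ?invr_ge0 ?enorm_ge0// mulVf.
Qed.

Lemma cvg_inner (I : Type) (F : set_system I) {FF : Filter F} (u : I -> V) (r l : V) :
  u x @[x --> F] --> l -> inner r (u x) @[x --> F] --> inner r l.
Proof.
move=> /cvg_enormP h; apply/cvgrPdist_le => e e0.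
have r1 : 0 < enorm r + 1 by rewrite ltr_wpDl// enorm_ge0.
have /cvgrPdist_le /(_ (e / (enorm r + 1))) := h; rewrite divr_gt0// => /(_ isT).
apply: filterS => i; rewrite sub0r normrN ger0_norm ?enorm_ge0// ler_pdivlMr// => hi.
rewrite -innerNr -innerDr; apply: (le_trans (norm_inner_le _ _)).
by rewrite enormB (le_trans _ hi)// mulrC ler_wpM2l ?enorm_ge0// lerDl ler01.
Qed.

Lemma is_derive_segment (b : V -> V) (r x v : V) (t : R) :
  differentiable b (x + t *: v) ->
  is_derive t 1 (fun s => inner r (b (x + s *: v))) (inner r (v *m 'J b (x + t *: v))).
Proof.
move=> db; have dv := deriveEjacobian v db.
have cb : h^-1 *: ((b \o shift (x + t *: v)) (h *: v) - b (x + t *: v)) @[h --> 0^'] -->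
    v *m 'J b (x + t *: v).
  by rewrite -dv; exact: diff_derivable.
have ci := cvg_inner (r := r) cb; have {}ci := ci (within_filter _ (@nbhs_filter R 0)).
have E : (fun h : R => inner r (h^-1 *: ((b \o shift (x + t *: v)) (h *: v) - b (x + t *: v)))) =
    (fun h => h^-1 *: (((fun s => inner r (b (x + s *: v))) \o shift t) (h *: 1) -
      inner r (b (x + t *: v)))).
  apply/funext => h; rewrite innerZr innerDr innerNr /=.
  have e : h *: v + (x + t *: v) = x + (h * 1 + t) *: v by rewrite mulr1 scalerDl addrCA.
  exact: (congr1 (fun z => h^-1 * (inner r (b z) - inner r (b (x + t *: v)))) e).
rewrite E in ci.
by apply: DeriveDef; [apply/cvg_ex; eexists; exact: ci|exact: (cvg_lim (@Rhausdorff R) ci)].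
Qed.

(** The remainder [r] is tested against itself: the mean value theorem applies to the scalar
    function [h] along the segment, and one factor [enorm r] cancels. *)
Lemma taylor_le (b : V -> V) (x y : V) (G : R) : (forall z, differentiable b z) ->
  (forall s : R, 0 <= s <= 1 ->
    opnorm ('J b (x + s *: (y - x)) - 'J b x) <= G * enorm (y - x)) ->
  enorm (b y - b x - (y - x) *m 'J b x) <= G * enorm (y - x) ^+ 2.
Proof.
move=> db hG; set v := y - x; set r := b y - b x - v *m 'J b x.
have [r0|r0] := eqVneq (enorm r) 0.
  rewrite r0; have := hG 0; rewrite lexx ler01 => /(_ isT).
  have := opnorm_le ('J b (x + 0 *: v) - 'J b x) v.
  rewrite scale0r addr0 subrr mulmx0 enorm0 => _ h.
  have o0 : 0 <= opnorm (0 : 'M[R]_d).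
    apply: ub_le_sup; first exact: opnorm_ub.
    by exists 0; rewrite /= ?enorm0// mul0mx enorm0.
  by rewrite expr2 mulrA mulr_ge0 ?enorm_ge0// (le_trans o0).
have rp : 0 < enorm r by rewrite lt0r r0 enorm_ge0.
pose h (s : R) := inner r (b (x + s *: v)) - s * inner r (v *m 'J b x).
have dh (s : R) : is_derive s 1 h (inner r (v *m ('J b (x + s *: v) - 'J b x))).
  rewrite mulmxBr innerDr innerNr; apply: is_deriveB; first exact: is_derive_segment.
  by apply: is_derive_eq; rewrite scaler0 add0r; exact: mulr1.
have ch : {within `[0, 1], continuous h}.
  apply: derivable_within_continuous => s _; exact: (@ex_derive _ _ _ _ _ _ _ (dh s)).
have [c c01 hc] := MVT ltr01 (fun s _ => dh s) ch.
rewrite subr0 mulr1 /h scale1r scale0r addr0 mul1r mul0r subr0 in hc.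
have E : inner r r = inner r (v *m ('J b (x + c *: v) - 'J b x)).
  have xv : x + v = y by rewrite /v addrC subrK.
  by rewrite -hc xv {2}/r !innerDr !innerNr; ring.
rewrite -(ler_pM2l rp) -[leLHS]expr2 [leLHS]enorm_sqr E.
apply: (le_trans (inner_le _ _)); rewrite ler_pM2l// expr2 mulrA.
apply: (le_trans (opnorm_le _ _)); rewrite ler_wpM2r ?enorm_ge0//; apply: hG.
by move: c01; rewrite in_itv/= => /andP[c0 c1]; rewrite !ltW.
Qed.

End taylor.

Section growth.
Context {R : realType}.

(** A natural exponent above [l], since the moment bounds are for natural powers. *)
Definition expo (l : R) : nat := (Num.truncn l).+1.

Lemma powR_le_expr (x s l : R) : 0 <= l -> 0 <= x -> 1 + x <= s -> x `^ l <= s ^+ expo l.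
Proof.
move=> l0 x0 xs; have s1 : 1 <= s by rewrite (le_trans _ xs)// lerDl.
have s0 : 0 <= s by rewrite (le_trans ler01).
apply: (@le_trans _ _ (s `^ l)).
  by apply: ge0_ler_powR; rewrite ?nnegrE// (le_trans _ xs)// lerDr.
by rewrite -powR_mulrn// ler_powR// ltW// truncnS_gt.
Qed.

Lemma expr_growth (s c C : R) (p q : nat) : 1 <= s -> 0 <= c -> c <= C -> (p <= q)%N ->
  c * s ^+ p <= C * s ^+ q.
Proof.
move=> s1 c0 cC pq; apply: ler_pM => //.
  by rewrite exprn_ge0// (le_trans ler01).
exact: ler_weXn2l.
Qed.

Lemma powR_growth (x y s l : R) : 0 <= l -> 0 <= x -> 0 <= y -> 1 + x <= s -> 1 + y <= s ->
  1 + x `^ l + y `^ l <= 3 * s ^+ expo l.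
Proof.
move=> l0 x0 y0 xs ys; have s1 : 1 <= s by rewrite (le_trans _ xs)// lerDl.
have := powR_le_expr l0 x0 xs; have := powR_le_expr l0 y0 ys.
have : 1 <= s ^+ expo l by exact: exprn_ege1.
by clear; lra.
Qed.

Lemma powR_sqr_cancel (dl th : R) : 0 < dl -> (dl `^ (- th)) ^+ 2 * dl = dl `^ (1 - 2 * th).
Proof.
move=> d0; rewrite -powR_mulrn ?powR_ge0// -powRrM -[X in _ * X](powRr1 (ltW d0)) -powRD.
  by congr (_ `^ _); ring.
by apply/implyP => _; rewrite gt_eqF.
Qed.

Lemma powR_cancel (dl th : R) : 0 < dl -> dl * dl `^ (- th) = dl `^ (1 - th).
Proof.
move=> d0; rewrite -[X in X * _](powRr1 (ltW d0)) -powRD//.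
by apply/implyP => _; rewrite gt_eqF.
Qed.

Lemma le_powR_root (dl a e f : R) : 0 <= dl -> 0 <= a -> 0 <= e -> dl <= a `^ f -> dl `^ e <= a `^ (f * e).
Proof.
by move=> d0 a0 e0 h; rewrite powRrM; apply: ge0_ler_powR; rewrite ?nnegrE ?powR_ge0.
Qed.

End growth.

(** * From the assumptions to the chain model *)

Section model.
Context {R : realType} {d : nat}.
Local Notation V := 'rV[R]_d.
Variables (b : V -> V) (b_ pi_ : R -> V -> V) (sigma : R).
Hypothesis d1 : (1 <= d)%N.
Hypothesis hb_m : forall dl : R, 0 < dl <= 1 -> measurable_fun setT (b_ dl).
Hypothesis hpi_m : forall dl : R, 0 < dl <= 1 -> measurable_fun setT (pi_ dl).
Variables (L0 l0 : R).
Hypotheses (hL0 : 0 < L0) (hl0 : 0 <= l0).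
Hypothesis ha : forall x y : V,
  enorm (b x - b y) <= L0 * (1 + enorm x `^ l0 + enorm y `^ l0) * enorm (x - y).
Hypothesis hb0 : forall dl : R, 0 < dl <= 1 -> pi_ dl 0 = 0.
Hypothesis hb1 : forall dl : R, 0 < dl <= 1 -> forall x y : V,
  enorm (pi_ dl x - pi_ dl y) <= enorm (x - y).

Lemma retract_le dl x : 0 < dl <= 1 -> enorm (pi_ dl x) <= enorm x.
Proof. by move=> hd; have := hb1 hd x 0; rewrite hb0// !subr0. Qed.

Lemma drift_increment_le x y s : 1 + enorm x <= s -> 1 + enorm y <= s ->
  enorm (b x - b y) <= 3 * L0 * s ^+ expo l0 * enorm (x - y).
Proof.
move=> xs ys; apply: (le_trans (ha x y)); rewrite ler_wpM2r ?enorm_ge0//.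
rewrite [3 * L0]mulrC -mulrA ler_pM2l//.
by apply: powR_growth; rewrite ?enorm_ge0.
Qed.

Section consistency.
Variables (c2 l2 lb cb beta : R).
Hypotheses (c20 : 0 <= c2) (l20 : 0 <= l2) (lb0 : 0 <= lb) (cb0 : 0 <= cb) (beta0 : 0 < beta).
Hypothesis hg1 : forall dl : R, 0 < dl <= 1 -> forall x : V,
  enorm (pi_ dl x - x) <= c2 * (1 + enorm x `^ l2) * dl `^ 2.
Hypothesis hg2 : forall dl : R, 0 < dl <= 1 -> forall x : V,
  enorm (b_ dl x - b x) <= cb * (1 + enorm x `^ lb) * dl `^ beta.

(** The retraction error, taken with exponent 2, is at most [dl * dl] and so already of the required
    order. The error of [b_] is multiplied by [dl], and so is the change of [b] caused by the
    retraction. *)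
Lemma scheme_consistency : exists c : R, exists k : nat, 0 <= c /\
  forall dl x, 0 < dl <= 1 ->
  enorm (pi_ dl x + dl *: b_ dl (pi_ dl x) - x - dl *: b x) <=
  c * (1 + enorm x) ^+ k * (dl * dl `^ Num.min 1 beta).
Proof.
pose k0 := expo l0; pose k2 := expo l2; pose kb := expo lb.
exists (2 * c2 + 2 * cb + 6 * L0 * c2), (k0 + k2 + kb)%N.
have L1 := ltW hL0.
split=> [|dl x hd]; first by nonneg.
have /andP[dl0 dl1] := hd; have dl0' := ltW dl0.
set s := 1 + enorm x; have x0 := enorm_ge0 x.
have s1 : 1 <= s by rewrite lerDl.
have s0 : 0 <= s by exact: le_trans s1.
set q := dl `^ Num.min 1 beta.
have q0 : 0 <= q by exact: powR_ge0.
have dq : dl <= q.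
  rewrite -[leLHS](powRr1 dl0') /q.
  by apply: ger_powR; rewrite ?dl0// ge_min lexx.
have bq : dl `^ beta <= q by apply: ger_powR; rewrite ?dl0// ge_min lexx orbT.
have px := retract_le x hd.
have pw (y l : R) : 0 <= l -> 0 <= y -> 1 + y <= s -> 1 + y `^ l <= 2 * s ^+ expo l.
  move=> l1 y0 ys; have := powR_le_expr l1 y0 ys; have := exprn_ege1 (expo l) s1.
  by lra.
have e1 : enorm (pi_ dl x - x) <= 2 * c2 * s ^+ k2 * (dl * q).
  apply: (le_trans (hg1 hd x)); rewrite [2 * c2]mulrC -[c2 * 2 * _]mulrA.
  apply: ler_pM; rewrite ?powR_ge0//.
  - by rewrite mulr_ge0// addr_ge0// powR_ge0.
  - by rewrite ler_wpM2l//; exact: pw.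
  - by rewrite (powR_mulrn 2)// expr2 ler_wpM2l.
have e2 : enorm (b_ dl (pi_ dl x) - b (pi_ dl x)) <= 2 * cb * s ^+ kb * q.
  apply: (le_trans (hg2 hd _)); rewrite [2 * cb]mulrC -[cb * 2 * _]mulrA.
  apply: ler_pM; rewrite ?powR_ge0//.
    by rewrite mulr_ge0// addr_ge0// powR_ge0.
  by rewrite ler_wpM2l//; apply: pw; rewrite ?enorm_ge0// lerD2l.
have e3 : enorm (b (pi_ dl x) - b x) <= 3 * L0 * s ^+ k0 * (2 * c2 * s ^+ k2 * (dl * q)).
  apply: (@le_trans _ _ (3 * L0 * s ^+ k0 * enorm (pi_ dl x - x))).
    by apply: drift_increment_le; rewrite ?lerD2l.
  by rewrite ler_wpM2l//; nonneg.
have -> : pi_ dl x + dl *: b_ dl (pi_ dl x) - x - dl *: b x =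
  (pi_ dl x - x) + dl *: ((b_ dl (pi_ dl x) - b (pi_ dl x)) + (b (pi_ dl x) - b x)).
  rewrite subrKA scalerBr addrA; congr (_ - _).
  by rewrite addrAC.
have g (k : nat) : (k <= k0 + k2 + kb)%N -> s ^+ k <= s ^+ (k0 + k2 + kb) by exact: ler_weXn2l.
have g1 : s ^+ k2 <= s ^+ (k0 + k2 + kb) by apply: g; rewrite addnAC leq_addl.
have g2 : s ^+ kb <= s ^+ (k0 + k2 + kb) by apply: g; rewrite leq_addl.
have g3 : s ^+ k0 * s ^+ k2 <= s ^+ (k0 + k2 + kb) by rewrite -exprD; apply: g; rewrite leq_addr.
set S := s ^+ (k0 + k2 + kb) in g1 g2 g3 *.
apply: (le_trans (ler_enormD _ _)); rewrite enormZ ger0_norm//.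
apply: (@le_trans _ _ (2 * c2 * S * (dl * q) + dl * (2 * cb * S * q + 6 * L0 * c2 * S * q))).
  have dq0 : 0 <= dl * q by rewrite mulr_ge0.
  apply: lerD; first by apply: (le_trans e1); rewrite ler_wpM2r// ler_wpM2l// mulr_ge0.
  rewrite ler_wpM2l//; apply: (le_trans (ler_enormD _ _)); apply: lerD.
    by apply: (le_trans e2); rewrite ler_wpM2r// ler_wpM2l// mulr_ge0.
  apply: (le_trans e3).
  have -> : 3 * L0 * s ^+ k0 * (2 * c2 * s ^+ k2 * (dl * q)) =
    6 * L0 * c2 * (s ^+ k0 * s ^+ k2) * (dl * q) by ring.
  apply: ler_pM => //; try by nonneg.
    by rewrite ler_wpM2l//; nonneg.
  by rewrite ler_piMl.
rewrite le_eqVlt; apply/orP; left; apply/eqP; ring.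
Qed.

End consistency.

Section expansion.
Variables (quad : bool) (L6 q : R).
Hypothesis hh : quad -> [/\ 0 <= L6, 0 <= q, (forall x : V, differentiable b x) &
  forall x y : V, opnorm (jacobian b x - jacobian b y) <=
    L6 * (1 + enorm x `^ q + enorm y `^ q) * enorm (x - y)].

Definition linear_part (x : V) : 'M[R]_d := if quad then jacobian b x else 0.

Lemma drift_expansion : exists c : R, exists k : nat, 0 <= c /\
  (forall x v, enorm (v *m linear_part x) <= c * (1 + enorm x) ^+ k * enorm v) /\
  (forall x y, enorm (b y - b x - (y - x) *m linear_part x) <=
    c * (1 + enorm x + enorm y) ^+ k * enorm (y - x) ^+ (if quad then 2 else 1)).
Proof.
rewrite /linear_part; case: quad hh => [/(_ isT)[hL hq db hJ]|_]; last first.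
  exists (3 * L0), (expo l0); split; first by rewrite mulr_ge0// ltW.
  split=> x y; first by rewrite mulmx0 enorm0; nonneg; exact: enorm_ge0.
  rewrite mulmx0 subr0 expr1.
  by apply: drift_increment_le; [rewrite -addrA lerD2l lerDr|rewrite lerDl]; exact: enorm_ge0.
have o0 : 0 <= opnorm (jacobian b 0).
  apply: ub_le_sup; first exact: opnorm_ub.
  by exists 0; rewrite /= ?enorm0// mul0mx enorm0.
have hJ' x y s : 1 + enorm x <= s -> 1 + enorm y <= s ->
    opnorm (jacobian b x - jacobian b y) <= 3 * L6 * s ^+ expo q * enorm (x - y).
  move=> xs ys; apply: (le_trans (hJ x y)); rewrite ler_wpM2r ?enorm_ge0//.
  rewrite [3 * L6]mulrC -mulrA ler_wpM2l//.
  by apply: powR_growth; rewrite ?enorm_ge0.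
exists (3 * L6 + opnorm (jacobian b 0)), (expo q).+1; split; first by nonneg.
split=> [x v|x y].
  have x0 := enorm_ge0 x; have v0 := enorm_ge0 v.
  set s := 1 + enorm x; have s1 : 1 <= s by rewrite lerDl.
  have h1 : enorm (v *m (jacobian b x - jacobian b 0)) <= 3 * L6 * s ^+ (expo q).+1 * enorm v.
    apply: (le_trans (opnorm_le _ _)); rewrite ler_wpM2r//.
    apply: (le_trans (hJ' x 0 s _ _)) => //; first by rewrite enorm0 addr0.
    rewrite subr0 exprSr mulrA ler_wpM2l ?lerDr//.
    by have ss := le_trans ler01 s1; nonneg.
  have h2 := opnorm_le (jacobian b 0) v.
  have -> : v *m jacobian b x = v *m (jacobian b x - jacobian b 0) + v *m jacobian b 0.
    by rewrite mulmxBr subrK.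
  apply: (le_trans (ler_enormD _ _)); rewrite -mulrA mulrDl; apply: lerD.
    by rewrite mulrA.
  apply: (le_trans h2); rewrite ler_wpM2l// ler_peMl//; exact: exprn_ege1.
have x0 := enorm_ge0 x; have y0 := enorm_ge0 y; have xy0 := enorm_ge0 (y - x).
set s := 1 + enorm x + enorm y.
have s1 : 1 <= s by rewrite /s -addrA lerDl addr_ge0.
apply: (@le_trans _ _ (3 * L6 * s ^+ expo q * enorm (y - x) ^+ 2)).
  apply: taylor_le => // t /andP[t0 t1].
  have zx : x + t *: (y - x) - x = t *: (y - x) by rewrite addrAC subrr add0r.
  apply: (le_trans (hJ' _ _ s _ _)).
  - have -> : x + t *: (y - x) = (1 - t) *: x + t *: y.
      by rewrite scalerBr scalerBl scale1r addrA addrAC.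
    rewrite /s -addrA lerD2l; apply: (le_trans (ler_enormD _ _)); rewrite !enormZ.
    rewrite !ger0_norm ?subr_ge0//; apply: lerD; rewrite ler_piMl//.
    by rewrite lerBlDr lerDl.
  - by rewrite lerDl.
  rewrite zx enormZ ger0_norm// ler_wpM2l//; last by rewrite ler_piMl.
  by have ss := le_trans ler01 s1; nonneg.
rewrite ler_wpM2r ?sqr_ge0//; apply: expr_growth => //; first by nonneg.
by rewrite lerDl.
Qed.

End expansion.

Variables (rho C K KR theta delta_R : R).
Hypotheses (hrho : 0 < rho) (hC : 0 < C) (hKR : 0 < KR) (hK : 0 < K).
Hypotheses (htheta : 0 <= theta < 1 / 2) (hdeltaR : 0 < delta_R <= 1).
Hypothesis hc1 : forall dl : R, 0 < dl <= delta_R -> forall x y : V,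
  enorm x <= rho -> enorm y <= rho ->
  enorm (b_ dl (pi_ dl x) - b_ dl (pi_ dl y)) <= C * enorm (x - y).
Hypothesis hc2 : forall dl : R, 0 < dl <= delta_R -> forall x y : V,
  rho < enorm x \/ rho < enorm y ->
  enorm (b_ dl (pi_ dl x) - b_ dl (pi_ dl y)) <= KR * dl `^ (- theta) * enorm (x - y) /\
  inner (pi_ dl x - pi_ dl y) (b_ dl (pi_ dl x) - b_ dl (pi_ dl y)) <=
    - K * enorm (pi_ dl x - pi_ dl y) ^+ 2.
Variables (psi1 psi2 : R -> R) (R0 dstar : R).
Hypothesis hpsi1_pos : forall r : R, 0 <= r -> 0 < psi1 r.
Hypothesis hpsi2_pos : forall r : R, 0 <= r -> 0 < psi2 r.
Hypothesis hd2 : forall dl : R, 0 < dl <= 1 -> forall (x : V) (r : R), 0 <= r ->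
  enorm (b_ dl (pi_ dl x)) <=
    psi1 r + psi2 r * dl `^ (- theta) * enorm (pi_ dl x) * (r < enorm (pi_ dl x))%R%:R.
Hypothesis hd1 : forall dl : R, 0 < dl <= dstar ->
  R0 <= inf [set enorm (pi_ dl x) | x in [set x | R0 <= enorm x]] /\
  forall x : V, enorm x <= R0 -> enorm (pi_ dl x) = enorm x.
Hypothesis R0E : R0 = 2 * ((1 + rho) * (1 + 96 * C / K) + psi1 1).
Hypothesis he : 8 * (1 + rho) / (d%:R * K) *
  Num.max (Num.max (3 * C * (K + 96 * C) * (1 + rho)) (psi1 rho * K)) (12 * C * psi1 R0)
  < sigma ^+ 2.

Definition rate_in : R := 6 * C * sigma ^+ 2 *
  (sigma ^+ 2 + 24 * C * (K + 96 * C) * (1 + rho) ^+ 2 / (d%:R * K))^-1 - 3 * C.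
Definition rate_out : R := K / 4.

Let dK0 : 0 < d%:R * K. Proof. by rewrite mulr_gt0// ltr0n. Qed.

(** Each entry of the maximum in [he] feeds one estimate of the weight: the rate [rate_in], the
    drift inside the ball, the drift between [rho] and [R0]. *)
Let noise_gt (m : R) :
  m <= Num.max (Num.max (3 * C * (K + 96 * C) * (1 + rho)) (psi1 rho * K)) (12 * C * psi1 R0) ->
  8 * (1 + rho) * m < sigma ^+ 2 * (d%:R * K).
Proof.
move=> hm; rewrite -ltr_pdivrMr//; apply: le_lt_trans he.
rewrite mulrAC ler_wpM2l// divr_ge0// ?(ltW dK0)//.
by rewrite mulr_ge0// addr_ge0// ltW.
Qed.

Lemma noise_curvature : 24 * C * (K + 96 * C) * (1 + rho) ^+ 2 < sigma ^+ 2 * (d%:R * K).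
Proof.
have := @noise_gt (3 * C * (K + 96 * C) * (1 + rho)); rewrite !le_max lexx => /(_ isT).
have -> // : 24 * C * (K + 96 * C) * (1 + rho) ^+ 2 =
  8 * (1 + rho) * (3 * C * (K + 96 * C) * (1 + rho)) by ring.
Qed.

Lemma noise_inner : 8 * (1 + rho) * psi1 rho < sigma ^+ 2 * d%:R.
Proof.
have := @noise_gt (psi1 rho * K); rewrite !le_max lexx orbT => /(_ isT).
by rewrite mulrA [X in _ < X]mulrA ltr_pM2r.
Qed.

Lemma noise_outer : 96 * (1 + rho) * C * psi1 R0 < sigma ^+ 2 * (d%:R * K).
Proof.
have := @noise_gt (12 * C * psi1 R0); rewrite !le_max lexx orbT => /(_ isT).
have -> // : 96 * (1 + rho) * C * psi1 R0 = 8 * (1 + rho) * (12 * C * psi1 R0) by ring.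
Qed.

Lemma sigma2_gt0 : 0 < sigma ^+ 2.
Proof.
have r1 : 0 < 1 + rho by rewrite addr_gt0.
have p0 := hpsi1_pos (ltW hrho).
have h : 0 < sigma ^+ 2 * d%:R.
  by apply: lt_trans noise_inner; rewrite mulr_gt0// mulr_gt0.
by rewrite -(pmulr_lgt0 _ (_ : 0 < d%:R :> R))// ltr0n.
Qed.

(** [noise_curvature] makes the second summand of the denominator smaller than [sigma ^+ 2], so the
    quotient exceeds one half of [6 * C]. *)
Lemma rate_in_gt0 : 0 < rate_in.
Proof.
have s0 := sigma2_gt0; rewrite /rate_in subr_gt0.
set Q := 24 * C * (K + 96 * C) * (1 + rho) ^+ 2 / (d%:R * K).
have Q1 : Q < sigma ^+ 2 by rewrite /Q ltr_pdivrMr//; exact: noise_curvature.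
have Q0 : 0 <= Q.
  by rewrite /Q; nonneg.
rewrite ltr_pdivlMr; last by rewrite ltr_pwDl.
have -> : 6 * C * sigma ^+ 2 = 3 * C * (sigma ^+ 2 + sigma ^+ 2) by ring.
by rewrite ltr_pM2l ?mulr_gt0// ltrD2l.
Qed.

Lemma R0_gt0 : 0 < R0.
Proof.
rewrite R0E mulr_gt0// addr_gt0 ?hpsi1_pos// mulr_gt0 ?addr_gt0//.
by rewrite divr_gt0// mulr_gt0.
Qed.

Variable D : R.
Hypotheses (D0 : 0 < D) (DR : D <= delta_R) (DK : D <= (2 * K)^-1).
Hypothesis DKR : D <= (K / KR ^+ 2) `^ (1 / (1 - 2 * theta)).
Hypotheses (DC : D <= 1 / C) (Dlam : D <= 1 / rate_in) (Dstar : D <= dstar).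
Hypothesis Dpsi : D <= (2 * psi2 1) `^ (1 / (theta - 1)).
Hypothesis Dsigma : D <= (4 * (2 + d%:R) * (1 + rho ^+ 2) * sigma ^+ 2)^-1.

Let D1 : D <= 1. Proof. by have /andP[_ h] := hdeltaR; exact: le_trans DR h. Qed.

Let dom1 dl : 0 < dl <= D -> 0 < dl <= 1.
Proof. by move=> /andP[-> h]; exact: le_trans D1. Qed.

Let domR dl : 0 < dl <= D -> 0 < dl <= delta_R.
Proof. by move=> /andP[-> h]; exact: le_trans DR. Qed.

Let domstar dl : 0 < dl <= D -> 0 < dl <= dstar.
Proof. by move=> /andP[-> h]; exact: le_trans Dstar. Qed.

Lemma step_C dl : 0 < dl <= D -> dl * C <= 1.
Proof. by move=> /andP[_ h]; rewrite -ler_pdivlMr//; exact: le_trans DC. Qed.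

Lemma step_K dl : 0 < dl <= D -> dl * (2 * K) <= 1.
Proof.
by move=> /andP[_ h]; rewrite -ler_pdivlMr ?mulr_gt0// div1r; exact: le_trans DK.
Qed.

Lemma step_KR dl : 0 < dl <= D -> (KR * dl `^ (- theta)) ^+ 2 * dl <= K.
Proof.
move=> /andP[dl0 h]; have /andP[th0 th1] := htheta.
have e0 : 0 < 1 - 2 * theta by move: th1; lra.
have KR2 : 0 < KR ^+ 2 by rewrite exprn_gt0.
have q0 : 0 <= K / KR ^+ 2 by rewrite divr_ge0 ?ltW.
rewrite exprMn -mulrA powR_sqr_cancel// mulrC -ler_pdivlMr//.
have := le_powR_root (ltW dl0) q0 (ltW e0) (le_trans h DKR).
by rewrite divfK ?gt_eqF// powRr1.
Qed.

Lemma step_psi dl : 0 < dl <= D -> dl * (psi2 1 * dl `^ (- theta)) <= 1 / 2.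
Proof.
move=> /andP[dl0 h]; have /andP[th0 th1] := htheta.
have e0 : 0 < 1 - theta by move: th1; lra.
have p0 : 0 < 2 * psi2 1 by rewrite mulr_gt0// hpsi2_pos.
have := le_powR_root (ltW dl0) (ltW p0) (ltW e0) (le_trans h Dpsi).
have -> : 1 / (theta - 1) * (1 - theta) = -1.
  by field; rewrite subr_eq0 lt_eqF//; move: th1; lra.
rewrite powR_inv1 ?(ltW p0)// -powR_cancel// -[leRHS]div1r ler_pdivlMr// => k.
by rewrite ler_pdivlMr//; move: k; lra.
Qed.

Lemma step_sigma dl : 0 < dl <= D -> 4 * (2 + d%:R) * (1 + rho ^+ 2) * sigma ^+ 2 * dl <= 1.
Proof.
move=> /andP[_ h]; have s0 := sigma2_gt0.
have q0 : 0 < 4 * (2 + d%:R) * (1 + rho ^+ 2) * sigma ^+ 2.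
  apply: mulr_gt0 => //; apply: mulr_gt0; last by rewrite ltr_pwDl// sqr_ge0.
  by rewrite mulr_gt0// ltr_pwDl.
by rewrite mulrC -ler_pdivlMr// div1r; exact: le_trans Dsigma.
Qed.

Definition scheme_mean (dl : R) (x : V) : V := pi_ dl x + dl *: b_ dl (pi_ dl x).

Lemma scheme_contract dl (g : probability V R) x y : 0 < dl <= D -> gaussian g (Num.sqrt dl) ->
  (\int[g]_z (weight rho C K sigma (scheme_mean dl x + sigma *: z))%:E *
     (enorm (scheme_mean dl x - scheme_mean dl y) ^+ 2)%:E <=
   ((1 - Num.min rate_in rate_out * dl) * (weight rho C K sigma x * enorm (x - y) ^+ 2))%:E)%E.
Proof.
move=> hd hg; have h1 := dom1 hd; have /andP[dl0 dl1] := h1; have hR := domR hd.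
have hs := domstar hd; have [hs1 hs2] := hd1 hs.
have r0 := R0_gt0; have rR : rho <= R0.
  have h : 0 < 96 * C / K by rewrite divr_gt0// mulr_gt0.
  have p0 := hpsi1_pos (@ler01 R).
  by rewrite R0E; move: (96 * C / K) h (mulr_gt0 hrho h) => t t0 rt; have r1 := hrho; lra.
have hp u : enorm (pi_ dl u) <= enorm u by exact: retract_le.
have small r u : 0 <= r -> enorm u <= r -> enorm (b_ dl (pi_ dl u)) <= psi1 r.
  move=> r1 ur; have := hd2 h1 u r1.
  by rewrite ltNge (le_trans (hp u) ur)/= mulr0 addr0.
apply: (@weight_contract R d rho C K KR (dl `^ (- theta)) dl (pi_ dl) (b_ dl) hC hK dl0
  (hb1 h1) (hc1 hR) (hc2 hR) (step_C hd) (step_K hd) (step_KR hd) sigma (psi1 1)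
  (psi1 rho) (psi1 R0) (psi2 1) R0) => //.
- exact: sigma2_gt0.
- by rewrite ltW// hpsi1_pos// ltW.
- by rewrite ltW// hpsi1_pos.
- exact: noise_inner.
- exact: noise_outer.
- exact: step_sigma.
- move=> z Rz; apply: (le_trans hs1); apply: ge_inf; last by exists z.
  by exists 0 => _ [u _ <-]; exact: enorm_ge0.
- by move=> z; apply: small; exact: ltW.
- by move=> z; apply: small; exact: ltW.
- move=> z; apply: (le_trans (hd2 h1 z ler01)); rewrite lerD2l ler_piMr ?lern1 ?leq_b1//.
  by rewrite !mulr_ge0 ?enorm_ge0 ?powR_ge0// ltW// hpsi2_pos.
- exact: step_psi.
- have /andP[_ dlD] := hd; rewrite -/rate_in -/rate_out.
  apply: (@le_trans _ _ (dl * rate_in)); first by rewrite ler_pM2l// ge_min lexx.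
  by rewrite -ler_pdivlMr ?rate_in_gt0//; exact: le_trans Dlam.
Qed.

Section assembly.
Variables (c2 l2 lb cb beta L6 q : R).
Hypotheses (c20 : 0 <= c2) (l20 : 0 <= l2) (lb0 : 0 <= lb) (cb0 : 0 <= cb) (beta0 : 0 < beta).
Hypothesis hg1 : forall dl : R, 0 < dl <= 1 -> forall x : V,
  enorm (pi_ dl x - x) <= c2 * (1 + enorm x `^ l2) * dl `^ 2.
Hypothesis hg2 : forall dl : R, 0 < dl <= 1 -> forall x : V,
  enorm (b_ dl x - b x) <= cb * (1 + enorm x `^ lb) * dl `^ beta.
Hypothesis hh : 1 / 2 < beta -> [/\ 0 <= L6, 0 <= q, (forall x : V, differentiable b x) &
  forall x y : V, opnorm (jacobian b x - jacobian b y) <=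
    L6 * (1 + enorm x `^ q + enorm y `^ q) * enorm (x - y)].

Lemma scheme_chain_model : exists Lw Ce : R, exists ke : nat,
  chain_model sigma D (Num.min rate_in rate_out) (Num.min 1 beta) C K rho (psi1 0)
    (@weight_max R d rho C K sigma) Lw Ce ke (1 / 2 < beta) b (linear_part (1 / 2 < beta))
    (weight rho C K sigma) scheme_mean.
Proof.
have [c1 [k1 [c10 hc]]] := scheme_consistency c20 l20 lb0 cb0 hg1 hg2.
have [c3 [k3 [c30 [hA hT]]]] := drift_expansion hh.
have s0 := sigma2_gt0; have r0 := rate_in_gt0.
(* Sums of all constants and all exponents, so that one pair serves every polynomial bound of the
   model. *)
pose Ce := 1 + c1 + 3 * L0 + c3; pose ke := (k1 + expo l0 + k3)%N.
have L1 : 0 <= 3 * L0 by rewrite mulr_ge0// ltW.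
have up (s c : R) k : 1 <= s -> 0 <= c -> c <= Ce -> (k <= ke)%N -> c * s ^+ k <= Ce * s ^+ ke.
  by move=> ? ? ? ?; exact: expr_growth.
have t1 : c1 <= Ce by rewrite /Ce; lra.
have t2 : 3 * L0 <= Ce by rewrite /Ce; lra.
have t3 : c3 <= Ce by rewrite /Ce; lra.
have u1 : (k1 <= ke)%N by rewrite /ke -addnA leq_addr.
have u2 : (expo l0 <= ke)%N by rewrite /ke addnAC leq_addl.
have u3 : (k3 <= ke)%N by rewrite /ke leq_addl.
have s1 (x : V) : 1 <= 1 + enorm x by rewrite lerDl enorm_ge0.
have s2 (x y : V) : 1 <= 1 + enorm x + enorm y by rewrite -addrA lerDl addr_ge0// enorm_ge0.
have hC' := hC; have hK' := hK; have hrho' := hrho.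
exists (@wt_eps R d C sigma * (2 * wt_in rho)), Ce, ke; split.
- by rewrite D0.
- by rewrite lt_min r0 divr_gt0.
- apply: (@le_trans _ _ (D * rate_in)); last by rewrite -ler_pdivlMr.
  by rewrite mulrC ler_pM2l// ge_min lexx.
- by rewrite lt_min ltr01 beta0 ge_min lexx.
- by [].
- by [].
- have : D * (2 * K) <= 1 by apply: step_K; rewrite D0 lexx.
  by move: (mulr_gt0 hK D0); lra.
- by [].
- by rewrite ltW// hpsi1_pos.
- rewrite mulr_ge0 ?(ltW (wt_eps_gt0 _ _ _))// mulr_ge0// ltW// wt_in_gt0//.
- by rewrite /Ce -!addrA lerDl !addr_ge0.
- by move=> x; exact: weight_ge1.
- by move=> x; exact: weight_le.
- by move=> x y; exact: weight_lip.
- move=> dl hd; have h1 := dom1 hd; apply: measurable_rVD; first exact: hpi_m.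
  apply: measurable_rVZ; first exact: measurable_cst.
  by apply: (measurableT_comp (hb_m h1)); exact: hpi_m.
- move=> dl hd x y; have /andP[dl0 _] := hd.
  exact: (drift_lip_sqr hC hK dl0 (hb1 (dom1 hd)) (hc1 (domR hd)) (hc2 (domR hd))
    (step_C hd) (step_K hd) (step_KR hd)).
- move=> dl hd x y xy; have /andP[dl0 _] := hd.
  exact: (drift_out dl0 (hb1 (dom1 hd)) (hc2 (domR hd)) (step_K hd) (step_KR hd) xy).
- by move=> dl hd g hg x y; exact: scheme_contract.
- move=> dl hd; have h1 := dom1 hd; have /andP[dl0 _] := h1.
  rewrite /scheme_mean hb0// add0r enormZ ger0_norm ?(ltW dl0)// mulrC ler_wpM2r ?(ltW dl0)//.
  by have := hd2 h1 0 (lexx 0); rewrite hb0// enorm0 mulr0 mul0r addr0.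
- move=> dl hd x; have h1 := dom1 hd; have /andP[dl0 _] := h1.
  apply: (le_trans (hc dl x h1)); rewrite ler_wpM2r ?up//.
  by rewrite mulr_ge0 ?powR_ge0// ltW.
- move=> x y; apply: (@le_trans _ _ (3 * L0 * (1 + enorm x + enorm y) ^+ expo l0 * enorm (y - x))).
    by apply: drift_increment_le; [rewrite -addrA lerD2l lerDr|rewrite lerDl]; exact: enorm_ge0.
  by rewrite ler_wpM2r ?enorm_ge0// up.
- by move=> x v; apply: (le_trans (hA x v)); rewrite ler_wpM2r ?enorm_ge0// up.
- move=> x y; apply: (le_trans (hT x y)); rewrite ler_wpM2r ?exprn_ge0 ?enorm_ge0// up//.
- by rewrite -leNgt => h; rewrite ge_min h orbT.
Qed.

End assembly.

End model.

Theorem theorem3p3 (R : realType) (d : nat) (hd : (1 <= d)%N)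
  (* stochastic basis, Brownian motion, SDE and scheme *)
  (disp : measure_display) (Omega : measurableType disp) (P : probability Omega R)
  (F : R -> set (set Omega)) (hF : complete_filtration P F)
  (W : R -> Omega -> 'rV[R]_d) (hW : brownian_motion P F W)
  (sigma : R)
  (b : 'rV[R]_d -> 'rV[R]_d) (hb : measurable_fun setT b)
  (hwp : strongly_well_posed P F W b sigma)
  (X : 'rV[R]_d -> R -> Omega -> 'rV[R]_d)
  (hX : forall x : 'rV[R]_d, sde_solution P F W b sigma (cst x) (X x))
  (b_ pi_ : R -> 'rV[R]_d -> 'rV[R]_d)
  (hb_m : forall delta : R, 0 < delta <= 1 -> measurable_fun setT (b_ delta))
  (hpi_m : forall delta : R, 0 < delta <= 1 -> measurable_fun setT (pi_ delta))
  (hb_cvg : forall x : 'rV[R]_d, b_ delta x @[delta --> 0^'+] --> b x)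
  (hpi_cvg : forall x : 'rV[R]_d, pi_ delta x @[delta --> 0^'+] --> x)
  (* (a) *)
  (L0 l0 : R) (hL0 : 0 < L0) (hl0 : 0 <= l0)
  (ha : forall x y : 'rV[R]_d, enorm (b x - b y) <=
     L0 * (1 + enorm x `^ l0 + enorm y `^ l0) * enorm (x - y))
  (* (b) *)
  (hb0 : forall delta : R, 0 < delta <= 1 -> pi_ delta 0 = 0)
  (hb1 : forall delta : R, 0 < delta <= 1 -> forall x y : 'rV[R]_d,
     enorm (pi_ delta x - pi_ delta y) <= enorm (x - y))
  (* (c); [rho] is the radius R *)
  (rho C_R K_R Kstar_R theta delta_R : R)
  (hrho : 0 < rho) (hCR : 0 < C_R) (hKR : 0 < K_R) (hKsR : 0 < Kstar_R)
  (htheta : 0 <= theta < 1 / 2) (hdeltaR : 0 < delta_R <= 1)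
  (hc1 : forall delta : R, 0 < delta <= delta_R -> forall x y : 'rV[R]_d,
     enorm x <= rho -> enorm y <= rho ->
     enorm (b_ delta (pi_ delta x) - b_ delta (pi_ delta y)) <= C_R * enorm (x - y))
  (hc2 : forall delta : R, 0 < delta <= delta_R -> forall x y : 'rV[R]_d,
     rho < enorm x \/ rho < enorm y ->
     enorm (b_ delta (pi_ delta x) - b_ delta (pi_ delta y)) <=
       K_R * delta `^ (- theta) * enorm (x - y) /\
     inner (pi_ delta x - pi_ delta y)
           (b_ delta (pi_ delta x) - b_ delta (pi_ delta y)) <=
       - Kstar_R * enorm (pi_ delta x - pi_ delta y) ^+ 2)
  (* (d) *)
  (deltastar : R -> R)
  (hdeltastar : forall r : R, 0 < r -> 0 < deltastar r <= 1)
  (hd1 : forall r : R, 0 < r -> forall delta : R, 0 < delta <= deltastar r ->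
     r <= inf [set enorm (pi_ delta x) | x in [set x | r <= enorm x]] /\
     forall x : 'rV[R]_d, enorm x <= r -> enorm (pi_ delta x) = enorm x)
  (psi1 psi2 : R -> R)
  (hpsi1_pos : forall r : R, 0 <= r -> 0 < psi1 r)
  (hpsi2_pos : forall r : R, 0 <= r -> 0 < psi2 r)
  (hpsi1_incr : forall r s : R, 0 <= r -> r <= s -> psi1 r <= psi1 s)
  (hpsi2_incr : forall r s : R, 0 <= r -> r <= s -> psi2 r <= psi2 s)
  (hd2 : forall delta : R, 0 < delta <= 1 -> forall (x : 'rV[R]_d) (r : R), 0 <= r ->
     enorm (b_ delta (pi_ delta x)) <=
       psi1 r + psi2 r * delta `^ (- theta) * enorm (pi_ delta x)
                * (r < enorm (pi_ delta x))%R%:R)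
  (* (f) *)
  (lambda_b C_b : R) (hlambda_b : 0 < lambda_b) (hC_b : 0 < C_b)
  (hf : forall x : 'rV[R]_d, inner x (b x) <= - lambda_b * enorm x ^+ 2 + C_b)
  (* (g) *)
  (c_ l_ : R -> R)
  (hc_ : forall alpha : R, 0 < alpha -> 0 <= c_ alpha)
  (hl_ : forall alpha : R, 0 < alpha -> 0 <= l_ alpha)
  (hg1 : forall alpha : R, 0 < alpha -> forall delta : R, 0 < delta <= 1 -> forall x : 'rV[R]_d,
     enorm (pi_ delta x - x) <=
       c_ alpha * (1 + enorm x `^ l_ alpha) * delta `^ alpha)
  (beta lstar_beta lambdastar_b : R)
  (hbeta : 0 < beta) (hlbeta : 0 <= lstar_beta) (hlambdastar : 0 <= lambdastar_b)
  (hg2 : forall delta : R, 0 < delta <= 1 -> forall x : 'rV[R]_d,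
     enorm (b_ delta x - b x) <=
       lambdastar_b * (1 + enorm x `^ lstar_beta) * delta `^ beta)
  (* (h) *)
  (L6 l0star : R)
  (hh : 1 / 2 < beta ->
     [/\ 0 <= L6, 0 <= l0star, (forall x : 'rV[R]_d, differentiable b x) &
         forall x y : 'rV[R]_d, opnorm (jacobian b x - jacobian b y) <=
           L6 * (1 + enorm x `^ l0star + enorm y `^ l0star) * enorm (x - y)]) :
  let R0 := 2 * ((1 + rho) * (1 + 96 * C_R / Kstar_R) + psi1 1) in
  (* (e) *)
  sigma ^+ 2 > 8 * (1 + rho) / (d%:R * Kstar_R) *
    Num.max (Num.max (3 * C_R * (Kstar_R + 96 * C_R) * (1 + rho))
                     (psi1 rho * Kstar_R))
            (12 * C_R * psi1 R0) ->
  let lambda1 := 6 * C_R * sigma ^+ 2 *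
    (sigma ^+ 2 + 24 * C_R * (Kstar_R + 96 * C_R) * (1 + rho) ^+ 2
                  / (d%:R * Kstar_R))^-1 - 3 * C_R in
  let lambda2 := Kstar_R / 4 in
  let delta1 :=
    \big[Num.min/delta_R]_(a <- [:: (2 * Kstar_R)^-1;
        (Kstar_R / K_R ^+ 2) `^ (1 / (1 - 2 * theta));
        1 / C_R; 1 / lambda1; 1 / lambda2; deltastar R0;
        (2 * psi2 1) `^ (1 / (theta - 1));
        (4 * (2 + d%:R) * (1 + rho ^+ 2) * sigma ^+ 2)^-1]) a in
  let delta2 :=
    Num.min delta1 ((Kstar_R / (4 * psi2 1 ^+ 2)) `^ (1 / (1 - 2 * theta))) in
  let lstar :=
    Num.max (Num.max (2 * l0 + 1 + (1 + l0star) * (1 / 2 < beta)%R%:R) (l0 + l_ 2))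
            lstar_beta in
  exists pi_inf : probability 'rV[R]_d R,
  exists pi_inf_ : R -> probability 'rV[R]_d R,
    [/\ finite_second_moment pi_inf,
        unique_such (sde_invariant P X) pi_inf,
        (forall delta : R, 0 < delta <= delta2 ->
           finite_second_moment (pi_inf_ delta) /\
           unique_such (chain_invariant P W (pi_ delta) (b_ delta) sigma delta)
                       (pi_inf_ delta)) &
        exists2 C0 : R, 0 < C0 &
          forall delta : R, 0 < delta <= delta2 ->
          forall (n : nat) (mu : probability 'rV[R]_d R), finite_second_moment mu ->
            (W2 pi_inf (pi_inf_ delta) <=
               (C0 * delta `^ Num.min 1 beta * d%:R `^ (lstar / 2))%:E)%E /\
            (W2 (chain_law P W (pi_ delta) (b_ delta) sigma delta mu n) pi_inf <=
               C0%:E *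
               ((expR (- (1 / 2) * Num.min lambda1 lambda2 * (n%:R * delta)))%:E
                  * W2 mu pi_inf
                + (delta `^ Num.min 1 beta * d%:R `^ (lstar / 2))%:E))%E].
Proof.
move=> R0 he lambda1 lambda2 delta1 delta2 lstar.
have /andP[dR0 _] := hdeltaR.
have p1 : 0 < psi1 1 by apply: hpsi1_pos.
have p2 : 0 < psi2 1 by apply: hpsi2_pos.
have R00 : 0 < R0 := R0_gt0 hrho hCR hKsR hpsi1_pos erefl.
have s0 : 0 < sigma ^+ 2 := sigma2_gt0 hd hrho hKsR hpsi1_pos he.
have la0 : 0 < lambda1 := rate_in_gt0 hd hrho hCR hKsR hpsi1_pos he.
have lb0 : 0 < lambda2 by rewrite divr_gt0.
have dm : delta1 = Num.min (2 * Kstar_R)^-1 (Num.min ((Kstar_R / K_R ^+ 2) `^ (1 / (1 - 2 * theta)))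
    (Num.min (1 / C_R) (Num.min (1 / lambda1) (Num.min (1 / lambda2) (Num.min (deltastar R0)
    (Num.min ((2 * psi2 1) `^ (1 / (theta - 1)))
    (Num.min (4 * (2 + d%:R) * (1 + rho ^+ 2) * sigma ^+ 2)^-1 delta_R))))))).
  by rewrite /delta1 !big_cons big_nil.
have D0 : 0 < delta2.
  have /andP[ds0 _] := hdeltastar R0 R00.
  rewrite /delta2 dm !lt_min !powR_gt0 ?divr_gt0 ?mulr_gt0 ?exprn_gt0//.
  have m2 : 0 < 2 * Kstar_R by rewrite mulr_gt0.
  have m4 : 0 < 4 * (2 + d%:R) * (1 + rho ^+ 2) * sigma ^+ 2.
    apply: mulr_gt0 => //; apply: mulr_gt0; last by rewrite ltr_pwDl// sqr_ge0.
    by rewrite mulr_gt0// ltr_pwDl.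
  by rewrite ds0 dR0 !invr_gt0 m2 m4.
have dle (a : R) : delta1 <= a -> delta2 <= a by apply: le_trans; rewrite ge_min lexx.
have [Lw [Ce [ke cm]]] : exists Lw Ce : R, exists ke : nat,
  chain_model sigma delta2 (Num.min lambda1 lambda2) (Num.min 1 beta) C_R Kstar_R rho (psi1 0)
    (@weight_max R d rho C_R Kstar_R sigma) Lw Ce ke (1 / 2 < beta) b
    (linear_part b (1 / 2 < beta)) (weight rho C_R Kstar_R sigma) (scheme_mean b_ pi_).
  apply: (scheme_chain_model hd hb_m hpi_m hL0 hl0 ha hb0 hb1 hrho hCR hKR hKsR htheta hdeltaR
    hc1 hc2 hpsi1_pos hpsi2_pos hd2 (hd1 R0 R00) erefl he D0 _ _ _ _ _ _ _ _
    (hc_ 2 _) (hl_ 2 _) hlbeta hlambdastar hbeta (hg1 2 _) hg2 hh) => //;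
    by apply: dle; rewrite dm !ge_min lexx ?orbT.
have [gam ns] := brownian_noise hF hW.
have mX x t : 0 <= t -> measurable_fun setT (X x t).
  move=> t0; have [_ Fs _ _] := hF; have [ad _ _ _] := hX x.
  by apply: mwrt_measurable (ad t t0); have [] := Fs t t0.
have [Kc [Kc0 hK]] := transport_cost_step cm ns hX mX.
have mnE dl x : scheme_mean b_ pi_ dl x = pi_ dl x + dl *: b_ dl (pi_ dl x) by [].
(* Outside the admissible steps the value is a placeholder. *)
exists (sde_stat cm ns), (fun dl => if pselect (0 < dl <= delta2) is left h
  then chain_stat cm ns h else sde_stat cm ns); split.
- exact: sde_stat_moment2.
- split; first exact: (sde_stat_invariant cm ns hX mX).
  by move=> p hp S mS; exact: (sde_stat_unique cm ns hX mX hp mS).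
- move=> dl hdl; case: pselect => // h; split; first exact: chain_stat_moment2.
  split; first exact: (chain_stat_invariant cm ns h (mnE dl)).
  by move=> p hp S mS; exact: (chain_stat_unique cm ns h (mnE dl) hp mS).
(* After the square root, [a] is the factor of the contraction and [k] that of the strong error; the
   summand 1 keeps the constant positive. *)
set a := Num.sqrt (2 * @weight_max R d rho C_R Kstar_R sigma); set k := Num.sqrt Kc.
have a0 : 0 <= a := sqrtr_ge0 _; have k0 : 0 <= k := sqrtr_ge0 _.
have C00 : 0 < 1 + a + k by lra.
exists (1 + a + k) => // dl hdl n mu _.
set u := d%:R `^ (lstar / 2); set q := dl `^ Num.min 1 beta.
have u1 : 1 <= u.
  rewrite -(powRr0 d%:R); apply: ler_powR; first by rewrite ler1n.
  by rewrite divr_ge0// /lstar le_max hlbeta orbT.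
have q0 : 0 <= q by exact: powR_ge0.
have kq : k * q <= (1 + a + k) * (q * u).
  apply: (@le_trans _ _ ((1 + a + k) * q)); first by rewrite ler_wpM2r//; lra.
  by rewrite ler_wpM2l ?(ltW C00)// ler_peMr.
case: pselect => // h; split.
  by apply: (le_trans (W2_stat Kc0 hK h (mnE dl))); rewrite lee_fin -mulrA.
apply: (le_trans (W2_chain Kc0 hK h (mnE dl) n mu)).
set e := expR _; set w := W2 mu _.
have w0 : (0 <= w)%E by exact: sqrte_ge0.
have e0 : 0 <= e by exact: expR_ge0.
rewrite ge0_muleDr ?mule_ge0 ?lee_fin ?mulr_ge0 ?(le_trans ler01 u1)//.
rewrite muleA -!EFinM; apply: leeD; last by rewrite lee_fin.
by rewrite lee_wpmul2r// lee_fin ler_wpM2r// addrAC lerDr addr_ge0.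
Qed.
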